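(* Let $\mathbb{K}$ be an algebraically closed field of characteristic zero and let $X$ be a normal affine algebraic variety over $\mathbb{K}$ of dimension $n$ with a commutative monoid structure of rank $r\in\{0,\,n-1,\,n\}$. Then $X$ is toric, so that $\mathbb{K}[X]=\bigoplus_{u\in S_X}\mathbb{K}\chi^u$, and the commutative monoid structures of rank $r$ on $X$ are classified up to isomorphism as follows. 1) If $r=n$, then $X$ is endowed with the toric monoid structure, and the comultiplication $\mathbb{K}[X]\to\mathbb{K}[X]\otimes\mathbb{K}[X]$ is given by $$\chi^u\mapsto\chi^u\otimes\chi^u\quad\text{for any }u\in S_X.$$ 2) If $r=n-1$, then the comultiplication $\mathbb{K}[X]\to\mathbb{K}[X]\otimes\mathbb{K}[X]$ is given by $$\chi^u\mapsto(\chi^u\otimes\chi^u)\,(1\otimes\chi^e+\chi^e\otimes1)^{\langle p_i,u\rangle}\quad\text{for any }u\in S_X,$$ where $p_i$ is the primitive vector on a ray of the fan of $X$ and $e\in\mathfrak{R}_i$ is a Demazure root corresponding to this ray. 3) If $r=0$, then $X=\mathbb{A}^n$ and $X$ has the vector monoid structure, with the comultiplication determined by $$\chi^u\mapsto\chi^u\otimes1+1\otimes\chi^u$$ for $u$ ranging over the standard basis vectors of $\mathbb{Z}^n_{\ge0}$ (that is, $x_j\mapsto x_j\otimes1+1\otimes x_j$ for the coordinate functions $x_j$, $1\le j\le n$).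
   Context: An algebraic monoid is an irreducible algebraic variety $X$ with an associative multiplication $\mu\colon X\times X\to X$, $(x,y)\mapsto x*y$, that is a morphism of varieties and has a unit $e\in X$ ($e*x=x*e=x$ for all $x$). A morphism of algebraic monoids is a morphism of varieties that preserves products and units; an isomorphism is an invertible morphism whose inverse is a morphism. The set $G(X)$ of invertible elements is a connected algebraic group, open in $X$. If $X$ is affine and commutative, then $G(X)\cong\mathbb{G}_m^r\times\mathbb{G}_a^s$, where $\mathbb{G}_m=(\mathbb{K}^\times,\times)$ and $\mathbb{G}_a=(\mathbb{K},+)$; the number $r$ is the rank of the monoid. The comultiplication is the homomorphism of $\mathbb{K}$-algebras $\mathbb{K}[X]\to\mathbb{K}[X]\otimes\mathbb{K}[X]$ dual to $\mu$. The vector monoid structure on $\mathbb{A}^n$ is vector addition. The toric monoid structure on an affine toric variety is the monoid structure with $G(X)$ equal to the acting torus (it is unique up to isomorphism). A normal irreducible variety $X$ is toric if a torus $T\cong(\mathbb{K}^\times)^n$ acts effectively on it with an open orbit. Let $M$ be the character lattice of $T$ and $N$ the dual lattice of one-parameter subgroups, with pairing $\langle\cdot,\cdot\rangle$; put $M_{\mathbb{Q}}=M\otimes\mathbb{Q}$, $N_{\mathbb{Q}}=N\otimes\mathbb{Q}$. Identifying $T$ with the open orbit (by choosing a point in it), characters $\chi^u$, $u\in M$, become rational functions on $X$, and for affine $X$ one has $\mathbb{K}[X]=\bigoplus_{u\in S_X}\mathbb{K}\chi^u$, where $S_X=M\cap\omega$ for a rational polyhedral cone $\omega\subseteq M_{\mathbb{Q}}$.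 Let $\sigma=\{v\in N_{\mathbb{Q}}\mid\langle v,u\rangle\ge0\ \forall u\in\omega\}$ be the dual cone; the fan of $X$ consists of the faces of $\sigma$. Let $\rho_1,\dots,\rho_m$ be the rays of $\sigma$ and $p_i\in N$ the primitive lattice vector on $\rho_i$. The set of Demazure roots corresponding to $\rho_i$ is $$\mathfrak{R}_i=\{e\in M\mid\langle p_i,e\rangle=-1,\ \langle p_j,e\rangle\ge0\text{ for all }j\ne i\}.$$ For $e\in\mathfrak{R}_i$ the function $\chi^e$ lies in $\mathbb{K}(X)$ but not in $\mathbb{K}[X]$; the expression in 2) is understood by binomial expansion, i.e. as $\sum_{j=0}^{a}\binom{a}{j}\chi^{u+(a-j)e}\otimes\chi^{u+je}$ with $a=\langle p_i,u\rangle$, and all $\chi^{u+je}$ with $0\le j\le a$ lie in $\mathbb{K}[X]$. ''Classified up to isomorphism'' means that every commutative monoid structure of the given rank on $X$ is isomorphic to one of the listed ones and the listed comultiplications do define such structures; different Demazure roots are allowed to give isomorphic structures. *)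

(* Defs.v *)
From mathcomp Require Import all_boot all_order all_algebra.
From mathcomp Require Export mpoly.

Set Implicit Arguments.
Unset Strict Implicit.
Unset Printing Implicit Defensive.

Import Order.TTheory GRing.Theory Num.Theory.
Local Open Scope ring_scope.

(* Varieties are classical: sets of points [X : 'rV[K]_N -> Prop] of an affine
   space over an algebraically closed field.  Functions and maps are total on
   the ambient space, but only their values on [X] are meaningful. *)

Section Varieties.
Variable K : closedFieldType.

Definition peval N (p : {mpoly K[N]}) (x : 'rV[K]_N) : K :=
  p.@[fun i => x ord0 i].

Definition zeros N (I : {mpoly K[N]} -> Prop) (x : 'rV[K]_N) : Prop :=
  forall p, I p -> peval p x = 0.

Definition zclosed N (Z : 'rV[K]_N -> Prop) : Prop :=
  exists I : {mpoly K[N]} -> Prop, forall x, Z x <-> zeros I x.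

Definition open_in N (X U : 'rV[K]_N -> Prop) : Prop :=
  exists I : {mpoly K[N]} -> Prop, forall x, U x <-> X x /\ ~ zeros I x.

Definition irreducible N (X : 'rV[K]_N -> Prop) : Prop :=
  (exists x, X x) /\
  forall Z1 Z2 : 'rV[K]_N -> Prop, zclosed Z1 -> zclosed Z2 ->
    (forall x, X x -> Z1 x \/ Z2 x) ->
    (forall x, X x -> Z1 x) \/ (forall x, X x -> Z2 x).

Definition affine_variety N (X : 'rV[K]_N -> Prop) : Prop :=
  zclosed X /\ irreducible X.

(* Regular functions on a locally closed set [Y]: locally quotients of
   polynomials.  The neighbourhood of [x] on which [f = p / q] can be taken to
   be the locus [q != 0] itself: if [f = p / q] only holds where moreover
   [h != 0], replace [p], [q] by [h * p], [h * q]. *)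
Definition regular N (Y : 'rV[K]_N -> Prop) (f : 'rV[K]_N -> K) : Prop :=
  forall x, Y x -> exists p q : {mpoly K[N]},
    peval q x <> 0 /\
    forall y, Y y -> peval q y <> 0 -> f y = peval p y / peval q y.

Definition regular_map N M (Y : 'rV[K]_N -> Prop) (Z : 'rV[K]_M -> Prop)
    (F : 'rV[K]_N -> 'rV[K]_M) : Prop :=
  (forall y, Y y -> Z (F y)) /\
  (forall j : 'I_M, regular Y (fun y => F y ord0 j)).

Definition mutually_inverse N M (Y : 'rV[K]_N -> Prop) (Z : 'rV[K]_M -> Prop)
    (F : 'rV[K]_N -> 'rV[K]_M) (G : 'rV[K]_M -> 'rV[K]_N) : Prop :=
  (forall y, Y y -> G (F y) = y) /\ (forall z, Z z -> F (G z) = z).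

Definition variety_iso N M (Y : 'rV[K]_N -> Prop) (Z : 'rV[K]_M -> Prop)
    (F : 'rV[K]_N -> 'rV[K]_M) : Prop :=
  exists G : 'rV[K]_M -> 'rV[K]_N,
    [/\ regular_map Y Z F, regular_map Z Y G & mutually_inverse Y Z F G].

Definition prodv N M (Y : 'rV[K]_N -> Prop) (Z : 'rV[K]_M -> Prop)
    (z : 'rV[K]_(N + M)) : Prop := Y (lsubmx z) /\ Z (rsubmx z).

Definition affine_space n (x : 'rV[K]_n) : Prop := True.

(* For affine [X]: the coordinate ring is integrally closed in its field of
   fractions; the displayed equation says that [f / g] is integral over it. *)
Definition normal_variety N (X : 'rV[K]_N -> Prop) : Prop :=
  forall f g : 'rV[K]_N -> K, regular X f -> regular X g ->
    (exists x, X x /\ g x <> 0) ->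
    (exists (d : nat) (a : 'I_d -> 'rV[K]_N -> K),
       (forall i, regular X (a i)) /\
       forall x, X x ->
         f x ^+ d + \sum_(i < d) a i x * f x ^+ i * g x ^+ (d - i) = 0) ->
    exists h, regular X h /\ forall x, X x -> f x = g x * h x.

Definition alg_independent N (X : 'rV[K]_N -> Prop) k
    (F : 'I_k -> 'rV[K]_N -> K) : Prop :=
  forall P : {mpoly K[k]},
    (forall x, X x -> P.@[fun i => F i x] = 0) -> P = 0.

(* Transcendence degree of the coordinate ring (i.e. of the function field)
   of an affine variety. *)
Definition has_dim N (X : 'rV[K]_N -> Prop) (n : nat) : Prop :=
  (exists F : 'I_n -> 'rV[K]_N -> K,
     (forall i, regular X (F i)) /\ alg_independent X F) /\
  ~ (exists F : 'I_n.+1 -> 'rV[K]_N -> K,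
       (forall i, regular X (F i)) /\ alg_independent X F).

(* Elements of K[X] (x) K[X] = K[X x X] are seen as functions on [prodv X X].
   This loses nothing, see [tensor_faithful]. *)
Definition tensor N M (f : 'rV[K]_N -> K) (g : 'rV[K]_M -> K)
    (z : 'rV[K]_(N + M)) : K := f (lsubmx z) * g (rsubmx z).

Lemma tensor_faithful N M (X : 'rV[K]_N -> Prop) (Y : 'rV[K]_M -> Prop) k
    (f : 'I_k -> 'rV[K]_N -> K) (g : 'I_k -> 'rV[K]_M -> K) :
  (forall c : 'I_k -> K,
     (forall y, Y y -> \sum_(i < k) c i * g i y = 0) -> forall i, c i = 0) ->
  (forall z, prodv X Y z -> \sum_(i < k) tensor (f i) (g i) z = 0) ->
  forall i x, X x -> f i x = 0.
Proof.
move=> indep fg0 i x Xx; apply: (indep (fun i => f i x)) => y Yy.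
have := fg0 (row_mx x y); rewrite /prodv /tensor row_mxKl row_mxKr.
exact.
Qed.

Definition comult N (mul : 'rV[K]_N -> 'rV[K]_N -> 'rV[K]_N)
    (f : 'rV[K]_N -> K) (z : 'rV[K]_(N + N)) : K :=
  f (mul (lsubmx z) (rsubmx z)).

Definition comult_eq N (X : 'rV[K]_N -> Prop)
    (mul : 'rV[K]_N -> 'rV[K]_N -> 'rV[K]_N)
    (f : 'rV[K]_N -> K) (h : 'rV[K]_(N + N) -> K) : Prop :=
  forall z, prodv X X z -> comult mul f z = h z.

Record comm_monoid N (X : 'rV[K]_N -> Prop)
    (mul : 'rV[K]_N -> 'rV[K]_N -> 'rV[K]_N) (one : 'rV[K]_N) : Prop :=
  CommMonoid {
    cm_regular : regular_map (prodv X X) X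
                   (fun z => mul (lsubmx z) (rsubmx z));
    cm_assoc : forall x y z, X x -> X y -> X z ->
                 mul x (mul y z) = mul (mul x y) z;
    cm_comm : forall x y, X x -> X y -> mul x y = mul y x;
    cm_one : X one;
    cm_unit : forall x, X x -> mul one x = x /\ mul x one = x }.

Definition monoid_iso N M
    (X : 'rV[K]_N -> Prop) (mulX : 'rV[K]_N -> 'rV[K]_N -> 'rV[K]_N)
    (oneX : 'rV[K]_N)
    (Y : 'rV[K]_M -> Prop) (mulY : 'rV[K]_M -> 'rV[K]_M -> 'rV[K]_M)
    (oneY : 'rV[K]_M) : Prop :=
  exists F : 'rV[K]_N -> 'rV[K]_M,
    [/\ variety_iso X Y F,
        (forall x y, X x -> X y -> F (mulX x y) = mulY (F x) (F y))
      & F oneX = oneY].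

Definition units N (X : 'rV[K]_N -> Prop)
    (mul : 'rV[K]_N -> 'rV[K]_N -> 'rV[K]_N) (one : 'rV[K]_N)
    (x : 'rV[K]_N) : Prop :=
  X x /\ exists y, [/\ X y, mul x y = one & mul y x = one].

Definition torus n (t : 'rV[K]_n) : Prop := forall i, t ord0 i <> 0.

Definition tmul n (s t : 'rV[K]_n) : 'rV[K]_n :=
  \row_i (s ord0 i * t ord0 i).

Definition GmGa r s : 'rV[K]_(r + s) -> Prop :=
  prodv (@torus r) (@affine_space s).

Definition GmGa_mul r s (g h : 'rV[K]_(r + s)) : 'rV[K]_(r + s) :=
  row_mx (tmul (lsubmx g) (lsubmx h)) (rsubmx g + rsubmx h).

Definition GmGa_one r s : 'rV[K]_(r + s) := row_mx (const_mx 1) 0.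

Definition has_rank N (X : 'rV[K]_N -> Prop)
    (mul : 'rV[K]_N -> 'rV[K]_N -> 'rV[K]_N) (one : 'rV[K]_N)
    (r : nat) : Prop :=
  exists s : nat,
    monoid_iso (units X mul one) mul one
               (@GmGa r s) (@GmGa_mul r s) (GmGa_one r s).

Record torus_action n N (X : 'rV[K]_N -> Prop)
    (act : 'rV[K]_n -> 'rV[K]_N -> 'rV[K]_N) : Prop :=
  TorusAction {
    ta_regular : regular_map (prodv (@torus n) X) X
                   (fun z => act (lsubmx z) (rsubmx z));
    ta_one : forall x, X x -> act (const_mx 1) x = x;
    ta_mul : forall s t x, torus s -> torus t -> X x ->
               act (tmul s t) x = act s (act t x) }.

Definition orbit n N (act : 'rV[K]_n -> 'rV[K]_N -> 'rV[K]_N)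
    (x0 x : 'rV[K]_N) : Prop := exists t, torus t /\ x = act t x0.

(* A toric structure, together with the point of the open orbit used to
   identify that orbit with the torus. *)
Definition toric_structure n N (X : 'rV[K]_N -> Prop)
    (act : 'rV[K]_n -> 'rV[K]_N -> 'rV[K]_N) (x0 : 'rV[K]_N) : Prop :=
  [/\ torus_action X act,
      (forall t, torus t -> (forall x, X x -> act t x = x) -> t = const_mx 1),
      X x0
    & open_in X (orbit act x0)].

(* The character lattice M and the lattice N of one-parameter subgroups of
   [torus n] are both ['rV[int]_n], in dual bases. *)
Definition character n (u : 'rV[int]_n) (t : 'rV[K]_n) : K :=
  \prod_(i < n) t ord0 i ^ u ord0 i.

(* [f] is the rational function [chi^u], provided it belongs to K[X]: it is
   regular on [X] and is the character [u] on the open orbit. *)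
Definition is_chi n N (X : 'rV[K]_N -> Prop)
    (act : 'rV[K]_n -> 'rV[K]_N -> 'rV[K]_N) (x0 : 'rV[K]_N)
    (u : 'rV[int]_n) (f : 'rV[K]_N -> K) : Prop :=
  regular X f /\ forall t, torus t -> f (act t x0) = character u t.

End Varieties.

Definition pairing (R : comNzRingType) n (v u : 'rV[R]_n) : R :=
  \sum_(i < n) v ord0 i * u ord0 i.

Definition toQ n (u : 'rV[int]_n) : 'rV[rat]_n := map_mx (fun z => z%:~R) u.

Definition polyhedral_cone n (omega : 'rV[rat]_n -> Prop) : Prop :=
  exists (k : nat) (A : 'M[rat]_(k, n)), forall w,
    omega w <-> exists c : 'rV[rat]_k, (forall i, 0 <= c ord0 i) /\ w = c *m A.

Definition dual_cone n (omega : 'rV[rat]_n -> Prop) (v : 'rV[rat]_n) : Prop :=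
  forall u, omega u -> 0 <= pairing v u.

Definition is_face n (sigma tau : 'rV[rat]_n -> Prop) : Prop :=
  exists u, dual_cone sigma u /\
    forall v, tau v <-> sigma v /\ pairing v u = 0.

Definition primitive n (p : 'rV[int]_n) : Prop :=
  forall (k : int) (q : 'rV[int]_n), p = k *: q -> `|k| = 1.

(* [p] is the primitive lattice vector on a ray of the fan of faces of
   [sigma]. *)
Definition ray_vector n (sigma : 'rV[rat]_n -> Prop) (p : 'rV[int]_n) : Prop :=
  primitive p /\
  is_face sigma (fun v => exists c : rat, 0 <= c /\ v = c *: toQ p).

Definition demazure_root n (sigma : 'rV[rat]_n -> Prop)
    (p e : 'rV[int]_n) : Prop :=
  pairing p e = -1 /\
  forall q, ray_vector sigma q -> q <> p -> 0 <= pairing q e.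

Section Classification.
Variable K : closedFieldType.

(* K[X] is the direct sum of the lines spanned by [chi u] for [u] in the set
   of lattice points of the rational polyhedral cone [omega]; this set is
   exactly S_X = {u | chi^u is in K[X]}.  The value [chi u] is irrelevant for
   [u] outside S_X. *)
Record toric_decomposition n N (X : 'rV[K]_N -> Prop)
    (act : 'rV[K]_n -> 'rV[K]_N -> 'rV[K]_N) (x0 : 'rV[K]_N)
    (omega : 'rV[rat]_n -> Prop)
    (chi : 'rV[int]_n -> 'rV[K]_N -> K) : Prop :=
  ToricDecomposition {
    td_cone : polyhedral_cone omega;
    td_lattice : forall u,
      omega (toQ u) <-> exists f, is_chi X act x0 u f;
    td_chi : forall u, omega (toQ u) -> is_chi X act x0 u (chi u);
    td_span : forall f, regular X f ->
      exists (s : seq 'rV[int]_n) (c : 'rV[int]_n -> K),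
        (forall u, u \in s -> omega (toQ u)) /\
        forall x, X x -> f x = \sum_(u <- s) c u * chi u x;
    td_free : forall (s : seq 'rV[int]_n) (c : 'rV[int]_n -> K),
      uniq s -> (forall u, u \in s -> omega (toQ u)) ->
      (forall x, X x -> \sum_(u <- s) c u * chi u x = 0) ->
      forall u, u \in s -> c u = 0 }.

Definition toric_monoid n N
    (X : 'rV[K]_N -> Prop)
    (act : 'rV[K]_n -> 'rV[K]_N -> 'rV[K]_N) (x0 : 'rV[K]_N)
    (mul : 'rV[K]_N -> 'rV[K]_N -> 'rV[K]_N) (one : 'rV[K]_N) : Prop :=
  (forall x, units X mul one x <-> orbit act x0 x) /\
  (forall s t, torus s -> torus t ->
     mul (act s x0) (act t x0) = act (tmul s t) x0).

Definition toric_comult n N (X : 'rV[K]_N -> Prop)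
    (omega : 'rV[rat]_n -> Prop) (chi : 'rV[int]_n -> 'rV[K]_N -> K)
    (mul : 'rV[K]_N -> 'rV[K]_N -> 'rV[K]_N) : Prop :=
  forall u, omega (toQ u) ->
    comult_eq X mul (chi u) (tensor (chi u) (chi u)).

Definition root_comult n N (X : 'rV[K]_N -> Prop)
    (omega : 'rV[rat]_n -> Prop) (chi : 'rV[int]_n -> 'rV[K]_N -> K)
    (p e : 'rV[int]_n)
    (mul : 'rV[K]_N -> 'rV[K]_N -> 'rV[K]_N) : Prop :=
  forall u, omega (toQ u) ->
    let a := absz (pairing p u) in
    comult_eq X mul (chi u)
      (fun z => \sum_(j < a.+1)
         'C(a, j)%:R * tensor (chi (u + e *+ (a - j))) (chi (u + e *+ j)) z).

Definition vector_comult n N (X : 'rV[K]_N -> Prop)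
    (x_ : 'I_n -> 'rV[K]_N -> K)
    (mul : 'rV[K]_N -> 'rV[K]_N -> 'rV[K]_N) : Prop :=
  forall j, comult_eq X mul (x_ j)
    (fun z => tensor (x_ j) (fun _ => 1) z + tensor (fun _ => 1) (x_ j) z).

(* The commutative monoid structures of rank [r] on [X] are, up to
   isomorphism, those described by [D i] for an admissible index [i]; distinct
   indices may give isomorphic structures. *)
Definition classified_by N (X : 'rV[K]_N -> Prop) (r : nat)
    (I : Type) (adm : I -> Prop)
    (D : I -> ('rV[K]_N -> 'rV[K]_N -> 'rV[K]_N) -> 'rV[K]_N -> Prop) : Prop :=
  (forall i, adm i -> exists mul one,
     [/\ comm_monoid X mul one, has_rank X mul one r & D i mul one]) /\
  (forall mul one, comm_monoid X mul one -> has_rank X mul one r ->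
     exists i mul' one',
       [/\ adm i, comm_monoid X mul' one', D i mul' one'
         & monoid_iso X mul one X mul' one']).

End Classification.

(* Main.v *)
Require Import Defs.
From mathcomp Require Import all_boot all_order all_algebra.
From mathcomp Require Import ring lra zify.
From mathcomp Require Import boolp.
From mathcomp Require classical_sets.

Set Implicit Arguments.
Unset Strict Implicit.
Unset Printing Implicit Defensive.

Import Order.TTheory GRing.Theory Num.Theory.
Local Open Scope ring_scope.

(** Consider first a commutative monoid [X] with group of units [G], a product
    of [r] multiplicative and [s] additive groups.  Multiplication by [x] acts
    on a finite-dimensional space of functions containing the coordinates, and
    [x] is a unit exactly when the determinant [h] of this action does not
    vanish ([units_open]); so [G] is a dense principal open set.  A function on
    [G] without zeros is a multiple of a character ([unit_character]).  Hence
    [h] is constant when [r = 0], and then [X] is a vector group; and, after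
    multiplication by a power of [h], the coordinates of [G] extend to [X],
    which together with a count of monomials gives [n = r + s] ([dim_ge],
    [dim_le]).

    A regular function on [X] restricts to a combination of monomials on [G].
    If [s <= 1] each of these monomials extends to [X], with all its divided
    derivatives in the additive variable: they are linear combinations of
    translates of the function, and the characteristic is zero
    ([extf_weights]).  If [r = 0] this is clear.  So the torus scaling all
    coordinates of [G] acts on [X] ([monoid_toric]), and in the characters of
    this toric structure the comultiplication is the binomial formula
    [(chi^u (x) chi^u) (1 (x) chi^e + chi^e (x) 1)^<p,u>], with [p] the
    additive coordinate and [e = - p] in dual bases ([toric_data_shift]).

    It remains to express this in an arbitrary toric structure on [X].  The
    weights of [K[X]] are the lattice points of a cone, by normality, and they
    generate the lattice, as the torus acts effectively ([toric_data_exists]).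
    The key point is that two toric structures on [X] differ by an
    automorphism of [X] ([toric_iso]), because the cone is determined by the
    ring [K[X]] up to an automorphism of the lattice ([frame_unique]).  To see
    this, divisorial ideals of [K[X]] are, up to multiplication, spanned by
    characters, as Laurent polynomials have greatest common divisors
    ([laurent_gcd]), so their classes form the cokernel of the matrix [P] of
    facet normals.  The number of facets whose prime divisor lies in a given
    nonprincipal class is read off from [K[X]] as the largest codimension of the
    space of decomposable elements modulo a maximal ideal ([codim_upper],
    [codim_lower]), and the rank of the group of units gives the number of
    principal facets.  Thus the facets of both
    cones are matched so that the two matrices have the same image.

    Finally, a pair [p, e] such that [<p,e> = -1] and [u + <p,u> e] is a weight
    for all weights [u] is a ray of the fan with one of its Demazure roots
    ([root_of_shift]); and conversely a ray and a Demazure root define a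
    monoid, as the binomial formula is the group law of
    [Gm^(n-1) x Ga] in coordinates adapted to [p] and [e]
    ([root_monoid_exists]). *)

(** * Unique factorization in polynomial rings *)

Section Divisibility.
Variable R : idomainType.

Definition dv (p a : R) := exists c, a = c * p.

Definition prime_elt (p : R) :=
  [/\ p != 0, p \isn't a GRing.unit
    & forall a b, dv p (a * b) -> dv p a \/ dv p b].

Definition factorial := forall a : R, a != 0 ->
  exists (s : seq R) (u : R),
    [/\ u \is a GRing.unit, forall p, p \in s -> prime_elt p
      & a = u * \prod_(p <- s) p].

Lemma dvMl p a b : dv p b -> dv p (a * b).
Proof. by case=> c ->; exists (a * c); rewrite mulrA. Qed.

Lemma dvMr p a b : dv p a -> dv p (a * b).
Proof. by rewrite mulrC; apply: dvMl. Qed.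

Lemma dvD p a b : dv p a -> dv p b -> dv p (a + b).
Proof. by case=> c -> [d ->]; exists (c + d); rewrite mulrDl. Qed.

Lemma dvN p a : dv p a -> dv p (- a).
Proof. by case=> c ->; exists (- c); rewrite mulNr. Qed.

Lemma dv0 p : dv p 0.
Proof. by exists 0; rewrite mul0r. Qed.

Lemma dv_sum p (I : eqType) (r : seq I) (P : pred I) (f : I -> R) :
  (forall i, i \in r -> P i -> dv p (f i)) -> dv p (\sum_(i <- r | P i) f i).
Proof.
move=> h; rewrite big_seq_cond; elim/big_ind: _ => //; first exact: dv0.
- by move=> a b; apply: dvD.
- by move=> i /andP [ri Pi]; apply: h.
Qed.

Lemma prime_dv_prod p u (s : seq R) : prime_elt p -> u \is a GRing.unit ->
  dv p (u * \prod_(q <- s) q) -> exists2 q, q \in s & dv p q.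
Proof.
case=> p0 pu pP uu; elim: s => [|q s IH].
  rewrite big_nil mulr1 => -[c uE]; case/negP: pu.
  by move: uu; rewrite uE unitrM => /andP [].
rewrite big_cons mulrCA => /pP [pq|/IH [q' q's pq']].
  by exists q; rewrite ?mem_head.
by exists q' => //; rewrite in_cons q's orbT.
Qed.

Lemma prime_dv_prime p q : prime_elt p -> prime_elt q -> dv p q ->
  exists2 u, u \is a GRing.unit & q = u * p.
Proof.
case=> p0 pu pP [q0 qu qP] [c qE]; exists c => //.
have /qP [[d cE]|[d pE]] : dv q (c * p) by exists 1; rewrite -qE mul1r.
  case/negP: pu; apply/unitrP; exists d.
  have: q * (d * p) = q * 1 by rewrite mulr1 mulrA (mulrC q) -cE -qE.
  by move/(mulfI q0) => dp; split; rewrite // mulrC.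
apply/unitrP; exists d.
have: p * (d * c) = p * 1 by rewrite mulr1 {2}pE qE; ring.
by move/(mulfI p0) => dp; split; rewrite // mulrC.
Qed.

End Divisibility.

Lemma factorial_iso (R S : idomainType) (f : {rmorphism R -> S}) (g : S -> R) :
  cancel f g -> cancel g f -> factorial S -> factorial R.
Proof.
move=> fg gf facS a a0; have fI := can_inj fg.
have gM x y : g (x * y) = g x * g y by apply: fI; rewrite rmorphM !gf.
have g1 : g 1 = 1 by apply: fI; rewrite rmorph1 gf.
have g0 : g 0 = 0 by apply: fI; rewrite rmorph0 gf.
have fa0 : f a != 0.
  by apply: contra_neq a0 => fa; rewrite -(fg a) fa.
have [s [u [uu sP fE]]] := facS _ fa0.
exists [seq g p | p <- s], (g u); split.
- apply/unitrP; exists (g u^-1).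
  by rewrite -!gM mulVr // mulrV // g1.
- move=> _ /mapP [p ps ->]; have [p0 pu pP] := sP _ ps; split.
  + by apply: contra_neq p0 => gp; rewrite -(gf p) gp rmorph0.
  + by apply: contra pu => /(rmorph_unit f); rewrite gf.
  + move=> b c [d bc].
    have /pP [[e bE]|[e cE]] : dv p (f b * f c).
      by exists (f d); rewrite -rmorphM bc rmorphM gf.
    * by left; exists (g e); rewrite -gM -bE fg.
    * by right; exists (g e); rewrite -gM -cE fg.
- by rewrite -(fg a) fE gM; congr (_ * _); rewrite (big_morph g gM g1) big_map.
Qed.

Section FactorialPoly.
Variable R : idomainType.
Hypothesis facR : factorial R.
Implicit Types f g h : {poly R}.

Lemma dv_polyC (p : R) f : (forall i, dv p f`_i) -> dv p%:P f.
Proof.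
move=> h; have [c cP] := choice h.
exists (\poly_(i < size f) c i); apply/polyP => i.
rewrite coefMC coef_poly; case: ltnP => // ifs.
by rewrite mul0r nth_default.
Qed.

(** Gauss's lemma: the first coefficients of [f] and [g] that [p] does not
    divide meet in a coefficient of [f * g] all of whose other summands are
    multiples of [p]. *)
Lemma prime_polyC (p : R) : prime_elt p -> prime_elt p%:P.
Proof.
case=> p0 pu pP; split; first by rewrite polyC_eq0.
  apply: contra pu => /unitrP [c [_ pc]].
  apply/unitrP; exists c`_0; have := congr1 (fun q : {poly R} => q`_0) pc.
  rewrite coefCM coef1 => e; by rewrite mulrC.
move=> f g [h fg]; apply: contrapT => /not_orP [nf ng].
have ex q : ~ dv p%:P q -> exists2 i, ~ dv p q`_i & forall j, (j < i)%N -> dv p q`_j.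
  move=> nq; have exi : exists i, `[< ~ dv p q`_i >].
    apply: contrapT => hh; apply: nq; apply: dv_polyC => i.
    by apply: contrapT => ni; apply: hh; exists i; apply/asboolP.
  case: (ex_minnP exi) => i /asboolP iP imin.
  exists i => // j ji; apply: contrapT => nj.
  have := imin j; rewrite leqNgt ji => hn; suff: false by [].
  by apply: hn; apply/asboolP.
have [i fi fl] := ex _ nf; have [j gj gl] := ex _ ng.
have : dv p (f`_i * g`_j).
  have := congr1 (fun q : {poly R} => q`_(i + j)) fg; rewrite coefMC coefM.
  have ij : (i < (i + j).+1)%N by rewrite ltnS leq_addr.
  rewrite (bigD1 (Ordinal ij)) //= addKn => E.
  have -> : f`_i * g`_j = h`_(i + j) * p -
     \sum_(k < (i + j).+1 | k != Ordinal ij) f`_k * g`_(i + j - k).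
    by rewrite -E addrK.
  apply: dvD; first by exists h`_(i + j).
  apply: dvN; apply: dv_sum => k _ kn.
  have [ki|ik] := ltnP k i; first by apply: dvMr; apply: fl.
  apply: dvMl; apply: gl; move: kn; rewrite -val_eqE /= => kn.
  by have := ltn_ord k; lia.
by case/pP.
Qed.

Let primf f := f != 0 /\ forall p : R, prime_elt p -> ~ dv p%:P f.

Let strip f g (c : R) : primf f -> c != 0 -> dv f (c%:P * g) -> dv f g.
Proof.
move=> [f0 fP] c0; have [s [u [uu sP ->]]] := facR c0.
elim: s sP => [|p s IH] sP.
  rewrite big_nil mulr1 => -[h gE]; exists ((u^-1)%:P * h).
  by rewrite -mulrA -gE mulrA -polyCM mulVr // mul1r.
rewrite big_cons mulrCA polyCM -mulrA => -[h gE].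
have [p0 pu pP] := prime_polyC (sP p (mem_head _ _)).
have /pP [[k hk]|/fP []] : dv p%:P (h * f).
- by rewrite -gE mulrC; exists ((u * \prod_(j <- s) j)%:P * g).
- apply: IH => [q qs|]; first by apply: sP; rewrite in_cons qs orbT.
  by exists k; apply: (mulfI p0); rewrite gE hk; ring.
- exact: sP (mem_head _ _).
Qed.

Let split_const f g h (c : R) : c != 0 -> c%:P * f = g * h -> f != 0 ->
  exists g' h' (d : R), [/\ f = g' * h', d != 0, h = d%:P * h'
                          & size g' = size g].
Proof.
move=> c0; have [s [u [uu sP ->]]] := facR c0.
elim: s sP f g h => [|p s IH] sP f g h.
  rewrite big_nil mulr1 => fE f0.
  exists ((u^-1)%:P * g), h, 1; split; rewrite ?oner_eq0 ?mul1r //.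
    by rewrite -mulrA -fE mulrA -polyCM mulVr // mul1r.
  by rewrite mul_polyC size_scale // invr_eq0; apply: contraTneq uu => ->; rewrite unitr0.
have IH' := IH (fun q qs => sP q (@mem_behead _ (p :: s) q qs)).
have pp := sP p (mem_head _ _).
have p0' : p != 0 by case: pp.
rewrite big_cons mulrCA polyCM -mulrA => gE f0.
have [p0 pu pP] := prime_polyC pp.
have /pP [[k gk]|[k hk]] : dv p%:P (g * h).
- by rewrite -gE; exists ((u * \prod_(j <- s) j)%:P * f); rewrite mulrC.
- have /IH' /(_ f0) [g' [h' [d [e1 e2 e3 e4]]]] :
      (u * \prod_(j <- s) j)%:P * f = k * h.
    by apply: (mulfI p0); rewrite gE gk; ring.
  exists g', h', d; split=> //; rewrite e4 gk mulrC mul_polyC size_scale //.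
- have /IH' /(_ f0) [g' [h' [d [e1 e2 e3 e4]]]] :
      (u * \prod_(j <- s) j)%:P * f = g * k.
    by apply: (mulfI p0); rewrite gE hk; ring.
  exists g', h', (d * p); split; rewrite ?mulf_neq0 //.
  by rewrite hk e3 polyCM; ring.
Qed.

(** Over the field of fractions an irreducible polynomial is coprime to every
    polynomial it does not divide; the denominators of a Bezout relation are
    cancelled one prime at a time, which primitivity of [f] allows. *)
Let irr_prime f : primf f -> (1 < size f)%N ->
  (forall g h, f = g * h -> (size g <= 1)%N \/ (size h <= 1)%N) ->
  prime_elt f.
Proof.
Import Pdiv.Idomain.
move=> pf sf irr; have [f0 fP] := pf; split=> //.
  by rewrite poly_unitE; apply/negP => /andP [/eqP e _]; rewrite e in sf.
move=> g h fgh; pose d := gcdp f g.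
have [[c1 q1] /= c1nz fE] := dvdpP _ _ (dvdp_gcdl f g).
have [[c2 q2] /= c2nz gE] := dvdpP _ _ (dvdp_gcdr f g).
have d0 : d != 0 by rewrite gcdp_eq0 negb_and f0.
rewrite -mul_polyC in fE.
have [q' [d' [e [fE' e0 dE sq]]]] := split_const c1nz fE f0.
have d'0 : d' != 0 by apply: contra_neq d0; rewrite /d dE => ->; rewrite mulr0.
have q'0 : q' != 0 by apply: contra_neq f0; rewrite fE' => ->; rewrite mul0r.
have [s1|s1] := irr _ _ fE'.
  left; have [k k0 qk] : exists2 k : R, k != 0 & q' = k%:P.
    by move: q'0; rewrite (size1_polyC s1) polyC_eq0 => ?; exists q'`_0.
  apply: (strip pf (mulf_neq0 k0 c2nz)); exists (q2 * e%:P).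
  by rewrite polyCM -mulrA mul_polyC mul_polyC gE dE fE' qk -mul_polyC; ring.
right; have [k k0 dk] : exists2 k : R, k != 0 & d = k%:P.
  exists (e * d'`_0); last by rewrite /d dE {1}(size1_polyC s1) polyCM.
  by move: d'0; rewrite (size1_polyC s1) polyC_eq0 coefC /= => ?; rewrite mulf_neq0.
have [[u v] /= /eqpP [[a b] /= /andP [a0 b0] uv]] := Bezoutp f g.
rewrite -/d dk in uv.
apply: (strip pf (mulf_neq0 b0 k0)).
have -> : (b * k)%:P * h = a *: (u * f + v * g) * h.
  by rewrite uv polyCM mul_polyC.
rewrite -scalerAl -mul_polyC; apply: dvMl; rewrite mulrDl; apply: dvD.
  by exists (u * h); ring.
by rewrite -mulrA; apply: dvMl.
Qed.

Let content f : f != 0 -> exists (s : seq R) (g : {poly R}),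
  [/\ forall p, p \in s -> prime_elt p, f = (\prod_(p <- s) p)%:P * g,
      primf g & size g = size f].
Proof.
move=> f0; have lf0 : lead_coef f != 0 by rewrite lead_coef_eq0.
have [s [u [uu sP lE]]] := facR lf0; clear lf0.
elim: {s}(size s) {-2}s (erefl (size s)) => [|n IH] s sz in f f0 u uu sP lE *.
  exists [::], f; rewrite big_nil mul1r; split=> //; split=> // p pp [g fE].
  have : dv p (lead_coef f).
    by exists (lead_coef g); rewrite fE lead_coefM lead_coefC.
  rewrite lE => /(prime_dv_prod pp uu) [q]; by rewrite (size0nil sz).
have [pf|npf] := pselect (primf f).
  by exists [::], f; rewrite big_nil mul1r; split.
have [p pp [g fE]] : exists2 p : R, prime_elt p & dv p%:P f.
  apply: contrapT => h; apply: npf; split=> // p pp pf.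
  by apply: h; exists p.
have g0 : g != 0 by apply: contra_neq f0; rewrite fE => ->; rewrite mul0r.
have p0 : p != 0 by case: pp.
have lg : lead_coef g * p = u * \prod_(q <- s) q.
  by rewrite -lE fE lead_coefM lead_coefC.
have [q qs pq] : exists2 q, q \in s & dv p q.
  by apply: (prime_dv_prod pp uu); exists (lead_coef g).
have [v vu qE] := prime_dv_prime pp (sP _ qs) pq.
have lgE : lead_coef g = (u * v) * \prod_(q <- rem q s) q.
  apply: (mulIf p0); rewrite lg (perm_big _ (perm_to_rem qs)) big_cons /= qE.
  by rewrite -!mulrA; congr (_ * _); rewrite mulrCA mulrC mulrA.
have uvu : u * v \is a GRing.unit by rewrite unitrM uu.
have sr : size (rem q s) = n by rewrite size_rem // sz.
have [t [k [tP gE pk sk]]] := IH _ sr g g0 _ uvu (fun r rs => sP r (mem_rem rs)) lgE.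
exists (p :: t), k; split=> //.
- by move=> r; rewrite in_cons => /predU1P [->|/tP].
- by rewrite fE gE big_cons polyCM; ring.
- by rewrite sk fE mulrC mul_polyC size_scale.
Qed.

Lemma factorial_poly : factorial {poly R}.
Proof.
move=> f; move: {2}(size f) (leqnn (size f)) => n.
elim: n f => [|n IH] f sf f0.
  by rewrite leqn0 size_poly_eq0 (negbTE f0) in sf.
have [s [g [sP fE pg sg]]] := content f0.
have g0 : g != 0 by case: pg.
suff [t [u [uu tP gE]]] : exists (t : seq {poly R}) u, [/\ u \is a GRing.unit,
    forall p, p \in t -> prime_elt p & g = u * \prod_(p <- t) p].
  exists ([seq p%:P | p <- s] ++ t), u; split=> //.
    move=> p; rewrite mem_cat => /orP [/mapP [q /sP qp ->]|/tP //].
    exact: prime_polyC.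
  by rewrite big_cat big_map /= fE gE rmorph_prod /=; ring.
have [s1|s1] := leqP (size g) 1.
  have [k k0 gk] : exists2 k : R, k != 0 & g = k%:P.
    by move: g0; rewrite (size1_polyC s1) polyC_eq0 => ?; exists g`_0.
  have [t [u [uu tP kE]]] := facR k0.
  exists [seq p%:P | p <- t], u%:P; split.
  - rewrite poly_unitE coefC /= uu size_polyC andbT.
    have [u0|//] := eqVneq u 0; by rewrite u0 unitr0 in uu.
  - by move=> _ /mapP [q /tP qp ->]; exact: prime_polyC.
  - by rewrite gk kE big_map polyCM rmorph_prod.
have [irr|] := pselect (forall h k, g = h * k -> (size h <= 1)%N \/ (size k <= 1)%N).
  exists [:: g], 1; rewrite unitr1 big_seq1 mul1r; split=> // p.
  by rewrite mem_seq1 => /eqP ->; apply: irr_prime.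
move=> /existsNP [h] /existsNP [k] /not_implyP [gE] /not_orP [/negP sh /negP sk].
rewrite -ltnNge in sh; rewrite -ltnNge in sk.
have h0 : h != 0 by rewrite -size_poly_gt0; lia.
have k0 : k != 0 by rewrite -size_poly_gt0; lia.
have := size_mul h0 k0; rewrite -gE sg => sE.
have [t1 [u1 [uu1 tP1 hE]]] := IH h ltac:(lia) h0.
have [t2 [u2 [uu2 tP2 kE]]] := IH k ltac:(lia) k0.
exists (t1 ++ t2), (u1 * u2); split.
- by rewrite unitrM uu1.
- by move=> p; rewrite mem_cat => /orP [/tP1|/tP2].
- by rewrite gE {1}hE {1}kE big_cat /=; ring.
Qed.

End FactorialPoly.

Lemma muniX n (R : comNzRingType) (m : 'X_{1..n.+1}) :
  muni ('X_[m] : {mpoly R[n.+1]}) =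
  'X_[[multinom (m (widen_ord (leqnSn n) i)) | i < n]] *: 'X^(m ord_max).
Proof. by rewrite muniE msuppX big_seq1 mcoeffX eqxx scale1r. Qed.

Definition muni_inv n (R : comNzRingType) (p : {poly {mpoly R[n]}}) :
  {mpoly R[n.+1]} := (map_poly (@mwiden n R) p).['X_ord_max].

Lemma muniK n (R : comNzRingType) :
  cancel (@muni n R) (@muni_inv n R).
Proof.
move=> p; rewrite [p in LHS]mpolyE raddf_sum /= /muni_inv rmorph_sum /= horner_sum.
rewrite [RHS]mpolyE; apply: eq_bigr => m _.
rewrite muniZ muniX map_polyZ map_polyZ /= map_polyXn !hornerZ hornerXn.
rewrite mwidenC mul_mpolyC; congr (_ *: _).
rewrite mwidenX mpolyXn -mpolyXD; congr ('X_[_]).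
apply/mnmP => i; rewrite mnmDE mulmnE mnm1E.
case: (unliftP ord_max i) => [j ->|->].
  have -> : lift ord_max j = widen_ord (leqnSn n) j by apply: val_inj; rewrite /= /bump leqNgt ltn_ord.
  rewrite mnmwiden_widen mnmE (_ : (ord_max == widen_ord (leqnSn n) j) = false) ?mul0n ?addn0 //.
  by apply/negbTE; rewrite -val_eqE /= neq_ltn ltn_ord orbT.
by rewrite mnmwiden_ordmax eqxx mul1n.
Qed.

Lemma muni_invK n (R : comNzRingType) :
  cancel (@muni_inv n R) (@muni n R).
Proof.
have hC (c : {mpoly R[n]}) : muni (mwiden c) = c%:P.
  rewrite [in LHS](mpolyE c) (rmorph_sum (@mwiden n R)) (rmorph_sum (@muni n R)) /=.
  rewrite [in RHS](mpolyE c) rmorph_sum /=.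
  apply: eq_bigr => m _; rewrite mwidenZ mwidenX muniZ muniX mnmwiden_ordmax expr0.
  rewrite -!mul_polyC mulr1 -polyCM mul_mpolyC; congr ((_ *: 'X_[_])%:P).
  by apply/mnmP => i; rewrite mnmE mnmwiden_widen.
have hX : muni ('X_ord_max : {mpoly R[n.+1]}) = 'X.
  rewrite muniX mnm1E eqxx expr1 -mul_polyC -[RHS]mul1r -polyC1; congr (_%:P * _).
  rewrite -mpolyX0; congr ('X_[_]); apply/mnmP => i; rewrite mnmE mnm1E mnm0E.
  by apply/eqP; rewrite eqb0 -val_eqE /= neq_ltn ltn_ord orbT.
elim/poly_ind => [|q c IH]; first by rewrite /muni_inv !rmorph0 horner0 rmorph0.
have -> : muni_inv (q * 'X + c%:P) = muni_inv q * 'X_ord_max + mwiden c.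
  by rewrite /muni_inv rmorphD rmorphM /= map_polyX map_polyC hornerMXaddC.
by rewrite rmorphD rmorphM /= hX hC IH.
Qed.

Lemma mpoly0C (R : comNzRingType) (p : {mpoly R[0]}) : p = (p@_0)%:MP.
Proof.
apply/mpolyP => m; rewrite mcoeffC.
have -> : m = 0%MM by apply/mnmP => -[].
by rewrite eqxx mulr1.
Qed.

Lemma factorial_mpoly (K : fieldType) n : factorial {mpoly K[n]}.
Proof.
elim: n => [|n IH]; last first.
  exact: factorial_iso (@muniK n K) (@muni_invK n K) (factorial_poly IH).
move=> a a0; exists [::], a; split; rewrite ?big_nil ?mulr1 //.
have [c aE] : exists c, a = c%:MP by exists a@_0; apply: mpoly0C.
have c0 : c != 0 by apply: contra_neq a0 => c0; rewrite aE c0.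
by apply/unitrP; exists (c^-1)%:MP; rewrite aE -!mpolyCM mulVf ?mulfV.
Qed.

(** * Hilbert's Nullstellensatz *)

Definition ideal (R : comNzRingType) (I : R -> Prop) :=
  [/\ I 0, forall a b, I a -> I b -> I (a + b) & forall a b, I b -> I (a * b)].

Definition prime_ideal (R : comNzRingType) (I : R -> Prop) :=
  [/\ ideal I, ~ I 1 & forall a b, I (a * b) -> I a \/ I b].

Lemma idealN (R : comNzRingType) (I : R -> Prop) a : ideal I -> I a -> I (- a).
Proof. by case=> _ _ iM Ia; rewrite -mulN1r; apply: iM. Qed.

Lemma ideal_sum (R : comNzRingType) (I : R -> Prop) (J : Type) (r : seq J)
  (P : pred J) (F : J -> R) :
  ideal I -> (forall j, P j -> I (F j)) -> I (\sum_(j <- r | P j) F j).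
Proof. by move=> [i0 iD _] h; elim/big_ind: _. Qed.

Lemma prime_idealX (R : comNzRingType) (I : R -> Prop) a k :
  prime_ideal I -> I (a ^+ k) -> I a.
Proof.
move=> [_ i1 iP]; elim: k => [|k IH]; first by rewrite expr0 => /i1.
by rewrite exprS => /iP [//|/IH].
Qed.

Lemma nonroot (K : closedFieldType) (p : {poly K}) : p != 0 -> exists b, p.[b] != 0.
Proof.
move=> p0; have [|/negP/negP] := boolP (size p <= 1)%N.
  by move/size1_polyC => pE; exists 0; move: p0; rewrite pE polyC_eq0 hornerC.
rewrite -ltnNge => sp; have sp1 : size (p - 1) != 1%N.
  by rewrite size_polyDl ?size_polyN ?size_poly1 // neq_ltn sp orbT.
have [b /rootP] := closed_rootP _ sp1; rewrite hornerD hornerN hornerC => /eqP.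
by rewrite subr_eq0 => /eqP e; exists b; rewrite e oner_eq0.
Qed.

Section NullstellensatzStep.
Variables (K : closedFieldType) (R : idomainType).
Variables (T : Type) (ev : T -> {rmorphism R -> K}).
Hypothesis nssR : forall (P : R -> Prop) (h : R), prime_ideal P -> ~ P h ->
  exists t, (forall c, P c -> ev t c = 0) /\ ev t h != 0.
Variables (Q : {poly R} -> Prop) (h : {poly R}).
Hypotheses (Qprime : prime_ideal Q) (Qh : ~ Q h).

Let Qi : ideal Q. Proof. by case: Qprime. Qed.
Let Q0 : Q 0. Proof. by case: Qi. Qed.
Let QD a b : Q a -> Q b -> Q (a + b). Proof. by case: Qi => _ /(_ a b). Qed.
Let QM a b : Q b -> Q (a * b). Proof. by case: Qi => _ _ /(_ a b). Qed.
Let QP a b : Q (a * b) -> Q a \/ Q b. Proof. by case: Qprime => _ _ /(_ a b). Qed.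
Let QX a k : Q (a ^+ k) -> Q a. Proof. exact: prime_idealX. Qed.

Let Q' (c : R) := Q c%:P.
Let Q'prime : prime_ideal Q'.
Proof.
split; last by move=> a b; rewrite /Q' polyCM => /QP.
  split=> [|a b|a b]; rewrite /Q'; first (by rewrite polyC0); first by rewrite polyCD; apply: QD.
  by rewrite polyCM; apply: QM.
by rewrite /Q'; case: Qprime.
Qed.

Let Q'0 : Q' 0. Proof. by rewrite /Q' polyC0. Qed.

(* [null] polynomials are those of the extension of [Q'] to [{poly R}]. *)
Let null (g : {poly R}) := forall i, Q' g`_i.

Let null_Q g : null g -> Q g.
Proof.
move=> ng; rewrite -[g]coefK poly_def; apply: ideal_sum => // i _.
by rewrite -mul_polyC mulrC; apply: QM; apply: ng.
Qed.

Let nullD f g : null f -> null g -> null (f + g).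
Proof. by move=> nf ng i; rewrite /Q' coefD polyCD; exact: QD (nf i) (ng i). Qed.

Let nullM f g : null g -> null (f * g).
Proof.
move=> ng i; rewrite /Q' coefM rmorph_sum /=; apply: ideal_sum => // j _.
by rewrite polyCM; apply: QM; apply: ng.
Qed.

Let reduce (S : {poly R} -> Prop) g : (forall f g, S f -> S g -> S (f + g)) ->
  (forall f, Q f -> S f) -> S g -> ~ null g ->
  exists g', [/\ S g', (size g' <= size g)%N & ~ Q' (lead_coef g')].
Proof.
move=> SD QS; move: {2}(size g) (leqnn (size g)) => n.
elim: n g => [|n IH] g sg Sg ng.
  by exfalso; apply: ng => i; rewrite nth_default ?(leq_trans sg) //.
have [lg|lg] := pselect (Q' (lead_coef g)); last by exists g.
pose t := (- lead_coef g)%:P * 'X^((size g).-1).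
have nt : null t.
  move=> i; rewrite /Q' coefCM polyCM mulrC; apply: QM.
  by rewrite polyCN; apply: idealN.
have g0 : g != 0 by apply: contra_notN ng => /eqP -> i; rewrite coef0; apply: Q'0.
have sgt : (size (g + t)%R < size g)%N.
  rewrite /t polyCN mulNr mul_polyC.
  have [k sk] : exists k, size g = k.+1 by exists (size g).-1; rewrite prednK ?size_poly_gt0.
  rewrite sk ltnS; apply/leq_sizeP => j kj; rewrite coefB coefZ coefXn /=.
  have [->|jk] := eqVneq j k; first by rewrite mulr1 lead_coefE sk subrr.
  by rewrite mulr0 subr0 nth_default // sk; lia.
have [|||g' [Sg' sg' lg']] := IH (g + t); first by lia.
- by apply: SD => //; apply: QS; apply: null_Q.
- move=> ngt; apply: ng; have -> : g = (g + t) + (-1) * t by ring.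
  by apply: nullD => //; apply: nullM.
- by exists g'; split=> //; lia.
Qed.

Let minimal (S : {poly R} -> Prop) g : (forall f g, S f -> S g -> S (f + g)) ->
  (forall f, Q f -> S f) -> S g -> ~ null g ->
  exists f, [/\ S f, ~ Q' (lead_coef f)
    & forall g, S g -> (size g < size f)%N -> null g].
Proof.
move=> SD QS Sg ng.
pose A n := `[< exists f, [/\ S f, size f = n & ~ Q' (lead_coef f)] >].
have exA : exists n, A n.
  have [f [Sf _ lf]] := reduce SD QS Sg ng.
  by exists (size f); apply/asboolP; exists f.
case: (ex_minnP exA) => n /asboolP [f [Sf sf lf]] nmin.
exists f; split=> // k Sk sk; apply: contrapT => nk.
have [k' [Sk' sk' lk']] := reduce SD QS Sk nk.
have : A (size k') by apply/asboolP; exists k'.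
by move/nmin; lia.
Qed.

Let Qpseudo (f g : {poly R}) : ~ Q' (lead_coef g) ->
  exists (k : nat) (q r : {poly R}),
   [/\ (lead_coef g ^+ k)%:P * f = q * g + r & (size r < size g)%N].
Proof.
move=> lg; exists (Pdiv.IdomainDefs.scalp f g), (Pdiv.IdomainDefs.divp f g).
exists (Pdiv.IdomainDefs.modp f g); split.
  by rewrite mul_polyC -Pdiv.WeakIdomain.divp_eq.
rewrite Pdiv.CommonIdomain.ltn_modp -lead_coef_eq0.
by apply/eqP => l0; apply: lg; rewrite l0; apply: Q'0.
Qed.

Let nQ'X c k : ~ Q' c -> ~ Q (c ^+ k)%:P.
Proof. by move=> nc; rewrite rmorphXn => /QX. Qed.

(** If [Q] is not extended from [Q'], an element [f] of [Q] of least degree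
    generates [Q] up to powers of its leading coefficient, and an element [g]
    of least degree of [Q + (h)] divides both [f] and [h] up to such powers, so
    it is a constant.  A point of [Q'] where the leading coefficient of [f] and
    that constant do not vanish lifts to any root of [f] above it. *)
Lemma nullstellensatz_poly : exists t b,
  (forall g, Q g -> (map_poly (ev t) g).[b] = 0) /\
  (map_poly (ev t) h).[b] != 0.
Proof.
have nh : ~ null h by move/null_Q.
have [allnull|/existsNP [f0 /not_implyP [Qf0 nf0]]] :=
    pselect (forall g, Q g -> null g).
  have /existsNP [i hi] := nh.
  have [t [t0 th]] := nssR Q'prime hi; exists t.
  have [|b hb] := @nonroot K (map_poly (ev t) h).
    by apply: contra_neq th => h0; rewrite -coef_map h0 coef0.
  exists b; split=> // g /allnull ng; suff -> : map_poly (ev t) g = 0 by rewrite horner0.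
  by apply/polyP => j; rewrite coef_map coef0 /= t0.
have [f [Qf lf fmin]] := minimal QD (fun f Qf => Qf) Qf0 nf0.
pose S g := exists v, Q (g - v * h).
have QS g : Q g -> S g by exists 0; rewrite mul0r subr0.
have SD g k : S g -> S k -> S (g + k).
  move=> [u gu] [v kv]; exists (u + v).
  have -> : g + k - (u + v) * h = (g - u * h) + (k - v * h) by ring.
  exact: QD.
have SM g k : S k -> S (g * k).
  move=> [u gu]; exists (g * u); rewrite -mulrA -mulrBr; exact: QM.
have Sh : S h by exists 1; rewrite mul1r subrr.
have [g [Sg lg gmin]] := minimal SD QS Sh nh.
have Sr k q r : S k -> k = q * g + r -> (size r < size g)%N -> null r.
  move=> Sk kE sr; apply: gmin => //.
  have -> : r = k + (- q) * g by rewrite kE; ring.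
  by apply: SD => //; apply: SM.
have nQg : ~ Q g.
  move=> Qg; have [k [q [r [e sr]]]] := Qpseudo h lg.
  have nr : null r by apply: (Sr _ _ _ _ e sr); apply: SM.
  have : Q ((lead_coef g ^+ k)%:P * h).
    by rewrite e; apply: QD; [apply: QM|apply: null_Q].
  by case/QP => // /(nQ'X lg).
have [k [q [r [e sr]]]] := Qpseudo f lg.
have nr : null r by apply: (Sr _ _ _ _ e sr); apply: SM; apply: QS.
have Qq : Q q.
  have : Q (q * g).
    have -> : q * g = (lead_coef g ^+ k)%:P * f + (-1) * r by rewrite e; ring.
    by apply: QD; apply: QM => //; apply: null_Q.
  by case/QP.
have fn0 : f != 0 by rewrite -lead_coef_eq0; apply/eqP => l0; apply: lf; rewrite l0; apply: Q'0.
have g0 : g != 0 by rewrite -lead_coef_eq0; apply/eqP => l0; apply: lg; rewrite l0; apply: Q'0.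
have lgk0 : lead_coef g ^+ k != 0 by rewrite expf_neq0 // lead_coef_eq0.
have sg : (size g <= 1)%N.
  rewrite leqNgt; apply/negP => sg.
  have nq : null q.
    apply: fmin => //; have [->|q0] := eqVneq q 0.
      by rewrite size_poly0 size_poly_gt0.
    have := congr1 (size \o @polyseq R) e => /=.
    rewrite mul_polyC size_scale // size_polyDl.
      by rewrite size_mul // => ->; move: sg; case: (size g) => // -[] // m _; rewrite !addnS /=; lia.
    by rewrite size_mul //; move: q0; rewrite -size_poly_gt0; case: (size q) => // m _; lia.
  have : null ((lead_coef g ^+ k)%:P * f) by rewrite e mulrC; apply: nullD => //; apply: nullM.
  move/(_ (size f).-1); rewrite /Q' coefCM polyCM => /QP [/(nQ'X lg) //|]; exact: lf.
have gE := size1_polyC sg; set c := g`_0 in gE.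
have lgc : lead_coef g = c by rewrite gE lead_coefC.
have sf : (1 < size f)%N.
  rewrite ltnNge; apply/negP => sf; apply: lf.
  by rewrite (size1_polyC sf) lead_coefC /Q' -size1_polyC.
have lc : ~ Q' (lead_coef f * c).
  by rewrite /Q' polyCM => /QP [//|]; rewrite -lgc.
have [t [t0 tlc]] := nssR Q'prime lc; exists t.
move: tlc; rewrite rmorphM mulf_eq0 negb_or => /andP [tl tc].
have sft : size (map_poly (ev t) f) != 1%N by rewrite size_poly_eq //; lia.
have [b /rootP fb] := closed_rootP _ sft.
have Qb k' : Q k' -> (map_poly (ev t) k').[b] = 0.
  move=> Qk; have [i [p [s [e1 ss]]]] := Qpseudo k' lf.
  have ns : null s.
    apply: fmin => //; have -> : s = (lead_coef f ^+ i)%:P * k' + (- p) * f by rewrite e1; ring.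
    by apply: QD; apply: QM.
  have := congr1 (fun z => (map_poly (ev t) z).[b]) e1.
  rewrite /= rmorphD !rmorphM /= !hornerE fb mulr0 add0r map_polyC hornerC /=.
  have -> : map_poly (ev t) s = 0.
    by apply/polyP => j; rewrite coef_map coef0 /= t0.
  rewrite horner0 rmorphXn => /eqP; rewrite mulf_eq0 expf_eq0 (negbTE tl) andbF.
  by move/eqP.
exists b; split=> //.
have [v /Qb] := Sg; rewrite gE rmorphB rmorphM /= map_polyC !hornerE => /eqP.
rewrite subr_eq0 => /eqP ce; apply: contraNneq tc => h0.
by rewrite /= ce h0 mulr0.
Qed.
End NullstellensatzStep.

Definition vext n (K : Type) (a : 'I_n -> K) (b : K) (i : 'I_n.+1) : K :=
  if unlift ord_max i is Some j then a j else b.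

Lemma meval_muni n (K : comNzRingType) (p : {mpoly K[n.+1]}) (a : 'I_n -> K) b :
  p.@[vext a b] = (map_poly (meval a) (muni p)).[b].
Proof.
have vw j : vext a b (widen_ord (leqnSn n) j) = a j.
  have -> : widen_ord (leqnSn n) j = lift ord_max j.
    by apply: val_inj; rewrite /= /bump leqNgt ltn_ord.
  by rewrite /vext liftK.
have vm : vext a b ord_max = b by rewrite /vext unlift_none.
rewrite (mpolyE p) raddf_sum (rmorph_sum (@muni n K)) rmorph_sum /= horner_sum.
apply: eq_bigr => m _; rewrite mevalZ muniZ muniX !map_polyZ /= map_polyXn.
rewrite !hornerZ hornerXn mevalC !mevalX big_ord_recr /= vm; congr (_ * (_ * _)).
by apply: eq_bigr => j _; rewrite vw mnmE.
Qed.

Lemma nullstellensatz_prime (K : closedFieldType) n (P : {mpoly K[n]} -> Prop) h :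
  prime_ideal P -> ~ P h ->
  exists v : 'I_n -> K, (forall p, P p -> p.@[v] = 0) /\ h.@[v] != 0.
Proof.
elim: n P h => [|n IH] P h Pp Ph.
  have [Pi P1 _] := Pp; exists (fun=> 0); rewrite (mpoly0C h) mevalC; split.
    move=> p; rewrite (mpoly0C p) mevalC => Pc; apply/eqP/negPn/negP => c0.
    apply: P1; have [_ _ PM] := Pi; have := PM ((p@_0)^-1)%:MP _ Pc.
    by rewrite -mpolyCM mulVf // mpolyC1.
  apply: contra_notN Ph => /eqP h0; rewrite (mpoly0C h) h0 mpolyC0.
  by case: Pi.
have invM : {morph @muni_inv n K : x y / x * y}.
  by move=> x y; apply: (can_inj (@muniK n K)); rewrite rmorphM /= !muni_invK.
have invD : {morph @muni_inv n K : x y / x + y}.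
  by move=> x y; apply: (can_inj (@muniK n K)); rewrite rmorphD /= !muni_invK.
pose Q p := P (muni_inv p).
have Qp : prime_ideal Q.
  have [[P0 PD PM] P1 PP] := Pp; split; last by move=> a b; rewrite /Q invM => /PP.
    split; first by rewrite /Q -(rmorph0 (@muni n K)) muniK.
      by move=> a b; rewrite /Q invD; apply: PD.
    by move=> a b; rewrite /Q invM; apply: PM.
  by rewrite /Q -(rmorph1 (@muni n K)) muniK.
have Qh : ~ Q (muni h) by rewrite /Q muniK.
have [a [b [v0 vh]]] :=
  @nullstellensatz_poly K _ ('I_n -> K) (fun v => meval v) IH Q (muni h) Qp Qh.
exists (vext a b); split; last by rewrite meval_muni.
by move=> p Pp'; rewrite meval_muni; apply: v0; rewrite /Q muniK.
Qed.

(** An ideal that is maximal among those containing no power of [h] is prime. *)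
Lemma prime_avoiding (R : comNzRingType) (I : R -> Prop) (h : R) :
  ideal I -> (forall k, ~ I (h ^+ k)) ->
  exists P, [/\ prime_ideal P, forall a, I a -> P a & ~ P h].
Proof.
move=> Ii Ih.
pose ok (J : R -> Prop) := [/\ ideal J, forall a, I a -> J a & forall k, ~ J (h ^+ k)].
(* The empty set is added so that unions of empty chains stay in the family. *)
pose fam : classical_sets.set (classical_sets.set R) :=
  fun J => (forall a, ~ J a) \/ ok J.
have [F Ftot Ffam|J [Jok Jmax]] := @classical_sets.Zorn_bigcup R fam.
  have [[J FJ [a Ja]]|none] := pselect (exists2 J, F J & exists a, J a); last first.
    by left => a [J FJ Ja]; apply: none; exists J => //; exists a.
  have okF L : F L -> (exists b, L b) -> ok L.
    by move=> FL [b Lb]; case: (Ftot _ FL) => // /(_ b).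
  right; split.
  - split; first by exists J => //; case: (okF J FJ) => [|[]//]; exists a.
    + move=> x y [J1 F1 x1] [J2 F2 y2].
      have [[_ D1 _] _ _] : ok J1 by apply: okF => //; exists x.
      have [[_ D2 _] _ _] : ok J2 by apply: okF => //; exists y.
      have [s|s] := Ffam _ _ F1 F2.
        by exists J2 => //; apply: D2 => //; apply: s.
      by exists J1 => //; apply: D1 => //; apply: s.
    + move=> x y [J1 F1 y1]; exists J1 => //.
      by have [[_ _ M1] _ _] : ok J1 by [apply: okF => //; exists y]; apply: M1.
  - move=> x Ix; exists J => //.
    by have [_ IJ _] : ok J by [apply: okF => //; exists a]; apply: IJ.
  - move=> k [L FL Lh]; have [_ _ Lk] : ok L by apply: okF => //; exists (h ^+ k).
    exact: Lk Lh.
have Iok : ok I by split.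
have {}Jok : ok J.
  case: Jok => // Jn; case: (Jmax I); last by right.
  split; first by move=> a /Jn.
  by case: Ii => I0 _ _ /(_ 0 I0) /Jn.
have [[J0 JD JM] IJ Jh] := Jok; exists J; split=> //; last by rewrite -[h]expr1.
split=> //; first by rewrite -(expr0 h).
have grow a : ~ J a -> exists k b, J (h ^+ k - b * a).
  move=> na; apply: contrapT => none.
  case: (Jmax (fun x => exists b, J (x - b * a))).
    split; first by move=> x Jx; exists 0; rewrite mul0r subr0.
    by move=> hs; apply: na; apply: hs; exists 1; rewrite mul1r subrr.
  right; split.
  - split; first by exists 0; rewrite mul0r subr0.
    + move=> x y [b xb] [c yc]; exists (b + c).
      have -> : x + y - (b + c) * a = (x - b * a) + (y - c * a) by ring.
      exact: JD.
    + move=> x y [c yc]; exists (x * c); rewrite -mulrA -mulrBr; exact: JM.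
  - by move=> x /IJ Jx; exists 0; rewrite mul0r subr0.
  - by move=> k [b hb]; apply: none; exists k, b.
move=> a b Jab; apply: contrapT => /not_orP [/grow [k [c kc]] /grow [l [d ld]]].
apply: (Jh (k + l)); rewrite exprD.
have -> : h ^+ k * h ^+ l = h ^+ l * (h ^+ k - c * a) + c * a * (h ^+ l - d * b)
   + (c * d) * (a * b) by ring.
exact: (JD _ _ (JD _ _ (JM _ _ kc) (JM _ _ ld)) (JM _ _ Jab)).
Qed.

Theorem nullstellensatz (K : closedFieldType) n (I : {mpoly K[n]} -> Prop) h :
  ideal I ->
  (forall v : 'I_n -> K, (forall p, I p -> p.@[v] = 0) -> h.@[v] = 0) ->
  exists k, I (h ^+ k).
Proof.
move=> Ii Ih; apply: contrapT => none.
have [|P [Pp IP Ph]] := @prime_avoiding _ I h Ii.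
  by move=> k hk; apply: none; exists k.
have [v [v0]] := nullstellensatz_prime Pp Ph.
by rewrite Ih ?eqxx // => p /IP /v0.
Qed.

(** * Monomial frames in a field *)

Lemma uniq_map_inj (T U : eqType) (f : T -> U) (s : seq T) :
  uniq (map f s) -> {in s &, injective f}.
Proof.
elim: s => // r s IH /= /andP [rs us] x y; rewrite !in_cons.
move=> /predU1P [->|xs] /predU1P [->|ys] // e; last exact: IH.
  by rewrite e map_f in rs.
by rewrite -e map_f in rs.
Qed.

Section Frame.
Variables (K F : fieldType) (cst : {rmorphism K -> F}) (n : nat).
Notation M := 'rV[int]_n.
Variable chi : M -> F.

(** Formal Laurent polynomials are lists of terms; [ev] is their value. *)
Notation terms := (seq (K * M)).

Definition ev (l : terms) : F := \sum_(p <- l) cst p.1 * chi p.2.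

Definition supp (P : M -> Prop) (l : terms) := forall p, p \in l -> P p.2.

Definition gspan (P : M -> Prop) (z : F) := exists2 l, supp P l & z = ev l.

Definition lsum (Q : pred M) (l : terms) : K := \sum_(p <- l | Q p.2) p.1.

Definition lscale (k : K) (l : terms) : terms := [seq (k * p.1, p.2) | p <- l].

Definition lmul (l1 l2 : terms) : terms :=
  [seq (p.1 * q.1, p.2 + q.2) | p <- l1, q <- l2].

Hypothesis chiD : forall u v, chi (u + v) = chi u * chi v.
Hypothesis chi0 : chi 0 = 1.
Hypothesis chi_free : forall (s : seq M) (a : M -> K), uniq s ->
  \sum_(u <- s) cst (a u) * chi u = 0 -> forall u, u \in s -> a u = 0.

Lemma chi_neq0 u : chi u != 0.
Proof.
have: chi u * chi (- u) = 1 by rewrite -chiD subrr.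
by apply: contra_eq_neq => ->; rewrite mul0r eq_sym oner_eq0.
Qed.

Lemma chiN u : chi (- u) = (chi u)^-1.
Proof.
by apply: (mulfI (chi_neq0 u)); rewrite -chiD subrr mulfV ?chi_neq0.
Qed.

Lemma ev_cat l1 l2 : ev (l1 ++ l2) = ev l1 + ev l2.
Proof. by rewrite /ev big_cat. Qed.

Lemma ev_scale k l : ev (lscale k l) = cst k * ev l.
Proof.
rewrite /ev big_map mulr_sumr; apply: eq_bigr => p _ /=.
by rewrite rmorphM mulrA.
Qed.

Lemma ev_mul l1 l2 : ev (lmul l1 l2) = ev l1 * ev l2.
Proof.
rewrite /ev /lmul big_allpairs_dep big_distrl; apply: eq_bigr => p _.
rewrite big_distrr; apply: eq_bigr => q _ /=.
by rewrite rmorphM chiD mulrACA.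
Qed.

Lemma lsum_cat Q l1 l2 : lsum Q (l1 ++ l2) = lsum Q l1 + lsum Q l2.
Proof. by rewrite /lsum big_cat. Qed.

Lemma lsum_scale Q k l : lsum Q (lscale k l) = k * lsum Q l.
Proof. by rewrite /lsum big_map mulr_sumr. Qed.

Lemma lsum_mul Q l1 l2 :
  lsum Q (lmul l1 l2) = \sum_(q <- l2) q.1 * lsum (fun u => Q (u + q.2)) l1.
Proof.
rewrite /lsum /lmul big_mkcond big_allpairs_dep exchange_big /=.
apply: eq_bigr => q _; rewrite [in RHS]big_mkcond big_distrr /=.
by apply: eq_bigr => p _; case: ifP; rewrite ?mulr0 // mulrC.
Qed.

Lemma supp_cat P l1 l2 : supp P l1 -> supp P l2 -> supp P (l1 ++ l2).
Proof. by move=> h1 h2 p; rewrite mem_cat => /orP [/h1|/h2]. Qed.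

Lemma supp_scale P k l : supp P l -> supp P (lscale k l).
Proof. by move=> h _ /mapP [p /h Pp ->]. Qed.

Lemma supp_mul (P Q T : M -> Prop) l1 l2 :
  (forall u v, P u -> Q v -> T (u + v)) ->
  supp P l1 -> supp Q l2 -> supp T (lmul l1 l2).
Proof.
move=> h h1 h2 _ /allpairsP [[p q] [/= /h1 Pp /h2 Qq ->]]; exact: h.
Qed.

Lemma big_by_exponent (V : nmodType) (f : K * M -> V) (R : pred M) (l : terms) :
  \sum_(p <- l | R p.2) f p =
  \sum_(u <- undup [seq p.2 | p <- l] | R u) \sum_(p <- l | p.2 == u) f p.
Proof.
rewrite (exchange_big_dep (fun p => R p.2)) /=; last by move=> u p Ru /eqP ->.
rewrite big_seq_cond [in RHS]big_seq_cond; apply: eq_bigr => p /andP [pl Rp].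
have ps : p.2 \in undup [seq p.2 | p <- l] by rewrite mem_undup map_f.
rewrite -big_filter (_ : filter _ _ = [:: p.2]) ?big_seq1 //.
rewrite (@eq_in_filter _ _ (pred1 p.2)) ?filter_pred1_uniq ?undup_uniq //.
by move=> u _ /=; have [<-|] := eqVneq p.2 u; rewrite ?andbF // andbT.
Qed.

Definition coef (l : terms) (u : M) : K := lsum (pred1 u) l.

Lemma ev_coef l : ev l = \sum_(u <- undup [seq p.2 | p <- l]) cst (coef l u) * chi u.
Proof.
rewrite /ev (big_by_exponent _ xpredT); apply: eq_bigr => u _.
by rewrite /coef /lsum rmorph_sum mulr_suml; apply: eq_bigr => p /eqP ->.
Qed.

(** By linear independence a formal Laurent polynomial of value zero has zero
    coefficients. *)
Lemma lsum_ev0 Q l : ev l = 0 -> lsum Q l = 0.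
Proof.
rewrite ev_coef => /(chi_free (undup_uniq _)) cf0.
by rewrite /lsum big_by_exponent big_seq_cond big1 // => u /andP [/cf0].
Qed.

Lemma lsum_ev Q l1 l2 : ev l1 = ev l2 -> lsum Q l1 = lsum Q l2.
Proof.
move=> e; apply/eqP; rewrite -subr_eq0 -mulN1r -lsum_scale -lsum_cat; apply/eqP.
by apply: lsum_ev0; rewrite ev_cat ev_scale e rmorphN1 mulN1r subrr.
Qed.

Lemma gspan0 P : gspan P 0.
Proof. by exists [::] => //; rewrite /ev big_nil. Qed.

Lemma gspanD P z w : gspan P z -> gspan P w -> gspan P (z + w).
Proof.
move=> [l1 h1 ->] [l2 h2 ->]; exists (l1 ++ l2); rewrite ?ev_cat //.
exact: supp_cat.
Qed.

Lemma gspanZ P k z : gspan P z -> gspan P (cst k * z).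
Proof.
move=> [l h ->]; exists (lscale k l); rewrite ?ev_scale //; exact: supp_scale.
Qed.

Lemma gspanN P z : gspan P z -> gspan P (- z).
Proof. by rewrite -mulN1r -(rmorphN1 cst); apply: gspanZ. Qed.

Lemma gspanB P z w : gspan P z -> gspan P w -> gspan P (z - w).
Proof. by move=> hz hw; apply: gspanD => //; apply: gspanN. Qed.

Lemma gspanM (P Q T : M -> Prop) z w : (forall u v, P u -> Q v -> T (u + v)) ->
  gspan P z -> gspan Q w -> gspan T (z * w).
Proof.
move=> h [l1 h1 ->] [l2 h2 ->]; exists (lmul l1 l2); rewrite ?ev_mul //.
exact: supp_mul h h1 h2.
Qed.

Lemma gspanS (P Q : M -> Prop) z : (forall u, P u -> Q u) -> gspan P z -> gspan Q z.
Proof. by move=> h [l hl ->]; exists l => // p /hl /h. Qed.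

Lemma gspan_chi (P : M -> Prop) u : P u -> gspan P (chi u).
Proof.
move=> Pu; exists [:: (1, u)]; first by move=> p; rewrite mem_seq1 => /eqP ->.
by rewrite /ev big_seq1 rmorph1 mul1r.
Qed.

Lemma gspan_ind (P : M -> Prop) (H : F -> Prop) z :
  H 0 -> (forall x y, H x -> H y -> H (x + y)) ->
  (forall k u, P u -> H (cst k * chi u)) -> gspan P z -> H z.
Proof.
move=> H0 HD Hm [l hl ->]; rewrite /ev big_seq; elim/big_ind: _ => // p /hl.
exact: Hm.
Qed.

Notation L := (gspan (fun=> True)).

Lemma gspanL P z : gspan P z -> L z. Proof. exact: gspanS. Qed.

(** The normal form of a Laurent polynomial, which only involves exponents
    that occur in every expression of it. *)
Lemma normal_form z : L z -> exists l : terms,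
  [/\ z = ev l, uniq [seq p.2 | p <- l],
      (forall p, p \in l -> p.1 != 0)
    & forall P, gspan P z -> supp P l].
Proof.
case=> l _ zE; pose s := [seq u <- undup [seq p.2 | p <- l] | coef l u != 0].
have sE : [seq p.2 | p <- [seq (coef l u, u) | u <- s]] = s.
  by rewrite -map_comp -[RHS]map_id.
exists [seq (coef l u, u) | u <- s]; split.
- rewrite zE ev_coef /ev big_map big_filter /= [in RHS]big_mkcond /=.
  by apply: eq_bigr => u _; case: eqP => // ->; rewrite rmorph0 mul0r.
- by rewrite sE filter_uniq // undup_uniq.
- by move=> _ /mapP [u us ->] /=; move: us; rewrite mem_filter => /andP [].
- move=> P [l' hl' zE'] _ /mapP [u us ->] /=.
  move: us; rewrite mem_filter => /andP [cu _].
  have : coef l' u != 0 by rewrite /coef -(@lsum_ev _ l l') -?zE.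
  have [/hasP [p pl' /eqP <-] _|/hasPn none] := boolP (has (fun p => p.2 == u) l').
    exact: hl'.
  by rewrite /coef /lsum big_seq_cond big1 ?eqxx // => p /andP [/none /negbTE]  /= ->.
Qed.

Lemma gspanI (P Q : M -> Prop) z : gspan P z -> gspan Q z ->
  gspan (fun u => P u /\ Q u) z.
Proof.
move=> hP hQ; have [l [zE _ _ h]] := normal_form (gspanL hP).
by exists l => // p pl; split; [exact: (h P hP p pl)|exact: (h Q hQ p pl)].
Qed.

Lemma gspan_forall (I : Type) (P : I -> M -> Prop) z : L z ->
  (forall i, gspan (P i) z) -> gspan (fun u => forall i, P i u) z.
Proof.
move=> Lz hP; have [l [zE _ _ h]] := normal_form Lz.
by exists l => // p pl i; exact: (h (P i) (hP i) p pl).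
Qed.

Lemma gspan_none (P : M -> Prop) z : (forall u, ~ P u) -> gspan P z -> z = 0.
Proof.
move=> h [[|p l] hl ->]; first by rewrite /ev big_nil.
by case: (h p.2); apply: hl; rewrite mem_head.
Qed.

(** ** Monomial valuations *)

Section Level.
Variables (v : M -> int) (vD : {morph v : u w / u + w}).

Definition ge (a : int) := gspan (fun u => a <= v u).

(* [z] has value exactly [a] for the valuation attached to [v]. *)
Definition lev (z : F) (a : int) :=
  exists z0 z1, [/\ z = z0 + z1, z0 != 0, gspan (fun u => v u = a) z0
                  & ge (a + 1) z1].

Lemma level_exists z : L z -> z != 0 -> exists a, lev z a.
Proof.
move=> Lz z0; have [l [zE ul l0 _]] := normal_form Lz.
have : exists2 q, q \in l & forall p, p \in l -> v q.2 <= v p.2.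
  have: l != [::] by apply: contra_neq z0 => l0'; rewrite zE l0' /ev big_nil.
  elim: l {zE ul l0} => // p l IH _; have [->|/IH [q ql hq]] := eqVneq l [::].
    by exists p; rewrite ?mem_head // => r; rewrite mem_seq1 => /eqP ->.
  have [pq|qp] := leP (v p.2) (v q.2).
    exists p; rewrite ?mem_head // => r; rewrite in_cons => /predU1P [->//|/hq].
    exact: le_trans.
  exists q; rewrite ?in_cons ?ql ?orbT // => r; rewrite in_cons.
  by move=> /predU1P [->|/hq//]; apply: ltW.
move=> [q ql hq]; pose a := v q.2.
pose l1 := [seq p <- l | v p.2 == a]; pose l2 := [seq p <- l | v p.2 != a].
exists a, (ev l1), (ev l2); split.
- rewrite zE /ev !big_filter [LHS](bigID (fun p : K * M => v p.2 == a)).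
  by congr (_ + _).
- apply/eqP => l10; have /(lsum_ev0 (pred1 q.2)) := l10.
  rewrite /lsum -big_filter -filter_predI.
  rewrite (@eq_in_filter _ _ (pred1 q)) ?filter_pred1_uniq ?(map_uniq ul) //.
    by rewrite big_seq1 => /eqP; apply/negP; apply: l0.
  move=> p pl /=; apply/andP/eqP => [[/eqP pq _]|->]; last by rewrite !eqxx.
  exact: (uniq_map_inj ul).
- by exists l1 => // p; rewrite mem_filter => /andP [/eqP].
- exists l2 => // p; rewrite mem_filter => /andP [pa /hq].
  by move=> qp; rewrite lezD1 lt_neqAle eq_sym pa.
Qed.

Lemma geD a b z w : ge a z -> ge b w -> ge (a + b) (z * w).
Proof. by apply: gspanM => u x ? ?; rewrite vD lerD. Qed.

Lemma geS a b z : a <= b -> ge b z -> ge a z.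
Proof. by move=> ab; apply: gspanS => u; apply: le_trans. Qed.

Lemma lev_ge z a : lev z a -> ge a z.
Proof.
move=> [z0 [z1 [-> _ h0 h1]]]; apply: gspanD.
  by apply: gspanS h0 => u ->.
by apply: geS h1; rewrite lerDl.
Qed.

(** Values add up because the product of two initial forms is not zero. *)
Lemma lev_mul z w a b k : lev z a -> lev w b -> ge k (z * w) -> k <= a + b.
Proof.
move=> lz lw gk; rewrite leNgt; apply/negP => abk.
have [z0 [z1 [zE z0n hz0 hz1]]] := lz; have [w0 [w1 [wE w0n hw0 hw1]]] := lw.
have h1 : gspan (fun u => v u = a + b) (z0 * w0).
  by apply: gspanM hz0 hw0 => u x <- <-; rewrite vD.
have h2 : ge (a + b + 1) (z0 * w0).
  have -> : z0 * w0 = z * w - (z0 * w1 + z1 * w) by rewrite zE wE; ring.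
  apply: gspanB; first by apply: geS gk; lia.
  apply: gspanD.
    have hz0' : ge a z0 by apply: gspanS hz0 => u ->.
    by apply: geS (geD hz0' hw1); rewrite addrA.
  by apply: geS (geD hz1 (lev_ge lw)); lia.
have /gspan_none e : gspan (fun u => v u = a + b /\ a + b + 1 <= v u) (z0 * w0).
  exact: gspanI.
suff /eqP : z0 * w0 = 0 by rewrite mulf_eq0 (negbTE z0n) (negbTE w0n).
by apply: e => u [->]; lia.
Qed.

Lemma lev1 : lev 1 0.
Proof.
exists 1, 0; rewrite addr0 oner_eq0; split=> //; last exact: gspan0.
by rewrite -chi0; apply: gspan_chi; apply: (addrI (v 0)); rewrite -vD !addr0.
Qed.

Lemma lev_unique z a k : lev z a -> ge k z -> k <= a.
Proof. by move=> lz gz; rewrite -[a]addr0; apply: lev_mul lz lev1 _; rewrite mulr1. Qed.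

End Level.

(** An invertible Laurent polynomial has the same lowest and highest value in
    every coordinate, so it is a monomial. *)
Lemma laurent_unit g h : L g -> L h -> g * h = 1 ->
  exists k u, k != 0 /\ g = cst k * chi u.
Proof.
move=> Lg Lh gh; have g0 : g != 0 by apply: contra_eq_neq gh => ->; rewrite mul0r eq_sym oner_eq0.
have h0 : h != 0 by apply: contra_eq_neq gh => ->; rewrite mulr0 eq_sym oner_eq0.
have cst_v (v : M -> int) : {morph v : u w / u + w} ->
    exists a, gspan (fun u => v u = a) g.
  move=> vD; have vND : {morph (fun u => - v u) : u w / u + w}.
    by move=> u w; rewrite vD opprD.
  have [a la] := level_exists v Lg g0; have [b lb] := level_exists v Lh h0.
  have [a' la'] := level_exists (fun u => - v u) Lg g0.
  have [b' lb'] := level_exists (fun u => - v u) Lh h0.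
  have sum0 (w : M -> int) (wD : {morph w : u x / u + x}) c d :
      lev w g c -> lev w h d -> c + d = 0.
    move=> lc ld; apply: le_anti; apply/andP; split.
      by apply: (lev_unique wD (lev1 wD)); rewrite -gh; apply: geD => //; apply: lev_ge.
    by apply: (lev_mul wD lc ld); rewrite gh; apply: lev_ge (lev1 wD).
  have ab := sum0 v vD _ _ la lb; have ab' := sum0 _ vND _ _ la' lb'.
  have gI := gspanI (lev_ge la) (lev_ge la').
  have bb' := gspanI (lev_ge lb) (lev_ge lb'); exists a.
  suff aE : a = - a' by apply: gspanS gI => u [? ?]; apply: le_anti; lia.
  apply: le_anti; apply/andP; split; last first.
    have [//|lt] := leP (- a') a.
    case/negP: h0; apply/eqP; apply: gspan_none bb' => u [? ?]; lia.
  have [//|lt] := leP a (- a').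
  case/negP: g0; apply/eqP; apply: gspan_none gI => u [? ?]; lia.
have [u ug] : exists u, gspan (eq u) g.
  have [a ha] := choice (fun i : 'I_n => cst_v (fun u => u ord0 i) (fun u w => mxE _ _ _ _)).
  exists (\row_i a i); apply: gspanS (gspan_forall Lg ha) => w hw.
  by apply/rowP => i; rewrite mxE -(hw i).
have {ug} [k gE] : exists k, g = cst k * chi u.
  apply: (gspan_ind (H := fun z => exists k, z = cst k * chi u)) ug.
  - by exists 0; rewrite rmorph0 mul0r.
  - by move=> x y [k ->] [l ->]; exists (k + l); rewrite rmorphD mulrDl.
  - by move=> k _ <-; exists k.
exists k, u; split=> //; apply: contra_neq g0 => k0.
by rewrite gE k0 rmorph0 mul0r.
Qed.

(** ** Greatest common divisors of Laurent polynomials *)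

Definition mrow (m : 'X_{1..n}) : M := \row_i (m i)%:Z.

Lemma mrowD m1 m2 : mrow (m1 + m2)%MM = mrow m1 + mrow m2.
Proof. by apply/rowP => i; rewrite !mxE mnmDE PoszD. Qed.

Lemma mrow_inj : injective mrow.
Proof.
by move=> m1 m2 /rowP e; apply/mnmP => i; have := e i; rewrite !mxE => -[].
Qed.

Definition chi_var (i : 'I_n) : F := chi (delta_mx ord0 i).
Local Notation poly_val := (mmap cst chi_var).

Lemma poly_valX m : poly_val 'X_[m] = chi (mrow m).
Proof.
have chiMn u k : chi (u *+ k) = chi u ^+ k.
  by elim: k => [|k IH]; rewrite ?mulr0n ?chi0 // mulrS chiD IH exprS.
have chi_sum (f : 'I_n -> M) : chi (\sum_i f i) = \prod_i chi (f i).
  by apply: (big_morph chi); [apply: chiD|apply: chi0].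
rewrite mmapX /mmap1 [mrow m]row_sum_delta chi_sum.
by apply: eq_bigr => i _; rewrite mxE -chiMn -scaler_nat natz.
Qed.

Lemma poly_valE p : poly_val p = ev [seq (p@_m, mrow m) | m <- msupp p].
Proof.
rewrite /ev big_map; apply: eq_bigr => m _ /=.
by rewrite -poly_valX mmapX.
Qed.

Lemma poly_val_inj : injective poly_val.
Proof.
move=> p q /eqP; rewrite -subr_eq0 -rmorphB /= => /eqP; set r := p - q => r0.
apply/eqP; rewrite -subr_eq0 -/r; apply/eqP/mpolyP => m; rewrite mcoeff0.
have [mr|] := boolP (m \in msupp r); last by rewrite mcoeff_msupp negbK => /eqP.
have := r0; rewrite poly_valE => /(lsum_ev0 (pred1 (mrow m))).
rewrite /lsum big_map big_mkcond (bigD1_seq m) //= eqxx big1 ?addr0 // => m' mm'.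
by case: eqP => // /mrow_inj e; rewrite e eqxx in mm'.
Qed.

Lemma poly_val_L p : L (poly_val p).
Proof. by rewrite poly_valE; eexists; last by []. Qed.

Lemma LM x y : L x -> L y -> L (x * y). Proof. exact: gspanM. Qed.

Lemma L_chi u : L (chi u). Proof. exact: gspan_chi. Qed.

Lemma L_clear z : L z -> exists p w, z * chi (mrow w) = poly_val p.
Proof.
apply: (gspan_ind (H := fun z => exists p w, z * chi (mrow w) = poly_val p)) => [|x y [p [w e]] [q [w' e']]|k u _].
- by exists 0, 0%MM; rewrite mul0r rmorph0.
- exists (p * 'X_[w'] + q * 'X_[w]), (w + w')%MM.
  by rewrite rmorphD !rmorphM /= !poly_valX -e -e' mrowD chiD; ring.
- exists (k *: 'X_[[multinom absz (u ord0 i + (absz (u ord0 i))%:Z)%R | i < n]]).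
  exists [multinom absz (u ord0 i) | i < n].
  rewrite -mul_mpolyC rmorphM /= poly_valX -mulrA -chiD mmapC.
  have e (x : int) : x + (absz x)%:Z = (absz (x + (absz x)%:Z))%:Z by lia.
  by congr (_ * chi _); apply/rowP => i; rewrite !mxE !mnmE; apply: e.
Qed.

Let valM p q : poly_val (p * q) = poly_val p * poly_val q.
Proof. exact: rmorphM. Qed.

(* Two Laurent polynomials become polynomials after multiplication by monomials;
   identities between them can therefore be checked on polynomials. *)
Let dvL (pi : {mpoly K[n]}) (p r : {mpoly K[n]}) u : prime_elt pi ->
  poly_val p * chi u = poly_val r * poly_val pi ->
  (exists w, dv pi 'X_[w]) \/ dv pi p.
Proof.
move=> [_ _ piP] e; have [q [w wq]] := L_clear (L_chi u).
have : p * q = r * 'X_[w] * pi.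
  by apply: poly_val_inj; rewrite !valM -wq poly_valX mulrA e; ring.
move=> e'; have : dv pi (p * q) by exists (r * 'X_[w]).
case/piP => [|[k kq]]; first by right.
left; have [q' [w' wq']] := L_clear (L_chi (- u)).
exists (w + w')%MM; exists (k * q').
apply: poly_val_inj; rewrite poly_valX !valM mulrAC -valM -kq.
by rewrite -wq -wq' mrowD chiD chiN; field; rewrite chi_neq0.
Qed.

(** A family of Laurent polynomials has a greatest common divisor [d]: a
    fraction which multiplies the family divided by [d] into Laurent
    polynomials is itself one.  A common divisor of maximal degree will do:
    a prime factor of the denominator of the fraction that does not divide its
    numerator would divide every member of the family divided by [d]. *)
Lemma laurent_gcd (J : F -> Prop) j0 :
  (forall f, exists a b, [/\ L a, L b, b != 0 & f = a / b]) ->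
  (forall j, J j -> L j) -> J j0 -> j0 != 0 ->
  exists d, [/\ d != 0, L d, forall j, J j -> L (j / d)
    & forall f, (forall j, J j -> L (f * j / d)) -> L f].
Proof.
move=> frac JL Jj0 j00.
pose Jp p := exists j w, J j /\ j * chi (mrow w) = poly_val p.
have [p0 [w0 e0]] := L_clear (JL _ Jj0).
have p00 : p0 != 0.
  have: poly_val p0 != 0 by rewrite -e0 mulf_neq0 // chi_neq0.
  by apply: contra_neq => ->; rewrite rmorph0.
have Jp0 : Jp p0 by exists j0, w0.
pose cd k := `[< exists2 d, msize d = k & forall p, Jp p -> dv d p >].
have exk : exists k, cd k.
  exists (msize (1 : {mpoly K[n]})); apply/asboolP; exists 1 => // p _.
  by exists p; rewrite mulr1.
have cd_le k : cd k -> (k <= msize p0)%N.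
  move=> /asboolP [d <- /(_ _ Jp0) [c pE]].
  have d0 : d != 0 by apply: contra_neq p00 => d0; rewrite pE d0 mulr0.
  have c0 : c != 0 by apply: contra_neq p00 => c0; rewrite pE c0 mul0r.
  rewrite pE msizeM // -[msize c]prednK ?lt0n ?msize_poly_eq0 //.
  by rewrite addSn /= leq_addl.
case: (ex_maxnP exk cd_le) => k /asboolP [d sd dJ] kmax.
have d0 : d != 0 by apply: contra_neq p00 => d0; have [c ->] := dJ _ Jp0; rewrite d0 mulr0.
have D0 : poly_val d != 0 by apply: contra_neq d0 => e; apply: poly_val_inj; rewrite e rmorph0.
have JLd j : J j -> L (j / poly_val d).
  move=> Jj; have [p [w e]] := L_clear (JL _ Jj).
  have [c pE] : dv d p by apply: dJ; exists j, w.
  have -> : j / poly_val d = poly_val c * chi (- mrow w).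
    apply: (mulIf D0); rewrite divfK // mulrAC -valM -pE -e -mulrA -chiD.
    by rewrite subrr chi0 mulr1.
  by apply: LM; [apply: poly_val_L|apply: L_chi].
have nocommon pi : prime_elt pi -> (exists w, dv pi 'X_[w]) \/
   exists j, J j /\ ~ exists q u, j / poly_val d * chi u = poly_val (q * pi).
  move=> pip; apply: contrapT => /not_orP [nX /forallNP hJ].
  have [pi0 piu _] := pip.
  have spi : (1 < msize pi)%N.
    rewrite ltnNge; apply: contra piu => s1; rewrite (msize1_polyC s1).
    have c0 : pi@_0 != 0.
      by apply: contra_neq pi0 => c0; rewrite (msize1_polyC s1) c0 mpolyC0.
    apply/unitrP; exists ((pi@_0)^-1)%:MP.
    by rewrite -!mpolyCM mulVf // mulfV.
  have : cd (msize (d * pi)).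
    apply/asboolP; exists (d * pi) => // p Jpp; have [j [w [Jj e]]] := Jpp.
    have [q [u qu]] : exists q u, j / poly_val d * chi u = poly_val (q * pi).
      by apply: contrapT => h; apply: (hJ j).
    have [c pE] := dJ _ Jpp.
    have [//|[c' cE]] : (exists w, dv pi 'X_[w]) \/ dv pi c.
      apply: (@dvL pi c q (u - mrow w) pip).
      rewrite -valM -qu chiD chiN mulrCA -[poly_val c](mulfK D0) -valM -pE -e.
      by field; rewrite D0 chi_neq0.
    by exists c'; rewrite pE cE; ring.
  move/kmax; rewrite msizeM // -sd; move: spi d0; rewrite -msize_poly_eq0.
  by case: (msize pi) => [|[|s]] //; case: (msize d) => // t _ _; rewrite addSn /=; lia.
exists (poly_val d); split=> //; first exact: poly_val_L.
move=> f; have [a [b [La Lb b0 ->]]] := frac f.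
have [p [w e]] := L_clear La; have [q [w' e']] := L_clear Lb.
have q0 : q != 0.
  have: poly_val q != 0 by rewrite -e' mulf_neq0 // chi_neq0.
  by apply: contra_neq => ->; rewrite rmorph0.
have -> : a / b = poly_val p / poly_val q * chi (mrow w' - mrow w).
  by rewrite -e -e' chiD chiN; field; rewrite b0 !chi_neq0.
move=> hf; apply: LM; last exact: L_chi.
have {}hf j : J j -> L (poly_val p / poly_val q * (j / poly_val d)).
  move=> /hf; have := L_chi (mrow w - mrow w') => /LM h /h.
  suff -> : chi (mrow w - mrow w') * (poly_val p / poly_val q * chi (mrow w' - mrow w) * j / poly_val d)
    = poly_val p / poly_val q * (j / poly_val d) * chi ((mrow w - mrow w') + (mrow w' - mrow w)).
    by rewrite addrA subrK subrr chi0 mulr1.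
  by rewrite (chiD (mrow w - mrow w')); ring.
clear a b La Lb b0 e e' w w'.
have [s [u [uu sP qE]]] := factorial_mpoly q0.
have U0 x : x != 0 -> poly_val x != 0.
  by apply: contra_neq => x0; apply: poly_val_inj; rewrite x0 rmorph0.
elim: s sP q qE q0 p hf => [|pi s IH] sP q qE q0 p hf.
  rewrite big_nil mulr1 in qE; rewrite qE -rmorphV // -valM; exact: poly_val_L.
have pip := sP pi (mem_head _ _); have [pi0 _ _] := pip.
have [q' q'E] : exists q', q' = u * \prod_(r <- s) r by eexists.
have {}qE : q = q' * pi.
  by rewrite qE big_cons q'E; ring.
have q'0 : q' != 0 by apply: contra_neq q0 => q'0; rewrite qE q'0 mul0r.
have {}IH := IH (fun r rs => sP r (@mem_behead _ (pi :: s) r rs)) q' q'E q'0.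
have hpi := U0 _ pi0; have hq' := U0 _ q'0.
have red p1 : poly_val p1 / poly_val q' = poly_val (p1 * pi) / poly_val q.
  by rewrite qE !valM; field; rewrite hpi hq'.
have [[w [x wX]]|[j [Jj nj]]] := nocommon pi pip.
  have -> : poly_val p / poly_val q = poly_val p / poly_val q' * (poly_val x * chi (- mrow w)).
    have -> : chi (- mrow w) = (poly_val x * poly_val pi)^-1.
      by rewrite -valM -wX poly_valX chiN.
    have hx : poly_val x != 0.
      apply/eqP => x0; have := chi_neq0 (mrow w).
      by rewrite -poly_valX wX valM x0 mul0r eqxx.
    by rewrite qE valM; field; rewrite hpi hq' hx.
  apply: LM; last by apply: LM; [apply: poly_val_L|apply: L_chi].
  apply: IH => j /hf h; rewrite red.
  have -> : poly_val (p * pi) / poly_val q * (j / poly_val d) =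
            poly_val p / poly_val q * (j / poly_val d) * poly_val pi.
    by rewrite valM; ring.
  by apply: LM => //; apply: poly_val_L.
have [c [w cw]] := L_clear (hf j Jj); have [g [w' gw]] := L_clear (JLd j Jj).
have hq := U0 _ q0.
have pg : poly_val (p * g) * chi (mrow w - mrow w') = poly_val (c * q') * poly_val pi.
  rewrite !valM -cw -gw chiD chiN qE valM.
  by field; rewrite hpi hq' D0 chi_neq0.
have [nX|/(let: And3 _ _ h := pip in h) [[p' pE]|[g' gE]]] := dvL pip pg.
- have [w1 [x wX]] := nX; exfalso; apply: nj.
  have hx : poly_val x != 0.
    apply/eqP => x0; have := chi_neq0 (mrow w1).
    by rewrite -poly_valX wX valM x0 mul0r eqxx.
  exists (g * x), (mrow w' + mrow w1); rewrite chiD mulrA gw -poly_valX wX -valM.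
  by congr poly_val; ring.
- rewrite pE -red; by apply: IH => j' /hf; rewrite pE -red.
- by exfalso; apply: nj; exists g', (mrow w'); rewrite gw gE.
Qed.

End Frame.

(** * Divisorial fractional ideals *)

Definition nonneg m (x : 'rV[int]_m) : Prop := forall i, 0 <= x ord0 i.

Definition dvec m (i : 'I_m) : 'rV[int]_m := delta_mx ord0 i.

Lemma rv_eq (R : Type) m (x y : 'rV[R]_m) :
  (forall i, x ord0 i = y ord0 i) <-> x = y.
Proof. by split=> [e|->//]; apply/rowP => i; apply: e. Qed.

Lemma rowDE (R : nmodType) m (x y : 'rV[R]_m) i :
  (x + y) ord0 i = x ord0 i + y ord0 i.
Proof. exact: mxE. Qed.

Lemma rowNE (R : zmodType) m (x : 'rV[R]_m) i : (- x) ord0 i = - x ord0 i.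
Proof. exact: mxE. Qed.

Lemma row0E (R : nmodType) m i : (0 : 'rV[R]_m) ord0 i = 0.
Proof. exact: mxE. Qed.

Definition rvE := (rowDE, rowNE, row0E).

(* [lia] with the entries of matrices taken as atoms. *)
Ltac entry_lia :=
  repeat match goal with
    |- context [fun_of_matrix ?M ?i ?j] => move: (fun_of_matrix M i j) => ? end;
  lia.

Lemma dvecE m (i j : 'I_m) : dvec i ord0 j = (j == i)%:R.
Proof. by rewrite /dvec mxE eqxx. Qed.

Lemma nonnegD m (x y : 'rV[int]_m) : nonneg x -> nonneg y -> nonneg (x + y).
Proof. by move=> hx hy i; rewrite mxE addr_ge0. Qed.

Lemma nonneg0 m : nonneg (0 : 'rV[int]_m).
Proof. by move=> i; rewrite mxE. Qed.

Lemma nonneg_split m (x y : 'rV[int]_m) i :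
  nonneg x -> nonneg y -> x + y = dvec i -> x = 0 \/ y = 0.
Proof.
move=> hx hy /rowP e; have {}e j : x ord0 j + y ord0 j = (j == i)%:R.
  by rewrite -dvecE -e mxE.
have [xi|xi] := ltP 0 (x ord0 i); [right|left]; apply/rv_eq => j; rewrite [RHS]mxE;
  have := hx j; have := hy j; have := e j; case: (j =P i) => [->|_] /=; lia.
Qed.

Section Divisorial.
Variables (F : fieldType) (A : F -> Prop).
Implicit Types I J : F -> Prop.

(** The nonzero fractional ideals of [A] that are intersections of principal
    ones. *)
Definition dvl I := exists J j0 f0, [/\ J j0, j0 != 0, I f0, f0 != 0
  & forall f, I f <-> forall j, J j -> A (f * j)].

Definition colon I J h := forall f, J f -> I (h * f).

Definition sim I J := exists2 g, g != 0 & forall f, I f <-> J (f / g).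

Definition principal I := sim I A.

Lemma sim_refl I : sim I I.
Proof. by exists 1; rewrite ?oner_eq0 // => f; rewrite divr1. Qed.

Lemma sim_sym I J : sim I J -> sim J I.
Proof.
move=> [g g0 h]; exists g^-1; rewrite ?invr_eq0 // => f.
by rewrite h invrK mulfK.
Qed.

Lemma sim_trans I2 I1 I3 : sim I1 I2 -> sim I2 I3 -> sim I1 I3.
Proof.
move=> [g g0 h] [g' g0' h']; exists (g * g'); rewrite ?mulf_neq0 // => f.
by rewrite h h' invfM mulrA.
Qed.

Lemma sim_colon I J I' J' : sim I I' -> sim J J' -> sim (colon I J) (colon I' J').
Proof.
move=> [g g0 h] [g' g0' h']; exists (g / g'); first by rewrite mulf_neq0 ?invr_eq0.
move=> k; split=> hk f.
  move=> Jf; have /hk : J (f * g') by rewrite h' mulfK.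
  by rewrite h; congr I'; field; rewrite g0 g0'.
move=> /h' /hk; rewrite h; congr I'; by field; rewrite g0 g0'.
Qed.

Lemma sim_ext I J : (forall f, I f <-> J f) -> sim I J.
Proof. by move=> h; exists 1; rewrite ?oner_eq0 // => f; rewrite divr1. Qed.

End Divisorial.

Record frame (K F : fieldType) (cst : {rmorphism K -> F}) (A : F -> Prop) n
    (chi : 'rV[int]_n -> F) m (P : 'M[int]_(n, m)) : Prop := Frame {
  fr_D : forall u v, chi (u + v) = chi u * chi v;
  fr_0 : chi 0 = 1;
  fr_free : forall (s : seq 'rV[int]_n) (a : 'rV[int]_n -> K), uniq s ->
    \sum_(u <- s) cst (a u) * chi u = 0 -> forall u, u \in s -> a u = 0;
  fr_A : forall z, A z <-> gspan cst chi (fun u => nonneg (u *m P)) z;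
  fr_facet : forall i, exists w : 'rV[int]_n, (w *m P) ord0 i = 0 /\
     forall j, j != i -> 0 < (w *m P) ord0 j;
  fr_prim : forall i, exists u : 'rV[int]_n, (u *m P) ord0 i = 1;
  fr_frac : forall f, exists a b, [/\ A a, A b, b != 0 & f = a / b] }.

Section FrameIdeals.
Variables (K F : fieldType) (cst : {rmorphism K -> F}) (A : F -> Prop).
Variables (n m : nat) (chi : 'rV[int]_n -> F) (P : 'M[int]_(n, m)).
Hypothesis fr : frame cst A chi P.

Let chiD := fr_D fr.
Let chi0 := fr_0 fr.
Let free := fr_free fr.
Let chi_n0 u : chi u != 0. Proof. exact: chi_neq0 chiD chi0 u. Qed.
Let chiN u : chi (- u) = (chi u)^-1. Proof. exact: chiN chiD chi0 u. Qed.
Notation span := (gspan cst chi).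
Notation L := (span (fun=> True)).
Notation v i := (fun u : 'rV[int]_n => (u *m P) ord0 i).

Let vD i : {morph v i : u w / u + w}.
Proof. by move=> u w; rewrite /= mulmxDl mxE. Qed.

(** The monomial divisorial ideal of the divisor with coefficients [a]. *)
Definition mideal (a : 'rV[int]_m) := span (fun u => nonneg (u *m P + a)).

Lemma mideal0 f : mideal 0 f <-> A f.
Proof. by rewrite (fr_A fr); split; apply: gspanS => u; rewrite addr0. Qed.

Lemma mideal_chi a u : nonneg (u *m P + a) -> mideal a (chi u).
Proof. by move=> hu; apply: gspan_chi. Qed.

Lemma midealM a b f g : mideal a f -> mideal b g -> mideal (a + b) (f * g).
Proof.
apply: (gspanM chiD) => u w hu hw.
by rewrite mulmxDl addrACA; apply: nonnegD.
Qed.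

Lemma mideal_shift a u f : mideal (a - u *m P) f <-> mideal a (f / chi u).
Proof.
split=> h.
  rewrite -chiN -[a](subrK (u *m P)).
  apply: midealM h (mideal_chi _) => i; by rewrite mulNmx addNr mxE.
rewrite -[f](divfK (chi_n0 u)); apply: midealM h (mideal_chi _) => i.
by rewrite subrr mxE.
Qed.

Lemma mideal_shift_sim a u : sim (mideal (a - u *m P)) (mideal a).
Proof. by exists (chi u); rewrite // => f; apply: mideal_shift. Qed.

(* A monomial of [mideal b] that lies on the facet [i]. *)
Let facet_elt i (b : 'rV[int]_m) :
  exists u : 'rV[int]_n, (u *m P) ord0 i = - b ord0 i /\ nonneg (u *m P + b).
Proof.
have [w [wi wj]] := fr_facet fr i; have [u ui] := fr_prim fr i.
pose N := \sum_j `|b ord0 j - b ord0 i * (u *m P) ord0 j|.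
exists (N *: w - b ord0 i *: u).
have E j : ((N *: w - b ord0 i *: u) *m P) ord0 j =
    N * (w *m P) ord0 j - b ord0 i * (u *m P) ord0 j.
  by rewrite mulmxBl -!scalemxAl !mxE.
split; first by rewrite E wi ui mulr0 mulr1 sub0r.
move=> j; rewrite mxE E; have [->|ji] := eqVneq j i.
  by rewrite wi ui mulr0 mulr1 sub0r addNr.
have : `|b ord0 j - b ord0 i * (u *m P) ord0 j| <= N.
  by rewrite /N (bigD1 j) //= lerDl sumr_ge0.
have := wj j ji; set x := (w *m P) _ _; set y := b ord0 i * _; move=> x0 hN.
have : N * 1 <= N * x by apply: ler_wpM2l; [apply: sumr_ge0 | lia].
by move: hN; clearbody N y; rewrite mulr1; move: (N * x) (b ord0 j) => ? ?; lia.
Qed.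

Let some_elt (b : 'rV[int]_m) : exists u : 'rV[int]_n, nonneg (u *m P + b).
Proof.
have [i _|none] := pickP (fun _ : 'I_m => true).
  by have [u [_ hu]] := facet_elt i b; exists u.
by exists 0 => i; have := none i.
Qed.

Let AL f : A f -> L f. Proof. by move/(fr_A fr); apply: gspanL. Qed.

Let LM f g : L f -> L g -> L (f * g).
Proof. exact: (gspanM chiD). Qed.

Let L_chi u : L (chi u). Proof. exact: gspan_chi. Qed.

Lemma colon_mideal a b h : colon (mideal a) (mideal b) h <-> mideal (a - b) h.
Proof.
split=> [hc|hab f fb]; last by rewrite -[a](subrK b); apply: midealM.
have hu u : nonneg (u *m P + b) -> mideal (a + u *m P) h.
  move=> /mideal_chi /hc hu; rewrite -[h](mulfK (chi_n0 u)) -chiN.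
  apply: midealM hu _; apply: mideal_chi => i.
  by rewrite mulNmx addNr mxE.
have [u0 /hu h0] := some_elt b.
have : span (fun u => forall i, 0 <= (u *m P + (a - b)) ord0 i) h.
  apply: (gspan_forall free); first exact: gspanL h0.
  move=> i; have [u [ui /hu]] := facet_elt i b; apply: gspanS => w /(_ i).
  by rewrite !rvE ui; entry_lia.
exact.
Qed.

Lemma sim_mideal a b : sim (mideal a) (mideal b) <-> exists u, a - b = u *m P.
Proof.
split=> [[g g0 h]|[u e]]; last first.
  rewrite -[b](subrK a); have -> : b - a = - (u *m P) by rewrite -e opprB.
  rewrite addrC; exact: sim_sym (mideal_shift_sim a u).
have h1 : mideal (a - b) g.
  by apply/colon_mideal => f; rewrite h (mulrC g) mulfK.
have h2 : mideal (b - a) g^-1.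
  by apply/colon_mideal => f; rewrite h mulrC.
have [k [u [k0 gE]]] := laurent_unit chiD chi0 free (gspanL h1) (gspanL h2) (mulfV g0).
have mono c f w k' : k' != 0 -> f = cst k' * chi w -> mideal c f -> nonneg (w *m P + c).
  move=> k'0 -> hm.
  have : span (eq w) (cst k' * chi w) by apply: gspanZ; apply: gspan_chi.
  move/(gspanI free hm) => hI; apply: contrapT => nw.
  have : cst k' * chi w = 0 by apply: gspan_none hI => x [hx e]; apply: nw; rewrite e.
  by apply/eqP; rewrite mulf_neq0 // fmorph_eq0.
have p1 := mono _ _ _ _ k0 gE h1.
have p2 : nonneg ((- u) *m P + (b - a)).
  apply: (mono _ g^-1 _ k^-1); rewrite ?invr_eq0 // gE invfM fmorphV.
  by rewrite chiN.
exists (- u); apply/rv_eq => i; have := p1 i; have := p2 i.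
by rewrite mulNmx !rvE; entry_lia.
Qed.

Lemma principal_mideal a : principal A (mideal a) <-> exists u, a = u *m P.
Proof.
rewrite -[X in exists u, X = _]subr0 -sim_mideal; split=> h.
  by apply: sim_trans h _; apply: sim_ext => f; rewrite mideal0.
by apply: sim_trans h _; apply: sim_ext => f; rewrite mideal0.
Qed.

Lemma dvl_mideal a : dvl A (mideal a).
Proof.
have [u hu] := some_elt (- a); have [w hw] := some_elt a.
exists (mideal (- a)), (chi u), (chi w); split=> //; try exact: mideal_chi.
move=> f; have E : mideal a f <-> colon (mideal 0) (mideal (- a)) f.
  by rewrite colon_mideal sub0r opprK.
by rewrite E; split=> h j /h; rewrite mideal0.
Qed.

(** Divided by the greatest common divisor of [J], the fractions that multiply
    [J] into [A] are Laurent polynomials, and the only conditions left on them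
    are those on their values along the facets. *)
Lemma dvl_sim_mideal I : dvl A I -> exists a, sim I (mideal a).
Proof.
move=> [J [j0 [f0 [Jj0 j00 If0 f00 hI]]]].
have fJ j : J j -> A (f0 * j) by move: j; apply/hI.
pose J1 x := exists2 j, J j & x = f0 * j.
have fracL f : exists a b, [/\ L a, L b, b != 0 & f = a / b].
  by have [a [b [Aa Ab b0 ->]]] := fr_frac fr f; exists a, b; split=> //; apply: AL.
have [|||d [d0 Ld Jd hd]] := @laurent_gcd _ _ cst n chi chiD chi0 free J1 (f0 * j0) fracL.
- by move=> x [j Jj ->]; apply: AL; apply: fJ.
- by exists j0.
- by rewrite mulf_neq0.
pose J2 x := exists2 j, J j & x = f0 * j / d.
have J2L x : J2 x -> L x by move=> [j Jj ->]; apply: Jd; exists j.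
have IE f : I f <-> forall x, J2 x -> A (f * d / f0 * x).
  rewrite hI; split=> h.
    by move=> x [j Jj ->]; have := h j Jj; congr A; field; rewrite f00 d0.
  move=> j Jj; have : J2 (f0 * j / d) by exists j.
  by move/h; congr A; field; rewrite f00 d0.
have J20 : exists2 x, J2 x & x != 0.
  exists (f0 * j0 / d); first by exists j0.
  by rewrite !mulf_neq0 ?invr_eq0.
have dJ x : J2 x -> A (d * x) by move=> [j /fJ Jj ->]; rewrite mulrC divfK.
(* [a i] is the least value along the facet [i] of the members of [J2]. *)
have minv i : exists a, (exists2 x, J2 x & lev cst chi (v i) x a) /\
    forall x, J2 x -> ge cst chi (v i) a x.
  have [b lb] := level_exists free (v i) Ld d0.
  pose T k := `[< exists2 x, J2 x & exists a, lev cst chi (v i) x a /\ k = absz (a + b) >].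
  have low x a : J2 x -> lev cst chi (v i) x a -> 0 <= a + b.
    move=> /dJ /(fr_A fr) hx lx; rewrite addrC.
    apply: (lev_mul chiD free (@vD i) lb lx).
    by apply: gspanS hx => u /(_ i).
  have exT : exists k, T k.
    have [x J2x x0] := J20; have [a la] := level_exists free (v i) (J2L x J2x) x0.
    by exists (absz (a + b)); apply/asboolP; exists x => //; exists a.
  case: (ex_minnP exT) => k /asboolP [x J2x [a [la ka]]] kmin.
  exists a; split; first by exists x.
  move=> y J2y; have [->|y0] := eqVneq y 0; first exact: gspan0.
  have [c lc] := level_exists free (v i) (J2L y J2y) y0.
  apply: gspanS (lev_ge lc) => u; apply: le_trans.
  have /kmin : T (absz (c + b)) by apply/asboolP; exists y => //; exists c.
  have := low _ _ J2y lc; have := low _ _ J2x la; lia.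
have [a ha] := choice minv.
exists (\row_i a i), (f0 / d); first by rewrite mulf_neq0 ?invr_eq0.
move=> f; have -> : f / (f0 / d) = f * d / f0 by field; rewrite f00 d0.
rewrite IE; set z := f * d / f0; split=> [hz|hz x J2x].
  have Lz : L z.
    by apply: hd => x [j Jj ->]; rewrite -mulrA; apply: AL; apply: hz; exists j.
  have : span (fun u => forall i, 0 <= (u *m P + \row_i a i) ord0 i) z.
    apply: (gspan_forall free) => // i.
    have [z0|z0] := eqVneq z 0; first by rewrite z0; apply: gspan0.
    have [k lk] := level_exists free (v i) Lz z0.
    have [[x J2x lx] _] := ha i.
    have k0 : 0 <= k + a i.
      apply: (lev_mul chiD free (@vD i) lk lx).
      by have /(fr_A fr) := hz x J2x; apply: gspanS => u /(_ i).
    apply: gspanS (lev_ge lk) => u hu; rewrite rowDE [X in _ + X]mxE.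
    by apply: le_trans k0 _; rewrite lerD2r.
  exact.
apply/(fr_A fr).
have : span (fun u => forall i, 0 <= (u *m P) ord0 i) (z * x).
  apply: (gspan_forall free).
    by apply: LM; [apply: gspanL hz|apply: J2L].
  move=> i; have [_ hx] := ha i.
  apply: (gspanM chiD _ hz (hx x J2x)) => u w /(_ i).
  by rewrite mulmxDl !rvE [X in _ + X]mxE; entry_lia.
exact.
Qed.

End FrameIdeals.

(** * The classes of the torus-invariant prime divisors *)

Section Decomposable.
Variables (K F : fieldType) (cst : {rmorphism K -> F}) (A mm : F -> Prop).

(** The part of a divisorial ideal spanned by its products with the ideal [mm]
    of a point and by the products of two nonprincipal divisorial ideals. *)
Inductive dec (I : F -> Prop) : F -> Prop :=
| dec_zero : dec I 0
| dec_add f g of dec I f & dec I g : dec I (f + g)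
| dec_scale k f of dec I f : dec I (cst k * f)
| dec_point f g of mm f & I g : dec I (f * g)
| dec_prod J f h of dvl A J & ~ principal A J & ~ principal A (colon I J)
    & J f & colon I J h : dec I (f * h).

Lemma dec_sum I (T : Type) (r : seq T) (Q : pred T) (f : T -> F) :
  (forall i, Q i -> dec I (f i)) -> dec I (\sum_(i <- r | Q i) f i).
Proof.
by move=> h; elim/big_ind: _ => //; [apply: dec_zero|move=> x y; apply: dec_add].
Qed.

Lemma codim_le (I : F -> Prop) (T1 T2 : finType) (S1 : {set T1}) (S2 : {set T2})
  (f1 : T1 -> F) (f2 : T2 -> F) :
  (forall k, dec I (\sum_(i in S1) cst (k i) * f1 i) -> forall i, i \in S1 -> k i = 0) ->
  (forall i, i \in S1 -> I (f1 i)) ->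
  (forall f, I f -> exists k, dec I (f - \sum_(i in S2) cst (k i) * f2 i)) ->
  (#|S1| <= #|S2|)%N.
Proof.
move=> free1 I1 gen2.
have /choice [k hk] : forall i, exists k, i \in S1 ->
    dec I (f1 i - \sum_(j in S2) cst (k j) * f2 j).
  move=> i; have [iS|_] := boolP (i \in S1); last by exists (fun=> 0).
  by have [k hk] := gen2 _ (I1 i iS); exists k.
pose C := \matrix_(a < #|S1|, b < #|S2|) k (enum_val a) (enum_val b).
suff /eqP <- : row_free C by apply: rank_leq_col.
apply: inj_row_free => v vC.
pose w i := if [pick a | enum_val a == i :> T1] is Some a then v ord0 a else 0 : K.
have wE (a : 'I_#|S1|) : w (enum_val a) = v ord0 a.
  rewrite /w; case: pickP => [b /eqP /enum_val_inj ->//|/(_ a)].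
  by rewrite eqxx.
have w0 : dec I (\sum_(i in S1) cst (w i) * f1 i).
  have -> : \sum_(i in S1) cst (w i) * f1 i =
      \sum_(i in S1) cst (w i) * (f1 i - \sum_(j in S2) cst (k i j) * f2 j).
    under [RHS]eq_bigr => i _ do rewrite mulrBr mulr_sumr.
    rewrite sumrB exchange_big /= [X in _ - X]big1 ?subr0 // => j jS.
    have [b ->] : exists b : 'I_#|S2|, j = enum_val b.
      by exists (enum_rank_in jS j); rewrite enum_rankK_in.
    under eq_bigr => i _ do rewrite mulrA -rmorphM.
    rewrite -mulr_suml -rmorph_sum big_enum_val /=.
    have := congr1 (fun u : 'rV_ _ => u ord0 b) vC; rewrite !mxE => e.
    rewrite (eq_bigr (fun a => v ord0 a * C a b)) ?e ?rmorph0 ?mul0r // => a _.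
    by rewrite wE mxE.
  by apply: dec_sum => i iS; apply: dec_scale; apply: hk.
apply/rowP => a; rewrite mxE -(free1 w w0 (enum_val a) (enum_valP a)) wE.
by congr (v _ _); rewrite ord1.
Qed.

End Decomposable.

Section Counting.
Variables (K F : fieldType) (cst : {rmorphism K -> F}) (A : F -> Prop).
Variables (n m : nat) (chi : 'rV[int]_n -> F) (P : 'M[int]_(n, m)).
Hypothesis fr : frame cst A chi P.

Let chiD := fr_D fr.
Let chi0 := fr_0 fr.
Let free := fr_free fr.
Notation mideal := (mideal cst chi P).

(** The facets whose prime divisor belongs to the class of [I]. *)
Definition class_facets (I : F -> Prop) : {set 'I_m} :=
  [set i | `[< sim I (mideal (dvec i)) >]].

Lemma class_facetsP I a i : sim I (mideal a) ->
  i \in class_facets I -> exists w : 'rV[int]_n, w *m P + a = dvec i.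
Proof.
move=> sa; rewrite inE => /asboolP si.
have /(sim_mideal fr) [u uE] : sim (mideal a) (mideal (dvec i)).
  exact: sim_trans (sim_sym sa) si.
by exists (- u); rewrite mulNmx -uE opprB subrK.
Qed.

Let sect I : dvl A I -> exists g (a : 'rV[int]_m) (w : 'I_m -> 'rV[int]_n),
  [/\ g != 0, forall f, I f <-> mideal a (f / g), sim I (mideal a)
    & forall i, i \in class_facets I -> w i *m P + a = dvec i].
Proof.
move=> /(dvl_sim_mideal fr) [a sa]; have [g g0 h] := sa.
have /choice [w hw] : forall i, exists w : 'rV[int]_n,
    i \in class_facets I -> w *m P + a = dvec i.
  move=> i; have [ii|_] := boolP (i \in class_facets I); last by exists 0.
  by have [w e] := class_facetsP sa ii; exists w.
by exists g, a, w.
Qed.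

(** A monomial of a nonprincipal class has a nonprincipal factor [dvec i]; if
    the complementary factor is not principal either, the monomial is
    decomposable, and otherwise it is a multiple of the section of a facet in
    the class, by a function which is constant modulo the point. *)
Lemma codim_upper (mm : F -> Prop) I :
  (forall f, A f -> exists k, mm (f - cst k)) -> dvl A I -> ~ principal A I ->
  exists f_ : 'I_m -> F, forall f, I f ->
    exists k, dec cst A mm I (f - \sum_(i in class_facets I) cst (k i) * f_ i).
Proof.
move=> codim1 dI pI; have [g [a [w [g0 hI sa hw]]]] := sect dI.
exists (fun i => g * chi (w i)) => f If; rewrite -[f](divfK g0).
have := (hI f).1 If; move: (f / g) => z {f If}.
have np b : (exists u : 'rV[int]_n, b - a = u *m P) -> ~ exists u : 'rV[int]_n, b = u *m P.
  move=> [u hu] [u' hu']; apply: pI; apply: sim_trans sa _.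
  by apply/(principal_mideal fr); exists (u' - u); rewrite mulmxBl -hu -hu' opprB addrC subrK.
apply: (gspan_ind (H := fun z => exists k, dec cst A mm I
  (z * g - \sum_(i in class_facets I) cst (k i) * (g * chi (w i))))).
- exists (fun=> 0); rewrite mul0r big1 ?subr0; first exact: dec_zero.
  by move=> i _; rewrite rmorph0 mul0r.
- move=> x y [k hk] [l hl]; exists (fun i => k i + l i).
  under eq_bigr => i _ do rewrite rmorphD mulrDl.
  by rewrite big_split /= mulrDl opprD addrACA; apply: dec_add.
move=> k u hu; set b := u *m P + a in hu.
have bP : ~ exists x : 'rV[int]_n, b = x *m P.
  by apply: np; exists u; rewrite /b addrK.
have [i bi di] : exists2 i, 0 < b ord0 i & ~ exists x : 'rV[int]_n, dvec i = x *m P.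
  apply: contrapT => none; apply: bP.
  have /choice [x hx] : forall i, exists x : 'rV[int]_n, 0 < b ord0 i -> dvec i = x *m P.
    move=> i; have [bi|_] := boolP (0 < b ord0 i); last by exists 0.
    by apply: contrapT => hx; apply: none; exists i => // -[x e]; apply: hx; exists x.
  exists (\sum_i b ord0 i *: x i); rewrite mulmx_suml {1}[b]row_sum_delta.
  apply: eq_bigr => i _; rewrite -scalemxAl.
  have [bi|b0] := boolP (0 < b ord0 i); first by rewrite -(hx i bi).
  suff -> : b ord0 i = 0 by rewrite !scale0r.
  by apply: le_anti; rewrite hu andbT leNgt.
have bi1 : nonneg (b - dvec i).
  move=> j; rewrite rowDE rowNE dvecE; have := hu j; move: bi.
  by have [->|_] := eqVneq j i; rewrite /= ?mulr1n ?mulr0n; entry_lia.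
have [[x cx]|cP] := pselect (exists x : 'rV[int]_n, b - dvec i = x *m P).
  have ii : i \in class_facets I.
    rewrite inE; apply/asboolP; apply: sim_trans sa _; apply/(sim_mideal fr).
    by exists (x - u); rewrite mulmxBl -cx /b addrAC (addrC (u *m P)) addrK.
  have Au : A (chi (u - w i)).
    rewrite (fr_A fr); apply: gspan_chi; rewrite mulmxBl.
    suff -> : u *m P - w i *m P = b - dvec i by [].
    by rewrite -(hw i ii) /b opprD addrACA subrr addr0.
  have [c hc] := codim1 _ Au.
  exists (fun j => k * c *+ (j == i)).
  rewrite (bigD1 i) //= eqxx big1 ?addr0; last first.
    by move=> j /andP [_ /negbTE ->]; rewrite mulr0n rmorph0 mul0r.
  have -> : cst k * chi u * g - cst (k * c) * (g * chi (w i)) =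
      cst k * ((chi (u - w i) - cst c) * (g * chi (w i))).
    have -> : chi u = chi (u - w i) * chi (w i) by rewrite -chiD subrK.
    by rewrite rmorphM /=; ring.
  apply: dec_scale; apply: dec_point => //.
  rewrite hI mulrC mulKf //; apply: mideal_chi; rewrite hw //.
  by move=> j; rewrite dvecE; case: (_ == _).
exists (fun=> 0); rewrite big1 ?subr0; last by move=> j _; rewrite rmorph0 mul0r.
rewrite -mulrA; apply: dec_scale; rewrite -[_ * g]mul1r.
have sc : sim (colon I (mideal (dvec i))) (mideal (a - dvec i)).
  apply: sim_trans (sim_colon sa (sim_refl _)) _.
  by apply: sim_ext => h; exact: (colon_mideal fr).
apply: (@dec_prod _ _ _ _ _ _ (mideal (dvec i))).
- exact: dvl_mideal fr _.
- by move/(principal_mideal fr).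
- move=> pc; apply: cP.
  have /(principal_mideal fr) [x e] : principal A (mideal (a - dvec i)).
    exact: sim_trans (sim_sym sc) pc.
  by exists (u + x); rewrite mulmxDl -e /b addrA.
- rewrite -chi0; apply: mideal_chi; rewrite mul0mx add0r => j.
  by rewrite dvecE; case: (_ == _).
- move=> h hh; rewrite hI -[X in mideal X](subrK (dvec i)).
  have -> : chi u * g * h / g = chi u * h by field.
  apply: (midealM fr) => //; apply: mideal_chi.
  by rewrite addrA.
Qed.

(** The ideal of the point where the monomials without inverse vanish and the
    others take the value one. *)
Definition origin (f : F) :=
  exists l, [/\ supp (fun u => nonneg (u *m P)) l, f = ev cst chi l
              & lsum (fun u => u *m P == 0) l = 0].

Lemma origin_codim f : A f -> exists k, origin (f - cst k).
Proof.
rewrite (fr_A fr) => -[l hl ->].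
exists (lsum (fun u => u *m P == 0) l); exists (l ++ [:: (- lsum (fun u => u *m P == 0) l, 0)]).
split.
- apply: supp_cat => // p; rewrite mem_seq1 => /eqP -> /= i.
  by rewrite mul0mx mxE.
- by rewrite ev_cat /ev big_seq1 /= chi0 mulr1 rmorphN.
- by rewrite lsum_cat /lsum big_seq_cond [X in _ + X]big_cons /= mul0mx eqxx big_nil addr0 -big_seq_cond subrr.
Qed.

(** At that point the sections of the facets of a class are independent modulo
    the decomposable elements: the coefficient of the section of facet [i]
    vanishes on every product of two nonconstant monomials. *)
Lemma codim_lower I : dvl A I -> ~ principal A I ->
  exists f_ : 'I_m -> F, (forall i, i \in class_facets I -> I (f_ i)) /\
    forall k, dec cst A origin I (\sum_(i in class_facets I) cst (k i) * f_ i) ->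
      forall i, i \in class_facets I -> k i = 0.
Proof.
move=> dI pI; have [g [a [w [g0 hI sa hw]]]] := sect dI.
have nd i : nonneg (dvec i : 'rV[int]_m).
  by move=> j; rewrite dvecE; case: (_ == _).
have aP : ~ exists u : 'rV[int]_n, a = u *m P.
  by move=> /(principal_mideal fr) pa; apply: pI; apply: sim_trans sa pa.
exists (fun i => g * chi (w i)); split.
  by move=> i ii; rewrite hI mulrC mulKf //; apply: mideal_chi; rewrite hw.
pose T i (u : 'rV[int]_n) := u *m P + a == dvec i.
have key i f : dec cst A origin I f -> exists l,
    [/\ supp (fun u => nonneg (u *m P + a)) l, f = g * ev cst chi l & lsum (T i) l = 0].
  elim=> {f} [|f h _ [l1 [s1 -> e1]] _ [l2 [s2 -> e2]]|k f _ [l [s -> e]]|f h|J f h].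
  - by exists [::]; rewrite /ev /lsum !big_nil mulr0.
  - exists (l1 ++ l2); rewrite ev_cat lsum_cat e1 e2 addr0 mulrDr.
    by split=> //; apply: supp_cat.
  - exists (lscale k l); rewrite ev_scale lsum_scale e mulr0 mulrCA.
    by split=> //; apply: supp_scale.
  - move=> [l1 [s1 -> e1]] /hI [l2 s2 hE].
    exists (lmul l1 l2); split.
    + apply: supp_mul s1 s2 => u x hu hx.
      by rewrite mulmxDl -addrA; apply: nonnegD.
    + by rewrite (ev_mul _ chiD) -hE; field.
    + rewrite lsum_mul big_seq big1 // => q /s2 hq.
      have [qi|qi] := eqVneq (q.2 *m P + a) (dvec i).
        rewrite -[RHS](mulr0 q.1) -[in RHS]e1 /lsum; congr (_ * _).
        apply: eq_bigl => p; rewrite /T mulmxDl -addrA qi.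
        by rewrite -subr_eq0 addrK.
      rewrite /lsum big_seq_cond big1 ?mulr0 // => p /andP [/s1 hp].
      rewrite /T mulmxDl -addrA => /eqP e.
      have [p0|q0] := nonneg_split hp hq e.
        by move: qi; rewrite -e p0 add0r eqxx.
      by case: aP; exists (- q.2); apply/eqP; rewrite mulNmx -addr_eq0 addrC; apply/eqP.
  - move=> dJ pJ pc Jf ch.
    have [b sb] := dvl_sim_mideal fr dJ; have [g' g'0 hJ] := sb.
    have [l1 s1 fE] := (hJ f).1 Jf.
    have hcol : mideal (a - b) (h * g' / g).
      apply/(colon_mideal fr) => x xb.
      have /ch : J (x * g') by rewrite hJ mulfK.
      by rewrite hI; congr mideal; field.
    have [l2 s2 hE] := hcol.
    exists (lmul l1 l2); split.
    + apply: supp_mul s1 s2 => u x hu hx.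
      have -> : (u + x) *m P + a = (u *m P + b) + (x *m P + (a - b)).
        by rewrite mulmxDl addrACA [b + _]addrC subrK.
      exact: nonnegD.
    + by rewrite (ev_mul _ chiD) -hE -fE; field; rewrite g0 g'0.
    + have bP : ~ exists u : 'rV[int]_n, b = u *m P.
        by move=> /(principal_mideal fr) pb; apply: pJ; apply: sim_trans sb pb.
      have abP : ~ exists u : 'rV[int]_n, a - b = u *m P.
        move=> /(principal_mideal fr) pab; apply: pc; apply: sim_trans _ pab.
        apply: sim_trans (sim_colon sa sb) _.
        by apply: sim_ext => x; exact: (colon_mideal fr).
      rewrite lsum_mul big_seq big1 // => q /s2 hq.
      rewrite /lsum big_seq_cond big1 ?mulr0 // => p /andP [/s1 hp] /eqP e.
      have /(nonneg_split hp hq) [p0|q0] :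
          (p.2 *m P + b) + (q.2 *m P + (a - b)) = dvec i.
        by rewrite -e mulmxDl addrACA [b + _]addrC subrK.
      * by case: bP; exists (- p.2); apply/eqP; rewrite mulNmx -addr_eq0 addrC; apply/eqP.
      * by case: abP; exists (- q.2); apply/eqP; rewrite mulNmx -addr_eq0 addrC; apply/eqP.
move=> k hk i ii; have [l [_ lE l0]] := key i _ hk.
pose l' := [seq (k j, w j) | j <- enum (class_facets I)].
have l'E : ev cst chi l' = ev cst chi l.
  apply: (mulfI g0); rewrite -lE /ev big_map big_enum /= mulr_sumr.
  by apply: eq_bigr => j _; rewrite mulrCA.
have := lsum_ev free (T i) l'E; rewrite l0 /lsum big_map big_enum_cond /= => <-.
rewrite (bigD1 i) /=; last by rewrite ii /T hw // eqxx.
rewrite big1 ?addr0 // => j /andP [/andP [jc]]; rewrite /T hw // => /eqP e ji.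
have := congr1 (fun x : 'rV_m => x ord0 j) e.
by rewrite !dvecE eqxx (negbTE ji).
Qed.

End Counting.

(** * Integer matrices with the same row lattice *)

Lemma clear_denominators n (v : 'rV[rat]_n) :
  exists (N : int) (w : 'rV[int]_n), 0 < N /\ N%:~R *: v = toQ w.
Proof.
pose N := \prod_i denq (v ord0 i).
have Nd i : exists z : int, N%:~R * v ord0 i = z%:~R.
  exists (numq (v ord0 i) * \prod_(j | j != i) denq (v ord0 j)).
  rewrite /N (bigD1 i) //= !intrM numqE; ring.
have [w hw] := choice Nd.
exists N, (\row_i w i); split; first by apply: prodr_gt0 => i _; apply: denq_gt0.
by apply: (rv_eq _ _).1 => i; rewrite !mxE hw.
Qed.

Notation mxQ := (map_mx (intr : int -> rat)).

Lemma mxQ_unit n (L : 'M[int]_n) : L \in unitmx -> mxQ L \in unitmx.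
Proof.
move=> uL; rewrite unitmxE det_map_mx; exact: rmorph_unit.
Qed.

(* [G] is an echelon form of [Q]: up to the unimodular matrix [L], the first
   rows of [G] are independent and the others vanish. *)
Lemma integer_echelon n m (Q : 'M[int]_(n, m)) :
  exists (L : 'M[int]_n) (G : 'M[int]_(n, m)) (r : nat),
   [/\ L \in unitmx, Q = L *m G,
       forall i : 'I_n, (r <= i)%N -> row i G = 0,
       forall v : 'rV[int]_n, v *m G = 0 -> forall i : 'I_n, (i < r)%N -> v ord0 i = 0
     & r = \rank (mxQ Q)].
Proof.
have [L uL [R uR [d sd QE]]] := int_Smith_normal_form Q.
set D := \matrix_(i, j) _ in QE.
pose r0 := find (pred1 0) d; pose r := minn r0 (minn n m).
have d_nz i : (i < r0)%N -> d`_i != 0 by move=> /(before_find 0) /negbT.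
have d_z i : (r0 <= i)%N -> d`_i = 0.
  move=> ri; have [hd|nd] := boolP (has (pred1 0) d); last first.
    by rewrite nth_default //; move: nd ri; rewrite has_find -leqNgt => /leq_trans h /h.
  have [sz|si] := leqP (size d) i; first by rewrite nth_default.
  have dr0 : d`_r0 = 0 by apply/eqP; exact: (nth_find 0 hd).
  have : (d`_r0 %| d`_i)%Z.
    move: ri; rewrite leq_eqVlt => /predU1P [->|ri]; first exact: dvdzz.
    apply: (sorted_ltn_nth (@dvdz_trans) 0 sd); rewrite ?inE //.
    exact: ltn_trans ri si.
  by rewrite dr0 dvd0z => /eqP.
have row_D (v : 'rV[int]_n) (j : 'I_m) : (v *m D) ord0 j =
    if insub (j : nat) is Some i then v ord0 i * d`_j else 0.
  rewrite mxE; case: insubP => [i _ /= ij|nj].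
    rewrite (bigD1 i) //= big1 ?addr0 => [|k ki]; first by rewrite mxE (ij : nat_of_ord i = nat_of_ord j) eqxx mulr1n.
    rewrite mxE; have -> : (k == j :> nat) = false.
      by apply/negbTE; apply: contra ki => /eqP kj; apply/eqP/val_inj; exact: etrans kj (esym ij).
    by rewrite mulr0n mulr0.
  rewrite big1 // => k _; rewrite mxE; have -> : (k == j :> nat) = false.
    by apply/negbTE; apply: contra nj => /eqP <-; exact: ltn_ord.
  by rewrite mulr0n mulr0.
exists L, (D *m R), r; split.
- by [].
- by rewrite QE mulmxA.
- move=> i ri; rewrite row_mul; suff -> : row i D = 0 by rewrite mul0mx.
  apply/rowP => j; rewrite !mxE; have [ij|] := eqVneq (i : nat) j; last by rewrite mulr0n.
  rewrite mulr1n d_z //; move: ri; rewrite /r !geq_min => /or3P [//||].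
    by rewrite leqNgt ltn_ord.
  by rewrite ij leqNgt ltn_ord.
- move=> v vG i ir.
  have vD : v *m D = 0.
    by rewrite -[v *m D](mulmxK uR) -(mulmxA v) vG mul0mx.
  have ir' : (i < m)%N by move: ir; rewrite /r !ltn_min => /and3P [].
  have d0 : d`_i != 0 by apply: d_nz; move: ir; rewrite /r !ltn_min => /and3P [].
  have := row_D v (Ordinal ir'); rewrite vD row0E /= valK => /esym/eqP.
  by rewrite mulf_eq0 (negbTE d0) orbF => /eqP.
- rewrite QE !map_mxM.
  rewrite mxrankMfree; last by rewrite row_free_unit mxQ_unit.
  rewrite (eqmxMfull (mxQ D)); last by rewrite row_full_unit mxQ_unit.
  pose e : 'rV[rat]_n := \row_i (if (i < r0)%N then (d`_i)%:~R else 1).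
  have -> : mxQ D = diag_mx e *m pid_mx r.
    apply/matrixP => i j; rewrite mul_diag_mx !mxE.
    have [ij|] := eqVneq (i : nat) j; last by rewrite mulr0n mulr0.
    have im : (i < m)%N by rewrite ij.
    rewrite mulr1n /= /r !ltn_min ltn_ord im !andbT.
    by case: ltnP => ri; rewrite ?mulr1 // d_z // mulr0.
  rewrite (eqmxMfull _); last first.
    rewrite row_full_unit unitmxE det_diag unitfE prodf_seq_neq0; apply/allP => i _ /=.
    by rewrite mxE; case: ifP => [/d_nz|]; rewrite ?oner_eq0 ?intr_eq0.
  by rewrite rank_pid_mx // /r !geq_min leqnn ?orbT.
Qed.

Lemma same_row_lattice n m (Q1 Q2 : 'M[int]_(n, m)) (X' Y' : 'M[int]_n) :
  Q1 = X' *m Q2 -> Q2 = Y' *m Q1 ->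
  exists2 B, B \in unitmx & Q1 = B *m Q2.
Proof.
move=> E1 E2.
have [L1 [G1 [r1 [uL1 Q1E z1 f1 rk1]]]] := integer_echelon Q1.
have [L2 [G2 [r2 [uL2 Q2E z2 f2 rk2]]]] := integer_echelon Q2.
have rr : r1 = r2.
  apply/eqP; rewrite eqn_leq rk1 rk2 {1}E1 {3}E2 !map_mxM.
  by rewrite !mxrankM_maxr.
move: rr z1 f1 z2 f2 => <- {rk1 rk2 r2}; move: r1 => r z1 f1 z2 f2.
pose X1 := invmx L1 *m X' *m L2; pose Y1 := invmx L2 *m Y' *m L1.
have G1E : G1 = X1 *m G2.
  by rewrite /X1 -!mulmxA -Q2E -E1 Q1E mulKmx.
have G2E : G2 = Y1 *m G1.
  by rewrite /Y1 -!mulmxA -Q1E -E2 Q2E mulKmx.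
(* Only the upper left blocks of [X1] and [Y1] matter. *)
pose trunc (Z : 'M[int]_n) : 'M[int]_n := \matrix_(i, j)
  if (i < r)%N && (j < r)%N then Z i j else (i == j)%:R.
have truncG (Z G H : _) : (forall i : 'I_n, (r <= i)%N -> row i G = 0) ->
    (forall i : 'I_n, (r <= i)%N -> row i H = 0) -> H = Z *m G ->
    H = trunc Z *m G :> 'M[int]_(n, m).
  move=> zG zH HE; have G0 (i : 'I_n) j : (r <= i)%N -> G i j = 0.
    by move=> /zG /rowP /(_ j); rewrite !mxE.
  apply/matrixP => i j; have [ir|ri] := ltnP i r.
    rewrite HE !mxE; apply: eq_bigr => k _; rewrite mxE ir /=.
    by have [//|rk] := ltnP k r; rewrite (G0 k j rk) !mulr0.
  have -> : H i j = 0 by have /rowP /(_ j) := zH i ri; rewrite !mxE.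
  rewrite mxE big1 // => k _; rewrite mxE ltnNge ri /=.
  by have [<-|_] := eqVneq i k; rewrite ?mul0r // G0 // mulr0.
have inv (Z W G : _) : (forall v : 'rV[int]_n, v *m G = 0 -> forall i : 'I_n, (i < r)%N -> v ord0 i = 0) ->
    G = trunc Z *m trunc W *m G :> 'M[int]_(n, m) -> trunc Z *m trunc W = 1%:M.
  move=> fG GE; apply/matrixP => i j.
  have [jr|rj] := ltnP j r.
    apply/eqP; rewrite -subr_eq0; apply/eqP.
    have /fG /(_ j jr) : row i (trunc Z *m trunc W - 1%:M) *m G = 0.
      by rewrite -row_mul mulmxBl -GE mul1mx subrr raddf0.
    by rewrite !mxE.
  rewrite !mxE; have E (k : 'I_n) : trunc W k j = (k == j)%:R.
    by rewrite mxE [(j < r)%N]ltnNge rj andbF.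
  rewrite (bigD1 j) //= E eqxx mulr1 big1 ?addr0; last first.
    by move=> k kj; rewrite E (negbTE kj) mulr0.
  by rewrite mxE [(j < r)%N]ltnNge rj andbF.
have t1 := truncG _ _ _ z2 z1 G1E; have t2 := truncG _ _ _ z1 z2 G2E.
have XY : trunc X1 *m trunc Y1 = 1%:M.
  by apply: (inv _ _ _ f1); rewrite -mulmxA -t2.
exists (L1 *m trunc X1 *m invmx L2).
  rewrite !unitmx_mul uL1 unitmx_inv uL2 /= andbT.
  by have [] := mulmx1_unit XY.
by rewrite [in RHS]Q2E -!mulmxA mulKmx // -t1.
Qed.

(** * Uniqueness of monomial frames *)

Lemma class_matching (X : eqType) (E : rel X) (s1 s2 : seq X) :
  (forall x, E x x) -> (forall x y, E x y -> forall z, E z x = E z y) ->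
  (forall x, count (E x) s1 = count (E x) s2) ->
  exists l : seq (X * X), [/\ unzip1 l = s1, perm_eq (unzip2 l) s2
    & forall p, p \in l -> E p.1 p.2].
Proof.
move=> Er Ee; elim: s1 s2 => [|x s1 IH] s2 hc.
  by exists [::]; split=> //; case: s2 hc => // y s2 /(_ y) /=; rewrite Er.
have : has (E x) s2 by rewrite has_count -hc /= Er.
case/hasP => y ys2 xy; have hp := perm_to_rem ys2.
have [z|l [l1 l2 lE]] := IH (rem y s2).
  have := hc z; rewrite (permP hp) /= (Ee _ _ xy z); exact: addnI.
exists ((x, y) :: l); split; first by rewrite /= l1.
  by rewrite /= perm_sym (perm_trans hp) // perm_cons perm_sym.
by move=> p; rewrite in_cons => /predU1P [->//|/lE].
Qed.

Section Uniqueness.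
Variables (K F : fieldType) (cst : {rmorphism K -> F}) (A : F -> Prop).

Section Compare.
Variables (n m1 m2 : nat) (chi1 chi2 : 'rV[int]_n -> F).
Variables (P1 : 'M[int]_(n, m1)) (P2 : 'M[int]_(n, m2)).
Hypotheses (fr1 : frame cst A chi1 P1) (fr2 : frame cst A chi2 P2).

Lemma class_facets_le I : dvl A I -> ~ principal A I ->
  (#|class_facets cst chi1 P1 I| <= #|class_facets cst chi2 P2 I|)%N.
Proof.
move=> dI pI; have [f1 [If1 free1]] := codim_lower fr1 dI pI.
have [f2 gen2] := codim_upper fr2 (origin_codim fr1) dI pI.
exact: codim_le free1 If1 gen2.
Qed.

(** The monomials of [chi1] that are invertible in [A] are, up to constants,
    monomials of [chi2] that are invertible in [A]. *)
Lemma unit_monomial u : u *m P1 = 0 ->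
  exists k u', [/\ k != 0, chi1 u = cst k * chi2 u' & u' *m P2 = 0].
Proof.
move=> uP; have Au (v : 'rV[int]_n) : v *m P1 = 0 -> A (chi1 v).
  by move=> vP; rewrite (fr_A fr1); apply: gspan_chi; rewrite vP; apply: nonneg0.
have A1 := Au _ uP; have A2 := Au (- u) ltac:(by rewrite mulNmx uP oppr0).
have inv : chi1 u * chi1 (- u) = 1 by rewrite -(fr_D fr1) subrr (fr_0 fr1).
have AL z : A z -> gspan cst chi2 (fun=> True) z by move/(fr_A fr2); apply: gspanL.
have [k [u' [k0 e]]] := laurent_unit (fr_D fr2) (fr_0 fr2) (fr_free fr2) (AL _ A1) (AL _ A2) inv.
have pos c v : c != 0 -> A (cst c * chi2 v) -> nonneg (v *m P2).
  move=> c0 /(fr_A fr2) hv.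
  have : gspan cst chi2 (eq v) (cst c * chi2 v) by apply: gspanZ; apply: gspan_chi.
  move/(gspanI (fr_free fr2) hv) => hI; apply: contrapT => nv.
  have : cst c * chi2 v = 0 by apply: gspan_none hI => x [hx e']; apply: nv; rewrite e'.
  apply/eqP; rewrite mulf_neq0 ?fmorph_eq0 //.
  exact: chi_neq0 (fr_D fr2) (fr_0 fr2) v.
exists k, u'; split=> //.
have p1 : nonneg (u' *m P2) by apply: (pos k); rewrite // -e.
have p2 : nonneg ((- u') *m P2).
  apply: (pos k^-1); rewrite ?invr_eq0 //; have := A2; congr A.
  rewrite (chiN (fr_D fr1) (fr_0 fr1)) e invfM fmorphV.
  by rewrite (chiN (fr_D fr2) (fr_0 fr2)).
apply/rv_eq => i; have := p1 i; have := p2 i.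
by rewrite mulNmx !rvE; entry_lia.
Qed.

Lemma mxrank_le : (\rank (mxQ P2) <= \rank (mxQ P1))%N.
Proof.
have [L [G [r [uL PE z1 f1 rk]]]] := integer_echelon P1.
rewrite -rk.
pose y (i : 'I_n) := row i (invmx L).
have yP (i : 'I_n) : (r <= i)%N -> y i *m P1 = 0.
  by move=> ri; rewrite /y PE -row_mul mulKmx // z1.
have /choice [y' hy'] : forall i : 'I_n, exists u' : 'rV[int]_n,
   ((r <= i)%N -> (exists2 k, k != 0 & chi1 (y i) = cst k * chi2 u') /\ u' *m P2 = 0)
   /\ ((i < r)%N -> u' = 0).
  move=> i; have [ir|ri] := ltnP i r; first by exists 0.
  have [k [u' [k0 e e']]] := unit_monomial (yP i ri).
  by exists u'; split=> // _; split=> //; exists k.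
pose Y := \matrix_(i < n) y' i.
have rowY i : row i Y = y' i by apply/rowP => j; rewrite !mxE.
have YP : Y *m P2 = 0.
  apply/row_matrixP => i; rewrite row_mul rowY raddf0.
  have [ir|ri] := ltnP i r; first by rewrite (hy' i).2 // mul0mx.
  exact: ((hy' i).1 ri).2.
have le1 : (\rank (mxQ Y) + \rank (mxQ P2) <= n)%N.
  by apply: mulmx0_rank_max; rewrite -map_mxM YP map_mx0.
suff le2 : (\rank (kermx (mxQ Y)) <= r)%N.
  by move: le1 le2; rewrite mxrank_ker; have := rank_leq_row (mxQ Y); lia.
suff /mxrankS : (kermx (mxQ Y) <= (pid_mx r : 'M[rat]_n))%MS.
  move=> h; apply: leq_trans h _.
  have [rn|nr] := leqP r n; first by rewrite rank_pid_mx.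
  by apply: leq_trans (rank_leq_row _) _; apply: ltnW.
apply/row_subP => i; set v := row i _.
have vY : v *m mxQ Y = 0 by rewrite /v -row_mul mulmx_ker raddf0.
suff v0 (j : 'I_n) : (r <= j)%N -> v ord0 j = 0.
  apply/submxP; exists v; apply/rowP => j; rewrite [RHS]mxE (bigD1 j) //= big1 ?addr0.
    rewrite [pid_mx _ _ _]mxE eqxx /=; have [jr|rj] := ltnP j r; first by rewrite mulr1.
    by rewrite mulr0; apply: v0.
  by move=> k /negbTE kj; rewrite [pid_mx _ _ _]mxE val_eqE kj mulr0.
have [N [w [N0 Nw]]] := clear_denominators v.
have wY : w *m Y = 0.
  have : mxQ (w *m Y) = 0.
    by rewrite map_mxM -[mxQ w]/(toQ w) -Nw -scalemxAl vY scaler0.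
  move/matrixP => e; apply/matrixP => a b; have := e a b.
  by rewrite !mxE => /eqP; rewrite intr_eq0 => /eqP.
pose R (u u' : 'rV[int]_n) := exists2 k, k != 0 & chi1 u = cst k * chi2 u'.
have RD u u' x x' : R u u' -> R x x' -> R (u + x) (u' + x').
  move=> [k k0 e] [l l0 e']; exists (k * l); rewrite ?mulf_neq0 //.
  by rewrite (fr_D fr1) (fr_D fr2) e e' rmorphM mulrACA.
have R0 : R 0 0.
  by exists 1; rewrite ?oner_eq0 // (fr_0 fr1) (fr_0 fr2) rmorph1 mulr1.
have RN u u' : R u u' -> R (- u) (- u').
  move=> [k k0 e]; exists k^-1; rewrite ?invr_eq0 //.
  by rewrite (chiN (fr_D fr1) (fr_0 fr1)) e invfM fmorphV (chiN (fr_D fr2) (fr_0 fr2)).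
have RZ (z : int) u u' : R u u' -> R (z *: u) (z *: u').
  have Rn (k : nat) x x' : R x x' -> R (k%:Z *: x) (k%:Z *: x').
    move=> Rx; elim: k => [|k IH]; first by rewrite !scale0r.
    have -> : k.+1%:Z = k%:Z + 1 by rewrite -addn1 PoszD.
    by rewrite !scalerDl !scale1r; apply: RD.
  move=> Ru; case: z => k; first exact: Rn.
  by rewrite NegzE !scaleNr; apply: RN; apply: Rn.
have [k k0 e] : R (\sum_(j < n | (r <= j)%N) w ord0 j *: y j) 0.
  have S0 : \sum_(j < n | (r <= j)%N) w ord0 j *: y' j = 0.
    rewrite -[RHS]wY mulmx_sum_row [LHS]big_mkcond; apply: eq_bigr => a _.
    rewrite rowY; case: leqP => // ar.
    by rewrite (hy' a).2 // scaler0.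
  rewrite -[X in R _ X]S0.
  elim/big_rec2: _ => // a u u' ra; apply: RD; apply: RZ.
  exact: ((hy' a).1 ra).1.
set U := \sum_(_ < _ | _) _ in e.
have U0 : U = 0.
  apply: contrapT => /eqP U0; pose c (u : 'rV[int]_n) := if u == 0 then - k else 1 : K.
  have := fr_free fr1 (s := [:: U; 0]) (a := c).
  rewrite /= !inE U0 /= !big_cons big_nil /c (negbTE U0) eqxx rmorph1 mul1r addr0 e.
  rewrite (fr_0 fr1) (fr_0 fr2) rmorphN mulNr subrr => /(_ isT erefl 0).
  rewrite !inE eqxx orbT => /(_ isT) /eqP; rewrite oppr_eq0.
  by apply/negP.
have wL : (\row_j (if (r <= j)%N then w ord0 j else 0)) *m invmx L = 0.
  rewrite -U0 /U mulmx_sum_row [RHS]big_mkcond; apply: eq_bigr => a _.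
  by rewrite mxE; case: ifP => // _; rewrite scale0r.
move=> rj; have := congr1 (fun z => (z *m L) ord0 j) wL.
rewrite mulmxKV // mul0mx !mxE rj => wj.
have := congr1 (fun z : 'rV[rat]_n => z ord0 j) Nw; rewrite !mxE wj => /eqP.
by rewrite mulf_eq0 intr_eq0 gt_eqF //= => /eqP.
Qed.

End Compare.

End Uniqueness.

Lemma int_row_ind q (H : 'rV[int]_q -> Prop) : H 0 ->
  (forall x y, H x -> H y -> H (x - y)) -> (forall k, H (dvec k)) -> forall x, H x.
Proof.
move=> H0 HB Hd x; have HN y : H y -> H (- y) by rewrite -sub0r; apply: HB.
have HD y z : H y -> H z -> H (y + z) by move=> hy hz; rewrite -[z]opprK; apply/HB/HN.
rewrite [x]row_sum_delta; elim/big_ind: _ => // k _.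
have Hn (j : nat) : H (j%:Z *: dvec k).
  elim: j => [|j IH]; first by rewrite scale0r.
  have -> : j.+1%:Z = j%:Z + 1 by rewrite -addn1 PoszD.
  by rewrite scalerDl scale1r; apply: HD.
case: (x _ k) => j; first exact: Hn.
by rewrite NegzE scaleNr; apply: HN; apply: Hn.
Qed.

Section FacetSplit.
Variables (K F : fieldType) (cst : {rmorphism K -> F}) (A : F -> Prop).
Variables (n m : nat) (chi : 'rV[int]_n -> F) (P : 'M[int]_(n, m)).
Hypothesis fr : frame cst A chi P.

Definition selmx q (a : 'I_q -> 'I_m) : 'M[int]_(q, m) := \matrix_k dvec (a k).

Lemma mul_selmx_tr p q (a : 'I_q -> 'I_m) (B : 'M[int]_(p, m)) i k :
  (B *m (selmx a)^T) i k = B i (a k).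
Proof.
rewrite mxE (bigD1 (a k)) //= big1 ?addr0 => [|j jk].
  by rewrite !mxE !eqxx mulr1.
by rewrite !mxE (negbTE jk) andbF mulr0.
Qed.

(** When the facets outside the range of [a] have principal prime divisors,
    they split off a free summand of the lattice. *)
Lemma facet_split q (a : 'I_q -> 'I_m) : injective a ->
  (forall i, ~ principal A (mideal cst chi P (dvec i)) -> exists k, a k = i) ->
  let P' := P *m (selmx a)^T in
  exists k (P'' : 'M[int]_(n, k)) (W : 'M[int]_(k, n)),
  [/\ W *m P' = 0, W *m P'' = 1%:M,
      forall u : 'rV[int]_n, nonneg (u *m P) <-> nonneg (u *m P') /\ nonneg (u *m P''),
      forall u : 'rV[int]_n, u *m P'' = 0 -> u *m P = u *m P' *m selmx a
    & \rank (mxQ P) = (\rank (mxQ P') + k)%N].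
Proof.
move=> ainj aP P'; pose C := [set i : 'I_m | [forall k, a k != i]].
pose c (j : 'I_#|C|) := enum_val j; pose P'' := P *m (selmx c)^T.
have /choice [y hy] : forall j, exists y : 'rV[int]_n, dvec (c j) = y *m P.
  move=> j; apply/(principal_mideal fr); apply: contrapT => /aP [k kj].
  have := enum_valP j; rewrite inE => /forallP /(_ k) /eqP; apply.
  exact: kj.
have cover i : (exists k, a k = i) \/ exists j, c j = i.
  have [iC|] := boolP (i \in C); first by right; exists (enum_rank_in iC i); rewrite /c enum_rankK_in.
  by rewrite inE negb_forall => /existsP [k /negPn /eqP ak]; left; exists k.
have ac k j : (a k == c j) = false.
  apply/negbTE; have := enum_valP j; rewrite inE => /forallP; exact.
have aa k l : (a k == a l) = (k == l) by apply: inj_eq.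
have cc k l : (c k == c l) = (k == l) by apply: inj_eq; exact: enum_val_inj.
have tr (q1 q2 : nat) (f : 'I_q1 -> 'I_m) (g : 'I_q2 -> 'I_m) :
    selmx f *m (selmx g)^T = \matrix_(k, l) (f k == g l)%:R.
  by apply/matrixP => k l; rewrite mul_selmx_tr !mxE eqxx eq_sym.
have one : (selmx a)^T *m selmx a + (selmx c)^T *m selmx c = 1%:M.
  apply/matrixP => i j; rewrite !mxE.
  have sE (q1 : nat) (f : 'I_q1 -> 'I_m) : \sum_k (selmx f)^T i k * selmx f k j =
      \sum_k (f k == i)%:R * (f k == j)%:R.
    by apply: eq_bigr => k _; rewrite !mxE !eqxx [i == _]eq_sym [j == _]eq_sym.
  rewrite !sE; case: (cover i) => [[k <-]|[k <-]].
    rewrite (bigD1 k) //= eqxx mul1r big1 ?addr0 => [|l lk]; last first.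
      by rewrite aa (negbTE lk) mul0r.
    by rewrite big1 ?addr0 // => l _; rewrite eq_sym ac mul0r.
  rewrite big1 ?add0r => [|l _]; last by rewrite ac mul0r.
  rewrite (bigD1 k) //= eqxx mul1r big1 ?addr0 // => l lk.
  by rewrite cc (negbTE lk) mul0r.
pose W := \matrix_j y j.
have WP : W *m P = selmx c.
  by apply/row_matrixP => j; rewrite row_mul !rowK hy.
have WP' : W *m P' = 0.
  by rewrite mulmxA WP tr; apply/matrixP => k l; rewrite !mxE eq_sym ac.
have WP'' : W *m P'' = 1%:M.
  by rewrite mulmxA WP tr; apply/matrixP => k l; rewrite !mxE cc.
have PE : P = P' *m selmx a + P'' *m selmx c.
  by rewrite -!mulmxA -mulmxDr one mulmx1.
exists #|C|, P'', W; split=> //.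
- move=> u; rewrite /P' /P'' !mulmxA; split=> [hu|[h1 h2] i].
    by split=> k; rewrite mul_selmx_tr; apply: hu.
  by case: (cover i) => -[k <-]; rewrite -mul_selmx_tr.
- move=> u uP; rewrite -[RHS]addr0 -(mul0mx _ (selmx c)) -uP -!(mulmxA u).
  by rewrite -mulmxDr -PE.
pose Q := row_mx P' P''.
pose blk := block_mx P' 0 0 1%:M : 'M[int]_(n + #|C|, q + #|C|).
have QE : Q = P *m row_mx (selmx a)^T (selmx c)^T by rewrite mul_mx_row.
have PQ : P = Q *m col_mx (selmx a) (selmx c) by rewrite mul_row_col -PE.
have blkQ : blk = col_mx (1%:M - P'' *m W) W *m Q.
  rewrite mul_col_mx !mul_mx_row WP' WP'' !mulmxBl !mul1mx -!(mulmxA P'' W) WP' WP''.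
  by rewrite mulmx0 mulmx1 subr0 subrr /blk block_mxEv.
have Qblk : Q = row_mx 1%:M P'' *m blk.
  by rewrite mul_row_block !mul1mx !mulmx0 mulmx1 addr0 add0r.
have -> : \rank (mxQ P) = \rank (mxQ Q).
  have le1 : (\rank (mxQ P) <= \rank (mxQ Q))%N.
    by rewrite {1}PQ map_mxM mxrankM_maxl.
  have le2 : (\rank (mxQ Q) <= \rank (mxQ P))%N.
    by rewrite QE map_mxM mxrankM_maxl.
  by apply/eqP; rewrite eqn_leq le1.
have -> : \rank (mxQ Q) = \rank (mxQ blk).
  have le1 : (\rank (mxQ Q) <= \rank (mxQ blk))%N.
    by rewrite Qblk map_mxM mxrankM_maxr.
  have le2 : (\rank (mxQ blk) <= \rank (mxQ Q))%N.
    by rewrite blkQ map_mxM mxrankM_maxr.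
  by apply/eqP; rewrite eqn_leq le1.
by rewrite map_block_mx !map_mx0 map_mx1 rank_diag_block_mx mxrank1.
Qed.

End FacetSplit.

(** The torus-invariant prime divisors of two frames are matched according to
    their classes, principal ones being dealt with by a count of ranks; then
    the principal divisors supported by them correspond as well. *)
Theorem frame_unique (K F : fieldType) (cst : {rmorphism K -> F}) (A : F -> Prop)
  (n m1 m2 : nat) (chi1 chi2 : 'rV[int]_n -> F)
  (P1 : 'M[int]_(n, m1)) (P2 : 'M[int]_(n, m2)) :
  frame cst A chi1 P1 -> frame cst A chi2 P2 ->
  exists2 B : 'M[int]_n, B \in unitmx &
    forall u : 'rV[int]_n, nonneg (u *m P1) <-> nonneg (u *m B *m P2).
Proof.
move=> fr1 fr2.
pose I1 := mideal cst chi1 P1; pose I2 := mideal cst chi2 P2.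
pose D (x : 'I_m1 + 'I_m2) := match x with inl i => I1 (dvec i) | inr j => I2 (dvec j) end.
pose E x y := `[< sim (D x) (D y) >].
pose np x := ~~ `[< principal A (D x) >].
pose t1 : seq ('I_m1 + 'I_m2) := [seq inl i | i <- enum 'I_m1 & np (inl i)].
pose t2 : seq ('I_m1 + 'I_m2) := [seq inr i | i <- enum 'I_m2 & np (inr i)].
have dD x : dvl A (D x) by case: x => i; [apply: dvl_mideal fr1 _|apply: dvl_mideal fr2 _].
have Enp x y : E x y -> np x = np y.
  move=> /asboolP xy; congr (~~ _); apply/asboolP/asboolP => h.
    exact: sim_trans (sim_sym xy) h.
  exact: sim_trans xy h.
have Er x : E x x by apply/asboolP; apply: sim_refl.
have Ee x y : E x y -> forall z, E z x = E z y.
  move=> /asboolP xy z; apply/asboolP/asboolP => h; first exact: sim_trans h xy.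
  exact: sim_trans h (sim_sym xy).
have cnt x : count (E x) t1 = count (E x) t2.
  have [nx|] := boolP (np x); last first.
    move=> px; have z s : (forall y, y \in s -> np y) -> count (E x) s = 0%N.
      move=> hs; apply/eqP; rewrite -leqn0 leqNgt -has_count; apply/hasP => -[y ys /Enp e].
      by have := hs y ys; rewrite -e (negbTE px).
    rewrite (z t1); first rewrite (z t2) //.
      by move=> y /mapP [i]; rewrite mem_filter => /andP [ni _] ->.
    by move=> y /mapP [i]; rewrite mem_filter => /andP [ni _] ->.
  have px : ~ principal A (D x) by move/asboolP; apply/negP.
  have c1 : count (E x) t1 = #|class_facets cst chi1 P1 (D x)|.
    rewrite count_map count_filter -sum1_count -sum1_card big_enum_cond /=.
    apply: eq_bigl => i /=; rewrite [RHS]inE -/(E x (inl i)).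
    by have [/Enp <-|] := boolP (E x (inl i)).
  have c2 : count (E x) t2 = #|class_facets cst chi2 P2 (D x)|.
    rewrite count_map count_filter -sum1_count -sum1_card big_enum_cond /=.
    apply: eq_bigl => i /=; rewrite [RHS]inE -/(E x (inr i)).
    by have [/Enp <-|] := boolP (E x (inr i)).
  rewrite c1 c2; apply/eqP; rewrite eqn_leq.
  by rewrite (class_facets_le fr1 fr2) ?(class_facets_le fr2 fr1).
have [l [l1 l2 lE]] := class_matching Er Ee cnt.
pose q := size l; pose T := in_tuple l.
have /choice [a1 ha1] : forall k : 'I_q, exists i, (tnth T k).1 = inl i.
  move=> k; have : (tnth T k).1 \in t1 by rewrite -l1; apply: map_f; apply: mem_tnth.
  by case/mapP => i _ ->; exists i.
have /choice [a2 ha2] : forall k : 'I_q, exists i, (tnth T k).2 = inr i.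
  move=> k; have : (tnth T k).2 \in t2.
    by rewrite -(perm_mem l2); apply: map_f; apply: mem_tnth.
  by case/mapP => i _ ->; exists i.
have sim12 k : sim (I1 (dvec (a1 k))) (I2 (dvec (a2 k))).
  by have /lE /asboolP := mem_tnth k T; rewrite ha1 ha2.
have u1 : uniq (unzip1 l).
  rewrite l1 map_inj_uniq; last by move=> ? ? [].
  by apply: filter_uniq; apply: enum_uniq.
have u2 : uniq (unzip2 l).
  rewrite (perm_uniq l2) map_inj_uniq; last by move=> ? ? [].
  by apply: filter_uniq; apply: enum_uniq.
have linj (f : ('I_m1 + 'I_m2) * ('I_m1 + 'I_m2) -> 'I_m1 + 'I_m2) (k k' : 'I_q) :
    uniq (map f l) -> f (tnth T k) = f (tnth T k') -> k = k'.
  have nE x0 (j : 'I_q) : nth x0 (map f l) j = f (tnth T j).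
    rewrite (nth_map (tnth T j)) ?ltn_ord //; congr f.
    exact: esym (tnth_nth _ T j).
  move=> ul e; apply: val_inj; apply/eqP.
  rewrite -(nth_uniq (f (tnth T k)) _ _ ul) ?size_map ?ltn_ord //.
  by rewrite !nE e.
have a1inj : injective a1 by move=> k k' e; apply: (linj fst) u1 _; rewrite !ha1 e.
have a2inj : injective a2 by move=> k k' e; apply: (linj snd) u2 _; rewrite !ha2 e.
have a1P i : ~ principal A (I1 (dvec i)) -> exists k, a1 k = i.
  move=> ni; have : inl i \in unzip1 l.
    by rewrite l1 map_f // mem_filter mem_enum andbT; apply/asboolPn.
  case/mapP => p /(tnthP T) [k ->] e; exists k.
  by have := ha1 k; rewrite -e => -[].
have a2P i : ~ principal A (I2 (dvec i)) -> exists k, a2 k = i.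
  move=> ni; have : inr i \in unzip2 l.
    by rewrite (perm_mem l2) map_f // mem_filter mem_enum andbT; apply/asboolPn.
  case/mapP => p /(tnthP T) [k ->] e; exists k.
  by have := ha2 k; rewrite -e => -[].
have [k1 [R1 [W1 [W1P' W1R nn1 sp1 rk1]]]] := facet_split fr1 a1inj a1P.
have [k2 [R2 [W2 [W2P' W2R nn2 sp2 rk2]]]] := facet_split fr2 a2inj a2P.
set P1' := P1 *m (selmx a1)^T in W1P' nn1 sp1 rk1.
set P2' := P2 *m (selmx a2)^T in W2P' nn2 sp2 rk2.
have simx (x : 'rV[int]_q) : sim (I1 (x *m selmx a1)) (I2 (x *m selmx a2)).
  move: x; apply: int_row_ind => [|x y hx hy|k].
  - rewrite !mul0mx; apply: sim_ext => f.
    by rewrite /I1 /I2 (mideal0 fr1) (mideal0 fr2).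
  - rewrite !mulmxBl; have := sim_colon hx hy => /(sim_trans (sim_ext _)) h.
    have {h} h := h _ (fun f => iff_sym (colon_mideal fr1 _ _ f)).
    apply: sim_trans h _; apply: sim_ext => f; exact: (colon_mideal fr2).
  - by rewrite -!rowE !rowK.
have selK (m : nat) (a : 'I_q -> 'I_m) : injective a -> selmx a *m (selmx a)^T = 1%:M.
  by move=> ai; apply/matrixP => k k'; rewrite mul_selmx_tr !mxE eqxx eq_sym (inj_eq ai).
have im12 (u : 'rV[int]_n) : exists w : 'rV[int]_n, u *m P1' = w *m P2'.
  have : principal A (I1 (u *m P1' *m selmx a1)).
    apply/(principal_mideal fr1); exists (u - u *m R1 *m W1).
    rewrite sp1; last by rewrite mulmxBl -!mulmxA W1R mulmx1 subrr.
    by rewrite mulmxBl -(mulmxA _ W1) W1P' mulmx0 subr0.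
  move/(sim_trans (sim_sym (simx _)))/(principal_mideal fr2) => [w e].
  by exists w; rewrite /P2' mulmxA -e -mulmxA selK // mulmx1.
have im21 (u : 'rV[int]_n) : exists w : 'rV[int]_n, u *m P2' = w *m P1'.
  have : principal A (I2 (u *m P2' *m selmx a2)).
    apply/(principal_mideal fr2); exists (u - u *m R2 *m W2).
    rewrite sp2; last by rewrite mulmxBl -!mulmxA W2R mulmx1 subrr.
    by rewrite mulmxBl -(mulmxA _ W2) W2P' mulmx0 subr0.
  move/(sim_trans (simx _))/(principal_mideal fr1) => [w e].
  by exists w; rewrite /P1' mulmxA -e -mulmxA selK // mulmx1.
have matX (Q Q' : 'M[int]_(n, q)) : (forall u : 'rV[int]_n, exists w : 'rV[int]_n, u *m Q = w *m Q') ->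
    exists X, Q = X *m Q'.
  move=> h; have /choice [w hw] : forall i : 'I_n, exists w : 'rV[int]_n, row i Q = w *m Q'.
    by move=> i; rewrite rowE; apply: h.
  by exists (\matrix_i w i); apply/row_matrixP => i; rewrite row_mul rowK.
have [X XE] := matX _ _ im12; have [Y YE] := matX _ _ im21.
have kk : k1 = k2.
  have r12 : \rank (mxQ P1) = \rank (mxQ P2).
    by apply/eqP; rewrite eqn_leq (mxrank_le fr1 fr2) (mxrank_le fr2 fr1).
  have r12' : \rank (mxQ P1') = \rank (mxQ P2').
    have le1 : (\rank (mxQ P1') <= \rank (mxQ P2'))%N.
      by rewrite XE map_mxM mxrankM_maxr.
    have le2 : (\rank (mxQ P2') <= \rank (mxQ P1'))%N.
      by rewrite YE map_mxM mxrankM_maxr.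
    by apply/eqP; rewrite eqn_leq le1.
  by move: r12; rewrite rk1 rk2 r12' => /addnI.
move: kk R2 W2 W2P' W2R nn2 sp2 rk2 => <- R2 W2 W2P' W2R nn2 sp2 rk2.
have [B uB QB] : exists2 B, B \in unitmx & row_mx P1' R1 = B *m row_mx P2' R2.
  have gen (Qa Qb : 'M[int]_(n, q)) (Ra Rb : 'M[int]_(n, k1)) W Z : Qa = Z *m Qb ->
      W *m Qb = 0 -> W *m Rb = 1%:M ->
      row_mx Qa Ra = (Z + (Ra - Z *m Rb) *m W) *m row_mx Qb Rb.
    move=> e w0 w1; rewrite mul_mx_row !(mulmxDl Z) -!(mulmxA _ W) w0 w1 mulmx0 mulmx1 addr0 -e.
    by rewrite addrC subrK.
  exact: same_row_lattice (gen _ _ _ _ _ _ XE W2P' W2R) (gen _ _ _ _ _ _ YE W1P' W1R).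
have [] := eq_row_mx (etrans QB (mul_mx_row _ _ _)) => B1 B2.
exists B => // u; rewrite nn1 nn2 B1 B2.
by rewrite !mulmxA.
Qed.

(** * Regular functions *)

Section PolynomialMaps.
Variable K : closedFieldType.

Definition psub N M (q : 'I_M -> {mpoly K[N]}) (p : {mpoly K[M]}) : {mpoly K[N]} :=
  mmap (@mpolyC N K) q p.

Lemma meval_psub N M (q : 'I_M -> {mpoly K[N]}) (p : {mpoly K[M]}) v :
  (psub q p).@[v] = p.@[fun j => (q j).@[v]].
Proof.
rewrite /psub [in RHS]mevalE /mmap rmorph_sum /=; apply: eq_bigr => m _.
rewrite mevalM mevalC rmorph_prod; congr (_ * _).
by apply: eq_bigr => i _; rewrite rmorphXn.
Qed.

Definition lpoly N M (p : {mpoly K[N]}) : {mpoly K[N + M]} :=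
  psub (fun j => 'X_(lshift M j)) p.

Definition rpoly N M (p : {mpoly K[M]}) : {mpoly K[N + M]} :=
  psub (fun j => 'X_(rshift N j)) p.

Lemma peval_lpoly N M (p : {mpoly K[N]}) (z : 'rV[K]_(N + M)) :
  peval (lpoly M p) z = peval p (lsubmx z).
Proof. by rewrite /peval meval_psub; apply: meval_eq => j; rewrite mevalXU mxE. Qed.

Lemma peval_rpoly N M (p : {mpoly K[M]}) (z : 'rV[K]_(N + M)) :
  peval (rpoly N p) z = peval p (rsubmx z).
Proof. by rewrite /peval meval_psub; apply: meval_eq => j; rewrite mevalXU mxE. Qed.

Lemma pevalX N (j : 'I_N) (x : 'rV[K]_N) : peval 'X_j x = x ord0 j.
Proof. exact: mevalXU. Qed.

End PolynomialMaps.

Section Regular.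
Variable K : closedFieldType.
Variables (N : nat) (Y : 'rV[K]_N -> Prop).
Implicit Types f g : 'rV[K]_N -> K.

Lemma reg_ext f g : (forall y, Y y -> f y = g y) -> regular Y f -> regular Y g.
Proof.
move=> fg rf x Yx; have [p [q [qx h]]] := rf x Yx; exists p, q; split=> // y Yy qy.
by rewrite -fg // h.
Qed.

Lemma reg_poly (p : {mpoly K[N]}) : regular Y (peval p).
Proof.
move=> x Yx; exists p, 1; rewrite /peval rmorph1; split; first exact/eqP/oner_neq0.
by move=> y _ _; rewrite rmorph1 divr1.
Qed.

Lemma reg_cst c : regular Y (fun=> c).
Proof. by apply: reg_ext (reg_poly c%:MP) => y _; rewrite /peval mevalC. Qed.

Lemma regM f g : regular Y f -> regular Y g -> regular Y (fun y => f y * g y).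
Proof.
move=> rf rg x Yx; have [p [q [qx h]]] := rf x Yx; have [p' [q' [qx' h']]] := rg x Yx.
exists (p * p'), (q * q'); rewrite /peval rmorphM -!/(peval _ _).
split=> [/eqP|y Yy]; first by rewrite mulf_eq0 => /orP [] /eqP.
rewrite !rmorphM /= -!/(peval _ _) => /eqP; rewrite mulf_eq0 negb_or => /andP [/eqP a /eqP b].
by rewrite h // h' // mulf_div.
Qed.

Lemma regD f g : regular Y f -> regular Y g -> regular Y (fun y => f y + g y).
Proof.
move=> rf rg x Yx; have [p [q [qx h]]] := rf x Yx; have [p' [q' [qx' h']]] := rg x Yx.
exists (p * q' + p' * q), (q * q'); rewrite /peval rmorphM -!/(peval _ _).
split=> [/eqP|y Yy]; first by rewrite mulf_eq0 => /orP [] /eqP.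
rewrite rmorphD !rmorphM /= -!/(peval _ _) => /eqP; rewrite mulf_eq0 negb_or => /andP [a b].
by rewrite h; [rewrite h'; [rewrite addf_div| |apply/eqP]| |apply/eqP].
Qed.

Lemma regV f : (forall y, Y y -> f y != 0) -> regular Y f -> regular Y (fun y => (f y)^-1).
Proof.
move=> f0 rf x Yx; have [p [q [qx h]]] := rf x Yx.
exists (q * q), (p * q); rewrite /peval !rmorphM -!/(peval _ _); split.
  have := f0 x Yx; rewrite h // mulf_eq0 invr_eq0 negb_or => /andP [/eqP a _].
  by move/eqP; rewrite mulf_eq0 => /orP [] /eqP.
move=> y Yy; rewrite !rmorphM /= -!/(peval _ _) => /eqP; rewrite mulf_eq0 negb_or.
by move=> /andP [a b]; rewrite h //; [field; rewrite a b|apply/eqP].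
Qed.

Lemma regX f k : regular Y f -> regular Y (fun y => f y ^+ k).
Proof.
move=> rf; elim: k => [|k IH]; first exact: reg_cst.
by apply: reg_ext (regM rf IH) => y _; rewrite exprS.
Qed.

Lemma reg_sum (I : Type) (r : seq I) (P : pred I) (F : I -> 'rV[K]_N -> K) :
  (forall i, P i -> regular Y (F i)) -> regular Y (fun y => \sum_(i <- r | P i) F i y).
Proof.
move=> h; elim: r => [|i r IH].
  by apply: reg_ext (reg_cst 0) => y _; rewrite big_nil.
have [Pi|nPi] := boolP (P i).
  by apply: reg_ext (regD (h i Pi) IH) => y _; rewrite big_cons Pi.
by apply: reg_ext IH => y _; rewrite big_cons (negbTE nPi).
Qed.

Lemma reg_prod (I : Type) (r : seq I) (P : pred I) (F : I -> 'rV[K]_N -> K) :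
  (forall i, P i -> regular Y (F i)) -> regular Y (fun y => \prod_(i <- r | P i) F i y).
Proof.
move=> h; elim: r => [|i r IH].
  by apply: reg_ext (reg_cst 1) => y _; rewrite big_nil.
have [Pi|nPi] := boolP (P i).
  by apply: reg_ext (regM (h i Pi) IH) => y _; rewrite big_cons Pi.
by apply: reg_ext IH => y _; rewrite big_cons (negbTE nPi).
Qed.

Lemma reg_meval M (F : 'I_M -> 'rV[K]_N -> K) (p : {mpoly K[M]}) :
  (forall j, regular Y (F j)) -> regular Y (fun y => p.@[fun j => F j y]).
Proof.
move=> h; apply: (@reg_ext (fun y => \sum_(m <- msupp p) p@_m * \prod_(i < M) F i y ^+ m i)).
  by move=> y _; rewrite mevalE.
apply: reg_sum => m _; apply: regM; first exact: reg_cst.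
by apply: reg_prod => i _; apply: regX.
Qed.

Lemma reg_comp M (Z : 'rV[K]_M -> Prop) (F : 'rV[K]_N -> 'rV[K]_M) (f : 'rV[K]_M -> K)
    (q : 'I_M -> {mpoly K[N]}) :
  (forall y, Y y -> Z (F y)) -> (forall y, Y y -> forall j, F y ord0 j = peval (q j) y) ->
  @regular K M Z f -> regular Y (fun y => f (F y)).
Proof.
move=> YZ Fq rf x Yx; have [p [d [dx h]]] := rf _ (YZ _ Yx).
have E r y : Y y -> peval (psub q r) y = peval r (F y).
  by move=> Yy; rewrite /peval meval_psub; apply: meval_eq => j; rewrite Fq.
exists (psub q p), (psub q d); rewrite E //; split=> // y Yy.
by rewrite !E //; apply: h => //; apply: YZ.
Qed.

End Regular.

Lemma reg_sub (K : closedFieldType) N (Y Z : 'rV[K]_N -> Prop) f :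
  (forall y, Y y -> Z y) -> regular Z f -> regular Y f.
Proof.
move=> YZ rf x Yx; have [p [q [qx h]]] := rf x (YZ _ Yx).
by exists p, q; split=> // y /YZ; apply: h.
Qed.

Section ClosedSets.
Variable K : closedFieldType.

Lemma closed_pts N (Z : 'rV[K]_N -> Prop) x : zclosed Z ->
  (forall p, (forall y, Z y -> peval p y = 0) -> peval p x = 0) -> Z x.
Proof.
by move=> [I ZI] h; apply/ZI => p Ip; apply: h => y /ZI; apply.
Qed.

(** By the Nullstellensatz the denominators of a regular function on the locus
    of a closed set where [h] does not vanish include a power of [h]. *)
Lemma regular_principal N (Z : 'rV[K]_N -> Prop) (h : {mpoly K[N]}) f :
  zclosed Z -> regular (fun x => Z x /\ peval h x <> 0) f ->
  exists p k, forall x, Z x -> peval h x <> 0 -> peval h x ^+ k * f x = peval p x.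
Proof.
move=> cZ rf; pose Y x := Z x /\ peval h x <> 0.
pose I q := exists p, forall y, Y y -> peval q y * f y = peval p y.
have Ii : ideal I.
  split; first by exists 0 => y _; rewrite /peval !rmorph0 mul0r.
  - move=> a b [p hp] [q hq]; exists (p + q) => y Yy.
    by rewrite /peval !rmorphD /= -!/(peval _ _) mulrDl hp // hq.
  - move=> a b [p hp]; exists (a * p) => y Yy.
    by rewrite /peval !rmorphM /= -!/(peval _ _) -mulrA hp.
have [|k [p hp]] := @nullstellensatz K N I h Ii; last first.
  exists p, k => x Zx hx; rewrite -hp //; congr (_ * _).
  by rewrite /peval rmorphXn.
move=> v Iv; pose x : 'rV[K]_N := \row_i v i.
have px q : peval q x = q.@[v] by apply: meval_eq => i; rewrite mxE.
apply/eqP/negPn/negP => hv.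
have Zx : Z x.
  apply: closed_pts => // q Zq; rewrite px; apply: Iv; exists 0 => y [Zy _].
  by rewrite Zq // mul0r /peval rmorph0.
have [|a [b [bx hb]]] := rf x; first by split=> //; rewrite px; apply/eqP.
have : I (b * b).
  exists (a * b) => y Yy; rewrite /peval !rmorphM /= -!/(peval _ _).
  have [->|b0] := eqVneq (peval b y) 0; first by rewrite !mulr0 mul0r.
  have -> : f y = peval a y / peval b y by apply: hb => //; apply/eqP.
  by field.
by move/Iv; rewrite -px /peval rmorphM => /eqP; rewrite mulf_eq0 orbb => /eqP.
Qed.

Lemma regular_closed N (Z : 'rV[K]_N -> Prop) f : zclosed Z -> regular Z f ->
  exists p, forall x, Z x -> f x = peval p x.
Proof.
move=> cZ rf; have [|p [k hp]] := @regular_principal N Z 1 f cZ.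
  by apply: reg_sub rf => y [].
exists p => x Zx; rewrite -hp //; last by rewrite /peval rmorph1; apply/eqP/oner_neq0.
by rewrite /peval rmorph1 expr1n mul1r.
Qed.

Lemma zclosed_prodv N M (X : 'rV[K]_N -> Prop) (Y : 'rV[K]_M -> Prop) :
  zclosed X -> zclosed Y -> zclosed (prodv X Y).
Proof.
move=> [I hI] [J hJ].
exists (fun p => (exists2 q, I q & p = lpoly M q) \/ exists2 q, J q & p = rpoly N q).
move=> z; split=> [[/hI Xz /hJ Yz] p [] [q Iq ->]|h].
- by rewrite peval_lpoly; apply: Xz.
- by rewrite peval_rpoly; apply: Yz.
split; [apply/hI|apply/hJ] => q Iq.
- by rewrite -peval_lpoly; apply: h; left; exists q.
- by rewrite -peval_rpoly; apply: h; right; exists q.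
Qed.

Lemma zclosed_full N : zclosed (@affine_space K N).
Proof. by exists (fun=> False) => x; split=> // _ p. Qed.

Lemma irreducible_mul N (X : 'rV[K]_N -> Prop) p q : irreducible X ->
  (forall x, X x -> peval p x * peval q x = 0) ->
  (forall x, X x -> peval p x = 0) \/ (forall x, X x -> peval q x = 0).
Proof.
move=> [_ irr] pq.
have cl r : zclosed (fun x : 'rV[K]_N => peval r x = 0).
  by exists (eq r) => x; split=> [h _ <-|]; last exact.
apply: irr (cl p) (cl q) _ => x /pq /eqP.
by rewrite mulf_eq0 => /orP [] /eqP; [left|right].
Qed.

(** [p * h] vanishes on the irreducible set [X], and [h] does not. *)
Lemma dense_zero N (X : 'rV[K]_N -> Prop) h p : irreducible X ->
  (exists2 x, X x & peval h x <> 0) ->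
  (forall x, X x -> peval h x <> 0 -> peval p x = 0) ->
  forall x, X x -> peval p x = 0.
Proof.
move=> irr [x0 Xx0 hx0] hp.
have [//|h0] : (forall x, X x -> peval p x = 0) \/ (forall x, X x -> peval h x = 0).
  apply: irreducible_mul => // x Xx.
  have [->|/eqP hx] := eqVneq (peval h x) 0; first by rewrite mulr0.
  by rewrite hp // mul0r.
by case: hx0; apply: h0.
Qed.

Lemma mpoly_zero n (p : {mpoly K[n]}) : (forall v, p.@[v] = 0) -> p = 0.
Proof.
move=> p0; have [|k pk] := @nullstellensatz K n (fun q => q = 0) p _ (fun v _ => p0 v).
  split=> // [a b -> ->|a b ->]; by rewrite ?addr0 ?mulr0.
by apply/eqP; have := pk => /eqP; rewrite expf_eq0 => /andP [].
Qed.

Lemma mpoly_zero_torus n (p : {mpoly K[n]}) :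
  (forall t, torus t -> peval p t = 0) -> p = 0.
Proof.
move=> p0; have : p * \prod_(i < n) 'X_i = 0.
  apply: mpoly_zero => v; rewrite mevalM rmorph_prod /=.
  have [tv|] := boolP [forall i, v i != 0].
    suff -> : p.@[v] = 0 by rewrite mul0r.
    rewrite -(p0 (\row_i v i)); first by apply: meval_eq => i; rewrite mxE.
    by move=> i; rewrite mxE; apply/eqP; move/forallP: tv.
  rewrite negb_forall => /existsP [i /negPn /eqP vi].
  by rewrite (bigD1 i) //= mevalXU vi mul0r mulr0.
move/eqP; rewrite mulf_eq0 => /orP [/eqP //|].
rewrite prodf_seq_eq0 => /hasP [i _ /=] /eqP /(congr1 (mcoeff U_(i))) /eqP.
by rewrite mcoeffX eqxx mcoeff0 oner_eq0.
Qed.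

End ClosedSets.

(** * Characters *)

Section Characters.
Variable K : closedFieldType.

Lemma eval_points (T : Type) (Q : T -> Prop) k (f : 'I_k -> T -> K) :
  (forall c : 'I_k -> K, (forall t, Q t -> \sum_i c i * f i t = 0) -> forall i, c i = 0) ->
  exists t : 'I_k -> T, (forall i, Q (t i)) /\ \matrix_(j, i) f i (t j) \in unitmx.
Proof.
move=> free.
pose mx l (t : 'I_l -> T) := \matrix_(j < l, i < k) f i (t j).
pose R r := `[< exists l (t : 'I_l -> T), (forall j, Q (t j)) /\ \rank (mx l t) = r >].
have R0 : exists r, R r.
  have t0 : 'I_0 -> T by case.
  by exists (\rank (mx 0%N t0)); apply/asboolP; exists 0%N, t0; split=> // -[].
have Rle r : R r -> (r <= k)%N by move=> /asboolP [l [t [_ <-]]]; apply: rank_leq_col.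
case: (ex_maxnP R0 Rle) => r /asboolP [l [t [Qt rk]]] rmax.
have full : row_full (mx l t).
  rewrite /row_full rk eqn_leq -{1}rk rank_leq_col /= leqNgt; apply/negP => rk'.
  have : (cokermx (mx l t)) != 0.
    by rewrite -mxrank_eq0 mxrank_coker rk -lt0n subn_gt0.
  move/eqP => ck; apply: ck; apply/matrixP => a b; rewrite [RHS]mxE.
  apply: (free (fun i => cokermx (mx l t) i b)) => x Qx.
  pose t' (j : 'I_(1 + l)) := if split j is inr j' then t j' else x.
  have Qt' j : Q (t' j) by rewrite /t'; case: split.
  have mE : mx _ t' = col_mx (\row_i f i x) (mx l t).
    apply/matrixP => j i; rewrite mxE /t' -[j]splitK; case: (split j) => j'.
      by rewrite col_mxEu unsplitK mxE.
    by rewrite col_mxEd unsplitK mxE.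
  have sub : (\row_i f i x <= mx l t)%MS.
    have le : (\rank (mx _ t') <= \rank (mx l t))%N.
      by rewrite rk; apply: rmax; apply/asboolP; exists (1 + l)%N, t'.
    have s : (mx l t <= mx _ t')%MS by rewrite mE -addsmxE addsmxSr.
    have /eqmxP e : (mx l t == mx _ t')%MS.
      by rewrite s /=; case: (mxrank_leqif_sup s) => _; rewrite eqn_leq le (mxrankS s) => <-.
    by rewrite e mE -addsmxE addsmxSl.
  have := sub; rewrite submxE => /eqP /(congr1 (fun z : 'rV_k => z ord0 b)).
  rewrite mxE [RHS]mxE => e; rewrite -[RHS]e; apply: eq_bigr => i _.
  by rewrite mulrC; congr (_ * _); rewrite mxE.
exists (fun i => t (fullrankfun full i)); split=> [i|]; first exact: Qt.
have := fullrowsub_unit full.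
by congr (_ \in unitmx); apply/matrixP => i j; rewrite !mxE.
Qed.

End Characters.

Section Monomials.
Variable K : closedFieldType.
Variable n : nat.
Notation M := 'rV[int]_n.
Implicit Types (u w : M) (t : 'rV[K]_n).

(* The value of a monomial at [t] behaves well when only coordinates of [t] with
   nonnegative exponents vanish. *)
Definition defined_at u t := forall i, t ord0 i = 0 -> 0 <= u ord0 i.

Lemma torus_defined u t : torus t -> defined_at u t.
Proof. by move=> tt i /tt. Qed.

Lemma character0 t : character 0 t = 1.
Proof. by rewrite /character big1 // => i _; rewrite mxE expr0z. Qed.

Lemma characterD u w t : defined_at u t -> defined_at w t ->
  character (u + w) t = character u t * character w t.
Proof.
move=> du dw; rewrite /character -big_split /=; apply: eq_bigr => i _.
rewrite mxE; have [t0|t0] := eqVneq (t ord0 i) 0; last by rewrite expfzDr.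
move: (du i t0) (dw i t0); case: (u ord0 i) (w ord0 i) => // a [] // b _ _.
by rewrite exprzD_nat.
Qed.

Lemma defined_atD u w t : defined_at u t -> defined_at w t -> defined_at (u + w) t.
Proof. by move=> du dw i ti; rewrite mxE addr_ge0 ?du ?dw. Qed.

Lemma characterDt u w t : torus t -> character (u + w) t = character u t * character w t.
Proof. by move=> tt; apply: characterD; apply: torus_defined. Qed.

Lemma character_neq0 u t : torus t -> character u t != 0.
Proof. by move=> tt; apply/prodf_neq0 => i _; apply: expfz_neq0; apply/eqP/tt. Qed.

Lemma characterN u t : torus t -> character (- u) t = (character u t)^-1.
Proof.
move=> tt; apply: (mulfI (character_neq0 u tt)).
rewrite -characterD ?subrr ?character0 ?mulfV ?character_neq0 //;
  exact: torus_defined.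
Qed.

Lemma characterMn u k t : defined_at u t ->
  character (u *+ k) t = character u t ^+ k /\ defined_at (u *+ k) t.
Proof.
move=> du; elim: k => [|k [IH dk]].
  by rewrite mulr0n character0 expr0; split=> // i _; rewrite mxE.
by rewrite mulrS characterD // IH exprS; split=> //; apply: defined_atD.
Qed.

Lemma torus_tmul (s t : 'rV[K]_n) : torus s -> torus t -> torus (tmul s t).
Proof.
by move=> ts tt i; rewrite mxE; apply/eqP; rewrite mulf_neq0 //; apply/eqP; [apply: ts|apply: tt].
Qed.

Lemma torus1 : torus (const_mx 1 : 'rV[K]_n).
Proof. by move=> i; rewrite mxE; apply/eqP/oner_neq0. Qed.

Lemma tmulC (s t : 'rV[K]_n) : tmul s t = tmul t s.
Proof. by apply/rowP => i; rewrite !mxE mulrC. Qed.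

Lemma character_tmul u (s t : 'rV[K]_n) :
  character u (tmul s t) = character u s * character u t.
Proof.
rewrite /character -big_split /=; apply: eq_bigr => i _.
by rewrite mxE expfzMl.
Qed.

Lemma character_one u : character u (const_mx 1 : 'rV[K]_n) = 1.
Proof. by rewrite /character big1 // => i _; rewrite mxE exp1rz. Qed.

Lemma character_mrow m t : character (mrow m) t = ('X_[m] : {mpoly K[n]}).@[fun i => t ord0 i].
Proof. by rewrite mevalX; apply: eq_bigr => i _; rewrite mxE. Qed.

Definition mabs u : 'X_{1..n} := [multinom absz (u ord0 i) | i < n].

Lemma mabs_mrow u : nonneg u -> mrow (mabs u) = u.
Proof. by move=> hu; apply/rv_eq => i; rewrite mxE mnmE gez0_abs. Qed.

Lemma nonneg_shift (s : seq M) : exists m : 'X_{1..n}, forall u, u \in s -> nonneg (u + mrow m).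
Proof.
elim: s => [|u s [m hm]]; first by exists 0%MM.
exists (m + mabs u)%MM => w; rewrite in_cons => /predU1P [->|/hm h] i; last first.
  by have := h i; rewrite mrowD !rowDE !mxE; lia.
by rewrite mrowD !rowDE !mxE mnmE; move: (u ord0 i) => ?; lia.
Qed.

(** After a shift of the exponents a relation between characters becomes a
    polynomial that vanishes on the torus. *)
Lemma character_free (s : seq M) (c : M -> K) : uniq s ->
  (forall t, torus t -> \sum_(u <- s) c u * character u t = 0) ->
  forall u, u \in s -> c u = 0.
Proof.
move=> us h; have [m hm] := nonneg_shift s.
pose p : {mpoly K[n]} := \sum_(u <- s) c u *: 'X_[mabs (u + mrow m)].
have p0 : p = 0.
  apply: mpoly_zero_torus => t tt.
  apply: (@etrans _ _ (character (mrow m) t * \sum_(u <- s) c u * character u t)).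
    rewrite /peval rmorph_sum mulr_sumr /= big_seq [RHS]big_seq; apply: eq_bigr => u su.
    rewrite mevalZ -character_mrow mabs_mrow; last exact: hm.
    have -> : character (u + mrow m) t = character u t * character (mrow m) t.
      by apply: characterD; apply: torus_defined.
    ring.
  by rewrite h // mulr0.
move=> u su; have /mpolyP /(_ (mabs (u + mrow m))) := p0.
rewrite mcoeff0 raddf_sum /= (bigD1_seq u) //= mcoeffZ mcoeffX eqxx mulr1.
rewrite big1_seq ?addr0 // => w /andP [wu ws].
rewrite mcoeffZ mcoeffX; case: eqP => [e|_]; last by rewrite mulr0.
case/negP: wu; apply/eqP/(addIr (mrow m)).
by rewrite -(mabs_mrow (hm _ ws)) e (mabs_mrow (hm _ su)).
Qed.

(** The points whose coordinates in [b] do not vanish: tori, and products of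
    multiplicative and additive groups. *)
Definition bset (b : pred 'I_n) t := forall i, b i -> t ord0 i <> 0.

Lemma torus_bset b t : torus t -> bset b t. Proof. by move=> h i _; apply: h. Qed.

Definition bnonneg (b : pred 'I_n) u := forall i, ~~ b i -> 0 <= u ord0 i.

Lemma bnonneg_defined b u t : bset b t -> bnonneg b u -> defined_at u t.
Proof. by move=> bt bu i ti; apply: bu; apply/negP => /bt. Qed.

Lemma reg_character b u : bnonneg b u -> regular (bset b) (character u).
Proof.
move=> bu; apply: reg_prod => i _.
have ri : regular (bset b) (fun t => t ord0 i).
  apply: (@reg_ext _ _ _ (peval 'X_i)); last exact: reg_poly.
  by move=> t _; apply: pevalX.
have [bi|/bu] := boolP (b i); last first.
  by case: (u ord0 i) => // k _; apply: regX.
case: (u ord0 i) => k; first exact: regX.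
apply: (@reg_ext _ _ _ (fun t => (t ord0 i ^+ k.+1)^-1)) => //.
by apply: regV; [move=> t bt; apply: expf_neq0; apply/eqP/bt|apply: regX].
Qed.

Lemma reg_bset b f : regular (bset b) f -> exists (s : seq M) (c : M -> K),
  [/\ uniq s, forall u, u \in s -> bnonneg b u, forall u, u \in s -> c u != 0
    & forall t, bset b t -> f t = \sum_(u <- s) c u * character u t].
Proof.
move=> rf; pose h : {mpoly K[n]} := \prod_(i | b i) 'X_i.
have hE t : peval h t = \prod_(i | b i) t ord0 i.
  by rewrite /peval rmorph_prod; apply: eq_bigr => i _; apply: mevalXU.
have hb t : peval h t <> 0 <-> bset b t.
  rewrite hE; split=> [/eqP /prodf_neq0 ht i bi|bt]; first by apply/eqP/ht.
  by apply/eqP/prodf_neq0 => i bi; apply/eqP/bt.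
have [|p [k hp]] := @regular_principal K n (@affine_space K n) h f (@zclosed_full K n).
  by apply: reg_sub rf => t [_ /hb].
pose bv : M := \row_i (b i)%:R.
pose e m := mrow m - bv *+ k.
have einj : injective e by move=> m m' /addIr /mrow_inj.
pose inv u : 'X_{1..n} := mabs (u + bv *+ k).
have eK m : inv (e m) = m.
  apply: mrow_inj; rewrite mabs_mrow /e subrK //; by move=> i; rewrite mxE.
exists [seq e m | m <- msupp p], (fun u => p@_(inv u)); split.
- by rewrite map_inj_uniq.
- move=> _ /mapP [m _ ->] i /negbTE bi.
  have bvk : (bv *+ k) ord0 i = 0.
    by elim: (k) => [|j IH]; rewrite ?mulr0n ?mulrS !mxE ?bi ?add0r // -[RHS]IH mxE.
  by rewrite /e rowDE rowNE bvk subr0 mxE.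
- by move=> _ /mapP [m mp ->]; rewrite eK -mcoeff_msupp.
- move=> t bt; have ht : peval h t != 0 by apply/eqP/hb.
  have dv (i : 'I_n) : t ord0 i = 0 -> (bv *+ k) ord0 i = 0.
    move=> ti; have bi : b i = false by apply/negbTE/negP => /bt.
    by elim: (k) => [|j IH]; rewrite ?mulr0n ?mulrS !mxE ?bi ?add0r // -[RHS]IH mxE.
  have bvE : character bv t = peval h t.
    rewrite hE [RHS]big_mkcond; apply: eq_bigr => i _.
    by rewrite mxE; case: (b i) => //=; rewrite expr1z.
  have dbv : defined_at bv t by move=> i _; rewrite mxE; case: (b i).
  apply: (mulfI (expf_neq0 k ht)); rewrite hp //; last exact/eqP.
  rewrite [peval p t]mevalE [in RHS]big_map mulr_sumr; apply: eq_bigr => m _.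
  rewrite eK mulrCA -bvE; congr (_ * _).
  have [bk dk] := characterMn k dbv.
  rewrite -bk -characterD //.
    by rewrite /e addrC subrK character_mrow mevalX.
  by move=> i ti; rewrite /e rowDE rowNE (dv i ti) subr0 mxE.
Qed.

Lemma reg_bset_zero b f : regular (bset b) f ->
  (forall t, torus t -> f t = 0) -> forall t, bset b t -> f t = 0.
Proof.
move=> /reg_bset [s [c [us _ _ fE]]] f0 t bt; rewrite fE // big_seq big1 // => u su.
rewrite (@character_free s c us _ u su) ?mul0r // => x tx.
by rewrite -fE ?f0 //; apply: torus_bset.
Qed.

End Monomials.

(** If a family of functions [F t] is a combination of fixed functions [g i]
    with linearly independent coefficients, each [g i] is a combination of
    finitely many members of the family. *)
Lemma isolate (K : closedFieldType) (T U : Type) (Q : T -> Prop) (D : U -> Prop) k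
    (a : 'I_k -> T -> K) (g : 'I_k -> U -> K) (F : T -> U -> K) :
  (forall c : 'I_k -> K, (forall t, Q t -> \sum_i c i * a i t = 0) -> forall i, c i = 0) ->
  (forall t x, Q t -> D x -> F t x = \sum_i a i t * g i x) ->
  forall i, exists (t : 'I_k -> T) (d : 'I_k -> K), (forall j, Q (t j)) /\
    forall x, D x -> g i x = \sum_j d j * F (t j) x.
Proof.
move=> /eval_points [t [Qt uM]] FE i; set A := \matrix_(_, _) _ in uM.
exists t, (fun j => invmx A i j); split=> // x Dx.
have e : \col_j F (t j) x = A *m \col_l g l x.
  apply/matrixP => j l; rewrite !mxE FE //; apply: eq_bigr => h _.
  by rewrite !mxE.
have := congr1 (fun z => (invmx A *m z) i ord0) e.
rewrite mulKmx // [RHS]mxE => <-; rewrite mxE; apply: eq_bigr => j _.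
by rewrite mxE.
Qed.

Lemma nontrivial_root (K : closedFieldType) (d : nat) : [pchar K] =i pred0 ->
  d != 1%N -> exists2 z : K, z != 0 & z != 1 /\ z ^+ d = 1.
Proof.
move=> char0 d1.
have nat0 k : ((k%:R : K) == 0) = (k == 0)%N by apply: (pcharf0P _).1.
have [->|d0] := eqVneq d 0%N.
  exists 2%:R; first by rewrite nat0.
  by rewrite expr0 -[1]/(1%:R) -subr_eq0 -natrB // nat0.
pose p : {poly K} := \sum_(i < d) 'X^i.
have p0 : p.[1] = d%:R.
  rewrite /p horner_sum (eq_bigr (fun=> 1)) ?sumr_const ?card_ord // => i _.
  by rewrite hornerXn expr1n.
have [z /rootP zp] : exists z, root p z.
  apply: closed_rootP; have -> : p = \poly_(i < d) 1.
    by rewrite poly_def; apply: eq_bigr => i _; rewrite scale1r.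
  by rewrite size_poly_eq ?oner_neq0 //.
have zd : z ^+ d = 1.
  have sE : \sum_(i < d) z ^+ i = 0.
    by rewrite -[RHS]zp /p horner_sum; apply: eq_bigr => i _; rewrite hornerXn.
  by apply/eqP; rewrite -subr_eq0 subrX1 sE mulr0.
exists z; last by split=> //; apply: contraNneq d0 => z1; rewrite -nat0 -p0 -z1 zp.
by apply/eqP => z0; move/eqP: zd; rewrite z0 expr0n (negbTE d0) eq_sym oner_eq0.
Qed.

(** * Rational polyhedral cones *)

Section FourierMotzkin.
Variable n : nat.
Notation V := 'rV[rat]_n.

Definition lval (w : V) (h : 'cV[rat]_n) : rat := (w *m h) ord0 ord0.

Lemma max_or_zero (l : seq rat) :
  exists a, [/\ 0 <= a, forall x, x \in l -> x <= a & a = 0 \/ a \in l].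
Proof.
elim: l => [|y l [a [a0 al ae]]]; first by exists 0; split=> //; left.
have [ya|ay] := leP y a.
  exists a; split=> // [x|]; first by rewrite in_cons => /predU1P [->//|/al].
  by case: ae => [->|al']; [left|right; rewrite in_cons al' orbT].
exists y; split; first exact: le_trans a0 (ltW ay).
  by move=> x; rewrite in_cons => /predU1P [->//|/al xa]; apply: le_trans xa (ltW ay).
by right; rewrite mem_head.
Qed.

(** Fourier-Motzkin elimination: a finitely generated cone is cut out by
    finitely many linear inequalities. *)
Lemma fourier_motzkin (gs : seq V) : exists H : seq 'cV[rat]_n, forall w,
  (exists c : nat -> rat, (forall i, 0 <= c i) /\ w = \sum_(i < size gs) c i *: gs`_i) <->
  (forall h, h \in H -> 0 <= lval w h).
Proof.
elim: gs => [|g gs [H hH]].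
  exists ([seq delta_mx i ord0 | i <- enum 'I_n] ++ [seq - delta_mx i ord0 | i <- enum 'I_n]).
  have vd (w : V) i : lval w (delta_mx i ord0) = w ord0 i by rewrite /lval -colE mxE.
  move=> w; split=> [[c [_ ->]] h _|h]; first by rewrite big_ord0 /lval mul0mx mxE.
  exists (fun=> 0); split=> //; rewrite big_ord0; apply/rv_eq => i.
  have h1 : 0 <= w ord0 i by rewrite -vd; apply: h; rewrite mem_cat; apply/orP; left; apply/mapP; exists i; rewrite ?mem_enum.
  have : 0 <= lval w (- delta_mx i ord0).
    apply: h; rewrite mem_cat; apply/orP; right; apply/mapP.
    by exists i; rewrite ?mem_enum.
  rewrite /lval mulmxN mxE -/(lval _ _) vd oppr_ge0 => h2.
  by apply: le_anti; rewrite row0E h1 h2.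
pose gen p := lval g p.1 *: p.2 - lval g p.2 *: p.1 : 'cV[rat]_n.
pose H1 := [seq h <- H | 0 <= lval g h].
pose H2 := [seq gen p | p <- [seq (h, k) | h <- H, k <- H] & (0 < lval g p.1) && (lval g p.2 < 0)].
have vgen w p : lval w (gen p) = lval g p.1 * lval w p.2 - lval g p.2 * lval w p.1.
  by rewrite /gen /lval mulmxBr -!scalemxAr !mxE.
have vsub w a h : lval (w - a *: g) h = lval w h - a * lval g h.
  by rewrite /lval mulmxBl -scalemxAl !mxE.
exists (H1 ++ H2) => w.
have -> : (exists c : nat -> rat, (forall i, 0 <= c i) /\ w = \sum_(i < size (g :: gs)) c i *: (g :: gs)`_i) <->
    exists2 a, 0 <= a & forall h, h \in H -> 0 <= lval (w - a *: g) h.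
  split=> [[c [c0 ->]]|[a a0 /hH [c [c0 e]]]].
    exists (c 0%N) => //; apply/hH; exists (fun i => c i.+1); split; first by move=> i; apply: c0.
    by rewrite big_ord_recl /= addrC addKr.
  exists (fun i => if i is j.+1 then c j else a); split; first by case.
  by rewrite big_ord_recl /= -e addrC subrK.
split=> [[a a0 ha] h|h].
  rewrite mem_cat => /orP [].
    rewrite mem_filter => /andP [gh /ha]; rewrite vsub subr_ge0; apply: le_trans.
    exact: mulr_ge0.
  case/mapP => -[h1 h2]; rewrite mem_filter => /andP [/= /andP [g1 g2]].
  case/allpairsP => -[x y] [/= /ha hx /ha hy [e1 e2]] -> {h}; rewrite vgen /=.
  move: g1 g2; rewrite e1 e2 => g1 g2.
  move: hx hy; rewrite !vsub !subr_ge0 => hx hy.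
  apply: (@le_trans _ _ (lval g y * (a * lval g x))); first exact: ler_wnM2l (ltW g2) _ _ hx.
  apply: (@le_trans _ _ (lval g x * (a * lval g y))); last exact: ler_wpM2l (ltW g1) _ _ hy.
  by rewrite [leLHS](_ : _ = lval g x * (a * lval g y)) //; ring.
have [a [a0 al ae]] := max_or_zero [seq lval w k / lval g k | k <- H & lval g k < 0].
exists a => // k kH; rewrite vsub subr_ge0.
have [gk|gk|gk] := ltgtP (lval g k) 0.
- have : lval w k / lval g k <= a.
    by apply: al; apply/mapP; exists k; rewrite // mem_filter gk.
  by rewrite ler_ndivrMr // mulrC.
- have [->|/mapP [j]] := ae.
    rewrite mul0r; apply: h; rewrite mem_cat; apply/orP; left.
    by rewrite mem_filter kH ltW.
  rewrite mem_filter => /andP [gj jH] ->.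
  rewrite mulrAC ler_ndivrMr //.
  have : 0 <= lval w (gen (k, j)).
    apply: h; rewrite mem_cat; apply/orP; right; apply/mapP; exists (k, j) => //.
    rewrite mem_filter /= gk gj /=; apply/allpairsP; exists (k, j); by split.
  by rewrite vgen /= subr_ge0 [lval g j * _]mulrC [lval g k * _]mulrC.
- rewrite gk mulr0; apply: h; rewrite mem_cat; apply/orP; left.
  by rewrite mem_filter kH gk lexx.
Qed.

End FourierMotzkin.

Lemma toQ_mul n m (u : 'rV[int]_n) (P : 'M[int]_(n, m)) : toQ u *m mxQ P = toQ (u *m P).
Proof. by rewrite /toQ map_mxM. Qed.

Lemma toQ_nonneg m (x : 'rV[int]_m) : (forall i, 0 <= toQ x ord0 i) <-> nonneg x.
Proof. by split=> h i; have := h i; rewrite mxE ler0z. Qed.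

Lemma toQ_inj n : injective (@toQ n).
Proof.
move=> u w /rowP e; apply/rowP => i; have := e i; rewrite !mxE => /eqP.
by rewrite eqr_int => /eqP.
Qed.

Lemma primitive_multiple n (q : 'rV[rat]_n) : q != 0 ->
  exists (c : rat) (p : 'rV[int]_n), [/\ 0 < c, q = c *: toQ p
    & exists u : 'rV[int]_n, (u *m p^T) ord0 ord0 = 1].
Proof.
move=> q0; have [N [w [N0 Nw]]] := clear_denominators q.
have w0 : w != 0.
  apply: contra_neq q0 => w0; apply: (scalerI (a := N%:~R)).
    by rewrite intr_eq0 gt_eqF.
  by rewrite Nw w0 scaler0; apply/rowP => i; rewrite !mxE.
case: n q q0 w Nw w0 => [|n] q q0 w Nw w0; first by case/eqP: w0; apply/rowP => -[].
have [L uL [R uR [d _ wE]]] := int_Smith_normal_form w.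
pose z := L ord0 ord0 * d`_0.
have wz : w = z *: row ord0 R.
  rewrite {1}wE; apply/rowP => j; rewrite mxE (bigD1 ord0) //= big1 ?addr0.
    by rewrite !mxE big_ord1 mxE mulr1n.
  move=> i i0; rewrite mxE big_ord1 mxE.
  have -> : (nat_of_ord (ord0 : 'I_1) == nat_of_ord i) = false.
    by apply/negbTE; move: i0; rewrite -val_eqE /= eq_sym.
  by rewrite mulr0n mulr0 mul0r.
have Rinv : (row ord0 R *m col ord0 (invmx R)) ord0 ord0 = 1.
  have := congr1 (fun A : 'M_n.+1 => A ord0 ord0) (mulmxV uR).
  rewrite /= [RHS]mxE eqxx => e; rewrite -[RHS]e !mxE.
  by apply: eq_bigr => j _; rewrite !mxE.
have pair (p x : 'rV[int]_n.+1) : (p *m x^T) ord0 ord0 = (x *m p^T) ord0 ord0.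
  by rewrite !mxE; apply: eq_bigr => j _; rewrite !mxE mulrC.
have z0 : z != 0 by apply: contra_neq w0 => z0; rewrite wz z0 scale0r.
have Nq : N%:~R != 0 :> rat by rewrite intr_eq0 gt_eqF.
have qE c p : w = c *: p -> q = (c%:~R / N%:~R) *: toQ p.
  move=> wc; apply: (scalerI Nq); rewrite Nw scalerA mulrCA mulfV // mulr1 wc.
  by apply/rowP => j; rewrite !mxE rmorphM.
have [zp|zn] := ltP 0 z.
  exists (z%:~R / N%:~R), (row ord0 R); split.
  - by rewrite divr_gt0 ?ltr0z.
  - exact: qE wz.
  - by exists (col ord0 (invmx R))^T; rewrite pair trmxK.
exists ((- z)%:~R / N%:~R), (- row ord0 R); split.
- by rewrite divr_gt0 ?ltr0z // oppr_gt0 lt_neqAle z0.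
- by apply: qE; rewrite scaleNr scalerN opprK.
- exists (- (col ord0 (invmx R))^T); rewrite pair linearN /= trmxK mulmxN mulNmx opprK.
  exact: Rinv.
Qed.

(** A cone spanned by lattice vectors that generate the lattice is cut out by
    the primitive normals of its facets: in a shortest list of inequalities
    each one is violated by a vector that satisfies the others, and the segment
    from there to an interior point crosses the corresponding facet. *)
Lemma cone_facets n k (A : 'M[int]_(k, n)) (C : 'M[int]_(n, k)) : C *m A = 1%:M ->
  exists m (P : 'M[int]_(n, m)),
  [/\ forall w : 'rV[rat]_n,
         (exists c : 'rV[rat]_k, (forall i, 0 <= c ord0 i) /\ w = c *m mxQ A) <->
         forall i, 0 <= (w *m mxQ P) ord0 i,
      forall i, exists w : 'rV[int]_n, (w *m P) ord0 i = 0 /\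
        forall j, j != i -> 0 < (w *m P) ord0 j
    & forall i, exists u : 'rV[int]_n, (u *m P) ord0 i = 1].
Proof.
move=> CA; pose omega (w : 'rV[rat]_n) :=
  exists c : 'rV[rat]_k, (forall i, 0 <= c ord0 i) /\ w = c *m mxQ A.
pose good m := `[< exists Q : 'M[rat]_(n, m), forall w,
   omega w <-> forall i, 0 <= (w *m Q) ord0 i >].
have ex_good : exists m, good m.
  have [H hH] := fourier_motzkin [seq row i (mxQ A) | i <- enum 'I_k].
  exists (size H); apply/asboolP; exists (\matrix_(i, j) H`_j i ord0) => w.
  have <- : (exists c : nat -> rat, (forall i, 0 <= c i) /\
      w = \sum_(i < size [seq row i (mxQ A) | i <- enum 'I_k])
          c i *: [seq row i (mxQ A) | i <- enum 'I_k]`_i) <-> omega w.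
    rewrite size_map size_enum_ord; split=> [[c [c0 ->]]|[c [c0 ->]]].
      exists (\row_i c i); split=> [i|]; first by rewrite mxE.
      rewrite mulmx_sum_row; apply: eq_bigr => i _; rewrite mxE.
      by rewrite (nth_map i) ?size_enum_ord // nth_ord_enum.
    exists (fun i => if insub i is Some j then c ord0 j else 0); split.
      by move=> i; case: insubP.
    rewrite mulmx_sum_row; apply: eq_bigr => i _.
    by rewrite valK (nth_map i) ?size_enum_ord // nth_ord_enum.
  rewrite hH; have E (j : 'I_(size H)) :
      (w *m \matrix_(i, j) H`_j i ord0) ord0 j = lval w H`_j.
    by rewrite /lval !mxE; apply: eq_bigr => i _; rewrite !mxE.
  split=> [h j|h x /(nthP 0) [j jH <-]]; first by rewrite E; apply: h; apply: mem_nth.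
  by have := h (Ordinal jH); rewrite E.
case: (ex_minnP ex_good) => m /asboolP [Q hQ] mmin {ex_good}.
(* Minimality yields a point violating the inequality [i] only. *)
have viol i : exists u : 'rV[rat]_n, (u *m Q) ord0 i < 0 /\ forall j, j != i -> 0 <= (u *m Q) ord0 j.
  apply: contrapT => none; case: m Q hQ mmin i none => [|m] Q hQ mmin i none; first by case: i {none}.
  have : good m.
    apply/asboolP; exists (col' i Q) => w; rewrite hQ.
    have E j : (w *m col' i Q) ord0 j = (w *m Q) ord0 (lift i j).
      by rewrite !mxE; apply: eq_bigr => l _; rewrite !mxE.
    split=> [h j|h j]; first by rewrite E.
    have lft j' : j' != i -> 0 <= (w *m Q) ord0 j'.
      by case: (unliftP i j') => [x ->|->]; rewrite ?eqxx // -E.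
    have [->|/lft //] := eqVneq j i; rewrite leNgt; apply/negP => wi.
    by apply: none; exists w.
  by move/mmin; rewrite ltnn.
have gQ (i : 'I_k) j : 0 <= (mxQ A *m Q) i j.
  have : omega (row i (mxQ A)).
    exists (delta_mx ord0 i); rewrite -rowE; split=> // l; rewrite mxE; by case: (_ && _).
  by move/hQ => /(_ j); rewrite -row_mul mxE.
pose w0 : 'rV[rat]_n := const_mx 1 *m mxQ A.
have w0pos j : 0 < (w0 *m Q) ord0 j.
  have [u [uj _]] := viol j.
  have E : (w0 *m Q) ord0 j = \sum_i (mxQ A *m Q) i j.
    by rewrite /w0 -mulmxA mxE; apply: eq_bigr => i _; rewrite mxE mul1r.
  rewrite lt_neqAle eq_sym E sumr_ge0 // andbT; apply/negP => /eqP s0.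
  have z i : (mxQ A *m Q) i j = 0.
    apply: (psumr_eq0P _ s0) => // l _; exact: gQ.
  have uE : u *m Q = u *m mxQ C *m (mxQ A *m Q).
    by rewrite mulmxA -(mulmxA u) -map_mxM CA map_mx1 mulmx1.
  move: uj; rewrite uE mxE big1 ?ltxx // => l _; by rewrite z mulr0.
have /choice [p /choice [c hp]] : forall j, exists p : 'rV[int]_n, exists c : rat,
    [/\ 0 < c, (col j Q)^T = c *: toQ p & exists u : 'rV[int]_n, (u *m p^T) ord0 ord0 = 1].
  move=> j; have q0 : (col j Q)^T != 0.
    apply/eqP => q0; have [u [+ _]] := viol j.
    have -> : (u *m Q) ord0 j = (u *m (col j Q)) ord0 ord0.
      by rewrite !mxE; apply: eq_bigr => l _; rewrite !mxE.
    by rewrite -[col j Q]trmxK q0 trmx0 mulmx0 mxE ltxx.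
  by have [c [p h]] := primitive_multiple q0; exists p, c.
pose P := \matrix_(i < n, j < m) p j ord0 i.
have PQ (w : 'rV[rat]_n) j : (w *m Q) ord0 j = c j * (w *m mxQ P) ord0 j.
  have [_ e _] := hp j; rewrite !mxE mulr_sumr; apply: eq_bigr => i _.
  have /rowP /(_ i) := e; rewrite !mxE => ->; ring.
have cj j : 0 < c j by have [] := hp j.
exists m, P; split.
- move=> w; rewrite -/(omega w) hQ; split=> h i.
    by have := h i; rewrite PQ pmulr_rge0.
  by rewrite PQ pmulr_rge0.
- move=> i; have [u [ui uj]] := viol i.
  pose v := (w0 *m Q) ord0 i *: u - (u *m Q) ord0 i *: w0.
  have vE j : (v *m Q) ord0 j = (w0 *m Q) ord0 i * (u *m Q) ord0 j -
      (u *m Q) ord0 i * (w0 *m Q) ord0 j.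
    by rewrite /v mulmxBl -!scalemxAl rowDE rowNE; congr (_ - _); rewrite mxE.
  have [N [w [N0 Nw]]] := clear_denominators v.
  have wE j : ((w *m P) ord0 j)%:~R * c j = N%:~R * (v *m Q) ord0 j :> rat.
    have -> : ((w *m P) ord0 j)%:~R = (toQ w *m mxQ P) ord0 j :> rat by rewrite toQ_mul [RHS]mxE.
    by rewrite -Nw -scalemxAl mxE PQ; ring.
  exists w; split=> [|j ji].
    have /eqP := wE i; rewrite vE [X in _ * (_ - X)]mulrC subrr mulr0 mulf_eq0 intr_eq0.
    by rewrite (gt_eqF (cj i)) orbF => /eqP.
  have : 0 < ((w *m P) ord0 j)%:~R * c j.
    rewrite wE mulr_gt0 ?ltr0z // vE subr_gt0.
    apply: lt_le_trans (_ : 0 <= _); first by rewrite nmulr_rlt0.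
    by rewrite mulr_ge0 ?uj // ltW.
  by rewrite pmulr_lgt0 // ltr0z.
- move=> i; have [_ _ [u hu]] := hp i; exists u; rewrite -hu !mxE.
  by apply: eq_bigr => j _; rewrite !mxE.
Qed.

(** * Toric structures *)

Section Slices.
Variable K : closedFieldType.
Variables (N M : nat) (Y : 'rV[K]_N -> Prop) (Z : 'rV[K]_M -> Prop).
Variable f : 'rV[K]_(N + M) -> K.

Lemma reg_slice_l z : regular (prodv Y Z) f -> Z z -> regular Y (fun y => f (row_mx y z)).
Proof.
move=> rf Zz; pose q (j : 'I_(N + M)) : {mpoly K[N]} :=
  match split j with inl i => 'X_i | inr i => (z ord0 i)%:MP end.
apply: (@reg_comp _ _ Y _ (prodv Y Z) (fun y => row_mx y z) f q) rf.
- by move=> y Yy; rewrite /prodv row_mxKl row_mxKr.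
- move=> y _ j; rewrite mxE /q; case: (split j) => i; first by rewrite pevalX.
  by rewrite /peval mevalC.
Qed.

Lemma reg_slice_r y : regular (prodv Y Z) f -> Y y -> regular Z (fun z => f (row_mx y z)).
Proof.
move=> rf Yy; pose q (j : 'I_(N + M)) : {mpoly K[M]} :=
  match split j with inr i => 'X_i | inl i => (y ord0 i)%:MP end.
apply: (@reg_comp _ _ Z _ (prodv Y Z) (fun z => row_mx y z) f q) rf.
- by move=> z Zz; rewrite /prodv row_mxKl row_mxKr.
- move=> z _ j; rewrite mxE /q; case: (split j) => i; last by rewrite pevalX.
  by rewrite /peval mevalC.
Qed.
End Slices.

Section Substitution.
Variables (K F : fieldType) (cst : {rmorphism K -> F}) (n V : nat).
Notation M := 'rV[int]_n.
Notation terms := (seq (K * M)).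
Variable L : 'I_V -> terms.

(** Substituting formal Laurent polynomials for the variables of a polynomial:
    the result does not depend on the field in which characters are evaluated. *)
Definition lone : terms := [:: (1, 0)].
Definition lmono (m : 'X_{1..V}) : terms :=
  foldr (fun i l => lmul (iter (m i) (lmul (L i)) lone) l) lone (index_enum 'I_V).
Definition lcomp (p : {mpoly K[V]}) : terms :=
  flatten [seq lscale p@_m (lmono m) | m <- msupp p].

Lemma supp_lcomp (P : M -> Prop) p : P 0 -> (forall u w, P u -> P w -> P (u + w)) ->
  (forall j, supp P (L j)) -> supp P (lcomp p).
Proof.
move=> P0 PA PL.
have P1 : supp P lone by move=> q; rewrite mem_seq1 => /eqP ->.
have Pm m : supp P (lmono m).
  rewrite /lmono; elim: (index_enum _) => //= i r IH; apply: (supp_mul PA _ IH).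
  elim: (m i) => //= k; exact: (supp_mul PA (PL i)).
move=> q /flattenP [l /mapP [m _ ->]]; exact: supp_scale.
Qed.

Variable chi : M -> F.
Hypotheses (chiD : forall u v, chi (u + v) = chi u * chi v) (chi0 : chi 0 = 1).

Lemma ev_lcomp p : ev cst chi (lcomp p) = mmap cst (fun j => ev cst chi (L j)) p.
Proof.
have ev1 : ev cst chi lone = 1 by rewrite /ev big_seq1 /= chi0 mulr1 rmorph1.
have evm m : ev cst chi (lmono m) = mmap1 (fun j => ev cst chi (L j)) m.
  rewrite /lmono /mmap1; elim: (index_enum _) => [|i r IH] /=; first by rewrite big_nil.
  rewrite big_cons ev_mul // IH; congr (_ * _).
  by elim: (m i) => [|k IHk] //=; rewrite ev_mul // IHk exprS.
rewrite /lcomp /mmap; elim: (msupp p : seq _) => [|m r IH] /=.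
  by rewrite big_nil /ev big_nil.
by rewrite big_cons ev_cat ev_scale IH evm.
Qed.
End Substitution.

Section TermValues.
Variables (K : closedFieldType) (n : nat).
Notation M := 'rV[int]_n.
Implicit Types (l : seq (K * M)) (t : 'rV[K]_n).

Definition tev l t : K := ev idfun (fun u => character u t) l.

Lemma tevE l t : tev l t = \sum_(p <- l) p.1 * character p.2 t.
Proof. by []. Qed.

Lemma tev_coef l t :
  tev l t = \sum_(u <- undup [seq p.2 | p <- l]) coef l u * character u t.
Proof. exact: ev_coef. Qed.

Lemma tev_character (P : M -> Prop) l u : supp P l ->
  (forall t, torus t -> tev l t = character u t) -> P u.
Proof.
move=> hl h; have [ul|nul] := boolP (u \in [seq p.2 | p <- l]).
  by case/mapP: ul => p /hl pP ->.
pose s := u :: undup [seq p.2 | p <- l].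
have us : uniq s by rewrite /= mem_undup nul undup_uniq.
pose c w := if w == u then - 1 else coef l w.
suff : c u = 0 by rewrite /c eqxx => /eqP; rewrite oppr_eq0 oner_eq0.
apply: (character_free us) (mem_head _ _) => t tt.
rewrite big_cons {1}/c eqxx mulN1r -(h t tt) tev_coef.
suff -> : \sum_(w <- undup [seq p.2 | p <- l]) c w * character w t =
    \sum_(w <- undup [seq p.2 | p <- l]) coef l w * character w t by rewrite addNr.
rewrite big_seq [RHS]big_seq; apply: eq_bigr => w; rewrite mem_undup => ws.
by rewrite /c; case: eqP => // e; rewrite -e ws in nul.
Qed.

Lemma tev_lcomp V (L : 'I_V -> seq (K * M)) (p : {mpoly K[V]}) t : torus t ->
  tev (lcomp L p) t = p.@[fun j => tev (L j) t].
Proof.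
move=> tt; rewrite /tev ev_lcomp ?character0 // => u v; exact: characterDt.
Qed.
End TermValues.

Section ToricStructure.
Variables (K : closedFieldType) (N : nat) (X : 'rV[K]_N -> Prop) (n : nat).
Variables (act : 'rV[K]_n -> 'rV[K]_N -> 'rV[K]_N) (x0 : 'rV[K]_N).
Hypotheses (affX : affine_variety X) (tor : toric_structure X act x0).
Notation M := 'rV[int]_n.

Let cX : zclosed X. Proof. by case: affX. Qed.
Let iX : irreducible X. Proof. by case: affX. Qed.
Let tact : torus_action X act. Proof. by case: tor. Qed.
Let Xx0 : X x0. Proof. by case: tor. Qed.

Lemma act_in t x : torus t -> X x -> X (act t x).
Proof.
move=> tt Xx; have [h _] := ta_regular tact.
by have := h (row_mx t x); rewrite /prodv row_mxKl row_mxKr; apply.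
Qed.

Lemma orbit_in t : torus t -> X (act t x0). Proof. by move=> tt; apply: act_in. Qed.

Lemma act_orbit s t : torus s -> torus t -> act s (act t x0) = act (tmul s t) x0.
Proof. by move=> ts tt; rewrite (ta_mul tact). Qed.

Lemma reg_act_l x j : X x -> regular (@torus K n) (fun t => act t x ord0 j).
Proof.
move=> Xx; have [_ /(_ j) rj] := ta_regular tact.
apply: reg_ext (reg_slice_l rj Xx) => t _; by rewrite row_mxKl row_mxKr.
Qed.

Lemma reg_act_r t j : torus t -> regular X (fun x => act t x ord0 j).
Proof.
move=> tt; have [_ /(_ j) rj] := ta_regular tact.
apply: reg_ext (reg_slice_r rj tt) => x _; by rewrite row_mxKl row_mxKr.
Qed.

Lemma reg_orbit f : regular X f -> regular (@torus K n) (fun t => f (act t x0)).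
Proof.
move=> /(regular_closed cX) [p fp].
apply: (@reg_ext _ _ _ (fun t => p.@[fun j => act t x0 ord0 j])).
  by move=> t tt; rewrite fp //; apply: orbit_in.
by apply: reg_meval => j; apply: reg_act_l.
Qed.

Lemma reg_translate f t : regular X f -> torus t -> regular X (fun x => f (act t x)).
Proof.
move=> /(regular_closed cX) [p fp] tt.
apply: (@reg_ext _ _ _ (fun x => p.@[fun j => act t x ord0 j])).
  by move=> x Xx; rewrite fp //; apply: act_in.
by apply: reg_meval => j; apply: reg_act_r.
Qed.

Lemma orbit_open : exists2 h, peval h x0 <> 0 &
  forall x, X x -> peval h x <> 0 -> exists2 t, torus t & x = act t x0.
Proof.
have [_ _ _ [I hI]] := tor.
have /hI [_ /existsNP [h /not_implyP [Ih hx]]] : Defs.orbit act x0 x0.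
  by exists (const_mx 1); split; [apply: torus1|rewrite (ta_one tact)].
exists h => // x Xx hx'; have /hI [t [tt e]] : X x /\ ~ zeros I x.
  by split=> // /(_ h Ih).
by exists t.
Qed.

Lemma orbit_dense p : (forall t, torus t -> peval p (act t x0) = 0) ->
  forall x, X x -> peval p x = 0.
Proof.
move=> hp; have [h h0 hO] := orbit_open.
apply: (dense_zero iX (h := h)); first by exists x0.
by move=> x Xx /(hO x Xx) [t tt ->]; apply: hp.
Qed.

Lemma orbit_eq f g : regular X f -> regular X g ->
  (forall t, torus t -> f (act t x0) = g (act t x0)) -> forall x, X x -> f x = g x.
Proof.
move=> /(regular_closed cX) [p fp] /(regular_closed cX) [q gq] e x Xx.
apply/eqP; rewrite -subr_eq0 fp // gq // /peval -mevalB; apply/eqP.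
apply: (orbit_dense (p := p - q)) => // t tt.
by rewrite /peval mevalB -!/(peval _ _) -fp -?gq ?e ?subrr //; apply: orbit_in.
Qed.

Definition wt (u : M) := exists f, is_chi X act x0 u f.

Lemma is_chiM u w f g : is_chi X act x0 u f -> is_chi X act x0 w g ->
  is_chi X act x0 (u + w) (fun x => f x * g x).
Proof.
move=> [rf hf] [rg hg]; split=> [|t tt]; first exact: regM.
by rewrite hf // hg // characterDt.
Qed.

Lemma is_chi0 : is_chi X act x0 0 (fun=> 1).
Proof. by split=> [|t _]; [apply: reg_cst|rewrite character0]. Qed.

Lemma is_chiX u f k : is_chi X act x0 u f -> is_chi X act x0 (u *+ k) (fun x => f x ^+ k).
Proof.
move=> hf; elim: k => [|k IH]; first exact: is_chi0.
rewrite mulrS; have [r h] := is_chiM hf IH; split.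
  by apply: reg_ext r => x _; rewrite exprS.
by move=> t tt; rewrite exprS h.
Qed.

Lemma wt0 : wt 0. Proof. by exists (fun=> 1); apply: is_chi0. Qed.

Lemma wtD u w : wt u -> wt w -> wt (u + w).
Proof. by move=> [f hf] [g hg]; eexists; apply: is_chiM hf hg. Qed.

Lemma wtMn u k : wt u -> wt (u *+ k).
Proof. by move=> [f hf]; eexists; apply: is_chiX hf. Qed.

(** A regular function is a combination of characters on the orbit, and each
    of these characters extends to [X], being a combination of translates. *)
Lemma reg_weights f : regular X f -> exists (s : seq M) (c : M -> K),
  [/\ uniq s, forall u, u \in s -> wt u
    & forall t, torus t -> f (act t x0) = \sum_(u <- s) c u * character u t].
Proof.
move=> rf.
have [s [c [us _ c0 fE]]] : exists (s : seq M) (c : M -> K),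
    [/\ uniq s, forall u, u \in s -> bnonneg xpredT u, forall u, u \in s -> c u != 0
    & forall t, bset xpredT t -> f (act t x0) = \sum_(u <- s) c u * character u t].
  apply: reg_bset; apply: reg_sub (reg_orbit rf) => t bt i; exact: bt.
exists s, c; split=> // [u su|t tt]; last by apply: fE; apply: torus_bset.
have ix : (index u s < size s)%N by rewrite index_mem.
pose T := in_tuple s.
have [||t [d [Qt ht]]] := @isolate K _ 'rV[K]_n (@torus K n) (@torus K n) (size s)
   (fun i t => character (tnth T i) t)
   (fun i t => c (tnth T i) * character (tnth T i) t)
   (fun s t => f (act s (act t x0))) _ _ (Ordinal ix).
- move=> a ha i.
  pose b (w : M) := \sum_(j | tnth T j == w) a j.
  have bE j : b (tnth T j) = a j.
    rewrite /b (big_pred1 j) // => k /=; apply/eqP/eqP => [|->//].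
    exact: (elimT (tuple_uniqP T) us).
  rewrite -bE; apply: (character_free us) => [t tt|]; last exact: mem_tnth.
  rewrite -[RHS](ha t tt) (big_tnth _ _ s) /=; apply: eq_bigr => j _.
  by rewrite bE.
- move=> t t' tt tt'; rewrite act_orbit // fE; last exact/torus_bset/torus_tmul.
  rewrite (big_tnth _ _ s) /=; apply: eq_bigr => j _.
  by rewrite character_tmul; ring.
set i := Ordinal _ in ht.
have ti : tnth T i = u by rewrite (tnth_nth u) /= nth_index.
exists (fun x => (c u)^-1 * \sum_j d j * f (act (t j) x)); split.
  apply: regM; first exact: reg_cst.
  by apply: reg_sum => j _; apply: regM; [apply: reg_cst|apply: reg_translate].
move=> t' tt'; rewrite -ht // ti mulrA mulVf ?mul1r //; exact: c0.
Qed.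

End ToricStructure.

Lemma reg_coord (K : closedFieldType) N (Y : 'rV[K]_N -> Prop) j :
  regular Y (fun x => x ord0 j).
Proof. by have r := @reg_poly K N Y 'X_j; apply: (reg_ext _ r) => x _; rewrite pevalX. Qed.

Section ToricCone.
Variables (K : closedFieldType) (charK : [pchar K] =i pred0).
Variables (N : nat) (X : 'rV[K]_N -> Prop) (n : nat).
Variables (act : 'rV[K]_n -> 'rV[K]_N -> 'rV[K]_N) (x0 : 'rV[K]_N).
Hypotheses (affX : affine_variety X) (tor : toric_structure X act x0).
Notation M := 'rV[int]_n.
Notation wt := (wt X act x0).

Let cX : zclosed X. Proof. by case: affX. Qed.
Let tact : torus_action X act. Proof. by case: tor. Qed.
Let Xx0 : X x0. Proof. by case: tor. Qed.

Lemma coordinate_terms : exists L : 'I_N -> seq (K * M),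
  (forall j, supp wt (L j)) /\
  forall t, torus t -> forall j, act t x0 ord0 j = tev (L j) t.
Proof.
have h j : exists l, supp wt l /\
    forall t, torus t -> act t x0 ord0 j = tev l t.
  have rj : regular X (fun x => x ord0 j) by exact: reg_coord.
  have [s [c [us sw fE]]] := reg_weights affX tor rj.
  exists [seq (c u, u) | u <- s]; split=> [p /mapP [u su ->]|t tt]; first exact: sw.
  by rewrite fE // tevE big_map.
by have [L hL] := choice h; exists L; split=> [j|t tt j]; have [h1 h2] := hL j; auto.
Qed.

Lemma weight_generators : exists k (A : 'M[int]_(k, n)),
  forall u, wt u <-> exists2 c : 'rV[int]_k, nonneg c & u = c *m A.
Proof.
have [L [Lw LE]] := coordinate_terms.
pose G := flatten [seq [seq p.2 | p <- L j] | j <- enum 'I_N].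
pose A : 'M[int]_(size G, n) := \matrix_(i, j) (nth 0 G i) ord0 j.
have rowA i : row i A = nth 0 G i by apply/rv_eq => j; rewrite !mxE.
have GP u : u \in G -> wt u.
  by move=> /flattenP [l /mapP [j _ ->]] /mapP [p pl ->]; apply: (Lw j).
exists (size G), A => u; split=> [[f [rf fu]]|[c c0 ->]].
  have [q fq] := regular_closed cX rf.
  apply: (@tev_character _ _ (fun u => exists2 c : 'rV[int]_(size G), nonneg c & u = c *m A) (lcomp L q)).
    apply: supp_lcomp => [|v w [c c0 ->] [d d0 ->]|j p pl].
    - by exists 0; rewrite ?mul0mx // => i; rewrite mxE.
    - by exists (c + d); rewrite ?mulmxDl // => i; rewrite mxE addr_ge0.
    have pG : p.2 \in G.
      apply/flattenP; exists [seq p.2 | p <- L j]; last exact: map_f.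
      by apply: (map_f (fun j => [seq p.2 | p <- L j])); rewrite mem_enum.
    have ip : (index p.2 G < size G)%N by rewrite index_mem.
    exists (delta_mx 0 (Ordinal ip)); first by move=> i; rewrite mxE; case: andb.
    by rewrite -rowE rowA nth_index.
  move=> t tt; rewrite -fu // fq; last exact: (orbit_in tor).
  rewrite tev_lcomp // /peval; apply: meval_eq => j; by rewrite LE.
rewrite mulmx_sum_row; apply: (big_ind wt); [exact: wt0|exact: wtD|].
move=> i _; rewrite rowA.
have -> : c ord0 i *: nth 0 G i = nth 0 G i *+ absz (c ord0 i).
  by rewrite -{1}(gez0_abs (c0 i)) -scaler_nat natz.
by apply: wtMn; apply/GP/mem_nth.
Qed.

Lemma character_exp (z : K) (w u : M) : z != 0 ->
  character u (\row_j z ^ w ord0 j) = z ^ (pairing u w).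
Proof.
move=> z0; rewrite /character /pairing.
elim: (index_enum _) => [|i r IH]; first by rewrite !big_nil expr0z.
rewrite !big_cons IH mxE expfzDr //; congr (_ * _).
by rewrite exprz_exp mulrC.
Qed.

(** As the torus acts effectively, the weights of [K[X]] generate the character
    lattice: an elementary divisor [d <> 1] of the lattice of weights would give
    a [d]-th root of unity acting trivially. *)
Lemma effective_generators k (A : 'M[int]_(k, n)) :
  (forall u, wt u <-> exists2 c : 'rV[int]_k, nonneg c & u = c *m A) ->
  exists C : 'M[int]_(n, k), C *m A = 1%:M.
Proof.
move=> hA; have [L uL [R uR [d _ AE]]] := int_Smith_normal_form A.
set D := \matrix_(i, j) _ in AE.
have [D1|] := pselect (forall j : 'I_n, (j < k)%N /\ absz d`_j = 1%N); last first.
  move=> /existsNP [j0 hj0]; exfalso.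
  pose e := if (j0 < k)%N then d`_j0 else 0.
  have e1 : absz e != 1%N.
    by apply/eqP => e1; apply: hj0; move: e1; rewrite /e; case: ltnP.
  have [z z0 [z1 ze]] := nontrivial_root charK e1.
  have colD i : (D i j0) = e *+ (i == j0 :> nat).
    rewrite mxE /e; have [ij|_] := eqVneq (i : nat) j0; last by rewrite !mulr0n.
    by rewrite -ij ltn_ord.
  have ze' i : z ^ (i * e) = 1.
    rewrite mulrC -exprz_exp; suff -> : z ^ e = 1 by rewrite exp1rz.
    by move: ze; case: (e) => a /= ha; rewrite /exprz ha ?invr1.
  pose w : M := \row_j (invmx R) j j0.
  pose t : 'rV[K]_n := \row_j z ^ w ord0 j.
  have tt : torus t by move=> i; rewrite mxE; apply/eqP; rewrite expfz_neq0.
  have t1 u : wt u -> character u t = 1.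
    move=> /hA [c _ ->]; rewrite character_exp //.
    have -> : pairing (c *m A) w = (c *m A *m invmx R) ord0 j0.
      by rewrite [RHS]mxE; apply: eq_bigr => j _; rewrite !mxE.
    rewrite AE !mulmxA mulmxK // mxE.
    elim: (index_enum _) => [|i r IH]; first by rewrite big_nil expr0z.
    by rewrite big_cons expfzDr // IH mulr1 colD; case: eqP => _ /=; rewrite ?mulr1n ?mulr0n ?mulr0 ?expr0z // ze'.
  have [_ eff _ _] := tor.
  have : t = const_mx 1.
    apply: eff => // x Xx; apply/rv_eq => j.
    have rj : regular X (fun x => x ord0 j) by exact: reg_coord.
    apply: (@orbit_eq _ _ _ _ _ _ affX tor (fun x => act t x ord0 j) (fun x => x ord0 j) _ rj _ x Xx).
      exact: (reg_translate affX tor rj tt).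
    move=> s ts; rewrite (act_orbit tor) //.
    have [L' [Lw LE]] := coordinate_terms.
    rewrite !LE //; last exact: torus_tmul.
    rewrite !tevE big_seq [RHS]big_seq; apply: eq_bigr => p pl.
    by rewrite character_tmul t1 ?mul1r //; apply: (Lw j).
  move=> t1'; case/eqP: z1.
  have -> : z = character (row j0 R) t.
    rewrite character_exp //.
    have -> : pairing (row j0 R) w = (R *m invmx R) j0 j0.
      by rewrite mxE; apply: eq_bigr => j _; rewrite !mxE.
    by rewrite mulmxV // mxE eqxx expr1z.
  by rewrite t1' character_one.
pose D' : 'M[int]_(n, k) := \matrix_(i, j) (d`_i *+ (i == j :> nat)).
have DD : D' *m D = 1%:M.
  apply/matrixP => i j; rewrite !mxE.
  have [ik di] := D1 i.
  rewrite (bigD1 (Ordinal ik)) //= big1 ?addr0.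
    rewrite !mxE /= eqxx mulr1n -val_eqE /=; case: eqP => _; last by rewrite mulr0n mulr0.
    by have [->|->] : d`_i = 1 \/ d`_i = -1 by move: di; lia.
  move=> l; rewrite -val_eqE /= => li; rewrite mxE.
  by rewrite (eq_sym (i : nat)) (negbTE li) mulr0n mul0r.
exists (invmx R *m D' *m invmx L).
by rewrite AE !mulmxA mulmxKV // -(mulmxA _ D') DD mulmx1 mulVmx.
Qed.
End ToricCone.

(** * Cones and Demazure roots *)

Section Pairing.
Variables (R : comNzRingType) (n : nat).
Implicit Types u v w : 'rV[R]_n.

Lemma pairingC v u : pairing v u = pairing u v.
Proof. by apply: eq_bigr => i _; rewrite mulrC. Qed.

Lemma pairingDr v u w : pairing v (u + w) = pairing v u + pairing v w.
Proof. by rewrite /pairing -big_split; apply: eq_bigr => i _; rewrite mxE mulrDr. Qed.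

Lemma pairingZr v c u : pairing v (c *: u) = c * pairing v u.
Proof. by rewrite /pairing mulr_sumr; apply: eq_bigr => i _; rewrite mxE mulrCA. Qed.

Lemma pairing0r v : pairing v 0 = 0.
Proof. by rewrite /pairing big1 // => i _; rewrite mxE mulr0. Qed.

Lemma pairing_sumr v k (f : 'I_k -> 'rV[R]_n) :
  pairing v (\sum_j f j) = \sum_j pairing v (f j).
Proof.
by apply: (big_morph (pairing v)) => [x y|]; rewrite ?pairingDr ?pairing0r.
Qed.

Lemma pairingZl c v u : pairing (c *: v) u = c * pairing v u.
Proof. by rewrite !(pairingC _ u) pairingZr. Qed.

Lemma pairing_delta v i : pairing v (delta_mx ord0 i) = v ord0 i.
Proof.
rewrite /pairing (bigD1 i) //= mxE !eqxx mulr1 big1 ?addr0 // => j ji.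
by rewrite mxE eqxx (negbTE ji) mulr0.
Qed.
End Pairing.

Lemma pairing_toQ n (p u : 'rV[int]_n) : pairing (toQ p) (toQ u) = (pairing p u)%:~R.
Proof. by rewrite /pairing rmorph_sum; apply: eq_bigr => i _; rewrite !mxE rmorphM. Qed.

Lemma toQD n (u w : 'rV[int]_n) : toQ (u + w) = toQ u + toQ w.
Proof. exact: map_mxD. Qed.

Lemma toQZ n c (u : 'rV[int]_n) : toQ (c *: u) = c%:~R *: toQ u.
Proof. exact: map_mxZ. Qed.

Lemma toQMn n k (u : 'rV[int]_n) : toQ (u *+ k) = k%:R *: toQ u.
Proof. by rewrite -scaler_nat toQZ rmorph_nat. Qed.

Lemma pairingMnr n (v u : 'rV[int]_n) k : pairing v (u *+ k) = k%:Z * pairing v u.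
Proof. by rewrite -scaler_nat pairingZr natz. Qed.

Lemma int_factor_one (k x : int) : `|k * x| = 1 -> `|k| = 1.
Proof.
rewrite -!abszE abszM => -[/eqP]; by rewrite muln_eq1 => /andP [/eqP -> _].
Qed.

Section Rays.
Variables (n m : nat) (P : 'M[int]_(n, m)) (omega : 'rV[rat]_n -> Prop).
Hypothesis omegaP : forall w, omega w <-> forall i, 0 <= (w *m mxQ P) ord0 i.
Hypothesis facet : forall i, exists w : 'rV[int]_n, (w *m P) ord0 i = 0 /\
  forall j, j != i -> 0 < (w *m P) ord0 j.
Hypothesis prim : forall i, exists u : 'rV[int]_n, (u *m P) ord0 i = 1.

Notation sigma := (dual_cone omega).
Definition normal i : 'rV[int]_n := (col i P)^T.

Lemma pairing_normal i u : pairing (normal i) u = (u *m P) ord0 i.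
Proof. by rewrite mxE; apply: eq_bigr => j _; rewrite !mxE mulrC. Qed.

Lemma pairing_normalQ i w : pairing (toQ (normal i)) w = (w *m mxQ P) ord0 i.
Proof. by rewrite mxE; apply: eq_bigr => j _; rewrite !mxE mulrC. Qed.

Lemma omega_int u : omega (toQ u) <-> nonneg (u *m P).
Proof. by rewrite omegaP -toQ_nonneg toQ_mul. Qed.

Lemma omega_scale c w : 0 < c -> omega (c *: w) <-> omega w.
Proof.
move=> c0; rewrite !omegaP; split=> h i; have := h i;
  by rewrite -scalemxAl [((c *: _ : 'rV_m) _ _)]mxE pmulr_rge0.
Qed.

Lemma sigma_normal i : sigma (toQ (normal i)).
Proof. by move=> w /omegaP h; rewrite pairing_normalQ. Qed.

Lemma dual_dual w : dual_cone sigma w -> omega w.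
Proof.
move=> h; apply/omegaP => i; rewrite -pairing_normalQ pairingC; exact/h/sigma_normal.
Qed.

Lemma facet_ray i : ray_vector sigma (normal i).
Proof.
have [u1 u1i] := prim i; have [w [wi wj]] := facet i.
split=> [k q pq|].
  have : k * pairing q u1 = 1 by rewrite -pairingZl -pq pairing_normal.
  by move=> h; apply: (@int_factor_one k (pairing q u1)); rewrite h.
exists (toQ w); split=> [v vs|v].
  rewrite pairingC; apply: vs; apply/omega_int => j.
  by have [->|ji] := eqVneq j i; rewrite ?wi // ltW ?wj.
split=> [[c [c0 ->]]|[vs vw]].
  split=> [z /omegaP hz|]; first by rewrite pairingZl mulr_ge0 // pairing_normalQ.
  by rewrite pairingZl pairing_toQ pairing_normal wi mulr0.
(* Near the relative interior of its facet, the cone is a half-space. *)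
have half z : 0 <= pairing (toQ (normal i)) z -> 0 <= pairing v z.
  move=> hz; pose D : rat := 1 + \sum_j `|(z *m mxQ P) ord0 j|.
  have D0 j : `|(z *m mxQ P) ord0 j| <= D.
    by rewrite /D (bigD1 j) //= addrCA lerDl addr_ge0 // sumr_ge0.
  have : omega (D *: toQ w + z).
    apply/omegaP => j; rewrite mulmxDl -scalemxAl toQ_mul mxE [X in X + _]mxE.
    have [->|ji] := eqVneq j i.
      by rewrite [toQ _ _ _]mxE wi mulr0 add0r -pairing_normalQ.
    have h1 : 1 <= toQ (w *m P) ord0 j by rewrite mxE ler1z -gtz0_ge1 wj.
    have Dp : 0 <= D by rewrite /D addr_ge0 // sumr_ge0.
    have := D0 j; rewrite ler_norml => /andP [h2 _].
    have h3 : D * 1 <= D * toQ (w *m P) ord0 j by rewrite ler_wpM2l.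
    lra.
  by move/vs; rewrite pairingDr pairingZr vw mulr0 add0r.
have halfN z : 0 <= - pairing (toQ (normal i)) z -> 0 <= - pairing v z.
  by move=> h; have := half (- 1 *: z); rewrite !pairingZr !mulN1r; apply.
pose c := pairing v (toQ u1).
have c0 : 0 <= c by apply: half; rewrite pairing_toQ pairing_normal u1i.
exists c; split=> //; apply/rv_eq => j.
rewrite mxE -!pairing_delta; set z := delta_mx _ _.
set a := pairing (toQ _) z.
have a1 : pairing (toQ (normal i)) (z + - a *: toQ u1) = 0.
  rewrite pairingDr pairingZr pairing_toQ pairing_normal u1i. by rewrite mulr1z mulr1 subrr.
have := half _ (eq_ind_r (fun x => 0 <= x) (lexx 0) a1).
have := halfN (z + - a *: toQ u1); rewrite a1 oppr0 => /(_ (lexx 0)).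
by rewrite pairingDr pairingZr -/c => h1 h2; lra.
Qed.

Lemma ray_nonneg p w : ray_vector sigma p -> omega w -> 0 <= pairing (toQ p) w.
Proof.
move=> [_ [u [_ hu]]] ow; have /hu [h _] : exists c : rat, 0 <= c /\ toQ p = c *: toQ p.
  by exists 1; rewrite scale1r.
exact: h.
Qed.

Lemma ray_nonneg_int p u : ray_vector sigma p -> omega (toQ u) -> 0 <= pairing p u.
Proof. by move=> rp ou; have := ray_nonneg rp ou; rewrite pairing_toQ ler0z. Qed.

(** The root pairs nonnegatively with all other rays, so only the inequality
    given by [p] can fail. *)
Lemma demazure_shift p e u j : demazure_root sigma p e ->
  omega (toQ u) -> j%:Z <= pairing p u -> omega (toQ (u + e *+ j)).
Proof.
move=> [pe hq] ou ju; apply/omega_int => i; rewrite -pairing_normal pairingDr pairingMnr.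
have [->|np] := pselect (normal i = p).
  by rewrite pe; move: (pairing p u) ju => x; lia.
have h1 := hq _ (facet_ray i) np.
have := ray_nonneg_int (facet_ray i) ou.
by move: (pairing _ u) (pairing _ e) h1 => x y; nia.
Qed.

Hypothesis gp : forall u : 'rV[int]_n, exists a b,
  [/\ u = a - b, omega (toQ a) & omega (toQ b)].
Hypothesis polyO : polyhedral_cone omega.

(** Conversely a pair shifting every weight onto the hyperplane orthogonal to
    [p] consists of a ray and one of its Demazure roots.  A functional
    exposing the ray is the sum of the shifted generators of the cone. *)
Lemma root_of_shift p e : pairing p e = -1 ->
  (forall u, omega (toQ u) -> 0 <= pairing p u /\
     omega (toQ (u + e *+ absz (pairing p u)))) ->
  ray_vector sigma p /\ demazure_root sigma p e.
Proof.
move=> pe hs.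
have hsQ w : omega w -> 0 <= pairing (toQ p) w /\
    omega (w + pairing (toQ p) w *: toQ e).
  move=> ow; have [D [u [D0 Du]]] := clear_denominators w.
  have Dq : 0 < D%:~R :> rat by rewrite ltr0z.
  have ou : omega (toQ u) by rewrite -Du; apply/omega_scale.
  have [pu ou'] := hs u ou.
  have pQ : D%:~R * pairing (toQ p) w = (pairing p u)%:~R.
    by rewrite -pairingZr Du pairing_toQ.
  split; first by rewrite -(pmulr_rge0 _ Dq) pQ ler0z.
  apply/(omega_scale _ Dq); rewrite scalerDr scalerA pQ Du.
  by move: ou'; rewrite toQD toQMn -{2}(gez0_abs pu).
have sp : sigma (toQ p) by move=> w /hsQ [].
have primp : primitive p.
  move=> k q pq; have : k * pairing q e = - 1 by rewrite -pairingZl -pq.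
  by move=> h; apply: (@int_factor_one k (pairing q e)); rewrite h.
have [k [A hA]] := polyO.
have oA j : omega (row j A).
  apply/hA; exists (delta_mx ord0 j); rewrite -rowE; split=> // i.
  by rewrite mxE; case: andb.
pose g j := row j A + pairing (toQ p) (row j A) *: toQ e.
have og j : omega (g j) by have [] := hsQ _ (oA j).
have peQ : pairing (toQ p) (toQ e) = - 1 by rewrite pairing_toQ pe.
have rayp : ray_vector sigma p.
  split=> //; exists (\sum_j g j); split=> [v vs|v].
    by rewrite pairingC pairing_sumr sumr_ge0 // => j _; apply/vs/og.
  split=> [[c [c0 ->]]|[vs]].
    split=> [w /sp|]; first by rewrite pairingZl; apply: mulr_ge0.
    rewrite pairing_sumr big1 // => j _.
    by rewrite pairingZl pairingDr pairingZr peQ; ring.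
  rewrite pairing_sumr => /psumr_eq0P h.
  pose c := - pairing v (toQ e); exists c.
  have vA j : pairing v (row j A) = c * pairing (toQ p) (row j A).
    have := h (fun j _ => vs _ (og j)) j isT.
    by rewrite pairingDr pairingZr /c => ?; lra.
  have vO w : omega w -> pairing v w = c * pairing (toQ p) w.
    move=> /hA [d [_ ->]]; rewrite mulmx_sum_row !pairing_sumr mulr_sumr.
    by apply: eq_bigr => j _; rewrite !pairingZr vA mulrCA.
  have vM u : pairing v (toQ u) = c * pairing (toQ p) (toQ u).
    have [a [b [-> oa ob]]] := gp u.
    have -> : toQ (a - b) = toQ a + (-1) *: toQ b.
      by rewrite -scaleN1r toQD toQZ.
    by rewrite !pairingDr !pairingZr !vO //; ring.
  split; last first.
    apply/rv_eq => i; rewrite mxE -!pairing_delta.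
    have -> : delta_mx ord0 i = toQ (delta_mx ord0 i) :> 'rV[rat]_n.
      by apply/rv_eq => j; rewrite !mxE; case: andb.
    exact: vM.
  have [a [b [eab oa ob]]] := gp e.
  have pb : pairing (toQ p) (toQ b) = pairing (toQ p) (toQ a) + 1.
    have : pairing p e = pairing p a - pairing p b.
      by rewrite eab pairingDr -scaleN1r pairingZr mulN1r.
    rewrite pe !pairing_toQ; move: (pairing p a) (pairing p b) => y x hyx.
    have -> : x = y + 1 by lia.
    by rewrite rmorphD.
  have pa := sp _ oa; have := vs _ ob; rewrite vO // pmulr_lge0 //; lra.
split=> //; split=> // q rq qp.
have [primq [u [ud hu]]] := rq.
have ou := dual_dual ud.
have [pu opu] := hsQ _ ou.
have qs w : omega w -> 0 <= pairing (toQ q) w by apply: ray_nonneg.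
have qu : pairing (toQ q) u = 0.
  by have [] := (hu (toQ q)).1 (ex_intro _ 1 (conj ler01 (esym (scale1r _)))).
have := qs _ opu; rewrite pairingDr pairingZr qu add0r pairing_toQ.
rewrite pmulr_rge0 ?ler0z // lt_neqAle pu andbT eq_sym; apply/eqP => pu0.
have [c [c0 pq]] : exists c : rat, 0 <= c /\ toQ p = c *: toQ q by apply/hu.
have := peQ; rewrite pq pairingZl pairing_toQ.
(* Proportional primitive vectors of the same ray coincide. *)
set x := pairing q e => cx.
have xp : toQ q = - x%:~R *: toQ p by rewrite pq scalerA mulNr mulrC cx opprK scale1r.
have qx : q = - x *: p by apply: toQ_inj; rewrite toQZ rmorphN.
have x1 := primq _ _ qx.
case: qp; rewrite qx; suff -> : x = -1 by rewrite opprK scale1r.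
move: x1; rewrite normrN => x1; have : ~ 0 < x.
  by move=> x0; have := mulr_ge0 c0 (ltW (eq_ind_r is_true x0 (ltr0z rat x))); lra.
by move: x1; generalize x; lia.
Qed.
End Rays.

Record toric_data (K : closedFieldType) N (X : 'rV[K]_N -> Prop) n
    (act : 'rV[K]_n -> 'rV[K]_N -> 'rV[K]_N) (x0 : 'rV[K]_N)
    (omega : 'rV[rat]_n -> Prop) (chi : 'rV[int]_n -> 'rV[K]_N -> K)
    m (P : 'M[int]_(n, m)) : Prop := ToricData {
  td_dec : toric_decomposition X act x0 omega chi;
  td_gp : forall u : 'rV[int]_n, exists a b,
    [/\ u = a - b, omega (toQ a) & omega (toQ b)];
  td_omega : forall w, omega w <-> forall i, 0 <= (w *m mxQ P) ord0 i;
  td_facet : forall i, exists w : 'rV[int]_n, (w *m P) ord0 i = 0 /\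
    forall j, j != i -> 0 < (w *m P) ord0 j;
  td_prim : forall i, exists u : 'rV[int]_n, (u *m P) ord0 i = 1 }.

Section ToricData.
Variables (K : closedFieldType) (charK : [pchar K] =i pred0).
Variables (N : nat) (X : 'rV[K]_N -> Prop) (n : nat).
Variables (act : 'rV[K]_n -> 'rV[K]_N -> 'rV[K]_N) (x0 : 'rV[K]_N).
Hypotheses (affX : affine_variety X) (tor : toric_structure X act x0).
Notation M := 'rV[int]_n.
Notation wt := (wt X act x0).

Let Xx0 : X x0. Proof. by case: tor. Qed.

(** A root of a character of [K[X]] that is a quotient of such characters is
    integral over [K[X]]. *)
Lemma wt_saturated a b d : normal_variety X -> wt a -> wt b ->
  wt ((a - b) *+ d.+1) -> wt (a - b).
Proof.
move=> normX [f [rf hf]] [g [rg hg]] [k [rk hk]].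
have [||h [rh hh]] := normX f g rf rg.
- exists x0; split=> //; have [_ _ _ _] := tor.
  have tact : torus_action X act by case: tor.
  by rewrite -(ta_one tact Xx0) hg ?character_one; [apply/eqP; rewrite oner_eq0|apply: torus1].
- exists d.+1, (fun i x => if i == ord0 then - k x else 0); split=> [i|x Xx].
    case: (i == ord0); last exact: reg_cst.
    have r1 := regM (@reg_cst _ _ X (-1)) rk.
    by apply: (reg_ext _ r1) => y _; rewrite mulN1r.
  rewrite (bigD1 ord0) //= big1 ?addr0; last by move=> i /negbTE ->; rewrite !mul0r.
  rewrite expr0 mulr1 subn0 mulNr; apply/eqP; rewrite subr_eq0; apply/eqP.
  apply: (@orbit_eq _ _ _ _ _ _ affX tor (fun x => f x ^+ d.+1) (fun x => k x * g x ^+ d.+1)) => //.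
  - exact: regX.
  - by apply: regM => //; apply: regX.
  - move=> t tt; rewrite hf // hk // hg //.
    have td v : defined_at v t by apply: torus_defined.
    rewrite -(characterMn d.+1 (td b)).1 -characterDt // -(characterMn d.+1 (td a)).1.
    by rewrite -mulrnDl subrK.
exists h; split=> // t tt.
have := hh _ (orbit_in tor tt); rewrite hf // hg // => e.
apply: (mulfI (character_neq0 b tt)).
by rewrite -e -characterDt // addrC subrK.
Qed.

(** Finitely many weights generate all of them, and normality makes every
    lattice point of the cone that they span a weight. *)
Lemma toric_data_exists : normal_variety X ->
  exists omega chi m (P : 'M[int]_(n, m)), toric_data X act x0 omega chi P.
Proof.
move=> normX.
have [k [A hA]] := weight_generators affX tor.
have [C CA] := effective_generators charK affX tor hA.
have [m [P [oP facet prim]]] := cone_facets CA.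
pose omega w := exists c : 'rV[rat]_k, (forall i, 0 <= c ord0 i) /\ w = c *m mxQ A.
have gpw u : exists a b, [/\ u = a - b, wt a & wt b].
  pose v := u *m C.
  exists ((\row_i Num.max 0 (v ord0 i)) *m A), ((\row_i Num.max 0 (- v ord0 i)) *m A).
  split.
  - rewrite -mulmxBl; have -> : \row_i Num.max 0 (v ord0 i) - \row_i Num.max 0 (- v ord0 i) = v.
      by apply/rv_eq => i; rewrite !mxE; move: (v ord0 i); clear; lia.
    by rewrite /v -mulmxA CA mulmx1.
  - by apply/hA; eexists; last by []; move=> i; rewrite mxE; lia.
  - by apply/hA; eexists; last by []; move=> i; rewrite mxE; lia.
have hw u : omega (toQ u) <-> wt u.
  split=> [[c [c0 cu]]|/hA [c c0 ->]]; last first.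
    by exists (toQ c); split; [apply/toQ_nonneg|rewrite toQ_mul].
  have [D [c' [D0 Dc]]] := clear_denominators c.
  have c'0 : nonneg c'.
    apply/toQ_nonneg => i; rewrite -Dc mxE mulr_ge0 //; by rewrite ler0z ltW.
  have Du : D *: u = c' *m A.
    by apply: toQ_inj; rewrite toQZ cu scalemxAl Dc toQ_mul.
  have [a [b [eu wa wb]]] := gpw u.
  have [d eD] : exists d, D = d.+1%:Z.
    by case: D D0 {Dc Du} => [[|d]|d] //; exists d.
  rewrite eu; apply: (wt_saturated (d := d)) => //.
  rewrite -eu; apply/hA; exists c' => //.
  by rewrite -Du eD -scaler_nat natz.
pose chi u := if pselect (wt u) is left w then sval (cid w) else fun=> 0.
have hchi u : wt u -> is_chi X act x0 u (chi u).
  by rewrite /chi; case: pselect => // w _; apply: (svalP (cid w)).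
exists omega, chi, m, P; split=> //; last first.
  by move=> u; have [a [b [-> wa wb]]] := gpw u; exists a, b; split=> //; apply/hw.
split.
- by exists k, (mxQ A).
- by move=> u; apply: hw.
- by move=> u /hw /hchi.
- move=> f rf; have [s [c [us sw fE]]] := reg_weights affX tor rf.
  exists s, c; split=> [u /sw /hw //|]; apply: (orbit_eq affX tor) => //.
    rewrite (_ : (fun x => _) = fun x => \sum_(u <- s | u \in s) c u * chi u x); last first.
      by apply: funext => x; rewrite big_seq.
    by apply: reg_sum => u /sw /hchi [ru _]; apply: regM => //; apply: reg_cst.
  move=> t tt; rewrite fE // big_seq [RHS]big_seq; apply: eq_bigr => u /sw /hchi [_ ->//].
- move=> s c us sw h; apply: character_free => // t tt.
  rewrite -[RHS](h _ (orbit_in tor tt)) big_seq [RHS]big_seq; apply: eq_bigr => u su.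
  by have /hw /hchi [_ ->] := sw _ su.
Qed.
End ToricData.

(** * Comparison of toric structures *)

Section Fractions.
Import FracField.
Local Open Scope quotient_scope.

Lemma frac_split (R : idomainType) (f : {fraction R}) :
  exists a b : R, b != 0 /\ f = tofrac a / tofrac b.
Proof.
elim/quotW: f => x; exists (\n_x), (\d_x); split; first exact: denom_ratioP.
have d0 := denom_ratioP x.
rewrite -[_ / _]/(FracField.mul _ (FracField.inv _)) !piE.
apply/eqmodP; rewrite /= FracField.equivfE /mulf /invf.
by rewrite !numden_Ratio ?oner_eq0 ?mulr1 ?mul1r // mulrC.
Qed.
End Fractions.

Section Quotients.
Variables (R : nzRingType) (F : fieldType) (e : {rmorphism R -> F}).

Definition quotient_of f := exists a b, e b != 0 /\ f = e a / e b.

Lemma quotient_img a : quotient_of (e a).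
Proof. by exists a, 1; rewrite rmorph1 oner_neq0 divr1. Qed.

Lemma quotientD f g : quotient_of f -> quotient_of g -> quotient_of (f + g).
Proof.
move=> [a [b [b0 ->]]] [a' [b' [b'0 ->]]]; exists (a * b' + a' * b), (b * b').
by rewrite rmorphM mulf_neq0 // addf_div // rmorphD !rmorphM.
Qed.

Lemma quotientM f g : quotient_of f -> quotient_of g -> quotient_of (f * g).
Proof.
move=> [a [b [b0 ->]]] [a' [b' [b'0 ->]]]; exists (a * a'), (b * b').
by rewrite !rmorphM mulf_neq0 // mulf_div.
Qed.

Lemma quotientV f : quotient_of f -> quotient_of f^-1.
Proof.
move=> [a [b [b0 ->]]]; have [a0|a0] := eqVneq (e a) 0.
  by rewrite a0 mul0r invr0; exists 0, b; rewrite rmorph0 mul0r.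
by exists b, a; rewrite invf_div.
Qed.
End Quotients.

Section GenericPoint.
Variables (K : closedFieldType) (N : nat) (X : 'rV[K]_N -> Prop) (n : nat).
Variables (act : 'rV[K]_n -> 'rV[K]_N -> 'rV[K]_N) (x0 : 'rV[K]_N).
Hypotheses (affX : affine_variety X) (tor : toric_structure X act x0).
Variables (omega : 'rV[rat]_n -> Prop) (chi : 'rV[int]_n -> 'rV[K]_N -> K).
Variables (m : nat) (P : 'M[int]_(n, m)).
Hypothesis dat : toric_data X act x0 omega chi P.
Notation M := 'rV[int]_n.
Notation F := {fraction {mpoly K[n]}}.
Notation cst := (@tofrac {mpoly K[n]} \o @mpolyC n K : {rmorphism K -> F}).

Let cX : zclosed X. Proof. by case: affX. Qed.

Definition gchi (u : M) : F := \prod_i (tofrac 'X_i) ^ u ord0 i.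

Let X0 i : tofrac 'X_i != 0 :> F.
Proof. by rewrite tofrac_eq0 -msupp_eq0 msuppX. Qed.

Lemma gchiD u w : gchi (u + w) = gchi u * gchi w.
Proof. by rewrite -big_split; apply: eq_bigr => i _; rewrite mxE expfzDr. Qed.

Lemma gchi0 : gchi 0 = 1.
Proof. by rewrite /gchi big1 // => i _; rewrite mxE expr0z. Qed.

Lemma gchi_mrow k : gchi (mrow k) = tofrac 'X_[k].
Proof.
rewrite mpolyXE_id rmorph_prod; apply: eq_bigr => i _.
by rewrite mxE rmorphXn.
Qed.

(** The generic point of the torus satisfies the same identities as all its
    points together. *)
Lemma generic_zero (l : seq (K * M)) :
  ev cst gchi l = 0 <-> forall t, torus t -> tev l t = 0.
Proof.
set s := undup [seq p.2 | p <- l].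
have us : uniq s by apply: undup_uniq.
suff h : ev cst gchi l = 0 -> forall u, u \in s -> coef l u = 0.
  split=> [/h hc t tt|ht].
    by rewrite tev_coef big_seq big1 // => u /hc ->; rewrite mul0r.
  rewrite ev_coef big_seq big1 // => u su.
  have -> : coef l u = 0; last by rewrite rmorph0 mul0r.
  by apply: (character_free us) su => t tt; rewrite -tev_coef ht.
have [k hk] := nonneg_shift s; rewrite ev_coef => e.
apply: (character_free us) => t tt.
apply: (mulIf (character_neq0 (mrow k) tt)); rewrite mul0r mulr_suml.
pose p : {mpoly K[n]} := \sum_(u <- s) coef l u *: 'X_[mabs (u + mrow k)].
have p0 : p = 0.
  apply/eqP; rewrite -tofrac_eq0; apply/eqP.
  rewrite -(mul0r (gchi (mrow k))) -[X in X * _]e mulr_suml rmorph_sum.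
  rewrite big_seq [RHS]big_seq; apply: eq_bigr => u su.
  rewrite -mul_mpolyC rmorphM -mulrA -gchiD; congr (_ * _).
  by rewrite -{2}(mabs_mrow (hk u su)) gchi_mrow.
have e2 : p.@[fun i => t ord0 i] = 0 by rewrite p0 meval0.
rewrite -[RHS]e2.
have -> : p.@[fun i => t ord0 i] =
    \sum_(u <- s) coef l u * ('X_[mabs (u + mrow k)] : {mpoly K[n]}).@[fun i => t ord0 i].
  by rewrite raddf_sum; apply: eq_bigr => u _; rewrite /= mevalZ.
apply: eq_big_seq => u su.
by rewrite -mulrA -characterDt // -character_mrow mabs_mrow //; apply: hk.
Qed.

(** The coordinates of a point of the orbit, as combinations of characters,
    become elements of a field of fractions when the characters are replaced by
    Laurent monomials. *)
Lemma generic_point : exists (ev : {rmorphism {mpoly K[N]} -> F}),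
  [/\ forall c, ev c%:MP = cst c,
      forall p, ev p = 0 <-> forall x, X x -> peval p x = 0
    & forall f, exists a b, ev b != 0 /\ f = ev a / ev b].
Proof.
have [L [Lw LE]] := coordinate_terms affX tor.
have [e [eE eC]] : exists e : {rmorphism {mpoly K[N]} -> F},
    (forall p, e p = ev cst gchi (lcomp L p)) /\ forall c, e c%:MP = cst c.
  exists (mmap cst (fun j => ev cst gchi (L j))); split=> [p|c]; last exact: mmapC.
  by rewrite ev_lcomp //; [exact: gchiD|exact: gchi0].
have tE p t : torus t -> tev (lcomp L p) t = peval p (act t x0).
  by move=> tt; rewrite tev_lcomp // /peval; apply: meval_eq => j; rewrite LE.
have e0 p : e p = 0 <-> forall x, X x -> peval p x = 0.
  rewrite eE; split=> [/generic_zero h|h].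
    by apply: (orbit_dense affX tor) => t tt; rewrite -tE ?h.
  by apply/generic_zero => t tt; rewrite tE // h //; apply: (orbit_in tor).
exists e; split=> // f.
pose Q := quotient_of e.
have QM f1 f2 : Q f1 -> Q f2 -> Q (f1 * f2) by exact: quotientM.
have QV f1 : Q f1 -> Q f1^-1 by exact: quotientV.
have QC c : Q (cst c) by rewrite -eC; exact: quotient_img.
have Qw u : omega (toQ u) -> Q (gchi u).
  move=> /(td_chi (td_dec dat)) [/(regular_closed cX) [q qE] hq].
  have -> : gchi u = e q; last exact: quotient_img.
  apply/esym/eqP; rewrite -subr_eq0 eE; apply/eqP.
  have -> : ev cst gchi (lcomp L q) - gchi u = ev cst gchi (lcomp L q ++ [:: (-1, u)]).
    by rewrite ev_cat /ev big_seq1 /= rmorphN1 rmorphN rmorph1 mulN1r.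
  apply/generic_zero => t tt; have eu : tev [:: (-1, u)] t = - character u t by rewrite tevE big_seq1 mulN1r.
  have -> : tev (lcomp L q ++ [:: (-1, u)]) t = tev (lcomp L q) t + tev [:: (-1, u)] t.
    exact: ev_cat.
  by rewrite eu tE // -qE ?hq ?subrr //; apply: (orbit_in tor).
have gV u : gchi (- u) = (gchi u)^-1.
  have g1 : gchi (- u) * gchi u = 1 by rewrite -gchiD addNr gchi0.
  by apply/esym/(mulr1_eq); rewrite mulrC.
have Qg u : Q (gchi u).
  have [a [b [-> oa ob]]] := td_gp dat u.
  by rewrite gchiD gV; apply: QM; [apply: Qw|apply/QV/Qw].
have Qp p : Q (tofrac p).
  rewrite [p]mpolyE rmorph_sum; apply: (big_ind Q) => [||k _].
  - by have := QC 0; rewrite rmorph0.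
  - exact: quotientD.
  rewrite -mul_mpolyC rmorphM; apply: QM; first exact: QC.
  by have := Qg (mrow k); rewrite gchi_mrow.
have [a [b [_ ->]]] := frac_split f.
by apply: QM; [|apply: QV]; apply: Qp.
Qed.
End GenericPoint.

Section ToricFrame.
Variables (K : closedFieldType) (N : nat) (X : 'rV[K]_N -> Prop) (n : nat).
Variables (act : 'rV[K]_n -> 'rV[K]_N -> 'rV[K]_N) (x0 : 'rV[K]_N).
Hypotheses (affX : affine_variety X) (tor : toric_structure X act x0).
Variables (omega : 'rV[rat]_n -> Prop) (chi : 'rV[int]_n -> 'rV[K]_N -> K).
Variables (m : nat) (P : 'M[int]_(n, m)).
Hypothesis dat : toric_data X act x0 omega chi P.
Variables (F : fieldType) (cst : {rmorphism K -> F}) (e : {rmorphism {mpoly K[N]} -> F}).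
Hypothesis eC : forall c, e c%:MP = cst c.
Hypothesis e0 : forall p, e p = 0 <-> forall x, X x -> peval p x = 0.
Hypothesis efrac : forall f, exists a b, e b != 0 /\ f = e a / e b.
Notation M := 'rV[int]_n.
Notation S u := (omega (toQ u)).

Let cX : zclosed X. Proof. by case: affX. Qed.

Lemma SD u w : S u -> S w -> S (u + w).
Proof.
move=> /(omega_int (td_omega dat)) h1 /(omega_int (td_omega dat)) h2.
apply/(omega_int (td_omega dat)) => i.
by rewrite mulmxDl mxE addr_ge0 ?h1 ?h2.
Qed.

Lemma S0 : S 0.
Proof. by apply/(omega_int (td_omega dat)) => i; rewrite mul0mx mxE. Qed.

(** The functions [chi^u] and their quotients, as elements of the function
    field, form a frame of the coordinate ring. *)
Lemma toric_frame : exists c : M -> F, frame cst (fun z => exists p, z = e p) c P.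
Proof.
have qex u : exists q : {mpoly K[N]}, S u -> forall x, X x -> chi u x = peval q x.
  have [/(td_chi (td_dec dat)) [ru _]|] := pselect (S u); last by exists 0.
  by have [q hq] := regular_closed cX ru; exists q.
have [q qE] := choice qex.
have qt u t : S u -> torus t -> peval (q u) (act t x0) = character u t.
  move=> su tt; rewrite -qE //; last exact: (orbit_in tor).
  by have [_ ->] := td_chi (td_dec dat) su.
have ee p p' : (forall t, torus t -> peval p (act t x0) = peval p' (act t x0)) -> e p = e p'.
  move=> h; apply/eqP; rewrite -subr_eq0 -rmorphB; apply/eqP/e0.
  apply: (orbit_dense affX tor) => t tt.
  by rewrite /peval mevalB -!/(peval _ _) h ?subrr.
have eD u w : S u -> S w -> e (q (u + w)) = e (q u) * e (q w).
  move=> su sw; rewrite -rmorphM; apply: ee => t tt.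
  by rewrite /peval mevalM -!/(peval _ _) !qt ?characterDt //; apply: SD.
have eq1 : e (q 0) = 1.
  rewrite -[RHS](rmorph1 e); apply: ee => t tt.
  by rewrite qt ?character0 ?/peval ?meval1 //; apply: S0.
have eN0 u : S u -> e (q u) != 0.
  move=> su; apply/eqP => /e0 h; have [_ _ _ _] := tor.
  have := h _ (orbit_in tor (@torus1 _ _)); rewrite qt ?character_one => //; last exact: torus1.
  by move/eqP; rewrite oner_eq0.
have [ab abE] := choice (fun u => let: ex_intro a (ex_intro b h) := td_gp dat u in
  ex_intro (fun ab : M * M => [/\ u = ab.1 - ab.2, S ab.1 & S ab.2]) (a, b) h).
pose c u := e (q (ab u).1) / e (q (ab u).2).
have cE u a b : S a -> S b -> u = a - b -> c u = e (q a) / e (q b).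
  move=> sa sb u1; have [u2 sa' sb'] := abE u.
  apply/eqP; rewrite /c eqr_div ?eN0 // -!eD //; apply/eqP; congr (e (q _)).
  have h : a - b = (ab u).1 - (ab u).2 by rewrite -u1.
  by rewrite -[in RHS](subrK b a) h addrAC subrK.
have cS u : S u -> c u = e (q u).
  by move=> su; rewrite (cE u u 0) ?eq1 ?divr1 ?subr0 //; apply: S0.
have cD u w : c (u + w) = c u * c w.
  have [u2 sa sb] := abE u; have [w2 sa' sb'] := abE w.
  rewrite (cE u _ _ sa sb u2) (cE w _ _ sa' sb' w2) mulf_div -!eD //.
  apply: cE; [exact: SD|exact: SD|].
  by rewrite {1}u2 {1}w2 opprD addrACA.
have c0 : c 0 = 1 by rewrite cS ?eq1 //; apply: S0.
exists c; split=> //.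
- move=> s a us hs; pose w := \sum_(u <- s) (ab u).2.
  have Sw (r : seq M) : S (\sum_(u <- r) (ab u).2).
    by apply: (big_ind (fun u => S u)); [exact: S0|exact: SD|move=> u _; have [] := abE u].
  have Suw u : u \in s -> S (u + w).
    move=> su; rewrite /w (big_rem u) //= addrA.
    have [eu sa _] := abE u.
    by apply: SD => //; have -> : u + (ab u).2 = (ab u).1 by rewrite {1}eu subrK.
  apply: (character_free us) => t tt.
  apply: (mulIf (character_neq0 w tt)); rewrite mul0r mulr_suml.
  have : e (\sum_(u <- s) a u *: q (u + w)) = 0.
    rewrite -(mul0r (c w)) -hs mulr_suml rmorph_sum big_seq [RHS]big_seq.
    apply: eq_bigr => u su.
    by rewrite -mul_mpolyC rmorphM /= eC -mulrA -cD cS //; apply: Suw.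
  move/e0/(_ _ (orbit_in tor tt)); rewrite /peval raddf_sum => h.
  rewrite -[RHS]h big_seq [RHS]big_seq; apply: eq_bigr => u su.
  rewrite /= mevalZ -/(peval _ _) qt //; last exact: Suw.
  by rewrite characterDt // mulrA.
- move=> z; split=> [[p ->]|[l hl ->]]; last first.
    exists (\sum_(r <- l) r.1 *: q r.2); rewrite /ev rmorph_sum big_seq [RHS]big_seq.
    apply: eq_bigr => r rl; rewrite -mul_mpolyC rmorphM /= eC cS //.
    by apply/(omega_int (td_omega dat))/hl.
  have [s [a [ss hs]]] := td_span (td_dec dat) (@reg_poly _ _ X p).
  exists [seq (a u, u) | u <- s].
    by move=> r /mapP [u /ss /(omega_int (td_omega dat)) su ->].
  rewrite /ev big_map.
  have -> : e p = e (\sum_(u <- s) a u *: q u).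
    apply: ee => t tt; rewrite hs; last exact: (orbit_in tor).
    rewrite /peval raddf_sum big_seq [RHS]big_seq; apply: eq_bigr => u su /=.
    by rewrite mevalZ -/(peval _ _) -qE //; [apply: ss|apply: (orbit_in tor)].
  rewrite rmorph_sum big_seq [RHS]big_seq; apply: eq_bigr => u su.
  by rewrite -mul_mpolyC rmorphM /= eC cS //; apply: ss.
- exact: td_facet dat.
- exact: td_prim dat.
- by move=> f; have [a [b [b0 ->]]] := efrac f; exists (e a), (e b); split=> //; [exists a|exists b].
Qed.
End ToricFrame.

(** Any two toric structures on [X] have the same cone, up to an automorphism
    of the character lattice: both present the coordinate ring by a frame. *)
Lemma toric_unique (K : closedFieldType) N (X : 'rV[K]_N -> Prop) n
    (act1 act2 : 'rV[K]_n -> 'rV[K]_N -> 'rV[K]_N) x1 x2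
    omega1 omega2 chi1 chi2 m1 m2 (P1 : 'M[int]_(n, m1)) (P2 : 'M[int]_(n, m2)) :
  affine_variety X -> toric_structure X act1 x1 -> toric_structure X act2 x2 ->
  toric_data X act1 x1 omega1 chi1 P1 -> toric_data X act2 x2 omega2 chi2 P2 ->
  exists2 B : 'M[int]_n, B \in unitmx &
    forall u : 'rV[int]_n, omega1 (toQ u) <-> omega2 (toQ (u *m B)).
Proof.
move=> affX tor1 tor2 dat1 dat2.
have [e [eC e0 ef]] := generic_point affX tor1 dat1.
have [c1 fr1] := toric_frame affX tor1 dat1 eC e0 ef.
have [c2 fr2] := toric_frame affX tor2 dat2 eC e0 ef.
have [B uB hB] := frame_unique fr1 fr2; exists B => // u.
rewrite (omega_int (td_omega dat1)) (omega_int (td_omega dat2)); exact: hB.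
Qed.

Section Transport.
Variables (K : closedFieldType) (N : nat) (X : 'rV[K]_N -> Prop) (n : nat).

Definition tpow (B : 'M[int]_n) (t : 'rV[K]_n) : 'rV[K]_n :=
  \row_i character (row i B) t.

Lemma torus_tpow B t : torus t -> torus (tpow B t).
Proof. by move=> tt i; rewrite mxE; apply/eqP/character_neq0. Qed.

Lemma character_sum k (f : 'I_k -> 'rV[int]_n) (t : 'rV[K]_n) : torus t ->
  character (\sum_i f i) t = \prod_i character (f i) t.
Proof.
move=> tt; apply: (big_morph (fun u => character u t)) => [u v|].
  exact: characterDt.
exact: character0.
Qed.

Lemma characterZ k (u : 'rV[int]_n) (t : 'rV[K]_n) : torus t -> character (k *: u) t = character u t ^ k.
Proof.
move=> tt; rewrite /character.
elim: (index_enum _) => [|i r IH]; first by rewrite !big_nil exp1rz.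
by rewrite !big_cons IH mxE expfzMl exprz_exp (mulrC k).
Qed.

Lemma character_tpow B t u : torus t -> character u (tpow B t) = character (u *m B) t.
Proof.
move=> tt; rewrite mulmx_sum_row character_sum //.
by apply: eq_bigr => i _; rewrite characterZ // [tpow B t ord0 i]mxE.
Qed.

Lemma tpowK B C t : torus t -> C *m B = 1%:M -> tpow C (tpow B t) = t.
Proof.
move=> tt CB; apply/rv_eq => i; rewrite mxE character_tpow // -row_mul CB.
rewrite /character (bigD1 i) //= !mxE eqxx expr1z big1 ?mulr1 // => j ji.
by rewrite !mxE eq_sym (negbTE ji) expr0z.
Qed.

Lemma tpow_tmul B s t : tpow B (tmul s t) = tmul (tpow B s) (tpow B t).
Proof. by apply/rv_eq => i; rewrite !mxE character_tmul. Qed.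

Lemma reg_pullback M (Y : 'rV[K]_M -> Prop) (F : 'rV[K]_M -> 'rV[K]_N) f :
  zclosed X -> regular_map Y X F -> regular X f -> regular Y (fun y => f (F y)).
Proof.
move=> cX [hF rF] /(regular_closed cX) [p hp].
have r : regular Y (fun y => p.@[fun j => F y ord0 j]) by apply: reg_meval.
by apply: (reg_ext _ r) => y Yy; rewrite hp //; apply: hF.
Qed.

(** The coordinates of a point of the first orbit are combinations of
    characters; the corresponding functions for the second structure define
    the map. *)
Lemma transport_map act1 act2 x1 x2 omega1 omega2 chi1 chi2 m1 m2
    (P1 : 'M[int]_(n, m1)) (P2 : 'M[int]_(n, m2)) B :
  affine_variety X -> toric_structure X act1 x1 -> toric_structure X act2 x2 ->
  toric_data X act1 x1 omega1 chi1 P1 -> toric_data X act2 x2 omega2 chi2 P2 ->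
  (forall u : 'rV[int]_n, omega1 (toQ u) -> omega2 (toQ (u *m B))) ->
  exists Phi, regular_map X X Phi /\
    forall t, torus t -> Phi (act2 t x2) = act1 (tpow B t) x1.
Proof.
move=> affX tor1 tor2 dat1 dat2 hB; have [cX _] := affX.
have [L [Lw LE]] := coordinate_terms affX tor1.
have chi2E u : wt X act1 x1 u -> is_chi X act2 x2 (u *m B) (chi2 (u *m B)).
  by move/(td_lattice (td_dec dat1))/hB/(td_chi (td_dec dat2)).
pose Phi x : 'rV[K]_N := \row_j \sum_(p <- L j) p.1 * chi2 (p.2 *m B) x.
have PhiE t : torus t -> Phi (act2 t x2) = act1 (tpow B t) x1.
  move=> tt; apply/rv_eq => j; rewrite mxE LE; last exact: torus_tpow.
  rewrite tevE; apply: eq_big_seq => p pl; have [_ ->//] := chi2E _ (Lw j p pl).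
  by rewrite character_tpow.
have rPhi j : regular X (fun x => Phi x ord0 j).
  have r : regular X (fun x => \sum_(p <- L j | p \in L j) p.1 * chi2 (p.2 *m B) x).
    apply: reg_sum => p /(Lw j p) /chi2E [r _]; apply: regM => //; exact: reg_cst.
  by apply: (reg_ext _ r) => x _; rewrite mxE big_seq.
exists Phi; split=> //; split=> // x Xx.
apply: (closed_pts cX) => p pX.
have [q hq] : exists q, forall x, X x -> peval p (Phi x) = peval q x.
  apply: (regular_closed cX); exact: reg_meval.
rewrite hq //; apply: (orbit_dense affX tor2) Xx => t tt.
rewrite -hq ?PhiE ?pX //; first exact/(orbit_in tor1)/torus_tpow.
exact: (orbit_in tor2).
Qed.

(** The maps obtained from [B] and its inverse are inverse to each other on the
    orbits, which are dense. *)
Lemma toric_iso act1 act2 x1 x2 omega1 omega2 chi1 chi2 m1 m2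
    (P1 : 'M[int]_(n, m1)) (P2 : 'M[int]_(n, m2)) :
  affine_variety X -> toric_structure X act1 x1 -> toric_structure X act2 x2 ->
  toric_data X act1 x1 omega1 chi1 P1 -> toric_data X act2 x2 omega2 chi2 P2 ->
  exists (B : 'M[int]_n) (Phi Phi' : 'rV[K]_N -> 'rV[K]_N),
   [/\ B \in unitmx,
       (forall u : 'rV[int]_n, omega1 (toQ u) <-> omega2 (toQ (u *m B))),
       [/\ regular_map X X Phi, regular_map X X Phi' & mutually_inverse X X Phi Phi'],
       (forall t, torus t -> Phi (act2 t x2) = act1 (tpow B t) x1)
     & forall u x, omega1 (toQ u) -> X x -> chi1 u (Phi x) = chi2 (u *m B) x].
Proof.
move=> affX tor1 tor2 dat1 dat2; have [cX _] := affX.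
have [B uB hB] := toric_unique affX tor1 tor2 dat1 dat2.
have hB' u : omega2 (toQ u) -> omega1 (toQ (u *m invmx B)).
  by move=> h; apply/hB; rewrite mulmxKV.
have [Phi [rP hP]] := transport_map affX tor1 tor2 dat1 dat2 (fun u => (hB u).1).
have [Phi' [rP' hP']] := transport_map affX tor2 tor1 dat2 dat1 hB'.
have reg_map_coord (F G : 'rV[K]_N -> 'rV[K]_N) j :
    regular_map X X F -> regular_map X X G -> regular X (fun x => G (F x) ord0 j).
  by move=> rF [_ rG]; apply: (reg_pullback (f := fun x => G x ord0 j) cX rF).
exists B, Phi, Phi'; split=> //; last first.
  move=> u x ou; have [r1 h1] := td_chi (td_dec dat1) ou.
  have [r2 h2] := td_chi (td_dec dat2) ((hB u).1 ou).
  apply: (orbit_eq affX tor2 (f := fun x => chi1 u (Phi x))) => //.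
    exact: reg_pullback rP r1.
  move=> t tt; rewrite hP // h1; last exact: torus_tpow.
  by rewrite character_tpow // h2.
split=> //; split=> x Xx; apply/rv_eq => j.
- apply: (orbit_eq affX tor2 (f := fun x => Phi' (Phi x) ord0 j) (g := fun x => x ord0 j)) Xx => //.
  + exact: reg_map_coord.
  + exact: reg_coord.
  by move=> t tt; rewrite hP // hP' ?(tpowK tt) ?mulVmx //; apply: torus_tpow.
- apply: (orbit_eq affX tor1 (f := fun x => Phi (Phi' x) ord0 j) (g := fun x => x ord0 j)) Xx => //.
  + exact: reg_map_coord.
  + exact: reg_coord.
  by move=> t tt; rewrite hP' // hP ?(tpowK tt) ?mulmxV //; apply: torus_tpow.
Qed.
End Transport.

(** * The group of units *)

Lemma dependent (K : fieldType) (I J : finType) (T : Type) (Q : T -> Prop)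
    (f : I -> T -> K) (g : J -> T -> K) (a : I -> J -> K) :
  (#|J| < #|I|)%N -> (forall i t, Q t -> f i t = \sum_j a i j * g j t) ->
  exists2 c : I -> K, (exists i, c i != 0) &
    forall t, Q t -> \sum_i c i * f i t = 0.
Proof.
move=> JI fE.
pose A : 'M[K]_(#|I|, #|J|) := \matrix_(i, j) a (enum_val i) (enum_val j).
have [v [v0 vA]] : exists v : 'rV[K]_#|I|, v != 0 /\ v *m A = 0.
  have k0 : kermx A != 0.
    rewrite kermx_eq0 /row_free eqn_leq negb_and -!ltnNge; apply/orP; right.
    exact: leq_ltn_trans (rank_leq_col A) JI.
  have [i ri] := row_subPn (etrans (congr1 negb (submx0 (kermx A))) k0).
  exists (row i (kermx A)); split; first by move: ri; rewrite submx0.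
  by rewrite -row_mul mulmx_ker row0.
exists (fun i => v ord0 (enum_rank i)).
  have /rV0Pn [k vk] := v0.
  by exists (enum_val k); rewrite enum_valK.
move=> t Qt; under eq_bigr => i _ do rewrite fE // mulr_sumr.
rewrite exchange_big big1 // => j _.
under eq_bigr => i _ do rewrite mulrA.
rewrite -mulr_suml; suff -> : \sum_i v ord0 (enum_rank i) * a i j = 0 by rewrite mul0r.
have := congr1 (fun B : 'rV__ => B ord0 (enum_rank j)) vA; rewrite !mxE => h.
rewrite -[RHS]h (reindex (@enum_rank I)) /=; last exact: onW_bij (@enum_rank_bij I).
by apply: eq_bigr => k _; rewrite mxE !enum_rankK.
Qed.

Section Basis.
Variables (K : fieldType) (T : Type) (Q : T -> Prop).

Definition indep k (w : 'I_k -> T -> K) := forall c : 'I_k -> K,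
  (forall t, Q t -> \sum_i c i * w i t = 0) -> forall i, c i = 0.

Lemma finite_basis (R : (T -> K) -> Prop) (D : finType) (g : D -> T -> K) :
  (forall f, R f -> exists c : D -> K, forall t, Q t -> f t = \sum_j c j * g j t) ->
  exists k (w : 'I_k -> T -> K), [/\ forall i, R (w i), indep w
    & forall f, R f -> exists c : 'I_k -> K, forall t, Q t -> f t = \sum_j c j * w j t].
Proof.
move=> hR.
pose P k := `[< exists w : 'I_k -> T -> K, (forall i, R (w i)) /\ indep w >].
have P0 : exists k, P k by exists 0%N; apply/asboolP; exists (fun=> fun=> 0); split=> [[]|c _ []].
have PD k : P k -> (k <= #|D|)%N.
  move=> /asboolP [w [Rw iw]]; rewrite leqNgt; apply/negP => Dk.
  have [a aE] := choice (fun i => hR _ (Rw i)).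
  have [||c [i ci] hc] := @dependent _ 'I_k D T Q w g a; rewrite ?card_ord //.
  by case/eqP: ci; apply: iw.
case: (ex_maxnP P0 PD) => k /asboolP [w [Rw iw]] kmax; exists k, w; split=> // f Rf.
have [//|nf] := pselect (exists c : 'I_k -> K, forall t, Q t -> f t = \sum_j c j * w j t).
suff /kmax : P k.+1 by rewrite ltnn.
apply/asboolP; exists (fun i => if unlift ord0 i is Some j then w j else f).
split=> [i|c hc]; first by case: (unlift ord0 i).
have hc' t : Q t -> c ord0 * f t + \sum_(j < k) c (lift ord0 j) * w j t = 0.
  move=> Qt; rewrite -[RHS](hc t Qt) big_ord_recl unlift_none; congr (_ + _).
  by apply: eq_bigr => j _; rewrite liftK.
have c0 : c ord0 = 0.
  apply/eqP; apply: contra_notT nf => c0.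
  exists (fun j => - (c ord0)^-1 * c (lift ord0 j)) => t Qt.
  have := hc' t Qt; move/eqP; rewrite addrC addr_eq0 => /eqP e.
  under eq_bigr => j _ do rewrite -mulrA.
  by rewrite -mulr_sumr e mulrNN mulrA mulVf ?mul1r.
move=> i; case: (unliftP ord0 i) => [j ->|-> //].
apply: (iw (fun j => c (lift ord0 j))) => t Qt.
by have := hc' t Qt; rewrite c0 mul0r add0r.
Qed.
End Basis.

Lemma msize_psub (K : closedFieldType) N M (q : 'I_M -> {mpoly K[N]}) (p : {mpoly K[M]}) :
  (forall i, (msize (q i) <= 2)%N) -> (msize (psub q p) <= msize p)%N.
Proof.
move=> hq.
have hM a b (x y : {mpoly K[N]}) : (msize x <= a.+1)%N -> (msize y <= b.+1)%N ->
    (msize (x * y) <= (a + b).+1)%N.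
  have [->|x0] := eqVneq x 0; first by rewrite mul0r mmeasure0.
  have [->|y0] := eqVneq y 0; first by rewrite mulr0 mmeasure0.
  by rewrite msizeM //; move: (mmeasure _ x) (mmeasure _ y) => u v; lia.
have hX m : (msize (mmap1 q m) <= (mdeg m).+1)%N.
  rewrite mdegE /mmap1; elim: (index_enum _) => [|i r IH]; first by rewrite !big_nil msize1.
  rewrite !big_cons; apply: (hM _ _ _ _ _ IH); elim: (m i) => [|k IHk]; first by rewrite msize1.
  by rewrite exprS; exact: (hM 1%N k _ _ (hq i) IHk).
rewrite /psub /mmap; apply: leq_trans (mmeasure_sum _ _ _ _) _.
rewrite big_seq_cond; apply/bigmax_leqP_seq => m mp; rewrite andbT => mp'.
have := hM 0%N (mdeg m) (p@_m)%:MP (mmap1 q m); rewrite mmeasureC => h.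
apply: leq_trans (h _ (hX m)) _; first by case: (_ != _).
by rewrite add0n; apply: msize_mdeg_lt.
Qed.

Section Units.
Variables (K : closedFieldType) (N : nat) (X : 'rV[K]_N -> Prop).
Variables (mul : 'rV[K]_N -> 'rV[K]_N -> 'rV[K]_N) (one : 'rV[K]_N).
Hypotheses (affX : affine_variety X) (monX : comm_monoid X mul one).

Let cX : zclosed X. Proof. by case: affX. Qed.

Lemma mul_in x y : X x -> X y -> X (mul x y).
Proof.
move=> Xx Xy; have [h _] := cm_regular monX.
by have := h (row_mx x y); rewrite /prodv row_mxKl row_mxKr; apply.
Qed.

Lemma reg_mul_map x : X x -> regular_map X X (mul x).
Proof.
move=> Xx; split=> [y|j]; first exact: mul_in.
have [_ /(_ j) r] := cm_regular monX.
by apply: reg_ext (reg_slice_r r Xx) => y _; rewrite row_mxKl row_mxKr.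
Qed.

Lemma reg_mulr x f : X x -> regular X f -> regular X (fun y => f (mul x y)).
Proof. by move=> Xx; apply: reg_pullback cX (reg_mul_map Xx). Qed.

Lemma reg_mull y f : X y -> regular X f -> regular X (fun x => f (mul x y)).
Proof.
move=> Xy rf; apply: reg_ext (reg_mulr Xy rf) => x Xx.
by rewrite (cm_comm monX).
Qed.

(** Multiplication is polynomial, so the translates of the coordinates are
    combinations of the finitely many monomials of bounded degree. *)
Lemma translate_space : exists d (w : 'I_d -> 'rV[K]_N -> K),
  [/\ forall i, regular X (w i), indep X w,
      forall j, exists c : 'I_d -> K, forall x, X x -> x ord0 j = \sum_i c i * w i x
    & forall x i, X x -> exists c : 'I_d -> K,
        forall y, X y -> w i (mul x y) = \sum_k c k * w k y].
Proof.
have hP j : exists p : {mpoly K[N + N]}, forall x y, X x -> X y ->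
    mul x y ord0 j = peval p (row_mx x y).
  have [_ /(_ j) r] := cm_regular monX.
  have [p hp] := regular_closed (zclosed_prodv cX cX) r.
  exists p => x y Xx Xy; rewrite -hp ?row_mxKl ?row_mxKr //.
  by rewrite /prodv row_mxKl row_mxKr.
have [p pE] := choice hP.
pose k := (\max_j msize (p j))%N.
have kp j : (msize (p j) <= k)%N by rewrite /k (bigD1 j) //= leq_maxl.
pose cl (m : 'X_{1..N + N}) (x : 'rV[K]_N) := \prod_(l < N) x ord0 l ^+ m (lshift N l).
pose cr (m : 'X_{1..N + N}) (x : 'rV[K]_N) := \prod_(l < N) x ord0 l ^+ m (rshift N l).
pose D : finType := 'X_{1..(N + N)%N < k}.
pose R f := exists j x, X x /\ f = fun y => mul x y ord0 j.
have [f [j [x [Xx ->]]]|d [w [Rw iw sw]]] :=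
    @finite_basis K _ X R D (fun m y => cr m y).
  exists (fun m : D => (p j)@_m * cl m x) => y Xy.
  rewrite pE // /peval /meval (mmapE k) //; apply: eq_bigr => m _.
  rewrite /mmap1 big_split_ord mulrA /=; congr (_ * _ * _); apply: eq_bigr => l _.
    by rewrite row_mxEl.
  by rewrite row_mxEr.
exists d, w; split=> // [i|j|x i Xx].
- by have [j [x [Xx ->]]] := Rw i; exact: (@reg_mulr x (fun y => y ord0 j) Xx (@reg_coord _ _ X j)).
- have [|c hc] := sw (fun y => mul one y ord0 j); first by exists j, one; split=> //; apply: (cm_one monX).
  by exists c => x Xx; rewrite -hc // (cm_unit monX Xx).1.
- have [j [y [Xy wE]]] := Rw i.
  have [|c hc] := sw (fun z => mul (mul y x) z ord0 j).
    by exists j, (mul y x); split=> //; apply: mul_in.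
  by exists c => z Xz; rewrite wE -hc // (cm_assoc monX).
Qed.

(** Multiplication by [x] is injective on functions as soon as it acts
    invertibly on a finite-dimensional generating space.  A function [f] killed
    by it gives functions [f_k] with [f_k (x y) = f_(k-1) y] and [f_0 = f], all
    in a finite-dimensional space; multiplying the argument of a relation
    between them by a power of [x] leaves a multiple of [f]. *)
Lemma translation_injective d (w : 'I_d -> 'rV[K]_N -> K) x (rho : 'M[K]_d) p :
  X x -> rho \in unitmx ->
  (forall i y, X y -> w i (mul x y) = \sum_k rho i k * w k y) ->
  (forall y, X y -> p.@[fun i => w i (mul x y)] = 0) ->
  forall y, X y -> p.@[fun i => w i y] = 0.
Proof.
move=> Xx urho wE p0.
pose W k y i := ((iter k (mulmx (invmx rho)) (\col_i w i y)) i ord0).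
pose f k y := p.@[fun i => W k y i].
have WS k y i : X y -> W k.+1 (mul x y) i = W k y i.
  move=> Xy; rewrite /W; elim: k i => [|k IH] i.
    rewrite /= (_ : \col_i w i (mul x y) = rho *m \col_i w i y) ?mulKmx //.
    by apply/colP => l; rewrite !mxE wE //; apply: eq_bigr => m _; rewrite mxE.
  rewrite iterS [in RHS]iterS; congr ((_ *m _) _ _); apply/colP => l; exact: IH.
have fS k y : X y -> f k.+1 (mul x y) = f k y.
  by move=> Xy; apply: meval_eq => i; apply: WS.
have f0 y : X y -> f 0%N (mul x y) = 0.
  by move=> Xy; rewrite -[RHS](p0 y Xy); apply: meval_eq => i; rewrite /W /= mxE.
pose B k i : {mpoly K[d]} := \sum_l (iter k (mulmx (invmx rho)) 1%:M) i l *: 'X_l.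
have BE k y i : (B k i).@[fun i => w i y] = \sum_l (iter k (mulmx (invmx rho)) 1%:M) i l * w l y.
  by rewrite raddf_sum; apply: eq_bigr => l _; rewrite /= mevalZ mevalXU.
have WE k y i : W k y i = \sum_l (iter k (mulmx (invmx rho)) 1%:M) i l * w l y.
  transitivity ((iter k (mulmx (invmx rho)) 1%:M *m \col_l w l y) i ord0).
    rewrite /W; elim: (k) i => [|a IH] i /=; first by rewrite mul1mx.
    rewrite -mulmxA; congr ((_ *m _) _ _); apply/colP => l; exact: IH.
  by rewrite mxE; apply: eq_bigr => l _; rewrite mxE.
pose D : finType := 'X_{1..d < msize p}.
have [||c [i0 ci0] hc] := @dependent K 'I_(#|D|.+1) D _ X (fun k y => f k y)
   (fun m y => \prod_i w i y ^+ (m : 'X_{1..d}) i)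
   (fun k m => (psub (B k) p)@_(m : 'X_{1..d < msize p})).
- by rewrite card_ord.
- move=> k y Xy.
  have -> : f k y = (psub (B k) p).@[fun i => w i y].
    rewrite meval_psub; apply: meval_eq => i; rewrite BE; exact: WE.
  rewrite /meval (mmapE (msize p)) //; apply: msize_psub => i.
  apply: leq_trans (mmeasure_sum _ _ _ _) _; apply/bigmax_leqP => l _.
  by apply: leq_trans (msizeZ_le _ _) _; rewrite msizeX mdeg1.
have [k ck kmin] : exists2 k : 'I_(#|D|.+1), c k != 0 &
    forall l : 'I_(#|D|.+1), (k < l)%N -> c l = 0.
  case: (@arg_maxnP _ i0 (fun k => c k != 0) (fun k => k : nat) ci0) => k ck km.
  exists k => // l kl; apply/eqP; apply: contraTT kl => cl; rewrite -leqNgt; exact: km.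
have fk l k' y : X y -> (l <= k')%N -> f l (iter k' (mul x) y) = if (l == k')%N then f 0%N y else 0.
  elim: k' l y => [|k' IH] [|l] y Xy //= lk.
  - apply: f0; elim: (k') => //= a; exact: mul_in.
  - rewrite fS; first exact: IH.
    elim: (k') => //= a; exact: mul_in.
move=> y Xy; suff : c k * f 0%N y = 0.
  move/eqP; rewrite mulf_eq0 (negbTE ck) => /eqP <-.
  by apply: meval_eq => i; rewrite /W /= mxE.
have Xi : X (iter k (mul x) y) by elim: (k : nat) => //= a; apply: mul_in.
rewrite -[RHS](hc _ Xi) (bigD1 k) //= fk // eqxx big1 ?addr0 // => l lk.
have [kl|lk'] := ltnP k l; first by rewrite kmin ?mul0r.
by rewrite fk // -[_ == _]/(l == k) (negbTE lk) mulr0.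
Qed.

(** [h] is the determinant of the action on the translates of the coordinates.
    Where it does not vanish, the inverse matrix expresses the coordinates of [y]
    by those of [x y]; the map [inv] so defined preserves [X] and inverts the
    multiplication by [x], by [translation_injective]. *)
Lemma units_open : exists h : {mpoly K[N]},
  forall x, X x -> units X mul one x <-> peval h x <> 0.
Proof.
have [d [w [rw iw wc wm]]] := translate_space.
have [y [Xy uy]] := eval_points iw.
set Y := \matrix_(j, i) _ in uy.
pose rho x : 'M[K]_d := (\matrix_(i, j) w i (mul x (y j))) *m invmx Y^T.
have rhoE x i z : X x -> X z -> w i (mul x z) = \sum_k rho x i k * w k z.
  move=> Xx Xz; have [c hc] := wm x i Xx; rewrite hc //.
  apply: eq_bigr => k _; congr (_ * _).
  have -> : rho x i k = ((\row_k c k) *m Y^T *m invmx Y^T) ord0 k.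
    rewrite /rho !mxE; apply: eq_bigr => j _; congr (_ * _).
    by rewrite !mxE hc //; apply: eq_bigr => l _; rewrite !mxE.
  by rewrite mulmxK ?unitmx_tr // mxE.
have rhoM x z : X x -> X z -> rho (mul x z) = rho x *m rho z.
  move=> Xx Xz; have Xxz := mul_in Xx Xz.
  apply/matrixP => i j; apply/eqP; rewrite -subr_eq0; apply/eqP.
  apply: (iw (fun j => rho (mul x z) i j - (rho x *m rho z) i j)) j => t Xt.
  under eq_bigr => j _ do rewrite mulrBl.
  rewrite sumrB -rhoE // -(cm_assoc monX) // rhoE //; last exact: mul_in.
  apply/eqP; rewrite subr_eq0; apply/eqP.
  under [RHS]eq_bigr => j _ do rewrite mxE mulr_suml.
  rewrite exchange_big; apply: eq_bigr => k _ /=.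
  by rewrite rhoE // mulr_sumr; apply: eq_bigr => l _; rewrite mulrA.
have X1 := cm_one monX.
have rho1 : rho one = 1%:M.
  apply/matrixP => i j; apply/eqP; rewrite -subr_eq0; apply/eqP.
  apply: (iw (fun j => rho one i j - (1%:M : 'M_d) i j)) j => t Xt.
  under eq_bigr => j _ do rewrite mulrBl.
  rewrite sumrB -rhoE // (cm_unit monX Xt).1 (bigD1 i) //= mxE eqxx mul1r big1 ?addr0 ?subrr //.
  by move=> j ji; rewrite mxE eq_sym (negbTE ji) mul0r.
have rrho i k : regular X (fun x => rho x i k).
  have r : regular X (fun x => \sum_j w i (mul x (y j)) * (invmx Y^T) j k).
    apply: reg_sum => j _; apply: regM; last exact: reg_cst.
    by apply: reg_mull.
  by apply: (reg_ext _ r) => x _; rewrite !mxE; apply: eq_bigr => j _; rewrite mxE.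
have rdet : regular X (fun x => \det (rho x)).
  rewrite /determinant; apply: reg_sum => s _; apply: regM; first exact: reg_cst.
  by apply: reg_prod => i _; apply: rrho.
have [h hE] := regular_closed cX rdet; exists h => x Xx; rewrite -hE //.
split=> [[_ [x' [Xx' e _]]]|/eqP dx].
  move=> d0; have := congr1 determinant rho1; rewrite -e rhoM // det_mulmx d0 mul0r det1.
  by move/eqP; rewrite eq_sym oner_eq0.
have ux : rho x \in unitmx by rewrite unitmxE unitfE.
have [c cE] := choice wc.
pose a (j : 'I_N) (k : 'I_d) := ((\row_i c j i) *m invmx (rho x)) ord0 k.
pose inv z : 'rV[K]_N := \row_j \sum_k a j k * w k z.
have invE z : X z -> inv (mul x z) = z.
  move=> Xz; apply/rv_eq => j; rewrite mxE cE //.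
  under eq_bigr => k _ do rewrite rhoE // mulr_sumr.
  rewrite exchange_big; apply: eq_bigr => l _ /=.
  have -> : c j l = ((\row_i c j i) *m invmx (rho x) *m rho x) ord0 l by rewrite mulmxKV // mxE.
  by rewrite [X in _ = X * _]mxE mulr_suml; apply: eq_bigr => k _; rewrite mulrA.
have inj p : (forall z, X z -> p.@[fun i => w i (mul x z)] = 0) ->
    forall z, X z -> p.@[fun i => w i z] = 0.
  by apply: (translation_injective Xx ux) => i z Xz; apply: rhoE.
pose A j : {mpoly K[d]} := \sum_k a j k *: 'X_k.
have AE j z : (A j).@[fun i => w i z] = inv z ord0 j.
  by rewrite raddf_sum mxE; apply: eq_bigr => k _; rewrite /= mevalZ mevalXU.
have Xinv z : X z -> X (inv z).
  move=> Xz; apply: (closed_pts cX) => p pX.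
  have -> : peval p (inv z) = (psub A p).@[fun i => w i z].
    by rewrite meval_psub /peval; apply: meval_eq => j; rewrite AE.
  apply: inj Xz => t Xt; rewrite meval_psub.
  rewrite -[RHS](pX t Xt) /peval; apply: meval_eq => j.
  by rewrite AE invE.
have qex j : exists q : {mpoly K[d]}, forall z, X z ->
    mul x (inv z) ord0 j = q.@[fun i => w i z].
  have [p hp] := regular_closed cX ((reg_mul_map Xx).2 j).
  exists (psub A p) => z Xz; rewrite hp; last exact: Xinv.
  by rewrite meval_psub /peval; apply: meval_eq => i; rewrite AE.
have [q qE] := choice qex.
have mulinv z : X z -> mul x (inv z) = z.
  move=> Xz; apply/rv_eq => j; apply/eqP; rewrite -subr_eq0 qE // cE //; apply/eqP.
  have lE (c' : 'I_d -> K) t : (\sum_i c' i *: 'X_i : {mpoly K[d]}).@[fun i => w i t] =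
      \sum_i c' i * w i t.
    by rewrite raddf_sum; apply: eq_bigr => k _; rewrite /= mevalZ mevalXU.
  rewrite -lE -mevalB; apply: inj Xz => t Xt.
  rewrite mevalB lE -qE -?cE ?invE ?subrr //; exact: mul_in.
split=> //; exists (inv one); split; [exact: Xinv|exact: mulinv|].
by rewrite (cm_comm monX) ?mulinv //; apply: Xinv.
Qed.
End Units.

(** * Coordinates of a product of a torus and a vector group *)

Section LastCoordinate.
Variable K : closedFieldType.

(** The sum of the coordinates on the additive part; for an additive part of
    dimension at most one this is its coordinate. *)
Definition last_coord (R : nmodType) r s (g : 'rV[R]_(r + s)) : R :=
  \sum_(i < s) g ord0 (rshift r i).

Lemma character_split r s (u : 'rV[int]_(r + s)) (g : 'rV[K]_(r + s)) :
  character u g = character (lsubmx u) (lsubmx g) * character (rsubmx u) (rsubmx g).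
Proof.
rewrite /character big_split_ord; congr (_ * _); apply: eq_bigr => i _;
  by rewrite !mxE.
Qed.

Lemma character_last r s (u : 'rV[int]_(r + s)) (g : 'rV[K]_(r + s)) : (s <= 1)%N ->
  character u g = character (lsubmx u) (lsubmx g) * last_coord g ^ last_coord u.
Proof.
rewrite character_split => s1; congr (_ * _); rewrite /character /last_coord.
case: s s1 u g => [|[|//]] _ u g; first by rewrite !big_ord0 expr0z.
by rewrite !big_ord1 !mxE.
Qed.

Lemma last_mul r s (g g' : 'rV[K]_(r + s)) :
  last_coord (GmGa_mul g g') = last_coord g + last_coord g'.
Proof. by rewrite /last_coord -big_split; apply: eq_bigr => i _; rewrite row_mxEr !mxE. Qed.

Lemma lsub_mul r s (g g' : 'rV[K]_(r + s)) :
  lsubmx (GmGa_mul g g') = tmul (lsubmx g) (lsubmx g').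
Proof. by rewrite row_mxKl. Qed.

Definition delta_last r s : 'rV[int]_(r + s) := row_mx 0 (const_mx 1).

Lemma last_nonneg r s (u : 'rV[int]_(r + s)) : bnonneg (fun i : 'I_(r + s) => (i < r)%N) u -> 0 <= last_coord u.
Proof. by move=> h; apply: sumr_ge0 => i _; apply: h; rewrite /= -leqNgt leq_addr. Qed.

Lemma last_shift r s (u : 'rV[int]_(r + s)) k : (s <= 1)%N ->
  (k <= absz (last_coord u))%N -> 0 <= last_coord u ->
  last_coord (u - delta_last r s *+ k) = last_coord u - k%:Z.
Proof.
case: s u => [|[|//]] u _; rewrite /last_coord ?big_ord0 ?big_ord1.
  by move=> + _; rewrite /= leqn0 => /eqP ->.
by move=> _ _; rewrite !mxE mulmxnE row_mxEr mxE natz.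
Qed.

Lemma lsub_shift r s (u : 'rV[int]_(r + s)) k :
  lsubmx (u - delta_last r s *+ k) = lsubmx u.
Proof.
apply/rv_eq => i; rewrite !mxE mulmxnE row_mxEl mxE mul0rn oppr0 addr0.
by [].
Qed.

(** In this binomial formula [- delta_last r s] plays the part of the root. *)
Lemma character_GmGa_mul r s (u : 'rV[int]_(r + s)) (g g' : 'rV[K]_(r + s)) :
  (s <= 1)%N -> 0 <= last_coord u -> let a := absz (last_coord u) in
  character u (GmGa_mul g g') = \sum_(j < a.+1) 'C(a, j)%:R *
    (character (u - delta_last r s *+ (a - j)) g * character (u - delta_last r s *+ j) g').
Proof.
move=> s1 u0 a; rewrite character_last // lsub_mul last_mul character_tmul.
have ua : last_coord u = a%:Z by rewrite /a gez0_abs.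
rewrite ua addrC -exprnP exprDn mulr_sumr; apply: eq_bigr => j _.
have ja : (j <= a)%N by rewrite -ltnS.
rewrite !(character_last _ _ s1) !lsub_shift !last_shift ?leq_subr //.
rewrite ua -subzn // opprB addrCA subrr addr0 subzn // -!exprnP mulrnAr -[LHS]mulr_natl.
by ring.
Qed.

Lemma row_last_eq r s (u w : 'rV[int]_(r + s)) : (s <= 1)%N ->
  lsubmx u = lsubmx w -> last_coord u = last_coord w -> u = w.
Proof.
case: s u w => [|[|//]] u w _ luw; rewrite /last_coord ?big_ord1 => e;
  rewrite -[u]hsubmxK -[w]hsubmxK luw; congr row_mx; apply/rv_eq => i.
  by case: i.
by rewrite !mxE; have -> : i = ord0 by rewrite ord1.
Qed.

Lemma last_power r s (b : 'rV[K]_s) i : s = 1%N ->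
  last_coord (row_mx (const_mx 1 : 'rV[K]_r) b) ^+ i = character (const_mx i%:Z) b.
Proof.
move=> s1; case: s s1 b => [//|[|//]] _ b.
by rewrite /last_coord /character !big_ord1 row_mxEr [const_mx _ _ _]mxE.
Qed.

Lemma character_indep n k (E : 'I_k -> 'rV[int]_n) (c : 'I_k -> K) : injective E ->
  (forall t : 'rV[K]_n, torus t -> \sum_i c i * character (E i) t = 0) -> forall i, c i = 0.
Proof.
move=> iE hc i; pose S := [seq E i | i <- enum 'I_k].
have uS : uniq S by rewrite map_inj_uniq ?enum_uniq.
pose b u := \sum_(i | E i == u) c i.
have bE j : b (E j) = c j.
  by rewrite /b (big_pred1 j) // => l /=; apply/eqP/eqP => [/iE|->].
rewrite -bE; apply: (character_free uS); last by apply: map_f; rewrite mem_enum.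
move=> t tt; rewrite -[RHS](hc t tt) big_map big_enum; apply: eq_bigr => j _.
by rewrite bE.
Qed.
End LastCoordinate.

Section MonomialTerms.
Variables (K : closedFieldType) (n V : nat) (L : 'I_V -> seq (K * 'rV[int]_n)).

Lemma supp_lmono_bound A m :
  (forall i, supp (fun u : 'rV[int]_n => forall j, (absz (u ord0 j) <= A)%N) (L i)) ->
  supp (fun u : 'rV[int]_n => forall j, (absz (u ord0 j) <= A * mdeg m)%N) (lmono L m).
Proof.
move=> hL; rewrite mdegE /lmono.
pose B a (u : 'rV[int]_n) := forall j, (absz (u ord0 j) <= A * a)%N.
have BD a b u w : B a u -> B b w -> B (a + b)%N (u + w).
  move=> h1 h2 j; rewrite mxE; have := h1 j; have := h2 j.
  by move: (u ord0 j) (w ord0 j) => x y; rewrite mulnDr; lia.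
have B0 : supp (B 0%N) (lone K n).
  by move=> q; rewrite mem_seq1 => /eqP -> j; rewrite mxE.
elim: (index_enum _) => [|i l IH]; first by rewrite big_nil.
rewrite big_cons /=; apply: (supp_mul (BD (m i) _) _ IH).
elim: (m i) => [|k IHk] //=.
apply: (supp_mul (BD 1%N k) _ IHk) => p /hL hp j; by rewrite muln1.
Qed.

Lemma tev_mul (l1 l2 : seq (K * 'rV[int]_n)) (t : 'rV[K]_n) : torus t ->
  tev (lmul l1 l2) t = tev l1 t * tev l2 t.
Proof. by move=> tt; apply: ev_mul => u v; exact: characterDt. Qed.

Lemma tev_lmono m (t : 'rV[K]_n) : torus t ->
  tev (lmono L m) t = \prod_i tev (L i) t ^+ m i.
Proof.
move=> tt; have e1 : tev (lone K n) t = 1 by rewrite tevE big_seq1 /= character0 mulr1.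
rewrite /lmono; elim: (index_enum _) => [|i l IH] /=; first by rewrite big_nil.
rewrite big_cons tev_mul // IH; congr (_ * _).
by elim: (m i) => [|k IHk] //=; rewrite tev_mul // IHk exprS.
Qed.
End MonomialTerms.

Lemma mul_add1_neq0 (x : int) (e : nat) : (2 <= e)%N -> x * e%:Z + 1 != 0.
Proof.
move=> e2; apply/eqP => xe; have [x0|x0] := lerP 0 x.
  have := mulr_ge0 x0 (isT : 0 <= e%:Z); lia.
have : x * e%:Z <= - 1 * e%:Z by apply: ler_wpM2r => //; lia.
lia.
Qed.

Section Chart.
Variables (K : closedFieldType) (N : nat) (X : 'rV[K]_N -> Prop).
Variables (mul : 'rV[K]_N -> 'rV[K]_N -> 'rV[K]_N) (one : 'rV[K]_N).
Hypotheses (affX : affine_variety X) (monX : comm_monoid X mul one).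
Variables (r s : nat).
Variables (psi : 'rV[K]_(r + s) -> 'rV[K]_N) (phi : 'rV[K]_N -> 'rV[K]_(r + s)).
Variable h : {mpoly K[N]}.
Notation U := (units X mul one).
Notation V := (@GmGa K r s).
Notation M := 'rV[int]_(r + s).
Hypotheses (hU : forall x, X x -> U x <-> peval h x <> 0)
  (rpsi : regular_map V U psi) (rphi : regular_map U V phi)
  (psiK : forall g, V g -> phi (psi g) = g) (phiK : forall x, U x -> psi (phi x) = x)
  (psiM : forall g g', V g -> V g' -> psi (GmGa_mul g g') = mul (psi g) (psi g'))
  (psi1 : psi (GmGa_one K r s) = one).

Notation cstF := (@tofrac {mpoly K[r + s]} \o @mpolyC (r + s) K : {rmorphism K -> {fraction {mpoly K[r + s]}}}).

Let cX : zclosed X. Proof. by case: affX. Qed.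
Let iX : irreducible X. Proof. by case: affX. Qed.

Definition gm (i : 'I_(r + s)) := (i < r)%N.

Lemma GmGa_bset g : V g <-> bset gm g.
Proof.
split=> [[tg _] i ir|hg].
  by have := tg (Ordinal ir); rewrite mxE; congr (g _ _ <> _); apply: val_inj.
by split=> // i; rewrite mxE; apply: hg; rewrite /gm /= ltn_ord.
Qed.

Lemma torus_GmGa (t : 'rV[K]_(r + s)) : torus t -> V t.
Proof. by move=> tt; apply/GmGa_bset/torus_bset. Qed.

Lemma GmGa1 : V (GmGa_one K r s).
Proof. by split=> //; rewrite row_mxKl => i; rewrite mxE; apply/eqP; rewrite oner_eq0. Qed.

Lemma psi_in g : V g -> X (psi g). Proof. by move=> /rpsi.1 []. Qed.

Lemma reg_psi f : regular X f -> regular V (fun g => f (psi g)).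
Proof.
by apply: reg_pullback => //; split=> [g|]; [apply: psi_in|exact: rpsi.2].
Qed.

Lemma terms_of f : regular V f -> exists l : seq (K * M),
  supp (bnonneg gm) l /\ forall g, V g -> f g = tev l g.
Proof.
move=> rf; have [|S [c [us hs c0 fE]]] := @reg_bset K _ gm f.
  by apply: reg_sub rf => g /GmGa_bset.
exists [seq (c u, u) | u <- S]; split=> [p /mapP [u /hs hu ->] //|g /GmGa_bset hg].
by rewrite fE // tevE big_map.
Qed.

Lemma torus_eq f g : regular V f -> regular V g ->
  (forall t, torus t -> f t = g t) -> forall v, V v -> f v = g v.
Proof.
move=> rf rg e v /GmGa_bset hv; apply/eqP; rewrite -subr_eq0; apply/eqP.
apply: (@reg_bset_zero K _ gm (fun v => f v - g v)) hv => [|t tt]; last by rewrite e ?subrr.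
apply: (@reg_ext _ _ _ (fun v => f v + -1 * g v)) => [y _|]; first by rewrite mulN1r.
have VS y : bset gm y -> V y by move/GmGa_bset.
by apply: regD; [apply: reg_sub rf|apply: regM; [exact: reg_cst|apply: reg_sub rg]].
Qed.

Lemma reg_char_V (u : M) : bnonneg gm u -> regular V (character u).
Proof.
move=> hu; have hr := @reg_character K _ gm u hu.
by apply: (reg_sub _ hr) => g /GmGa_bset.
Qed.

Lemma psi_dense p : (forall g, V g -> peval p (psi g) = 0) ->
  forall x, X x -> peval p x = 0.
Proof.
have U1 : U one by have := rpsi.1 _ GmGa1; rewrite psi1.
have X1 := cm_one monX.
move=> hp; apply: (dense_zero iX (h := h)).
  by exists one => //; exact: (hU X1).1 U1.
by move=> x Xx /(hU Xx) Ux; rewrite -(phiK Ux); apply: hp; apply: rphi.1.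
Qed.

Lemma psi_torus_dense p : (forall t, torus t -> peval p (psi t) = 0) ->
  forall x, X x -> peval p x = 0.
Proof.
move=> hp; apply: psi_dense.
apply: (torus_eq (g := fun=> 0)) => //; last exact: reg_cst.
exact: reg_psi (@reg_poly _ _ X p).
Qed.

Lemma gchi_free (S : seq M) (a : M -> K) : uniq S ->
  \sum_(u <- S) cstF (a u) * @gchi K (r + s) u = 0 ->
  forall u, u \in S -> a u = 0.
Proof.
move=> us hS; apply: (character_free us) => t tt.
have := (generic_zero [seq (a u, u) | u <- S]).1.
by rewrite /ev big_map => /(_ hS t tt); rewrite tevE big_map.
Qed.

(** Such a function is an invertible Laurent polynomial; an exponent on the
    additive part is nonnegative, as is its opposite. *)
Lemma unit_character f : regular V f -> (forall g, V g -> f g != 0) ->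
  exists (k : K) (u : M), [/\ k != 0, forall i, ~~ gm i -> u ord0 i = 0
    & forall g, V g -> f g = k * character u g].
Proof.
move=> rf f0; have [l1 [s1 e1]] := terms_of rf.
have rV := regV f0 rf; have [l2 [s2 e2]] := terms_of rV.
pose e := ev cstF (@gchi K (r + s)).
have z0 l l' : (forall t, torus t -> tev l t = tev l' t) -> e l = e l'.
  move=> h1; apply/eqP; rewrite -subr_eq0; apply/eqP.
  have /generic_zero : forall t, torus t -> tev (l ++ lscale (-1) l') t = 0.
    by move=> t tt; rewrite /tev ev_cat ev_scale mulN1r; rewrite -!/(tev _ t) h1 ?subrr.
  by rewrite ev_cat ev_scale rmorphN1 mulN1r.
have e12 : e l1 * e l2 = 1.
  rewrite /e -ev_mul; last exact: gchiD.
  have -> : 1 = e [:: (1, 0)] by rewrite /e /ev big_seq1 /= !rmorph1 mul1r gchi0.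
  apply: z0 => t tt; have Vt := torus_GmGa tt.
  by rewrite tev_mul // -e1 // -e2 // mulfV ?f0 // tevE big_seq1 /= character0 mulr1.
have Lp l : gspan cstF (@gchi K (r + s)) (fun=> True) (e l).
  by exists l.
have [k [u [k0 ek]]] := laurent_unit (@gchiD _ _) (@gchi0 _ _) gchi_free (Lp l1) (Lp l2) e12.
have t1 t : torus t -> tev l1 t = k * character u t.
  move=> tt; have /generic_zero : e (l1 ++ [:: (- k, u)]) = 0.
    by rewrite /e ev_cat -/(e l1) ek /ev big_seq1 /= !rmorphN mulNr subrr.
  by move/(_ t tt); rewrite /tev ev_cat -/(tev l1 t) {1}/ev big_seq1 /= mulNr => /eqP; rewrite subr_eq0 => /eqP.
have t2 t : torus t -> tev l2 t = k^-1 * character (- u) t.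
  move=> tt; have Vt := torus_GmGa tt.
  by rewrite -e2 // e1 // t1 // invfM characterN.
have su : bnonneg gm u.
  apply: (tev_character (l := lscale k^-1 l1)); first exact: supp_scale.
  by move=> t tt; rewrite /tev ev_scale -/(tev l1 t) t1 // mulrA mulVf ?mul1r.
have suN : bnonneg gm (- u).
  apply: (tev_character (l := lscale k l2)); first exact: supp_scale.
  by move=> t tt; rewrite /tev ev_scale -/(tev l2 t) t2 // mulrA mulfV ?mul1r.
exists k, u; split=> // [i hi|].
  by have := su i hi; have := suN i hi; rewrite mxE; move: (u ord0 i) => x; lia.
apply: torus_eq => // [|t tt]; first by apply: regM; [exact: reg_cst|exact: reg_char_V].
by rewrite e1 ?t1 //; apply: torus_GmGa.
Qed.

Lemma peval_h_psi : exists (k : K) (u : M), [/\ k != 0, forall i, ~~ gm i -> u ord0 i = 0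
    & forall g, V g -> peval h (psi g) = k * character u g].
Proof.
apply: unit_character; first exact: reg_psi (@reg_poly _ _ X h).
by move=> g Vg; apply/eqP; apply: (hU (psi_in Vg)).1; apply: rpsi.1.
Qed.

(** When [r = 0] the only character without zeros is constant, so [h] is constant
    on the dense subset of units. *)
Lemma unipotent_units : r = 0%N -> forall x, X x -> U x.
Proof.
move=> r0 x Xx; have [k [u [k0 u0 hk]]] := peval_h_psi.
have u00 : u = 0.
  apply/rv_eq => i; rewrite u0 ?mxE // /gm -leqNgt.
  by move: (nat_of_ord i) => a; rewrite r0.
apply/(hU Xx); have := @psi_dense (h - k%:MP) _ x Xx.
rewrite /peval mevalB mevalC => e; have /eqP : (h.@[fun i => x ord0 i] - k = 0).
  by apply: e => g Vg; rewrite /peval mevalB mevalC -/(peval h _) hk // u00 character0 mulr1 subrr.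
by rewrite subr_eq0 => /eqP ->; apply/eqP.
Qed.

(** Lower bound for the dimension: the coordinates of the group, multiplied by
    a power of [h], extend to [X] and remain algebraically independent. *)
Lemma dim_ge n : has_dim X n -> (r + s <= n)%N.
Proof.
move=> [_ nX]; rewrite leqNgt; apply/negP => lt; apply: nX.
have [k [u [k0 u0 hk]]] := peval_h_psi.
have pex i : exists pe : {mpoly K[N]} * nat,
    forall x, X x -> peval h x <> 0 -> peval h x ^+ pe.2 * phi x ord0 i = peval pe.1 x.
  have [|p [e pe]] := @regular_principal _ _ X h (fun x => phi x ord0 i) cX.
    by apply: reg_sub (rphi.2 i) => x [Xx /(hU Xx)].
  by exists (p, e).
have [pe peE] := choice pex.
have [e [e2 ei]] : exists e, (2 <= e)%N /\ forall i, ((pe i).2 <= e)%N.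
  exists (2 + \max_i (pe i).2)%N; rewrite leq_addr; split=> // i.
  by apply: leq_trans (leq_addl _ _); rewrite (bigD1 i) //= leq_maxl.
pose w i : 'I_(r + s) := widen_ord lt i.
pose G (i : 'I_n.+1) x := peval (h ^+ (e - (pe (w i)).2) * (pe (w i)).1) x.
exists G; split=> [i|P hP]; first exact: reg_poly.
pose v i : M := u *+ e + delta_mx ord0 (w i).
have dg g (i : 'I_(r + s)) : character (delta_mx ord0 i) g = g ord0 i.
  rewrite /character (bigD1 i) //= mxE !eqxx expr1z big1 ?mulr1 // => j ji.
  by rewrite mxE eqxx (negbTE ji) expr0z.
have Gt i t : torus t -> G i (psi t) = k ^+ e * character (v i) t.
  move=> tt; have Vt := torus_GmGa tt.
  rewrite /G /peval mevalM -!/(peval _ _) -peE ?psiK //; first last.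
  - by apply: (hU (psi_in Vt)).1; apply: rpsi.1.
  - exact: psi_in.
  have -> : peval (h ^+ (e - (pe (w i)).2)) (psi t) = peval h (psi t) ^+ (e - (pe (w i)).2).
    by rewrite /peval rmorphXn.
  rewrite mulrA -exprD subnK // hk // exprMn.
  by rewrite /v characterDt // dg -(characterMn e (torus_defined u tt)).1 mulrA.
pose E (m : 'X_{1..n.+1}) : M := \sum_i v i *+ m i.
pose su (x : M) : int := \sum_i x ord0 i.
have suE m : su (E m) = (mdeg m)%:Z * (su u * e%:Z + 1).
  have suD : {morph su : x y / x + y}.
    by move=> x y; rewrite /su -big_split; apply: eq_bigr => i _; rewrite mxE.
  have su00 : su 0 = 0 by rewrite /su big1 // => i _; rewrite mxE.
  have suMn x a : su (x *+ a) = su x * a%:Z.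
    by elim: a => [|a IH]; rewrite ?mulr0 // mulrSr suD IH; lia.
  rewrite /E (big_morph su suD su00) mdegE -natz natr_sum mulr_suml.
  apply: eq_bigr => i _; rewrite natz suMn suD suMn.
  have -> : su (delta_mx ord0 (w i)) = 1.
    rewrite /su (bigD1 (w i)) //= mxE !eqxx big1 ?addr0 // => j ji.
    by rewrite mxE eqxx (negbTE ji).
  by rewrite mulrC.
have Einj : injective E.
  move=> m m' eE; have nz : su u * e%:Z + 1 != 0.
    exact: mul_add1_neq0.
  have dm : mdeg m = mdeg m'.
    have := congr1 su eE; rewrite !suE => /(mulIf nz) [].
    by [].
  have EE m1 : E m1 = u *+ (e * mdeg m1) + \sum_i (delta_mx ord0 (w i) : M) *+ m1 i.
    rewrite mdegE big_distrr -sumrMnr -big_split.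
    by apply: eq_bigr => i _; rewrite mulrnDl mulrnA.
  move: eE; rewrite !EE dm => /addrI e3.
  apply/mnmP => i; have := congr1 (fun x : M => x ord0 (w i)) e3.
  have cE m1 : (\sum_i (delta_mx ord0 (w i) : M) *+ m1 i) ord0 (w i) = (m1 i)%:Z.
    rewrite summxE (bigD1 i) //= big1 ?addr0.
      by rewrite mulmxnE mxE !eqxx /= mulr1n natz.
    move=> j ji; rewrite mulmxnE mxE eqxx.
    by rewrite (negbTE (_ : w i != w j)) ?mul0rn // -val_eqE eq_sym.
  by rewrite !cE => -[].
apply/mpolyP => m; rewrite mcoeff0; apply/eqP; rewrite mcoeff_eq0; apply/negP => mP.
pose S := [seq E m | m <- msupp P].
have uS : uniq S by rewrite map_inj_uniq ?msupp_uniq.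
pose c x := \sum_(m <- msupp P | E m == x) P@_m * (k ^+ e) ^+ mdeg m.
have cE m' : m' \in msupp P -> c (E m') = P@_m' * (k ^+ e) ^+ mdeg m'.
  move=> mP'; rewrite /c big_mkcond (bigD1_seq m') ?msupp_uniq //= eqxx big1 ?addr0 //.
  by move=> m2 m2m; case: eqP => // /Einj e3; rewrite e3 eqxx in m2m.
have cz : c (E m) = 0.
  apply: (character_free uS) (map_f _ mP) => t tt; have Vt := torus_GmGa tt.
  rewrite big_map -[RHS](hP (psi t) (psi_in Vt)) mevalE.
  apply: eq_big_seq => m' mP'; rewrite cE // -mulrA; congr (_ * _).
  rewrite /E character_sum // mdegE (big_morph (GRing.exp (k ^+ e)) (exprD _) (expr0 _)).
  rewrite -big_split; apply: eq_bigr => i _ /=.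
  have [-> _] := characterMn (m' i) (torus_defined (v i) tt).
  rewrite Gt // exprMn. by [].
move/eqP: cz; rewrite cE // mulf_eq0 expf_eq0 expf_eq0 (negbTE k0) !andbF orbF.
by apply/negP; rewrite -mcoeff_msupp.
Qed.

(** Upper bound for the dimension, by counting: the monomials of degree less
    than [D] in each of [n] functions are combinations of the characters in a
    box of size proportional to [D], so they are dependent when [n > r + s]. *)
Lemma dim_le n : has_dim X n -> (n <= r + s)%N.
Proof.
move=> [[f [rf fi]] _]; rewrite leqNgt; apply/negP => lt.
have [L hL] := choice (fun i => terms_of (reg_psi (rf i))).
have Lt i t : torus t -> f i (psi t) = tev (L i) t.
  by move=> tt; have [_ ->//] := hL i; apply: torus_GmGa.
pose A := (\max_(i < n) \max_(p <- L i) \max_(j < r + s) absz (p.2 ord0 j))%N.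
have AE i : supp (fun u : M => forall j, (absz (u ord0 j) <= A)%N) (L i).
  move=> p pl j; rewrite /A (bigD1 i) //=; apply: leq_trans (leq_maxl _ _).
  by rewrite (big_rem p) //= (bigD1 j) //= -maxnA leq_maxl.
pose C := (2 * (A * n) + 1)%N; pose D := (C ^ (r + s)).+1; pose R := (A * n * D)%N.
pose mm (m : {ffun 'I_n -> 'I_D}) : 'X_{1..n} := [multinom (m i : nat) | i < n].
have mmD m : (mdeg (mm m) <= n * D)%N.
  rewrite mdegE -[n in (n * D)%N]card_ord -sum_nat_const; apply: leq_sum => i _.
  by rewrite mnmE ltnW.
pose bx (b : {ffun 'I_(r + s) -> 'I_(2 * R).+1}) : M := \row_j ((b j)%:Z - R%:Z).
have bxE (l : seq (K * M)) t : supp (fun u => forall j, (absz (u ord0 j) <= R)%N) l ->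
    tev l t = \sum_b coef l (bx b) * character (bx b) t.
  move=> hl; rewrite /coef /lsum; under eq_bigr => b _ do rewrite big_mkcond mulr_suml.
  rewrite exchange_big tevE; apply: eq_big_seq => p pl /=.
  have jb j : (absz (p.2 ord0 j + R%:Z)%R < (2 * R).+1)%N by have := hl p pl j; move: (p.2 ord0 j) => x; lia.
  pose b0 : {ffun 'I_(r + s) -> 'I_(2 * R).+1} := [ffun j => Ordinal (jb j)].
  have b0E : bx b0 = p.2.
    apply/rv_eq => j; rewrite mxE ffunE /=; have := hl p pl j.
    by move: (p.2 ord0 j) => x; lia.
  rewrite (bigD1 b0) //= b0E eqxx big1 ?addr0 // => b nb.
  rewrite ifN ?mul0r //; apply: contra nb => /eqP e; apply/eqP/ffunP => j.
  apply: val_inj; have := congr1 (fun x : M => x ord0 j) (etrans b0E e).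
  by rewrite !mxE => /addIr [e3]; exact/esym.
have lm m : supp (fun u : M => forall j, (absz (u ord0 j) <= R)%N) (lmono L (mm m)).
  move=> p /(supp_lmono_bound AE) hp j; apply: leq_trans (hp j) _.
  by rewrite /R -mulnA leq_mul2l mmD orbT.
have [||c [m0 cm0] hc] := @dependent K {ffun 'I_n -> 'I_D} {ffun 'I_(r + s) -> 'I_(2 * R).+1} _
    (@torus K (r + s)) (fun m t => \prod_i f i (psi t) ^+ mm m i)
    (fun b t => character (bx b) t) (fun m b => coef (lmono L (mm m)) (bx b)).
- rewrite !card_ffun !card_ord.
  have h1 : ((2 * R).+1 ^ (r + s) <= (C * D) ^ (r + s))%N.
    have hb a b k : (a <= b)%N -> (a ^ k <= b ^ k)%N by case: k => // k ab; rewrite leq_exp2r.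
    by apply: hb; rewrite /R /C mulnDl mul1n mulnA -addn1 leq_add2l.
  apply: (leq_ltn_trans h1); rewrite expnMn.
  have h2 : (D ^ (r + s).+1 <= D ^ n)%N by rewrite leq_pexp2l.
  apply: leq_trans h2; rewrite expnS ltn_pmul2r ?expn_gt0 //.
- move=> m t tt; rewrite -bxE // tev_lmono //.
  by apply: eq_bigr => i _; rewrite Lt.
pose P : {mpoly K[n]} := \sum_m c m *: 'X_[mm m].
have P0 : P = 0.
  apply: fi => x Xx.
  have [q hq] : exists q, forall x, X x -> P.@[fun i => f i x] = peval q x.
    by apply: (regular_closed cX); apply: reg_meval.
  rewrite hq //; apply: psi_torus_dense Xx => t tt.
  rewrite -hq; last exact/psi_in/torus_GmGa.
  rewrite -[RHS](hc t tt) raddf_sum; apply: eq_bigr => m _.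
  by rewrite /= mevalZ mevalX.
case/eqP: cm0; have := congr1 (mcoeff (mm m0)) P0; rewrite mcoeff0 raddf_sum /= => e.
rewrite -[RHS]e (bigD1 m0) //= mcoeffZ mcoeffX eqxx mulr1 big1 ?addr0 // => m mm0.
rewrite mcoeffZ mcoeffX (negbTE (_ : mm m != mm m0)) ?mulr0 //.
apply: contra mm0 => /eqP e'; apply/eqP/ffunP => i; apply: val_inj.
by have := congr1 (fun x : 'X_{1..n} => x i) e'; rewrite !mnmE.
Qed.

(** * The toric structure of a monoid *)

Definition extf (p : 'rV[K]_(r + s) -> K) :=
  exists2 f, regular X f & forall g, V g -> f (psi g) = p g.

Lemma extf_eq p q : (forall g, V g -> p g = q g) -> extf p -> extf q.
Proof. by move=> e [f rf hf]; exists f => // g Vg; rewrite hf ?e. Qed.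

Lemma extf_sum (I : Type) (l : seq I) (Q : pred I) (p : I -> 'rV[K]_(r + s) -> K) :
  (forall i, Q i -> extf (p i)) -> extf (fun g => \sum_(i <- l | Q i) p i g).
Proof.
move=> hp; elim: l => [|i l IH].
  by exists (fun=> 0) => [|g _]; [exact: reg_cst|rewrite big_nil].
case: IH => f rf hf; have [Qi|nQ] := boolP (Q i); last first.
  by exists f => // g Vg; rewrite hf // big_cons (negbTE nQ).
have [f' rf' hf'] := hp i Qi; exists (fun x => f' x + f x) => [|g Vg]; first exact: regD.
by rewrite big_cons Qi hf // hf'.
Qed.

Lemma extfZ c p : extf p -> extf (fun g => c * p g).
Proof.
move=> [f rf hf]; exists (fun x => c * f x) => [|g Vg]; last by rewrite hf.
by apply: regM => //; exact: reg_cst.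
Qed.

Lemma GmGa_mulV g g' : V g -> V g' -> V (GmGa_mul g g').
Proof.
move=> [tg _] [tg' _]; split=> //; rewrite row_mxKl; exact: torus_tmul.
Qed.

Lemma extf_translate g0 p : V g0 -> extf p -> extf (fun g => p (GmGa_mul g0 g)).
Proof.
move=> V0 [f rf hf]; exists (fun x => f (mul (psi g0) x)) => [|g Vg].
  by apply: (reg_mulr affX monX (psi_in V0) rf).
by rewrite -psiM // hf //; apply: GmGa_mulV.
Qed.

(** By [isolate], because the translates of a function that extends to [X]
    extend as well. *)
Lemma extf_isolate (T : Type) (Q : T -> Prop) (tr : T -> 'rV[K]_(r + s)) k
    (a : 'I_k -> T -> K) (G : 'I_k -> 'rV[K]_(r + s) -> K) p :
  (forall c : 'I_k -> K, (forall t, Q t -> \sum_i c i * a i t = 0) -> forall i, c i = 0) ->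
  (forall t, Q t -> V (tr t)) -> extf p ->
  (forall t g, Q t -> V g -> p (GmGa_mul (tr t) g) = \sum_i a i t * G i g) ->
  forall i, extf (G i).
Proof.
move=> ia Vt ep hF i.
have [t [d [Qt hG]]] := @isolate K T _ Q V k a G (fun t g => p (GmGa_mul (tr t) g)) ia hF i.
apply: (extf_eq (p := fun g => \sum_j d j * p (GmGa_mul (tr (t j)) g))).
  by move=> g Vg; rewrite hG.
apply: extf_sum => j _; apply/extfZ/extf_translate => //; exact: Vt.
Qed.

Hypothesis charK : [pchar K] =i pred0.

(** The coefficients of the powers of [b] in [q (x + b)] are the divided
    derivatives of [q].  In characteristic zero they have all degrees up to that
    of [q], so they span all the powers in question. *)
Lemma extf_poly (v : 'rV[int]_r) (q : {poly K}) : (0 < s <= 1)%N ->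
  extf (fun g => character v (lsubmx g) * q.[last_coord g]) ->
  forall i, (i < size q)%N -> extf (fun g => character v (lsubmx g) * last_coord g ^+ i).
Proof.
move=> /andP [s0 s1] eq; have eN j : (j < size q)%N ->
    extf (fun g => character v (lsubmx g) * q^`N(j).[last_coord g]).
  move=> jq; apply: (@extf_isolate 'rV[K]_s (@torus K s) (fun b => row_mx (const_mx 1) b) (size q)
    (fun i b => last_coord (row_mx (const_mx 1 : 'rV_r) b) ^+ i)
    (fun i g => character v (lsubmx g) * q^`N(i).[last_coord g]) _ _ _ eq _ (Ordinal jq)).
  - move=> c hc; apply: (@character_indep K s (size q) (fun i => const_mx (i : nat)%:Z)).
      move=> i1 i2 /rv_eq /(_ (Ordinal s0)); rewrite !mxE => -[e]; exact: val_inj.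
    move=> t tt; rewrite -[RHS](hc t tt); apply: eq_bigr => i _; congr (_ * _).
    by rewrite last_power //; move: s0 s1; case: (s) => [|[|]].
  - by move=> t _; split=> //; rewrite row_mxKl => l; rewrite mxE; apply/eqP; rewrite oner_eq0.
  - move=> t g _ _; rewrite lsub_mul last_mul row_mxKl character_tmul character_one mul1r.
    rewrite addrC nderiv_taylor; last exact: mulrC.
    by rewrite mulr_sumr; apply: eq_bigr => l _; rewrite mulrCA mulrC mulrA mulrAC; ring.
elim/ltn_ind => i IH iq.
have j1 : ((size q).-1 - i < size q)%N by case: (size q) iq => // a; lia.
set j := (_ - _)%N in j1.
pose r' := q^`N(j).
have ri : r'`_i != 0.
  rewrite coef_nderivn; have -> : (j + i = (size q).-1)%N by rewrite /j subnK // -ltnS prednK // (leq_trans _ iq).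
  rewrite -mulr_natr mulf_neq0 //; last by rewrite ((pcharf0P K).1 charK) -lt0n bin_gt0 leq_subr.
  by rewrite -/(lead_coef q) lead_coef_eq0 -size_poly_eq0 -lt0n (leq_trans _ iq).
have rE g : r'.[last_coord g] = r'`_i * last_coord g ^+ i + \sum_(l < i) r'`_l * last_coord g ^+ l.
  rewrite (@horner_coef_wide _ i.+1) ?big_ord_recr 1?addrC //=.
  apply/leq_sizeP => l il; rewrite coef_nderivn nth_default ?mul0rn //.
  by rewrite /j; move: il iq; case: (size q) => //= a; lia.
apply: (extf_eq (p := fun g => (r'`_i)^-1 * (character v (lsubmx g) * r'.[last_coord g]) +
    \sum_(l < i) (- (r'`_i)^-1 * r'`_l) * (character v (lsubmx g) * last_coord g ^+ l))).
  move=> g _; rewrite rE; set x := character v _; set B := \sum_(l < i) r'`_l * _.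
  have -> : \sum_(l < i) (- (r'`_i)^-1 * r'`_l) * (x * last_coord g ^+ l) = - (r'`_i)^-1 * x * B.
    by rewrite /B mulr_sumr; apply: eq_bigr => l _; ring.
  by field.
have [f rf hf] := eN j j1.
have [|f' rf' hf'] := @extf_sum 'I_i (index_enum _) predT (fun l g => (- (r'`_i)^-1 * r'`_l) * (character v (lsubmx g) * last_coord g ^+ l)) _.
  by move=> l _; apply/extfZ/IH => //; apply: ltn_trans iq.
exists (fun x => (r'`_i)^-1 * f x + f' x) => [|g Vg]; last by rewrite hf // hf'.
by apply: regD => //; apply: regM => //; exact: reg_cst.
Qed.

(** Translations by the torus separate the parts of a function that belong to
    different characters of the torus, and [extf_poly] separates the powers of
    the additive coordinate. *)
Lemma extf_weights f : (s <= 1)%N -> regular X f ->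
  exists l, supp (fun u => extf (character u)) l /\ forall g, V g -> f (psi g) = tev l g.
Proof.
move=> s1 rf.
have [|S [c [us hs c0 fE]]] := @reg_bset K _ gm (fun g => f (psi g)).
  by apply: (reg_sub _ (reg_psi rf)) => g /GmGa_bset.
exists [seq (c u, u) | u <- S]; split; last first.
  by move=> g /GmGa_bset hg; rewrite fE // tevE big_map.
move=> p /mapP [u uS ->] /=.
pose C := undup [seq lsubmx u | u <- S].
pose q (v : 'rV[int]_r) : {poly K} := \sum_(u <- S | lsubmx u == v) c u *: 'X^(absz (last_coord u)).
have qE v g : (q v).[last_coord g] = \sum_(u <- S | lsubmx u == v) c u * last_coord g ^+ absz (last_coord u).
  by rewrite horner_sum; apply: eq_bigr => w _; rewrite hornerZ hornerXn.
have lu : lsubmx u \in C by rewrite mem_undup map_f.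
have iu : (index (lsubmx u) C < size C)%N by rewrite index_mem.
have ev : extf (fun g => character (lsubmx u) (lsubmx g) * (q (lsubmx u)).[last_coord g]).
  have := @extf_isolate 'rV[K]_r (@torus K r) (fun t => row_mx t 0) (size C)
    (fun i t => character (nth 0 C i) t)
    (fun i g => character (nth 0 C i) (lsubmx g) * (q (nth 0 C i)).[last_coord g])
    (fun g => f (psi g)) _ _ _ _ (Ordinal iu).
  rewrite /= nth_index //; apply.
  - move=> d; apply: character_indep => i j /eqP; rewrite nth_uniq ?undup_uniq //.
    by move/eqP/val_inj.
  - by move=> t tt; split=> //; rewrite row_mxKl.
  - by exists f.
  move=> t g tt Vg; have Vt : V (row_mx t 0) by split=> //; rewrite row_mxKl.
  rewrite fE; last by apply/GmGa_bset/GmGa_mulV.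
  rewrite -(big_mkord predT (fun i => character (nth 0 C i) t * (character (nth 0 C i) (lsubmx g) * (q (nth 0 C i)).[last_coord g]))).
  rewrite -(big_nth 0 predT (fun v => character v t * (character v (lsubmx g) * (q v).[last_coord g]))).
  under [RHS]eq_bigr => v _ do rewrite qE mulrA mulr_sumr big_mkcond.
  rewrite exchange_big; apply: eq_big_seq => w wS /=.
  have wC : lsubmx w \in C by rewrite mem_undup map_f.
  rewrite (bigD1_seq (lsubmx w)) ?undup_uniq //= eqxx big1 ?addr0; last first.
    by move=> v; rewrite eq_sym => /negbTE ->.
  rewrite (character_last _ _ s1) lsub_mul last_mul row_mxKl character_tmul.
  rewrite [last_coord (row_mx _ _)]big1 ?add0r; last by move=> l _; rewrite row_mxEr mxE.
  by rewrite -{1}(gez0_abs (last_nonneg (hs w wS))) -exprnP mulrCA.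
have qcoef : (q (lsubmx u))`_(absz (last_coord u)) = c u.
  rewrite coef_sum big_mkcond (bigD1_seq u) //= eqxx coefZ coefXn eqxx mulr1.
  rewrite -[RHS]addr0; congr (_ + _); rewrite big_seq_cond big1 // => w /andP [wS wu].
  case: eqP => // lw; rewrite coefZ coefXn; case: eqP => e; last by rewrite mulr0.
  case/eqP: wu; apply: row_last_eq => //.
  by rewrite -(gez0_abs (last_nonneg (hs w wS))) -(gez0_abs (last_nonneg (hs u uS))) e.
have sq : (absz (last_coord u) < size (q (lsubmx u)))%N.
  rewrite ltnNge; apply/negP => /leq_sizeP /(_ _ (leqnn _)) /eqP; rewrite qcoef.
  by rewrite (negbTE (c0 u uS)).
have ext0 : extf (fun g => character (lsubmx u) (lsubmx g) * last_coord g ^+ absz (last_coord u)).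
  have [s0|s0] := posnP s; last by apply: extf_poly sq => //; rewrite s0.
  have l0 (R : nmodType) (w : 'rV[R]_(r + s)) : last_coord w = 0.
    by rewrite /last_coord big1 // => i; have := ltn_ord i; rewrite {2}s0.
  apply: (extf_eq (p := fun g => (c u)^-1 * (character (lsubmx u) (lsubmx g) * (q (lsubmx u)).[last_coord g]))).
    move=> g _; rewrite !l0 /= expr0 horner_coef0 mulr1.
    by have := qcoef; rewrite l0 /= => ->; rewrite mulrCA mulVf ?mulr1 // c0.
  exact: extfZ.
apply: extf_eq ext0 => g _; rewrite (character_last _ _ s1).
by rewrite -{2}(gez0_abs (last_nonneg (hs u uS))).
Qed.

(** Here the group is all of [X]. *)
Lemma extf_unipotent u : r = 0%N -> bnonneg gm u -> extf (character u).
Proof.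
move=> r0 hu; have XU := unipotent_units r0.
have nu : nonneg u.
  by move=> i; apply: hu; rewrite /gm -leqNgt; move: (nat_of_ord i) => a; rewrite r0.
exists (fun x => ('X_[mabs u] : {mpoly K[r + s]}).@[fun i => phi x ord0 i]).
  apply: (reg_sub XU); apply: reg_meval => i; exact: rphi.2.
by move=> g Vg; rewrite psiK // -character_mrow mabs_mrow.
Qed.

Lemma weights_extend f : (s <= 1)%N \/ r = 0%N -> regular X f ->
  exists l, supp (fun u => extf (character u)) l /\ forall g, V g -> f (psi g) = tev l g.
Proof.
case=> [s1|r0] rf; first exact: extf_weights.
have [l [hl fE]] := terms_of (reg_psi rf); exists l; split=> // p pl.
by apply: extf_unipotent => //; apply: hl.
Qed.

Lemma psi_eq f g : regular X f -> regular X g ->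
  (forall v, V v -> f (psi v) = g (psi v)) -> forall x, X x -> f x = g x.
Proof.
move=> /(regular_closed cX) [p fp] /(regular_closed cX) [q gq] e x Xx.
apply/eqP; rewrite -subr_eq0 fp // gq // /peval -mevalB; apply/eqP.
apply: (psi_dense (p := p - q)) => // v Vv.
by rewrite /peval mevalB -!/(peval _ _) -fp -?gq ?e ?subrr //; apply: psi_in.
Qed.

Lemma torus_open : exists Q : {mpoly K[N]}, forall x, X x ->
  peval Q x <> 0 <-> exists2 t, torus t & x = psi t.
Proof.
have pex i : exists pe : {mpoly K[N]} * nat,
    forall x, X x -> peval h x <> 0 -> peval h x ^+ pe.2 * phi x ord0 i = peval pe.1 x.
  have [|p [e pe]] := @regular_principal _ _ X h (fun x => phi x ord0 i) cX.
    by apply: reg_sub (rphi.2 i) => x [Xx /(hU Xx)].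
  by exists (p, e).
have [pe peE] := choice pex.
exists (h * \prod_i (pe i).1) => x Xx.
have QE : peval (h * \prod_i (pe i).1) x = peval h x * \prod_i peval (pe i).1 x.
  by rewrite /peval mevalM rmorph_prod.
rewrite QE; split=> [/eqP|[t tt xt]].
  rewrite mulf_eq0 negb_or => /andP [/eqP hx /prodf_neq0 px].
  have Ux := (hU Xx).2 hx; exists (phi x); last by rewrite phiK.
  move=> i p0; have := px i isT; rewrite -peE // p0 mulr0.
  by rewrite eqxx.
have Vt := torus_GmGa tt; have hx : peval h x <> 0.
  by apply: (hU Xx).1; rewrite xt; apply: rpsi.1.
apply/eqP; rewrite mulf_neq0 //; first exact/eqP.
apply/prodf_neq0 => i _; rewrite -peE // mulf_neq0 ?expf_neq0 //; first exact/eqP.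
by rewrite xt psiK //; apply/eqP.
Qed.

Lemma tmul_GmGa t g : torus t -> V g -> V (tmul t g).
Proof.
move=> tt /GmGa_bset hg; apply/GmGa_bset => i hi; rewrite mxE; apply/eqP.
by rewrite mulf_neq0 //; apply/eqP; [exact: tt|exact: hg].
Qed.

Lemma tmul1 n (t : 'rV[K]_n) : tmul t (const_mx 1) = t.
Proof. by apply/rv_eq => i; rewrite !mxE mulr1. Qed.

(** The action multiplies monomials in the coordinates of the group by
    constants, so it extends to [X] because the monomials occurring in the
    coordinates of [X] do.  The open orbit consists of the units whose additive
    coordinates do not vanish. *)
Lemma monoid_toric : (s <= 1)%N \/ r = 0%N ->
  exists act, toric_structure X act (psi (const_mx 1)) /\
    forall t g, torus t -> V g -> act t (psi g) = psi (tmul t g).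
Proof.
move=> hrs.
have [L hL] := choice (fun j => weights_extend hrs (@reg_coord _ _ X j)).
have eex u : exists f, extf (character u) -> regular X f /\
    forall g, V g -> f (psi g) = character u g.
  have [[f rf hf]|ne] := pselect (extf (character u)); first by exists f.
  by exists (fun=> 0) => /ne.
have [e eE] := choice eex.
have re j p : p \in L j -> regular X (e p.2).
  by move=> pl; have [Lj _] := hL j; have [] := eE _ (Lj p pl).
pose act t x : 'rV[K]_N := \row_j \sum_(p <- L j) p.1 * character p.2 t * e p.2 x.
have actE t g : torus t -> V g -> act t (psi g) = psi (tmul t g).
  move=> tt Vg; apply/rv_eq => j; have [Lj LE] := hL j.
  rewrite mxE LE; last exact: tmul_GmGa.
  rewrite tevE; apply: eq_big_seq => p pl.
  by have [_ ->//] := eE _ (Lj p pl); rewrite character_tmul mulrA.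
have ract t j : regular X (fun x => act t x ord0 j).
  have r1 : regular X (fun x => \sum_(p <- L j | p \in L j) p.1 * character p.2 t * e p.2 x).
    by apply: reg_sum => p pl; apply: regM; [exact: reg_cst|exact: re pl].
  by apply: (reg_ext _ r1) => x _; rewrite mxE big_seq.
have Xact t x : torus t -> X x -> X (act t x).
  move=> tt Xx; apply: (closed_pts cX) => p pX.
  have [q hq] : exists q, forall x, X x -> peval p (act t x) = peval q x.
    by apply: (regular_closed cX); apply: reg_meval.
  rewrite hq //; apply: psi_dense Xx => g Vg.
  rewrite -hq ?actE //; last exact: psi_in.
  by apply: pX; apply: psi_in; apply: tmul_GmGa.
have T1 := @torus1 K (r + s); have V1 := torus_GmGa T1.
exists act; split=> //; split.
- split.
  + split=> [z [tz Xz]|j]; first exact: Xact.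
    have r1 : regular (prodv (@torus K (r + s)) X) (fun z => \sum_(p <- L j | p \in L j)
        p.1 * character p.2 (lsubmx z) * e p.2 (rsubmx z)).
      apply: reg_sum => p pl; apply: regM; first apply: regM; first exact: reg_cst.
        apply: (@reg_comp _ _ _ _ (@torus K (r + s)) (fun z => lsubmx z) (character p.2)
          (fun i => 'X_(lshift N i))) => [z [] //|z _ i|]; first by rewrite pevalX mxE.
        apply: (reg_sub _ (@reg_character K _ predT p.2 _)) => // t tt i _; exact: tt.
      apply: (@reg_comp _ _ _ _ X (fun z => rsubmx z) (e p.2)
          (fun i => 'X_(rshift (r + s) i))) => [z [] //|z _ i|]; first by rewrite pevalX mxE.
      exact: re pl.
    by apply: (reg_ext _ r1) => z _; rewrite mxE big_seq.
  + move=> x Xx; apply/rv_eq => j.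
    apply: (psi_eq (f := fun x => act (const_mx 1) x ord0 j) (g := fun x => x ord0 j)) Xx => //.
      exact: reg_coord.
    move=> g Vg; rewrite actE //; congr (psi _ _ _).
    by apply/rv_eq => i; rewrite !mxE mul1r.
  + move=> t t' x tt tt' Xx; apply/rv_eq => j.
    have rr : regular_map X X (act t') by split=> [y|i]; [exact: Xact|exact: ract].
    apply: (psi_eq (f := fun x => act (tmul t t') x ord0 j)
      (g := fun x => act t (act t' x) ord0 j)) Xx => //.
      exact: (reg_pullback (f := fun x => act t x ord0 j) cX rr).
    move=> g Vg; have ttt := torus_tmul tt tt'.
    rewrite !actE //; last exact: tmul_GmGa.
    by congr (psi _ _ _); apply/rv_eq => i; rewrite !mxE mulrA.
- move=> t tt ht; have := ht _ (psi_in V1); rewrite actE // tmul1 => /(congr1 phi).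
  by rewrite !psiK //; apply: torus_GmGa.
- exact: psi_in.
have [Q hQ] := torus_open; exists (fun q => q = Q) => x; split=> [[t [tt ->]]|[Xx /existsNP [q /not_implyP [-> hq]]]].
  rewrite actE // tmul1; have Xt := psi_in (torus_GmGa tt); split=> // z.
  by have := (hQ _ Xt).2 (ex_intro2 _ _ t tt erefl); apply; apply: z.
by have [t tt ->] := (hQ x Xx).1 hq; exists t; rewrite actE // tmul1.
Qed.

Section MonoidToric.
Variable act : 'rV[K]_(r + s) -> 'rV[K]_N -> 'rV[K]_N.
Hypothesis actE : forall t g, torus t -> V g -> act t (psi g) = psi (tmul t g).

Lemma is_chi_psi u f : is_chi X act (psi (const_mx 1)) u f ->
  bnonneg gm u /\ forall g, V g -> f (psi g) = character u g.
Proof.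
move=> [rf hf]; have V1 := torus_GmGa (@torus1 K (r + s)).
have ft t : torus t -> f (psi t) = character u t.
  by move=> tt; rewrite -hf // actE // tmul1.
have su : bnonneg gm u.
  have [l [hl fE]] := terms_of (reg_psi rf).
  apply: (tev_character hl) => t tt; rewrite -fE ?ft //; exact: torus_GmGa.
split=> //; apply: torus_eq => //; [exact: reg_psi|exact: reg_char_V].
Qed.

Lemma extf_is_chi u : extf (character u) -> exists f, is_chi X act (psi (const_mx 1)) u f.
Proof.
move=> [f rf hf]; exists f; split=> // t tt.
by rewrite actE ?tmul1 ?hf //; apply: torus_GmGa => //; exact: torus1.
Qed.

Lemma is_chi_shift u f k : (s <= 1)%N -> is_chi X act (psi (const_mx 1)) u f ->
  (k <= absz (last_coord u))%N ->
  exists f', is_chi X act (psi (const_mx 1)) (u - delta_last r s *+ k) f'.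
Proof.
move=> s1 hf ka; have [su fE] := is_chi_psi hf; have u0 := last_nonneg su.
have [s0|s0] := posnP s.
  have -> : delta_last r s *+ k = 0.
    apply/rv_eq => i; rewrite mulmxnE !mxE; case: splitP => j _; rewrite mxE ?mul0rn //.
    by have := ltn_ord j; rewrite {2}s0.
  by rewrite subr0; exists f.
apply: extf_is_chi.
have eu : extf (fun g => character (lsubmx u) (lsubmx g) * ('X^(absz (last_coord u))).[last_coord g]).
  case: hf => rf _; exists f => // g Vg; rewrite fE // (character_last _ _ s1) hornerXn.
  by rewrite -{1}(gez0_abs u0).
have := @extf_poly _ _ _ eu (absz (last_coord u) - k)%N; rewrite s0 s1 size_polyXn ltnS leq_subr.
move=> /(_ isT isT); apply: extf_eq => g _.
rewrite (character_last _ _ s1) lsub_shift last_shift // exprnP -subzn // gez0_abs //.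
Qed.

Lemma chi_comult u f (F : nat -> 'rV[K]_N -> K) : (s <= 1)%N ->
  is_chi X act (psi (const_mx 1)) u f ->
  (forall k, (k <= absz (last_coord u))%N ->
     is_chi X act (psi (const_mx 1)) (u - delta_last r s *+ k) (F k)) ->
  let a := absz (last_coord u) in forall x y, X x -> X y ->
  f (mul x y) = \sum_(j < a.+1) 'C(a, j)%:R * (F (a - j)%N x * F j y).
Proof.
move=> s1 hf hF a x y Xx Xy; have [su fE] := is_chi_psi hf.
have rF k : (k <= a)%N -> regular X (F k) by move=> ka; have [] := hF k ka.
have FE k g : (k <= a)%N -> V g -> F k (psi g) = character (u - delta_last r s *+ k) g.
  by move=> ka; have [_] := is_chi_psi (hF k ka); apply.
have ja (j : 'I_a.+1) : (j <= a)%N by rewrite -ltnS.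
have step g : V g -> forall z, X z ->
    f (mul (psi g) z) = \sum_(j < a.+1) 'C(a, j)%:R * (F (a - j)%N (psi g) * F j z).
  move=> Vg; apply: psi_eq.
  - by apply: (reg_mulr affX monX (psi_in Vg)); case: hf.
  - apply: reg_sum => j _; apply: regM; first exact: reg_cst.
    by apply: regM; [exact: reg_cst|exact: rF].
  move=> g' Vg'; rewrite -psiM // fE; last exact: GmGa_mulV.
  rewrite character_GmGa_mul //; last exact: last_nonneg.
  by apply: eq_bigr => j _; rewrite !FE ?leq_subr.
apply: (psi_eq (f := fun x => f (mul x y))
  (g := fun x => \sum_(j < a.+1) 'C(a, j)%:R * (F (a - j)%N x * F j y))) Xx => [||g Vg].
- by apply: (reg_mull affX monX Xy); case: hf.
- apply: reg_sum => j _; apply: regM; first exact: reg_cst.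
  by apply: regM; [apply: rF; exact: leq_subr|exact: reg_cst].
exact: step.
Qed.

Lemma toric_data_shift omega2 chi2 m2 (P2 : 'M[int]_(r + s, m2)) u : (s <= 1)%N ->
  toric_data X act (psi (const_mx 1)) omega2 chi2 P2 -> omega2 (toQ u) ->
  let a := absz (last_coord u) in
  [/\ 0 <= last_coord u,
      forall k, (k <= a)%N -> omega2 (toQ (u - delta_last r s *+ k))
    & forall x y, X x -> X y -> chi2 u (mul x y) = \sum_(j < a.+1) 'C(a, j)%:R *
        (chi2 (u - delta_last r s *+ (a - j)) x * chi2 (u - delta_last r s *+ j) y)].
Proof.
move=> s1 dat2 Su a; have hf := td_chi (td_dec dat2) Su.
have [su _] := is_chi_psi hf.
have Sk k : (k <= a)%N -> omega2 (toQ (u - delta_last r s *+ k)).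
  by move=> ka; apply/(td_lattice (td_dec dat2)); apply: is_chi_shift hf ka.
split=> [||x y Xx Xy] //; first exact: last_nonneg.
apply: (chi_comult (F := fun k => chi2 (u - delta_last r s *+ k)) s1 hf) => // k ka.
exact: (td_chi (td_dec dat2) (Sk k ka)).
Qed.

Lemma unipotent_weights omega2 chi2 m2 (P2 : 'M[int]_(r + s, m2)) u : r = 0%N ->
  toric_data X act (psi (const_mx 1)) omega2 chi2 P2 ->
  omega2 (toQ u) <-> bnonneg gm u.
Proof.
move=> r0 dat2; split=> [Su|hu].
  by have [] := is_chi_psi (td_chi (td_dec dat2) Su).
by apply/(td_lattice (td_dec dat2)); apply: extf_is_chi; apply: extf_unipotent.
Qed.
End MonoidToric.
End Chart.

(** An isomorphism [psi] from a standard group to the group of units, with its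
    inverse [phi], and an equation [h] of the set of other points. *)
Record group_chart (K : closedFieldType) N (X : 'rV[K]_N -> Prop) mul one r s
    (psi : 'rV[K]_(r + s) -> 'rV[K]_N) (phi : 'rV[K]_N -> 'rV[K]_(r + s)) (h : {mpoly K[N]}) : Prop :=
  GroupChart {
    gc_open : forall x, X x -> units X mul one x <-> peval h x <> 0;
    gc_psi : regular_map (@GmGa K r s) (units X mul one) psi;
    gc_phi : regular_map (units X mul one) (@GmGa K r s) phi;
    gc_psiK : forall g, GmGa g -> phi (psi g) = g;
    gc_phiK : forall x, units X mul one x -> psi (phi x) = x;
    gc_mul : forall g g', GmGa g -> GmGa g' ->
      psi (GmGa_mul g g') = mul (psi g) (psi g');
    gc_one : psi (GmGa_one K r s) = one }.

Lemma group_chart_exists (K : closedFieldType) N (X : 'rV[K]_N -> Prop) mul one r n :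
  affine_variety X -> has_dim X n -> comm_monoid X mul one -> has_rank X mul one r ->
  exists s psi phi h, @group_chart K N X mul one r s psi phi h /\ n = (r + s)%N.
Proof.
move=> affX dimX monX [s [phi [[psi [rphi rpsi [phiK psiK]]] phiM phi1]]].
have [h hU] := units_open affX monX.
have X1 := cm_one monX.
have U1 : units X mul one one.
  by split=> //; exists one; rewrite (cm_unit monX X1).1.
have psiM g g' : GmGa g -> GmGa g' -> psi (GmGa_mul g g') = mul (psi g) (psi g').
  move=> Vg Vg'; have Ug := rpsi.1 g Vg; have Ug' := rpsi.1 g' Vg'.
  have Um : units X mul one (mul (psi g) (psi g')).
    have [Xg [a [Xa ga _]]] := Ug; have [Xg' [b [Xb gb _]]] := Ug'.
    have Xm := mul_in monX; have mc := cm_comm monX; have ma := cm_assoc monX.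
    have e1 : mul (mul (psi g) (psi g')) (mul b a) = one.
      by rewrite -ma ?(ma (psi g') b a) ?gb ?(cm_unit monX Xa).1 //; apply: Xm.
    split; first exact: Xm.
    exists (mul b a); split=> //; first exact: Xm.
    by rewrite mc //; apply: Xm.
  by rewrite -[RHS]phiK // phiM // !psiK.
have psi1 : psi (GmGa_one K r s) = one by rewrite -phi1 phiK.
exists s, psi, phi, h; split; first by split.
apply/eqP; rewrite eqn_leq; apply/andP; split.
  exact: (dim_le affX monX hU rpsi rphi phiK psi1 dimX).
exact: (dim_ge affX hU rpsi rphi psiK dimX).
Qed.

(** * Monoids from Demazure roots *)

Lemma last_coord1 r (u : 'rV[int]_(r + 1)) : last_coord u = u ord0 (rshift r ord0).
Proof. by rewrite /last_coord big_ord1. Qed.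

(** The Smith normal form of [p] makes it a coordinate function; a transvection
    then turns [e] into the opposite of the corresponding basis vector. *)
Lemma root_matrix r (p e : 'rV[int]_(r + 1)) : pairing p e = -1 ->
  exists C : 'M[int]_(r + 1), [/\ C \in unitmx,
    forall u, last_coord (u *m C) = pairing p u & e *m C = - delta_last r 1].
Proof.
move=> pe; have [L uL [R uR [d _ pE]]] := int_Smith_normal_form p^T.
have n0 : (0 < r + 1)%N by rewrite addn1.
pose i0 : 'I_(r + 1) := Ordinal n0; pose l := rshift r (ord0 : 'I_1).
pose c := d`_0 * R ord0 ord0.
have pc u : pairing p u = (u *m L) ord0 i0 * c.
  have -> : pairing p u = (u *m p^T) ord0 ord0.
    by rewrite mxE; apply: eq_bigr => i _; rewrite mxE mulrC.
  rewrite pE !mulmxA [LHS]mxE big_ord1 /c mulrA; congr (_ * _).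
  rewrite mxE (bigD1 i0) //= mxE /= mulr1n big1 ?addr0 // => i ii0.
  by rewrite mxE /= (negbTE (_ : (i : nat) != 0%N)) ?mulr0n ?mulr0 // -[0%N]/(val i0) val_eqE.
have cc : c * c = 1.
  have : `|c| = 1 by apply: (@int_factor_one c ((e *m L) ord0 i0)); rewrite mulrC -pc pe normrN1.
  by move=> c1; have [->|->] : c = 1 \/ c = -1 by move: c1; generalize c; lia.
pose C1 := c *: xcol i0 l L.
have uC1 : C1 \in unitmx.
  have uc : c \is a GRing.unit by apply/unitrP; exists c.
  by rewrite /C1 unitmxZ // xcolE unitmx_mul uL unitmx_perm.
have lC1 u : (u *m C1) ord0 l = pairing p u.
  rewrite pc /C1 -scalemxAr mxE mulrC; congr (_ * _).
  by rewrite !mxE; apply: eq_bigr => i _; rewrite mxE perm.tpermR.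
pose f := e *m C1 + delta_last r 1.
have fl : f ord0 l = 0.
  by rewrite mxE lC1 pe /delta_last row_mxEr mxE addNr.
pose T : 'M[int]_(r + 1) := 1%:M + delta_mx l (ord0 : 'I_1) *m f.
pose T' : 'M[int]_(r + 1) := 1%:M - delta_mx l (ord0 : 'I_1) *m f.
have fd : f *m delta_mx l (ord0 : 'I_1) = 0.
  apply/matrixP => i j; rewrite mxE (bigD1 l) //= ord1 fl mul0r add0r big1 ?mxE // => k kl.
  by rewrite [delta_mx _ _ _ _]mxE (negbTE kl) mulr0.
have TT : T *m T' = 1%:M.
  rewrite /T /T' mulmxDl mul1mx mulmxBr mulmx1 -mulmxA (mulmxA f) fd mul0mx mulmx0 subr0.
  by rewrite subrK.
have [uT _] := mulmx1_unit TT.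
have CE (u : 'rV[int]_(r + 1)) : u *m (C1 *m T) = u *m C1 + pairing p u *: f.
  rewrite mulmxA mulmxDr mulmx1 mulmxA; congr (_ + _).
  have -> : u *m C1 *m delta_mx l (ord0 : 'I_1) = (pairing p u)%:M.
    apply/matrixP => i j; rewrite mxE (bigD1 l) //= [delta_mx _ _ _ _]mxE !ord1 !eqxx mulr1.
    rewrite lC1 big1 ?addr0 ?mxE ?eqxx // => k kl.
    by rewrite [delta_mx _ _ _ _]mxE (negbTE kl) mulr0.
  by rewrite mul_scalar_mx.
exists (C1 *m T); split; first by rewrite unitmx_mul uC1.
  by move=> u; rewrite CE last_coord1 -/l mxE [X in _ + X]mxE fl mulr0 addr0 lC1.
by rewrite CE pe /f scaleN1r opprD addrA subrr add0r.
Qed.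

Lemma bnonneg_last r s (u : 'rV[int]_(r + s)) : (s <= 1)%N -> 0 <= last_coord u ->
  bnonneg (@gm r s) u.
Proof.
case: s u => [|[|//]] u _; rewrite /last_coord ?big_ord0 ?big_ord1 => h i.
  by rewrite /gm; have := ltn_ord i; rewrite {2}addn0 => ->.
rewrite /gm -leqNgt => ri; suff -> : i = rshift r ord0 by [].
by apply: val_inj => /=; have := ltn_ord i; lia.
Qed.

Lemma GmGa_mulC (K : closedFieldType) r s (g g' : 'rV[K]_(r + s)) :
  GmGa_mul g g' = GmGa_mul g' g.
Proof. by rewrite /GmGa_mul tmulC addrC. Qed.

Lemma GmGa_mulA (K : closedFieldType) r s (g g' g'' : 'rV[K]_(r + s)) :
  GmGa_mul g (GmGa_mul g' g'') = GmGa_mul (GmGa_mul g g') g''.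
Proof.
rewrite /GmGa_mul !row_mxKl !row_mxKr addrA; congr row_mx.
by apply/rv_eq => i; rewrite !mxE mulrA.
Qed.

Lemma GmGa_mul1 (K : closedFieldType) r s (g : 'rV[K]_(r + s)) :
  GmGa_mul (GmGa_one K r s) g = g.
Proof.
rewrite /GmGa_mul row_mxKl row_mxKr add0r -[RHS]hsubmxK; congr row_mx.
by apply/rv_eq => i; rewrite !mxE mul1r.
Qed.

Lemma GmGa_inv (K : closedFieldType) r s (g : 'rV[K]_(r + s)) : GmGa g ->
  exists2 g', GmGa g' & GmGa_mul g g' = GmGa_one K r s.
Proof.
move=> [tg _]; exists (row_mx (\row_i (lsubmx g ord0 i)^-1) (- rsubmx g)).
  split=> //; rewrite row_mxKl => i; rewrite mxE; apply/eqP.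
  by rewrite invr_eq0; apply/eqP; apply: tg.
rewrite /GmGa_mul row_mxKl row_mxKr subrr; congr row_mx.
by apply/rv_eq => i; rewrite !mxE mulfV //; apply/eqP; have := tg i; rewrite mxE.
Qed.

Lemma reg_expz (K : closedFieldType) N (Y : 'rV[K]_N -> Prop) f (w : int) : regular Y f ->
  (0 <= w \/ forall y, Y y -> f y != 0) -> regular Y (fun y => f y ^ w).
Proof.
case: w => k rf h; first exact: regX.
case: h => // h; apply: regV; last exact: regX.
by move=> y Yy; rewrite expf_neq0 // h.
Qed.

Section Existence.
Variables (K : closedFieldType) (N : nat) (X : 'rV[K]_N -> Prop) (r s : nat).
Notation n := (r + s)%N.
Variables (act : 'rV[K]_n -> 'rV[K]_N -> 'rV[K]_N) (x0 : 'rV[K]_N).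
Hypotheses (affX : affine_variety X) (tor : toric_structure X act x0).
Variables (omega : 'rV[rat]_n -> Prop) (chi : 'rV[int]_n -> 'rV[K]_N -> K).
Variables (m : nat) (P : 'M[int]_(n, m)).
Hypothesis dat : toric_data X act x0 omega chi P.
Variables (p e : 'rV[int]_n) (C : 'M[int]_n).
Notation S u := (omega (toQ u)).
Notation V := (@GmGa K r s).
Hypotheses (s1 : (s <= 1)%N) (uC : C \in unitmx).
Hypothesis hC : forall u, last_coord (u *m C) = pairing p u.
Hypothesis eC : e *m C = - delta_last r s.
Hypothesis hp : forall u, S u -> 0 <= pairing p u.
Hypothesis hs : forall u k, S u -> (k <= absz (pairing p u))%N -> S (u + e *+ k).

Let cX : zclosed X. Proof. by case: affX. Qed.
Let iX : irreducible X. Proof. by case: affX. Qed.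

Variable L : 'I_N -> seq (K * 'rV[int]_n).
Hypotheses (Lw : forall j, supp (fun u => S u) (L j))
  (LE : forall t, torus t -> forall j, act t x0 ord0 j = tev (L j) t).

Definition rpsi (g : 'rV[K]_n) : 'rV[K]_N :=
  \row_j \sum_(q <- L j) q.1 * character (q.2 *m C) g.

Definition rmul (x y : 'rV[K]_N) : 'rV[K]_N :=
  \row_j \sum_(q <- L j) q.1 * \sum_(i < (absz (pairing p q.2)).+1)
    'C(absz (pairing p q.2), i)%:R *
    (chi (q.2 + e *+ (absz (pairing p q.2) - i)) x * chi (q.2 + e *+ i) y).

Let rchi u : S u -> regular X (chi u).
Proof. by move=> /(td_chi (td_dec dat)) []. Qed.

Let SC u : S u -> bnonneg (@gm r s) (u *m C).
Proof. by move=> Su; apply: bnonneg_last; rewrite ?hC ?hp. Qed.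

Let rV u : S u -> regular V (character (u *m C)).
Proof. by move=> Su; apply: reg_char_V; apply: SC. Qed.

Lemma rpsi_torus t : torus t -> rpsi t = act (tpow C t) x0.
Proof.
move=> tt; apply/rv_eq => j; rewrite mxE LE; last exact: torus_tpow.
by rewrite tevE; apply: eq_bigr => q _; rewrite character_tpow.
Qed.

Lemma reg_rpsi j : regular V (fun g => rpsi g ord0 j).
Proof.
have r1 : regular V (fun g => \sum_(q <- L j | q \in L j) q.1 * character (q.2 *m C) g).
  by apply: reg_sum => q /Lw Sq; apply: regM; [exact: reg_cst|exact: rV].
by apply: (reg_ext _ r1) => g _; rewrite mxE big_seq.
Qed.

Lemma rpsi_in g : V g -> X (rpsi g).
Proof.
move=> Vg; apply: (closed_pts cX) => q qX.
apply: (@torus_eq K r s (fun g => peval q (rpsi g)) (fun=> 0)) Vg => [||t tt].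
- by apply: reg_meval => j; exact: reg_rpsi.
- exact: reg_cst.
by apply: qX; rewrite rpsi_torus //; apply: (orbit_in tor); apply: torus_tpow.
Qed.

Lemma chi_rpsi u g : S u -> V g -> chi u (rpsi g) = character (u *m C) g.
Proof.
move=> Su; apply: (@torus_eq K r s (fun g => chi u (rpsi g)) (character (u *m C))) => [||t tt].
- by apply: (reg_pullback cX _ (rchi Su)); split=> [v|j]; [exact: rpsi_in|exact: reg_rpsi].
- exact: rV.
have [_ h] := td_chi (td_dec dat) Su.
by rewrite rpsi_torus // h ?character_tpow //; apply: torus_tpow.
Qed.

Lemma rpsi_eq f g : regular X f -> regular X g ->
  (forall v, V v -> f (rpsi v) = g (rpsi v)) -> forall x, X x -> f x = g x.
Proof.
move=> rf rg h; apply: (orbit_eq affX tor rf rg) => t tt.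
have -> : act t x0 = rpsi (tpow (invmx C) t).
  by rewrite rpsi_torus ?tpowK ?mulmxV //; apply: torus_tpow.
by apply: h; apply: torus_GmGa; apply: torus_tpow.
Qed.

Let binom u x y := \sum_(i < (absz (pairing p u)).+1)
    'C(absz (pairing p u), i)%:R *
    (chi (u + e *+ (absz (pairing p u) - i)) x * chi (u + e *+ i) y).

Let binom_psi u g g' : S u -> V g -> V g' ->
  binom u (rpsi g) (rpsi g') = character (u *m C) (GmGa_mul g g').
Proof.
move=> Su Vg Vg'; rewrite character_GmGa_mul //; last by rewrite hC hp.
rewrite hC; apply: eq_bigr => i _; have ia : (i <= absz (pairing p u))%N by rewrite -ltnS.
have eCk k : (u + e *+ k) *m C = u *m C - delta_last r s *+ k.
  by rewrite mulmxDl -scaler_nat -scalemxAl eC scaler_nat mulNrn.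
by rewrite !chi_rpsi ?eCk //; apply: hs; rewrite ?leq_subr.
Qed.

Lemma rmul_rpsi g g' : V g -> V g' -> rmul (rpsi g) (rpsi g') = rpsi (GmGa_mul g g').
Proof.
move=> Vg Vg'; apply/rv_eq => j; rewrite !mxE; apply: eq_big_seq => q /Lw Sq.
by congr (_ * _); exact: binom_psi.
Qed.

Let reg_binom_l u y : S u -> regular X (fun x => binom u x y).
Proof.
move=> Su; apply: reg_sum => i _; apply: regM; first exact: reg_cst.
apply: regM; last exact: reg_cst.
by apply: rchi; apply: hs => //; apply: leq_subr.
Qed.

Let reg_binom_r u x : S u -> regular X (fun y => binom u x y).
Proof.
move=> Su; apply: reg_sum => i _; apply: regM; first exact: reg_cst.
apply: regM; first exact: reg_cst.
by apply: rchi; apply: hs; rewrite // -ltnS.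
Qed.

Lemma reg_rmul_l y j : regular X (fun x => rmul x y ord0 j).
Proof.
have r1 : regular X (fun x => \sum_(q <- L j | q \in L j) q.1 * binom q.2 x y).
  by apply: reg_sum => q /Lw Sq; apply: regM; [exact: reg_cst|exact: reg_binom_l].
by apply: (reg_ext _ r1) => x _; rewrite mxE big_seq.
Qed.

Lemma reg_rmul_r x j : regular X (fun y => rmul x y ord0 j).
Proof.
have r1 : regular X (fun y => \sum_(q <- L j | q \in L j) q.1 * binom q.2 x y).
  by apply: reg_sum => q /Lw Sq; apply: regM; [exact: reg_cst|exact: reg_binom_r].
by apply: (reg_ext _ r1) => y _; rewrite mxE big_seq.
Qed.

Lemma rmul_in x y : X x -> X y -> X (rmul x y).
Proof.
move=> Xx Xy; apply: (closed_pts cX) => q qX.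
apply: (rpsi_eq (f := fun x => peval q (rmul x y)) (g := fun=> 0)) Xx => [||g Vg].
- by apply: reg_meval => j; exact: reg_rmul_l.
- exact: reg_cst.
apply: (rpsi_eq (f := fun y => peval q (rmul (rpsi g) y)) (g := fun=> 0)) Xy => [||g' Vg'].
- by apply: reg_meval => j; exact: reg_rmul_r.
- exact: reg_cst.
by apply: qX; rewrite rmul_rpsi //; apply: rpsi_in; apply: GmGa_mulV.
Qed.

Let map_l y : X y -> regular_map X X (fun x => rmul x y).
Proof. by move=> Xy; split=> [x Xx|j]; [exact: rmul_in|exact: reg_rmul_l]. Qed.
Let map_r x : X x -> regular_map X X (rmul x).
Proof. by move=> Xx; split=> [y Xy|j]; [exact: rmul_in|exact: reg_rmul_r]. Qed.

Lemma chi_rmul u x y : S u -> X x -> X y -> chi u (rmul x y) = binom u x y.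
Proof.
move=> Su Xx Xy; apply: (rpsi_eq (f := fun x => chi u (rmul x y)) (g := fun x => binom u x y)) Xx => [||g Vg].
- exact: (reg_pullback cX (map_l Xy) (rchi Su)).
- exact: reg_binom_l.
apply: (rpsi_eq (f := fun y => chi u (rmul (rpsi g) y)) (g := fun y => binom u (rpsi g) y)) Xy => [||g' Vg'].
- exact: (reg_pullback cX (map_r (rpsi_in Vg)) (rchi Su)).
- exact: reg_binom_r.
by rewrite rmul_rpsi // chi_rpsi ?binom_psi //; apply: GmGa_mulV.
Qed.

Definition rone := rpsi (GmGa_one K r s).
Let V1 : V (GmGa_one K r s). Proof. exact: GmGa1. Qed.

Lemma rmul1 x : X x -> rmul rone x = x.
Proof.
move=> Xx; apply/rv_eq => j.
apply: (rpsi_eq (f := fun x => rmul rone x ord0 j) (g := fun x => x ord0 j)) Xx => [||g Vg].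
- exact: reg_rmul_r.
- exact: reg_coord.
by rewrite rmul_rpsi // GmGa_mul1.
Qed.

Lemma rmulC x y : X x -> X y -> rmul x y = rmul y x.
Proof.
move=> Xx Xy; apply/rv_eq => j.
apply: (rpsi_eq (f := fun x => rmul x y ord0 j) (g := fun x => rmul y x ord0 j)) Xx => [||g Vg].
- exact: reg_rmul_l.
- exact: reg_rmul_r.
apply: (rpsi_eq (f := fun y => rmul (rpsi g) y ord0 j) (g := fun y => rmul y (rpsi g) ord0 j)) Xy => [||g' Vg'].
- exact: reg_rmul_r.
- exact: reg_rmul_l.
by rewrite !rmul_rpsi // GmGa_mulC.
Qed.

Lemma rmulA x y z : X x -> X y -> X z -> rmul x (rmul y z) = rmul (rmul x y) z.
Proof.
move=> Xx Xy Xz; apply/rv_eq => j; pose co (x : 'rV[K]_N) := x ord0 j.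
have rc y' : regular X (fun x => co (rmul x y')) by exact: reg_rmul_l.
have rc' x' : regular X (fun y => co (rmul x' y)) by exact: reg_rmul_r.
apply: (rpsi_eq (f := fun x => co (rmul x (rmul y z))) (g := fun x => co (rmul (rmul x y) z))) Xx => [//||g Vg].
  exact: (reg_pullback cX (map_l Xy) (rc z)).
have Xg := rpsi_in Vg.
apply: (rpsi_eq (f := fun y => co (rmul (rpsi g) (rmul y z))) (g := fun y => co (rmul (rmul (rpsi g) y) z))) Xy => [||g' Vg'].
- exact: (reg_pullback cX (map_l Xz) (rc' _)).
- exact: (reg_pullback cX (map_r Xg) (rc z)).
have Xg' := rpsi_in Vg'.
apply: (rpsi_eq (f := fun z => co (rmul (rpsi g) (rmul (rpsi g') z))) (g := fun z => co (rmul (rmul (rpsi g) (rpsi g')) z))) Xz => [|//|g'' Vg''].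
  exact: (reg_pullback cX (map_r Xg') (rc' _)).
by rewrite !rmul_rpsi ?GmGa_mulA //; apply: GmGa_mulV.
Qed.

Lemma rmul_monoid : comm_monoid X rmul rone.
Proof.
split; [|exact: rmulA|exact: rmulC|exact: rpsi_in V1|]; last first.
  by move=> x Xx; rewrite (rmulC Xx (rpsi_in V1)) rmul1.
split=> [z [Xx Xy]|j]; first exact: rmul_in.
have rl u : S u -> regular (prodv X X) (fun z => chi u (lsubmx z)).
  move=> Su; apply: (@reg_comp _ _ _ _ X (fun z => lsubmx z) (chi u)
    (fun i => 'X_(lshift N i))) (rchi Su) => [z [] //|z _ i]; by rewrite pevalX mxE.
have rr u : S u -> regular (prodv X X) (fun z => chi u (rsubmx z)).
  move=> Su; apply: (@reg_comp _ _ _ _ X (fun z => rsubmx z) (chi u)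
    (fun i => 'X_(rshift N i))) (rchi Su) => [z [] //|z _ i]; by rewrite pevalX mxE.
have r1 : regular (prodv X X) (fun z => \sum_(q <- L j | q \in L j) q.1 * binom q.2 (lsubmx z) (rsubmx z)).
  apply: reg_sum => q /Lw Sq; apply: regM; first exact: reg_cst.
  apply: reg_sum => i _; apply: regM; first exact: reg_cst.
  by apply: regM; [apply: rl|apply: rr]; apply: hs; rewrite ?leq_subr // -ltnS.
by apply: (reg_ext _ r1) => z _; rewrite mxE big_seq.
Qed.

Notation U := (units X rmul rone).

Lemma rpsi_unit g : V g -> U (rpsi g).
Proof.
move=> Vg; have [g' Vg' gg'] := GmGa_inv Vg; split; first exact: rpsi_in.
exists (rpsi g'); split; first exact: rpsi_in.
  by rewrite rmul_rpsi // gg'.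
by rewrite rmul_rpsi // GmGa_mulC gg'.
Qed.

Lemma chi_unit u x : S u -> pairing p u = 0 -> U x -> chi u x != 0.
Proof.
move=> Su pu [Xx [y [Xy xy _]]]; apply/eqP => c0.
have : chi u (rmul x y) = 1.
  rewrite xy chi_rpsi // /GmGa_one character_last // row_mxKl character_one.
  by rewrite hC pu expr0z mulr1.
rewrite chi_rmul // /binom pu /= big_ord1 /= mulr0n addr0 c0 mul0r mulr0.
by move/eqP; rewrite eq_sym oner_eq0.
Qed.

(** A coordinate of the group is a quotient of two characters.  Shifting both
    weights by a multiple of [e] makes the denominator orthogonal to [p], so that
    it does not vanish at units. *)
Lemma group_coordinates i : exists ab : 'rV[int]_n * 'rV[int]_n,
  [/\ S ab.1, S ab.2, pairing p ab.2 = 0, gm i -> pairing p ab.1 = 0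
    & ab.1 *m C = delta_mx ord0 i + ab.2 *m C].
Proof.
pose d : 'rV[int]_n := delta_mx ord0 i; pose u := d *m invmx C.
have [a [b [uab Sa Sb]]] := td_gp dat u.
have duC : u *m C = d by rewrite mulmxKV.
have ld : last_coord d = if gm i then 0 else 1.
  rewrite /last_coord; have [gi|gi] := boolP (gm i).
    rewrite big1 // => l _; rewrite mxE eqxx -val_eqE /=.
    by rewrite gtn_eqF ?mulr0n // (leq_trans gi) // leq_addr.
  have sl : (i - r < s)%N by have := ltn_ord i; move: gi; rewrite /gm; lia.
  have il : i = rshift r (Ordinal sl) by apply: val_inj; move: gi; rewrite /gm /=; lia.
  rewrite (bigD1 (Ordinal sl)) //= -il mxE !eqxx big1 ?addr0 // => l ll.
  by rewrite mxE eqxx il (inj_eq (@rshift_inj _ _)) (negbTE ll).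
have pab : pairing p a = last_coord d + pairing p b.
  have -> : a = u + b by rewrite uab subrK.
  by rewrite pairingDr -(hC u) duC.
have ld0 : 0 <= last_coord d by rewrite ld; case: ifP.
have pb := hp Sb; pose k := absz (pairing p b).
have kE : k%:Z = pairing p b by rewrite gez0_abs.
have ka : (k <= absz (pairing p a))%N.
  by move: pab ld0 pb kE; rewrite /k; move: (pairing p a) (pairing p b) (last_coord d) => x y z; lia.
have pbk : pairing p (b + e *+ k) = 0.
  rewrite pairingDr pairingMnr kE -(hC e) eC.
  have -> : last_coord (- delta_last r s) = - s%:Z.
    by rewrite /last_coord; under eq_bigr => l _ do rewrite mxE row_mxEr mxE; rewrite sumr_const card_ord mulNrn natz.
  have [s_0|s_0] := posnP s; last first.
    have -> : s%:Z = 1 by move: s_0 s1; case: (s) => [|[|]].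
    by rewrite mulrN1 subrr.
  have -> : pairing p b = 0.
    by rewrite -hC /last_coord big1 // => l; have := ltn_ord l; rewrite {2}s_0.
  by rewrite mul0r addr0.
exists (a + e *+ k, b + e *+ k); split=> /=; [exact: hs|exact: hs|exact: pbk| |].
  move=> gi; move: pbk; rewrite !pairingDr pab ld gi add0r => ->.
  by [].
by rewrite -/d -duC uab !mulmxDl mulNmx addrA subrK.
Qed.

Lemma rmul_rank : has_rank X rmul rone r /\
  forall x, U x -> exists2 g, V g & x = rpsi g.
Proof.
have [ab abP] := choice group_coordinates.
pose phi x : 'rV[K]_n := \row_i (chi (ab i).1 x / chi (ab i).2 x).
have phi_psi g : V g -> phi (rpsi g) = g.
  move=> Vg; apply/rv_eq => i; have [Sa Sb pb _ e1] := abP i; rewrite mxE.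
  have := chi_unit Sb pb (rpsi_unit Vg); rewrite !chi_rpsi // e1 => b0.
  rewrite characterD.
  - rewrite mulfK // /character (bigD1 i) //= mxE !eqxx expr1z big1 ?mulr1 // => l li.
    by rewrite mxE eqxx (negbTE li) expr0z.
  - by move=> l _; rewrite mxE; case: andb.
  by apply: (bnonneg_defined (b := @gm r s)); [apply/GmGa_bset|exact: SC].
pose H := (fun x => \prod_i (chi (ab i).2 x * (if gm i then chi (ab i).1 x else 1))).
have rH : regular X H.
  apply: reg_prod => i _; have [Sa Sb _ _ _] := abP i.
  by apply: regM; [exact: rchi|case: (gm i); [exact: rchi|exact: reg_cst]].
have [h hE] := regular_closed cX rH.
have hP x : X x -> peval h x <> 0 -> forall i, chi (ab i).2 x != 0 /\ (gm i -> chi (ab i).1 x != 0).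
  move=> Xx; rewrite -hE // => /eqP /prodf_neq0 h0 i; have := h0 i isT.
  by rewrite mulf_eq0 negb_or => /andP [-> ]; case: (gm i).
have Uh x : U x -> peval h x <> 0.
  move=> Ux; have [Xx _] := Ux; rewrite -hE //; apply/eqP/prodf_neq0 => i _.
  have [Sa Sb pb pa _] := abP i; rewrite mulf_neq0 ?chi_unit //.
  by case: ifP => gi; rewrite ?oner_eq0 ?chi_unit ?pa.
pose Y x := X x /\ peval h x <> 0.
have rphi i : regular Y (fun x => phi x ord0 i).
  have [Sa Sb _ _ _] := abP i.
  have r1 : regular Y (fun x => chi (ab i).1 x * (chi (ab i).2 x)^-1).
    have sub u : S u -> regular Y (chi u) by move=> Su; apply: (reg_sub _ (rchi Su)) => x [].
    by apply: regM; [exact: sub|apply: regV; [move=> x [Xx hx]; have [] := hP x Xx hx i|exact: sub]].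
  by apply: (reg_ext _ r1) => x _; rewrite mxE.
have phi_n0 x i : Y x -> gm i -> phi x ord0 i != 0.
  by move=> [Xx hx] gi; have [b0 a0] := hP x Xx hx i; rewrite mxE mulf_neq0 ?a0 ?invr_eq0.
have rcomp u : S u -> regular Y (fun x => character (u *m C) (phi x)).
  move=> Su; apply: reg_prod => i _; apply: reg_expz => //.
  have [gi|gi] := boolP (gm i); last by left; apply: SC.
  by right=> x Yx; apply: phi_n0.
have psi_phi x : U x -> rpsi (phi x) = x.
  move=> Ux; have [Xx _] := Ux; apply/rv_eq => j.
  have r1 : regular Y (fun x => rpsi (phi x) ord0 j).
    have r2 : regular Y (fun x => \sum_(q <- L j | q \in L j) q.1 * character (q.2 *m C) (phi x)).
      by apply: reg_sum => q /Lw Sq; apply: regM; [exact: reg_cst|exact: rcomp].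
    by apply: (reg_ext _ r2) => y _; rewrite mxE big_seq.
  have [q [k qE]] := regular_principal cX r1.
  have hx := Uh x Ux.
  apply: (mulfI (_ : peval h x ^+ k != 0)); first by rewrite expf_neq0 //; apply/eqP.
  rewrite qE //; apply/esym.
  apply: (rpsi_eq (f := fun x => peval h x ^+ k * x ord0 j) (g := peval q)) Xx => [||g Vg].
  - by apply: regM; [apply: regX; exact: reg_poly|exact: reg_coord].
  - exact: reg_poly.
  rewrite -qE; [by rewrite phi_psi|exact: rpsi_in|exact/Uh/rpsi_unit].
have UV x : U x -> V (phi x).
  move=> Ux; have [Xx _] := Ux; apply/GmGa_bset => i gi; apply/eqP.
  by apply: phi_n0 => //; split=> //; apply: Uh.
split; last by move=> x Ux; exists (phi x); [exact: UV|rewrite psi_phi].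
exists s, phi; split.
- exists rpsi; split.
  + split=> // j; apply: (reg_sub _ (rphi j)) => x Ux; split; [by case: Ux|exact: Uh].
  + by split=> [g|j]; [exact: rpsi_unit|exact: reg_rpsi].
  + by split=> [x|g]; [exact: psi_phi|exact: phi_psi].
- move=> x y Ux Uy; have Vx := UV x Ux; have Vy := UV y Uy.
  rewrite -{1}(psi_phi x Ux) -{1}(psi_phi y Uy) rmul_rpsi // phi_psi //.
  exact: GmGa_mulV.
- exact: phi_psi.
Qed.
End Existence.

(** In coordinates adapted to [p] and [e] the weights become exponents of
    monomials on a product of multiplicative and additive groups; the group law
    extends to [X] because the terms of the binomial formula are weights. *)
Lemma root_monoid_exists (K : closedFieldType) N (X : 'rV[K]_N -> Prop) r s
    (act : 'rV[K]_(r + s) -> 'rV[K]_N -> 'rV[K]_N) x0 omega chi m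
    (P : 'M[int]_(r + s, m)) (p e : 'rV[int]_(r + s)) (C : 'M[int]_(r + s)) :
  affine_variety X -> toric_structure X act x0 -> toric_data X act x0 omega chi P ->
  (s <= 1)%N -> C \in unitmx -> (forall u, last_coord (u *m C) = pairing p u) ->
  e *m C = - delta_last r s ->
  (forall u, omega (toQ u) -> 0 <= pairing p u) ->
  (forall u k, omega (toQ u) -> (k <= absz (pairing p u))%N -> omega (toQ (u + e *+ k))) ->
  exists mul one psi,
   [/\ comm_monoid X mul one, has_rank X mul one r,
       root_comult X omega chi p e mul,
       forall x, units X mul one x <-> exists2 g, GmGa g & x = psi g
     & (forall g g', @GmGa K r s g -> @GmGa K r s g' -> mul (psi g) (psi g') = psi (GmGa_mul g g')) /\
       forall t, torus t -> psi t = act (tpow C t) x0].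
Proof.
move=> affX tor dat s1 uC hC eC hp hs.
have [L [Lw LE]] := coordinate_terms affX tor.
have Lw' j : supp (fun u => omega (toQ u)) (L j).
  by move=> q /Lw; move/(td_lattice (td_dec dat)).
have [rk un] := rmul_rank affX tor dat s1 uC hC eC hp hs Lw' LE.
exists (rmul chi p e L), (rone C L), (rpsi C L); split=> //.
- exact: (rmul_monoid affX tor dat s1 uC hC eC hp hs Lw' LE).
- move=> u Su a z [Xx Xy].
  rewrite /comult (chi_rmul affX tor dat s1 uC hC eC hp hs Lw' LE) //.
- move=> x; split=> [/un //|[g Vg ->]].
  exact: (rpsi_unit affX tor dat s1 hC eC hp hs Lw' LE).
- split=> [g g' Vg Vg'|t tt]; first exact: (rmul_rpsi affX tor dat s1 hC eC hp hs Lw' LE).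
  exact: (rpsi_torus _ LE).
Qed.

(** * Classification *)

Lemma last_mulmx r s (u : 'rV[int]_(r + s)) (B : 'M[int]_(r + s)) :
  last_coord (u *m B) = pairing (\row_i last_coord (row i B)) u.
Proof.
rewrite /last_coord /pairing; under eq_bigr => l _ do rewrite mxE.
rewrite exchange_big; apply: eq_bigr => i _; rewrite mxE mulr_suml.
by apply: eq_bigr => l _; rewrite mxE mulrC.
Qed.

Lemma last_delta r s : last_coord (- delta_last r s) = - s%:Z.
Proof.
rewrite /last_coord; under eq_bigr => l _ do rewrite mxE row_mxEr mxE.
by rewrite sumr_const card_ord mulNrn natz.
Qed.

Lemma GmGa_torus (K : closedFieldType) r s (g : 'rV[K]_(r + s)) : s = 0%N ->
  GmGa g -> torus g.
Proof.
move=> s0 /GmGa_bset hg i; apply: hg; rewrite /gm.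
by have := ltn_ord i; rewrite {2}s0 addn0.
Qed.

Lemma GmGa_mul_torus (K : closedFieldType) r s (g g' : 'rV[K]_(r + s)) : s = 0%N ->
  GmGa_mul g g' = tmul g g'.
Proof.
move=> s0; rewrite -[RHS]hsubmxK; congr row_mx.
  by apply/rv_eq => i; rewrite !mxE.
by apply/rv_eq => i; have := ltn_ord i; rewrite {2}s0.
Qed.

Section TransportMonoid.
Variables (K : closedFieldType) (N : nat) (X : 'rV[K]_N -> Prop).
Variables (mul : 'rV[K]_N -> 'rV[K]_N -> 'rV[K]_N) (one : 'rV[K]_N).
Variables (Phi Phi' : 'rV[K]_N -> 'rV[K]_N).
Hypotheses (affX : affine_variety X) (monX : comm_monoid X mul one).
Hypotheses (rPhi : regular_map X X Phi) (rPhi' : regular_map X X Phi')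
  (invP : mutually_inverse X X Phi Phi').

Definition tmon x y := Phi (mul (Phi' x) (Phi' y)).

Let cX : zclosed X. Proof. by case: affX. Qed.
Let PK x : X x -> Phi' (Phi x) = x. Proof. by case: invP => h _; apply: h. Qed.
Let PK' x : X x -> Phi (Phi' x) = x. Proof. by case: invP => _ h; apply: h. Qed.
Let Xm x y : X x -> X y -> X (mul x y). Proof. exact: (mul_in monX). Qed.
Let XP x : X x -> X (Phi x). Proof. exact: (rPhi.1 x). Qed.
Let XP' x : X x -> X (Phi' x). Proof. exact: (rPhi'.1 x). Qed.

Lemma tmon_monoid : comm_monoid X tmon (Phi one).
Proof.
have X1 := cm_one monX.
split.
- split=> [z [Xx Xy]|j]; first by apply/XP/Xm; apply: XP'.
  pose F (z : 'rV[K]_(N + N)) := row_mx (Phi' (lsubmx z)) (Phi' (rsubmx z)).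
  have rF : regular_map (prodv X X) (prodv X X) F.
    split=> [z [Xx Xy]|i]; first by split; rewrite ?row_mxKl ?row_mxKr; apply: XP'.
    case: (splitP i) => k ik.
      have -> : i = lshift N k by apply: val_inj.
      have r1 : regular (prodv X X) (fun z : 'rV_(N + N) => Phi' (lsubmx z) ord0 k).
        apply: (@reg_comp _ _ _ _ X (fun z => lsubmx z) (fun x => Phi' x ord0 k)
          (fun i => 'X_(lshift N i))) (rPhi'.2 k) => [z [] //|z _ l]; by rewrite pevalX mxE.
      by apply: (reg_ext _ r1) => z _; rewrite row_mxEl.
    have -> : i = rshift N k by apply: val_inj.
    have r1 : regular (prodv X X) (fun z : 'rV_(N + N) => Phi' (rsubmx z) ord0 k).
      apply: (@reg_comp _ _ _ _ X (fun z => rsubmx z) (fun x => Phi' x ord0 k)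
        (fun i => 'X_(rshift N i))) (rPhi'.2 k) => [z [] //|z _ l]; by rewrite pevalX mxE.
    by apply: (reg_ext _ r1) => z _; rewrite row_mxEr.
  have r2 := reg_pullback cX (cm_regular monX) (rPhi.2 j).
  have r3 := reg_pullback (zclosed_prodv cX cX) rF r2.
  by apply: (reg_ext _ r3) => z _; rewrite row_mxKl row_mxKr.
- move=> x y z Xx Xy Xz; rewrite /tmon !PK; [|by apply: Xm; apply: XP'..].
  by rewrite (cm_assoc monX) //; apply: XP'.
- by move=> x y Xx Xy; rewrite /tmon (cm_comm monX) //; apply: XP'.
- exact: XP.
- move=> x Xx; rewrite /tmon !PK //; have [-> ->] := cm_unit monX (XP' Xx).
  by rewrite PK'.
Qed.

Lemma tmon_iso : monoid_iso X mul one X tmon (Phi one).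
Proof.
exists Phi; split=> //; first by exists Phi'.
by move=> x y Xx Xy; rewrite /tmon !PK.
Qed.

Lemma tmon_units x : X x -> units X tmon (Phi one) x <-> units X mul one (Phi' x).
Proof.
have X1 := cm_one monX.
move=> Xx; split=> [[_ [y [Xy xy _]]]|[_ [y [Xy xy _]]]].
  have e1 : mul (Phi' x) (Phi' y) = one.
    by rewrite -(PK X1) -xy /tmon PK //; apply: Xm; apply: XP'.
  split; first exact: XP'.
  exists (Phi' y); split=> //; first exact: XP'.
  by rewrite (cm_comm monX) //; apply: XP'.
split=> //; exists (Phi y); split; [exact: XP|by rewrite /tmon PK ?xy|].
by rewrite /tmon PK // (cm_comm monX) ?xy //; apply: XP'.
Qed.
End TransportMonoid.

(** Every monoid structure of rank [r] is isomorphic to one given by a pair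
    [p, e] in terms of any prescribed toric structure: its own toric structure
    is carried to the prescribed one by an automorphism of [X]. *)
Lemma monoid_in_toric_terms (K : closedFieldType) (charK : [pchar K] =i pred0) N
    (X : 'rV[K]_N -> Prop) r s (act : 'rV[K]_(r + s) -> 'rV[K]_N -> 'rV[K]_N) x0
    omega chi m (P : 'M[int]_(r + s, m)) mul one :
  affine_variety X -> normal_variety X -> has_dim X (r + s) -> (s <= 1)%N ->
  toric_structure X act x0 -> toric_data X act x0 omega chi P ->
  comm_monoid X mul one -> has_rank X mul one r ->
  exists mul' one' (p e : 'rV[int]_(r + s)),
   [/\ comm_monoid X mul' one', monoid_iso X mul one X mul' one',
       root_comult X omega chi p e mul',
       pairing p e = - s%:Z /\ (forall u, omega (toQ u) -> 0 <= pairing p u /\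
         omega (toQ (u + e *+ absz (pairing p u))))
     & s = 0%N -> [/\ toric_monoid X act x0 mul' one', p = 0 & e = 0]].
Proof.
move=> affX normX dimX s1 tor dat monX rankX.
have [s' [psi [phi [h [gc es]]]]] := group_chart_exists affX dimX monX rankX.
move: es => /addnI es; subst s'.
have [act2 [tor2 actE]] := monoid_toric affX monX (gc_open gc) (gc_psi gc) (gc_phi gc)
  (gc_psiK gc) (gc_phiK gc) (gc_mul gc) (gc_one gc) charK (or_introl s1).
have [omega2 [chi2 [m2 [P2 dat2]]]] := toric_data_exists charK affX tor2 normX.
have [B [Phi [Phi' [uB hB [rPhi rPhi' inv] PhiE chiE]]]] := toric_iso affX tor tor2 dat dat2.
have shift u (Su : omega2 (toQ u)) := toric_data_shift affX monX (gc_open gc) (gc_psi gc)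
  (gc_phi gc) (gc_phiK gc) (gc_mul gc) (gc_one gc) charK actE s1 dat2 Su.
have X1 := cm_one monX.
pose p : 'rV[int]_(r + s) := \row_i last_coord (row i B).
pose e : 'rV[int]_(r + s) := - delta_last r s *m invmx B.
have eB : e *m B = - delta_last r s by rewrite mulmxKV.
have pE u : pairing p u = last_coord (u *m B) by rewrite last_mulmx.
have eBk u k : (u + e *+ k) *m B = u *m B - delta_last r s *+ k.
  by rewrite mulmxDl -scaler_nat -scalemxAl eB scaler_nat mulNrn.
have [K1 K2] := inv.
have Sk u k : omega (toQ u) -> (k <= absz (pairing p u))%N -> omega (toQ (u + e *+ k)).
  move=> /hB Su ka; apply/hB; rewrite eBk; have [_ hk _] := shift _ Su.
  by apply: hk; rewrite -pE.
exists (tmon mul Phi Phi'), (Phi one), p, e; split.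
- exact: tmon_monoid.
- exact: tmon_iso.
- move=> u Su a z [Xx Xy]; have Su2 := (hB u).1 Su.
  rewrite /comult /tmon chiE //; last by apply: (mul_in monX); apply: rPhi'.1.
  have [_ _ ->] := shift _ Su2; [|exact: rPhi'.1|exact: rPhi'.1].
  rewrite -pE -/a; apply: eq_bigr => j _; rewrite /tensor.
  have ja : (j <= a)%N by rewrite -ltnS.
  have back k x : (k <= a)%N -> X x ->
      chi2 (u *m B - delta_last r s *+ k) (Phi' x) = chi (u + e *+ k) x.
    move=> ka hx; rewrite -eBk -chiE; [by rewrite K2|exact: Sk|exact: rPhi'.1].
  by rewrite !back ?leq_subr.
- split=> [|u Su]; first by rewrite pE eB last_delta.
  split; last exact: Sk.
  by rewrite pE; have [] := shift _ ((hB u).1 Su).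
move=> s0; have T1 := @torus1 K (r + s); have V1 := torus_GmGa T1.
have orb t : torus t -> act t x0 = Phi (psi (tpow (invmx B) t)).
  move=> tt; have tt' := torus_tpow (B := invmx B) tt; have Vt := torus_GmGa tt'.
  have := PhiE _ tt'; rewrite actE // tmul1 tpowK ?mulmxV //.
have orb' t : torus t -> Phi (psi t) = act (tpow B t) x0.
  by move=> tt; rewrite -PhiE // actE // tmul1.
have Xpsi g : GmGa g -> X (psi g) by move=> Vg; have [] := (gc_psi gc).1 g Vg.
have d0 : delta_last r s = 0.
  apply/rv_eq => i; rewrite !mxE; case: splitP => j _; rewrite mxE //.
  by have := ltn_ord j; rewrite {2}s0.
split.
- split=> [x|t t' tt tt'].
    split=> [Ux|[t [tt ->]]].
      have [Xx _] := Ux; have U2 := (tmon_units monX rPhi rPhi' inv Xx).1 Ux.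
      have tp := GmGa_torus s0 ((gc_phi gc).1 _ U2).
      exists (tpow B (phi (Phi' x))); split; first exact: torus_tpow.
      by rewrite -orb' // (gc_phiK gc) // K2.
    have tt2 := torus_tpow (B := invmx B) tt; have Vt := torus_GmGa tt2.
    rewrite orb //; have Xp := Xpsi _ Vt.
    apply/(tmon_units monX rPhi rPhi' inv (rPhi.1 _ Xp)); rewrite K1 //.
    exact: (gc_psi gc).1.
  have tt2 := torus_tpow (B := invmx B) tt; have Vt := torus_GmGa tt2.
  have tt2' := torus_tpow (B := invmx B) tt'; have Vt' := torus_GmGa tt2'.
  rewrite !orb //; last exact: torus_tmul.
  have Xp := Xpsi _ Vt; have Xp' := Xpsi _ Vt'.
  by rewrite /tmon !K1 // -(gc_mul gc) // GmGa_mul_torus // tpow_tmul.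
- by apply/rv_eq => i; rewrite !mxE /last_coord big1 // => l; have := ltn_ord l; rewrite {2}s0.
- by rewrite /e d0 oppr0 mul0mx.
Qed.

Section VectorMonoids.
Variables (K : closedFieldType) (N : nat) (X : 'rV[K]_N -> Prop) (n : nat).
Variables (z : 'rV[K]_N -> 'rV[K]_n) (zi : 'rV[K]_n -> 'rV[K]_N).
Hypotheses (affX : affine_variety X) (rz : regular_map X (@affine_space K n) z)
  (rzi : regular_map (@affine_space K n) X zi)
  (zK : forall x, X x -> zi (z x) = x) (ziK : forall v, z (zi v) = v).

Let cX : zclosed X. Proof. by case: affX. Qed.

Definition vmul x y := zi (z x + z y).

Let Xzi v : X (zi v). Proof. exact: (rzi.1 v). Qed.

Lemma GmGa0 (g : 'rV[K]_(0 + n)) : GmGa g.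
Proof. by split=> // -[]. Qed.

Lemma GmGa_mul0 (g g' : 'rV[K]_(0 + n)) : GmGa_mul g g' = g + g'.
Proof.
rewrite -[RHS]hsubmxK; congr row_mx; first by apply/rv_eq => -[].
by apply/rv_eq => i; rewrite !mxE.
Qed.

Lemma GmGa_one0 : GmGa_one K 0 n = 0.
Proof.
rewrite -[RHS]hsubmxK; congr row_mx; first by apply/rv_eq => -[].
by apply/rv_eq => i; rewrite !mxE.
Qed.

Lemma vmul_monoid : comm_monoid X vmul (zi 0).
Proof.
split.
- split=> [w _|j]; first exact: Xzi.
  pose F (w : 'rV[K]_(N + N)) := z (lsubmx w) + z (rsubmx w).
  have rF : regular_map (prodv X X) (@affine_space K n) F.
    split=> // i.
    have r1 : regular (prodv X X) (fun w : 'rV_(N + N) => z (lsubmx w) ord0 i + z (rsubmx w) ord0 i).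
      apply: regD.
        apply: (@reg_comp _ _ _ _ X (fun w => lsubmx w) (fun x => z x ord0 i)
          (fun l => 'X_(lshift N l))) (rz.2 i) => [w [] //|w _ l]; by rewrite pevalX mxE.
      apply: (@reg_comp _ _ _ _ X (fun w => rsubmx w) (fun x => z x ord0 i)
        (fun l => 'X_(rshift N l))) (rz.2 i) => [w [] //|w _ l]; by rewrite pevalX mxE.
    by apply: (reg_ext _ r1) => w _; rewrite mxE.
  exact: (reg_pullback (zclosed_full K n) rF (rzi.2 j)).
- by move=> x y w _ _ _; rewrite /vmul !ziK addrA.
- by move=> x y _ _; rewrite /vmul addrC.
- exact: Xzi.
- by move=> x Xx; rewrite /vmul ziK add0r addr0 zK.
Qed.

Lemma vmul_units x : X x -> units X vmul (zi 0) x.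
Proof.
move=> Xx; split=> //; exists (zi (- z x)); split=> //.
  by rewrite /vmul ziK subrr.
by rewrite /vmul ziK addNr.
Qed.

Lemma vmul_rank : has_rank X vmul (zi 0) 0.
Proof.
have UX x : units X vmul (zi 0) x -> X x by case.
exists n, z; split.
- exists zi; split.
  + by split=> [x _|j]; [exact: GmGa0|exact: (reg_sub UX (rz.2 j))].
  + split=> [g _|j]; first exact: vmul_units.
    by apply: (reg_sub _ (rzi.2 j)).
  + by split=> [x /UX|g _]; [exact: zK|exact: ziK].
- by move=> x y _ _; rewrite GmGa_mul0 /vmul ziK.
- by rewrite GmGa_one0 ziK.
Qed.

Lemma vmul_iso mul one (psi : 'rV[K]_(0 + n) -> 'rV[K]_N) phi h : 
  comm_monoid X mul one -> @group_chart K N X mul one 0 n psi phi h ->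
  monoid_iso X mul one X vmul (zi 0).
Proof.
move=> monX gc.
have XU x (Xx : X x) : units X mul one x :=
  unipotent_units affX monX (gc_open gc) (gc_psi gc) (gc_phi gc) (gc_phiK gc) (gc_one gc) erefl Xx.
have Xpsi g : X (psi g) by have [] := (gc_psi gc).1 g (GmGa0 g).
have rphi : regular_map X (@affine_space K n) phi.
  by split=> // j; apply: (reg_sub XU); exact: ((gc_phi gc).2 j).
have rpsi : regular_map (@affine_space K n) X psi.
  split=> [g _|j]; first exact: Xpsi.
  by apply: (reg_sub _ ((gc_psi gc).2 j)) => g _; exact: GmGa0.
exists (fun x => zi (phi x)); split.
- exists (fun x => psi (z x)); split.
  + split=> [x _|j]; first exact: Xzi.
    exact: (reg_pullback (zclosed_full K n) rphi (rzi.2 j)).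
  + split=> [x _|j]; first exact: Xpsi.
    exact: (reg_pullback (zclosed_full K n) rz (rpsi.2 j)).
  + split=> x Xx; first by rewrite ziK (gc_phiK gc) //; apply: XU.
    by rewrite (gc_psiK gc) ?zK //; exact: GmGa0.
- move=> x y Xx Xy; rewrite /vmul !ziK; congr zi.
  rewrite -{1}(gc_phiK gc (XU x Xx)) -{1}(gc_phiK gc (XU y Xy)).
  rewrite -(gc_mul gc); [|exact: GmGa0|exact: GmGa0].
  by rewrite (gc_psiK gc) ?GmGa_mul0 //; exact: GmGa0.
- by rewrite -(gc_one gc) (gc_psiK gc) ?GmGa_one0 //; exact: GmGa0.
Qed.
End VectorMonoids.

(** A monoid of rank zero is a group by [unipotent_units], and the weights of
    its own toric structure are all nonnegative vectors; the comparison of toric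
    structures carries the standard basis to [B]. *)
Lemma unipotent_coordinates (K : closedFieldType) (charK : [pchar K] =i pred0) N
    (X : 'rV[K]_N -> Prop) n (act : 'rV[K]_n -> 'rV[K]_N -> 'rV[K]_N) x0
    omega chi m (P : 'M[int]_(n, m)) mul one :
  affine_variety X -> normal_variety X -> has_dim X n ->
  toric_structure X act x0 -> toric_data X act x0 omega chi P ->
  comm_monoid X mul one -> has_rank X mul one 0 ->
  exists (B : 'M[int]_n) (zi : 'rV[K]_n -> 'rV[K]_N),
   [/\ B \in unitmx,
       forall u : 'rV[int]_n, omega (toQ u) <->
         exists c : 'I_n -> nat, u = \sum_(j < n) row j B *+ c j,
       regular_map X (@affine_space K n) (fun x => \row_j chi (row j B) x),
       regular_map (@affine_space K n) X zi
     & (forall x, X x -> zi (\row_j chi (row j B) x) = x) /\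
       forall v, \row_j chi (row j B) (zi v) = v].
Proof.
move=> affX normX dimX tor dat monX rankX.
have [s' [psi [phi [h [gc es]]]]] := group_chart_exists affX dimX monX rankX.
have es' : s' = n by rewrite es.
subst s'.
have [act2 [tor2 actE]] := monoid_toric affX monX (gc_open gc) (gc_psi gc) (gc_phi gc)
  (gc_psiK gc) (gc_phiK gc) (gc_mul gc) (gc_one gc) charK (or_intror erefl).
have [omega2 [chi2 [m2 [P2 dat2]]]] := toric_data_exists charK affX tor2 normX.
have [A [Phi [Phi' [uA hA [rPhi rPhi' inv] PhiE chiE]]]] := toric_iso affX tor tor2 dat dat2.
have [K1 K2] := inv.
have XU x (Xx : X x) : units X mul one x :=
  unipotent_units affX monX (gc_open gc) (gc_psi gc) (gc_phi gc) (gc_phiK gc) (gc_one gc) erefl Xx.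
have V0 (g : 'rV[K]_(0 + n)) : GmGa g by split=> // -[].
have Xpsi g : X (psi g) by have [] := (gc_psi gc).1 g (V0 g).
have S2 (u : 'rV[int]_(0 + n)) : omega2 (toQ u) <-> nonneg u.
  rewrite (unipotent_weights affX monX (gc_open gc) (gc_psi gc) (gc_phi gc) (gc_psiK gc)
    (gc_phiK gc) (gc_one gc) actE u erefl dat2).
  by split=> hu i => [|_]; apply: hu.
pose B := invmx A.
have uB : B \in unitmx by rewrite unitmx_inv.
have BA j : row j B *m A = delta_mx ord0 j by rewrite -row_mul mulVmx // row1.
have Sj j : omega (toQ (row j B)).
  by apply/hA; rewrite BA; apply/S2 => i; rewrite mxE; case: andb.
pose g x := phi (Phi' x).
have zE x : X x -> \row_j chi (row j B) x = g x.
  move=> Xx; have Xx' := rPhi'.1 x Xx; apply/rv_eq => j; rewrite mxE.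
  rewrite -{1}(K2 x Xx) chiE // BA -{1}(gc_phiK gc (XU _ Xx')).
  have S2j : omega2 (toQ (delta_mx ord0 j : 'rV_(0 + n))) by rewrite -BA; apply/hA.
  have [_ ->] := is_chi_psi affX (gc_psi gc) actE (td_chi (td_dec dat2) S2j); last exact: V0.
  rewrite /character (bigD1 j) //= mxE !eqxx expr1z big1 ?mulr1 // => i ij.
  by rewrite mxE eqxx (negbTE ij) expr0z.
exists B, (fun v => Phi (psi v)); split=> //.
- move=> u; rewrite hA S2; split=> [hu|[c ->] i].
    exists (fun j => absz ((u *m A) ord0 j)).
    rewrite -[LHS](mulmxK uA) -/B mulmx_sum_row; apply: eq_bigr => j _.
    by rewrite -{1}(gez0_abs (hu j)) -scaler_nat natz.
  rewrite mulmx_suml summxE sumr_ge0 // => j _.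
  rewrite -scaler_nat -scalemxAl BA !mxE; apply: mulr_ge0; first by rewrite ?natz.
  by case: (_ && _).
- split=> // j; have r1 : regular X (chi (row j B)) by have [] := td_chi (td_dec dat) (Sj j).
  by apply: (reg_ext _ r1) => x _; rewrite mxE.
- split=> [v _|j]; first exact/rPhi.1/Xpsi.
  have rp : regular_map (@affine_space K n) X psi.
    split=> [v _|i]; first exact: Xpsi.
    by apply: (reg_sub _ ((gc_psi gc).2 i)) => v _; exact: V0.
  exact: (reg_pullback (f := fun x => Phi x ord0 j) (proj1 affX) rp (rPhi.2 j)).
split=> [x Xx|v].
  by rewrite zE // /g (gc_phiK gc) ?K2 //; apply: XU; apply: rPhi'.1.
rewrite zE; last exact/rPhi.1/Xpsi.
by rewrite /g K1 // (gc_psiK gc) //; exact: V0.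
Qed.

Theorem theorem1 (K : closedFieldType) (charK : [pchar K] =i pred0)
    (N : nat) (X : 'rV[K]_N -> Prop) (n r : nat)
    (affX : affine_variety X) (normX : normal_variety X) (dimX : has_dim X n)
    (hr : r = 0%N \/ r.+1 = n \/ r = n)
    (mul : 'rV[K]_N -> 'rV[K]_N -> 'rV[K]_N) (one : 'rV[K]_N)
    (monX : comm_monoid X mul one) (rankX : has_rank X mul one r) :
  (exists (act : 'rV[K]_n -> 'rV[K]_N -> 'rV[K]_N) (x0 : 'rV[K]_N),
      toric_structure X act x0) /\
  (forall (act : 'rV[K]_n -> 'rV[K]_N -> 'rV[K]_N) (x0 : 'rV[K]_N),
    toric_structure X act x0 ->
    exists (omega : 'rV[rat]_n -> Prop) (chi : 'rV[int]_n -> 'rV[K]_N -> K),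
      [/\ toric_decomposition X act x0 omega chi,
          (r = n ->
             classified_by X r (fun _ : unit => True)
               (fun _ mul' one' =>
                  toric_monoid X act x0 mul' one' /\
                  toric_comult X omega chi mul')),
          (r.+1 = n ->
             classified_by X r
               (fun pe : 'rV[int]_n * 'rV[int]_n =>
                  ray_vector (dual_cone omega) pe.1 /\
                  demazure_root (dual_cone omega) pe.1 pe.2)
               (fun pe mul' _ => root_comult X omega chi pe.1 pe.2 mul'))
        & (r = 0%N ->
             exists B : 'M[int]_n,
               [/\ B \in unitmx,
                   (forall u : 'rV[int]_n, omega (toQ u) <->
                      exists c : 'I_n -> nat, u = \sum_(j < n) row j B *+ c j),
                   variety_iso X (@affine_space K n)
                     (fun x => \row_j chi (row j B) x)
                 & classified_by X r (fun _ : unit => True)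
                     (fun _ mul' _ =>
                        vector_comult X (fun j => chi (row j B)) mul')])]).

Proof.
have [s [psi [phi [h [gc en]]]]] := group_chart_exists affX dimX monX rankX.
have hrs : (s <= 1)%N \/ r = 0%N.
  case: hr => [->|h1]; first by right.
  by left; case: h1 => h1; move: h1; rewrite en; lia.
have tor2 : exists (act : 'rV[K]_n -> 'rV[K]_N -> 'rV[K]_N) (x0 : 'rV[K]_N),
    toric_structure X act x0.
  rewrite en.
  have [act2 [tor2 _]] := monoid_toric affX monX (gc_open gc) (gc_psi gc) (gc_phi gc)
    (gc_psiK gc) (gc_phiK gc) (gc_mul gc) (gc_one gc) charK hrs.
  by exists act2; eexists; exact: tor2.
split=> // act x0 tor.
have [omega [chi [m [P dat]]]] := toric_data_exists charK affX tor normX.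
have oP := td_omega dat; have fP := td_facet dat; have pP := td_prim dat.
exists omega, chi; split; first exact: td_dec dat.
- move=> rn; have s0 : s = 0%N by move: en; rewrite rn; lia.
  subst s; move: act x0 tor omega chi m P dat {oP fP pP tor2 hr} dimX; rewrite en.
  move=> act x0 tor omega chi m P dat dimX.
  split=> [_ _|mul' one' mon' rank'].
    have d0 : delta_last r 0 = 0 by apply/rv_eq => i; rewrite !mxE; case: splitP => [j _|[]//]; rewrite mxE.
    have [||||mul' [one' [psi' [mon' rank' com' un' [mulE psiE]]]]] :=
      @root_monoid_exists K N X r 0 act x0 omega chi m P 0 0 1%:M affX tor dat isT (unitmx1 _ _).
    - by move=> u; rewrite mulmx1 /last_coord big_ord0 /pairing big1 // => i _; rewrite mxE mul0r.
    - by rewrite mul0mx d0 oppr0.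
    - by move=> u _; rewrite /pairing big1 // => i _; rewrite mxE mul0r.
    - by move=> u k Su _; rewrite mul0rn addr0.
    have psiE' t : torus t -> psi' t = act t x0.
      move=> tt; rewrite psiE //; congr act; apply/rv_eq => i; rewrite mxE row1.
      rewrite /character (bigD1 i) //= mxE !eqxx expr1z big1 ?mulr1 // => j ji.
      by rewrite mxE eqxx (negbTE ji) expr0z.
    exists mul', one'; split=> //; split.
      split=> [x|t t' tt tt'].
        split=> [/un' [g Vg ->]|[t [tt ->]]].
          by have tg := GmGa_torus erefl Vg; exists g; rewrite psiE'.
        by apply/un'; exists t; [exact: torus_GmGa|rewrite psiE'].
      have Vt := torus_GmGa tt; have Vt' := torus_GmGa tt'.
      rewrite -!psiE' ?mulE ?GmGa_mul_torus //; exact: torus_tmul.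
    move=> u Su w Xw; rewrite (com' u Su w Xw).
    have -> : pairing (0 : 'rV[int]_(r + 0)) u = 0 by rewrite /pairing big1 // => i _; rewrite mxE mul0r.
    by rewrite big_ord1 /= !mul0rn addr0 mul1r.
  have [mul2 [one2 [p [e [mon2 iso2 com2 _ tm]]]]] :=
    monoid_in_toric_terms charK affX normX dimX (isT : (0 <= 1)%N) tor dat mon' rank'.
  have [tm2 p0 e0] := tm erefl.
  exists tt, mul2, one2; split=> //; split=> // u Su w Xw; rewrite (com2 u Su w Xw) p0 e0.
  have -> : pairing (0 : 'rV[int]_(r + 0)) u = 0 by rewrite /pairing big1 // => i _; rewrite mxE mul0r.
  by rewrite big_ord1 /= !mul0rn addr0 mul1r.
- move=> rn; have s0 : s = 1%N by move: en; rewrite -rn; lia.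
  subst s; move: act x0 tor omega chi m P dat oP fP pP {tor2 hr rn} dimX; rewrite en.
  move=> act x0 tor omega chi m P dat oP fP pP dimX.
  split=> [[p e] /= [rp dr]|mul' one' mon' rank'].
    have [C [uC hC eC]] := root_matrix dr.1.
    have [||mul' [one' [psi' [mon' rank' com' _ _]]]] :=
      @root_monoid_exists K N X r 1 act x0 omega chi m P p e C affX tor dat isT uC hC eC.
    - by move=> u Su; apply: (ray_nonneg_int rp Su).
    - move=> u k Su ka; apply: (demazure_shift oP fP pP dr Su).
      by have := ray_nonneg_int rp Su; move: ka; move: (pairing p u) => x; lia.
    by exists mul', one'.
  have [mul2 [one2 [p [e [mon2 iso2 com2 [pe hs] _]]]]] :=
    monoid_in_toric_terms charK affX normX dimX (isT : (1 <= 1)%N) tor dat mon' rank'.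
  have [rp dr] := root_of_shift oP (td_gp dat) (td_cone (td_dec dat)) pe hs.
  by exists (p, e), mul2, one2.
move=> r0; subst r.
have [B [zi [uB hB rz rzi [zK ziK]]]] := unipotent_coordinates charK affX normX dimX tor dat monX rankX.
exists B; split=> //; first by exists zi.
pose z x : 'rV[K]_n := \row_j chi (row j B) x.
have vc : vector_comult X (fun j => chi (row j B)) (vmul z zi).
  move=> j w _; rewrite /comult /tensor /vmul mulr1 mul1r.
  have := congr1 (fun v : 'rV_n => v ord0 j) (ziK (z (lsubmx w) + z (rsubmx w))).
  by rewrite !mxE.
have vm := vmul_monoid rz rzi zK ziK.
have vr := vmul_rank rz rzi zK ziK.
split=> [_ _|mul' one' mon' rank']; first by exists (vmul z zi), (zi 0).
have [s' [psi' [phi' [h' [gc' en']]]]] := group_chart_exists affX dimX mon' rank'.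
have es' : s' = n by rewrite en'.
subst s'.
exists tt, (vmul z zi), (zi 0); split=> //.
exact: (vmul_iso affX rz rzi zK ziK mon' gc').
Qed.
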